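(* (i) The vacuum vector $\Omega$ is cyclic for the family of operators $(\langle f,\xi\rangle)_{f\in B_0(T)}$, i.e. $\mathscr P\Omega$ is dense in $\mathcal F^Q(\mathcal G)$. (ii) Consider the linear mapping $I:\mathscr P\to\mathcal F^Q(\mathcal G)$ defined by $Ip:=p\Omega$ for $p\in\mathscr P$. Then $Ip$ does not depend on the choice of representative $p$ of a class in $\mathscr P/\mathscr P_0$, and $I$ extends to a unitary operator $I:L^2(\tau)\to\mathcal F^Q(\mathcal G)$.
   Context: $T$ is a locally compact Polish space with Borel $\sigma$-algebra $\mathcal B(T)$; $\sigma$ is a Radon non-atomic measure on $T$. $A\in\mathcal B(T^2)$ is a symmetric set containing the diagonal, with $\sigma^{\otimes2}(A)=0$; $Q:T^2\setminus A\to\{z\in\mathbb C:|z|=1\}$ is measurable with $Q(s,t)=\overline{Q(t,s)}$. $B_0(T)$: real-valued bounded Borel functions on $T$ with compact support. $\nu$ is a probability measure on $\mathbb R$ with $\int_{\mathbb R}e^{\varepsilon|x|}\nu(dx)<\infty$ for some $\varepsilon>0$; $\mu_k(x):=x^k$. Extend $Q$ by $Q(t_1,x_1,t_2,x_2):=Q(t_1,t_2)$, $x_1,x_2\in\mathbb R$. $\mathcal G:=L^2(T\times\mathbb R,\sigma\otimes\nu)$ with complexification $\mathcal G_{\mathbb C}$. On $\mathcal G_{\mathbb C}^{\otimes n}=L^2((T\times\mathbb R)^n\to\mathbb C,(\sigma\otimes\nu)^{\otimes n})$ let $(\Psi_jF)(t_1,x_1,\dots,t_n,x_n)$ be $Q(t_j,t_{j+1})$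 times $F$ with $(t_j,x_j)$ and $(t_{j+1},x_{j+1})$ interchanged; these extend to a unitary representation $\pi\mapsto\Psi_\pi$ of $S_n$ with $\Psi_{(j,j+1)}=\Psi_j$; $P_n:=\frac1{n!}\sum_{\pi\in S_n}\Psi_\pi$, $\mathcal G_{\mathbb C}^{\circledast n}:=P_n\mathcal G_{\mathbb C}^{\otimes n}$, $\mathcal G_{\mathbb C}^{\circledast0}:=\mathbb C$. $\mathcal F^Q(\mathcal G):=\bigoplus_{n\ge0}\mathcal G_{\mathbb C}^{\circledast n}n!$ (so $\|F\|^2=\sum_nn!\|F^{(n)}\|^2$), $\Omega:=(1,0,0,\dots)$. $\mathfrak D\subset\mathcal F^Q(\mathcal G)$ consists of all finite sequences $(F^{(0)},\dots,F^{(n)},0,0,\dots)$ with each $F^{(k)}$, $k\ge1$, of the form $P_k\big[\sum_{(i_1,\dots,i_k)\in\{0,\dots,N\}^k}f_{(i_1,\dots,i_k)}(t_1,\dots,t_k)x_1^{i_1}\dotsm x_k^{i_k}\big]$, $f_{(i_1,\dots,i_k)}\in L^2(T^k\to\mathbb C,\sigma^{\otimes k})$, $N\in\mathbb N$. For $f\in B_0(T)$, the operator $\langle f,\xi\rangle:\mathfrak D\to\mathfrak D$ is $$\langle f,\xi\rangle:=a^+(f\otimes\mu_0)+a^0(f\otimes\mu_1)+a^-(f\otimes\mu_0),$$ where for $F^{(k)}\in\mathcal G_{\mathbb C}^{\circledast k}$: $a^+(h)F^{(k)}:=P_{k+1}(h\otimes F^{(k)})$; $a^-(h)$ is the adjoint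 of $a^+(h)$ (restricted to $\mathfrak D$); $a^0(h)F^{(k)}$ is $F^{(k)}$ multiplied by $h(t_1,x_1)+\dots+h(t_k,x_k)$. $\mathscr P$ is the complex unital $*$-algebra of operators on $\mathfrak D$ generated by $(\langle f,\xi\rangle)_{f\in B_0(T)}$ ($p^*$ being the adjoint in $\mathcal F^Q(\mathcal G)$, restricted to $\mathfrak D$); $\tau(p):=(p\Omega,\Omega)_{\mathcal F^Q(\mathcal G)}$; $(p_1,p_2)_{L^2(\tau)}:=\tau(p_2^*p_1)$; $\mathscr P_0:=\{p\in\mathscr P:(p,p)_{L^2(\tau)}=0\}$; $L^2(\tau)$ is the completion of $\mathscr P/\mathscr P_0$ in the norm generated by $(\cdot,\cdot)_{L^2(\tau)}$. *)

(* Defs.v *)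
From HB Require Import structures.
From mathcomp Require Import all_boot all_order all_algebra.
From mathcomp Require Import perm complex.
From mathcomp Require Import ring.
From mathcomp Require Import all_classical all_reals all_analysis.
Set Implicit Arguments.
Unset Strict Implicit.
Unset Printing Implicit Defensive.
Import Order.TTheory GRing.Theory Num.Theory.
Import numFieldNormedType.Exports.
Local Open Scope classical_set_scope.
Local Open Scope ring_scope.
Local Open Scope complex_scope.

(* The quotient of a left module by a submodule, as a left module (the library  *)
(* only has the quotient of a zmodType).                                       *)
Section lmodule_quotient.
Variables (K : pzRingType) (V : lmodType K) (I : submodClosed V).
Local Open Scope quotient_scope.

(* submodClosed carries no opprClosed structure; lquot_pred I is I with it *)
Definition lquot_pred : {pred V} := I.

HB.instance Definition _ := GRing.isZmodClosed.Build V lquot_pred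
  (GRing.submod_closedB (GRing.submodClosedP I)).

Definition lquot := Quotient.quot lquot_pred.

HB.instance Definition _ := Choice.on lquot.
HB.instance Definition _ := GRing.Zmodule.on lquot.
HB.instance Definition _ := EqQuotient.on lquot.

Definition lproj (u : V) : lquot := \pi_lquot u.

Lemma lproj_eq u v : lproj u = lproj v <-> u - v \in I.
Proof.
rewrite -(Quotient.equivE lquot_pred); split => [/eqP|uv]; first by rewrite piE.
by apply/eqP; rewrite piE.
Qed.

Lemma lproj_repr x : lproj (repr x) = x.
Proof. exact: reprK. Qed.

Lemma lprojD u v : lproj (u + v) = lproj u + lproj v.
Proof. by rewrite /lproj piE. Qed.

Definition lquot_scale a (x : lquot) : lquot := lproj (a *: repr x).

Lemma lprojZ a u : lquot_scale a (lproj u) = lproj (a *: u).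
Proof.
by apply/lproj_eq; rewrite -scalerBr rpredZ//; apply/lproj_eq; rewrite lproj_repr.
Qed.

Lemma lquot_scaleA a b x :
  lquot_scale a (lquot_scale b x) = lquot_scale (a * b) x.
Proof. by rewrite -(lproj_repr x) !lprojZ scalerA. Qed.

Lemma lquot_scale1 : left_id 1 lquot_scale.
Proof. by move=> x; rewrite -(lproj_repr x) lprojZ scale1r. Qed.

Lemma lquot_scaleDr : right_distributive lquot_scale +%R.
Proof.
move=> a x y; rewrite -(lproj_repr x) -(lproj_repr y).
by rewrite -lprojD !lprojZ scalerDr lprojD.
Qed.

Lemma lquot_scaleDl x : {morph lquot_scale^~ x : a b / a + b}.
Proof. by move=> a b; rewrite -(lproj_repr x) !lprojZ scalerDl lprojD. Qed.

HB.instance Definition _ := GRing.Zmodule_isLmodule.Build K lquot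
  lquot_scaleA lquot_scale1 lquot_scaleDr lquot_scaleDl.

Lemma lproj_linear : linear lproj.
Proof. by move=> a u v; rewrite lprojD -lprojZ. Qed.

HB.instance Definition _ := GRing.isLinear.Build K V lquot _ lproj lproj_linear.

End lmodule_quotient.

(* Positive semi-definite Hermitian forms, linear in the first argument. *)
Record semi_inner (R : realType) (V : lmodType R[i]) (B : V -> V -> R[i]) : Prop := SemiInner {
  semi_inner_linear : forall w, linear_for *%R (B ^~ w);
  semi_inner_sym : forall u v, B v u = (B u v)^*%C;
  semi_inner_ge0 : forall u, 0 <= B u u }.

Section semi_inner_product.
Variables (R : realType) (V : lmodType R[i]) (B : V -> V -> R[i]) (hB : semi_inner B).

Lemma sipDl u v w : B (u + v) w = B u w + B v w.
Proof. by rewrite -{1}(scale1r u) (semi_inner_linear hB) mul1r. Qed.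

Lemma sip0l w : B 0 w = 0.
Proof. by apply: (addrI (B 0 w)); rewrite -sipDl !addr0. Qed.

Lemma sipZl a u w : B (a *: u) w = a * B u w.
Proof. by rewrite -[a *: u]addr0 (semi_inner_linear hB) sip0l addr0. Qed.

Lemma sipDr u v w : B w (u + v) = B w u + B w v.
Proof.
by rewrite 3!(semi_inner_sym hB _ w) sipDl rmorphD.
Qed.

Lemma sipZr a u w : B w (a *: u) = a^*%C * B w u.
Proof. by rewrite 2!(semi_inner_sym hB _ w) sipZl rmorphM. Qed.

Lemma sipBl u v w : B (u - v) w = B u w - B v w.
Proof. by rewrite sipDl -scaleN1r sipZl mulN1r. Qed.

Lemma sipBr u v w : B w (u - v) = B w u - B w v.
Proof. by rewrite sipDr -scaleN1r sipZr rmorphN rmorph1 mulN1r. Qed.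

Lemma sip_null u n : B n n = 0 -> B n u = 0.
Proof.
move=> Bnn; apply/eqP; apply: contraT => Bnu0.
set c := B n u * (B n u)^*%C.
have c0 : 0 < c by rewrite lt_neqAle mulcJ_ge0 eq_sym mulf_neq0// conjc_eq0.
have [uu0 uuR] : 0 <= B u u /\ (B u u)^*%C = B u u.
  by split; [exact: semi_inner_ge0|rewrite -semi_inner_sym].
have cR : c^*%C = c by rewrite rmorphM/= conjcK mulrC.
pose k : R[i] := (B u u + 1) / c.
have kR : k^*%C = k by rewrite /k rmorphM fmorphV rmorphD rmorph1/= uuR cR.
have kc : k * c = B u u + 1 by rewrite /k divfK// lt0r_neq0.
have := semi_inner_ge0 hB (u - (k * (B n u)^*%C) *: n).
rewrite sipBl !sipBr !sipZl !sipZr Bnn (semi_inner_sym hB n u) rmorphM/= conjcK kR.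
rewrite [leRHS](_ : _ = B u u - (k * c) *+ 2); last by rewrite /c; ring.
rewrite kc (_ : _ - _ = - (B u u + 2)); last by ring.
by rewrite oppr_ge0 lt_geF// ltr_wpDl// ltr0n.
Qed.

Lemma sip_nullr u n : B n n = 0 -> B u n = 0.
Proof. by move=> /sip_null Bn; rewrite (semi_inner_sym hB n u) Bn rmorph0. Qed.

Lemma sip_parallelogram u v :
  B (u + v) (u + v) <= (B u u + B v v) *+ 2.
Proof.
rewrite -subr_ge0 [leRHS](_ : _ = B (u - v) (u - v)) ?semi_inner_ge0//.
by rewrite sipBl !sipBr sipDl !sipDr; ring.
Qed.

Definition null_vectors of semi_inner B : {pred V} := [pred u | B u u == 0].

Lemma null_vectors_submod : submod_closed (null_vectors hB).
Proof.
split=> [|a u v]; rewrite !inE/= ?sip0l// => /eqP uu /eqP vv.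
by rewrite sipDl !sipDr !sipZl !sipZr uu vv !(sip_null _ uu) !(sip_nullr _ uu) !mulr0 !addr0.
Qed.

HB.instance Definition _ := GRing.isSubmodClosed.Build R[i] V (null_vectors hB)
  (GRing.submod_closed_semi null_vectors_submod).

(* squot = V / {u | B u u = 0}, with the form squot_ip induced by B (see        *)
(* squot_projE); completion below is applied to this space.                    *)
Definition squot := lquot (null_vectors hB).

HB.instance Definition _ := GRing.Lmodule.on squot.

Definition squot_proj (u : V) : squot := lproj (null_vectors hB) u.

Definition squot_ip (x y : squot) : R[i] := B (repr x) (repr y).

Lemma squot_projE u v : squot_ip (squot_proj u) (squot_proj v) = B u v.
Proof.
have [n1 n1E n1n] : exists2 n, repr (squot_proj u) = u + n & B n n = 0.
  exists (repr (squot_proj u) - u); first by rewrite addrC subrK.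
  by apply/eqP; apply/(lproj_eq (null_vectors hB)); exact: lproj_repr.
have [n2 n2E n2n] : exists2 n, repr (squot_proj v) = v + n & B n n = 0.
  exists (repr (squot_proj v) - v); first by rewrite addrC subrK.
  by apply/eqP; apply/(lproj_eq (null_vectors hB)); exact: lproj_repr.
by rewrite /squot_ip n1E n2E sipDl !sipDr !(sip_nullr _ n2n) !(sip_null _ n1n) !addr0.
Qed.

Lemma squot_ipP : semi_inner squot_ip.
Proof.
split=> [w a x y|x y|x].
- rewrite -(lproj_repr x) -(lproj_repr y) -(lproj_repr w).
  by rewrite -linearP !squot_projE (semi_inner_linear hB).
- by rewrite -(lproj_repr x) -(lproj_repr y) !squot_projE (semi_inner_sym hB).
- by rewrite -(lproj_repr x) squot_projE semi_inner_ge0.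
Qed.

(* The norm is u |-> sqrt (B u u); Cauchy and null sequences are expressed with *)
(* its square. The completion is the space of Cauchy sequences modulo null     *)
(* sequences, with the inner product lim_n B (x_n) (y_n).                      *)
Definition cauchy_seqs of semi_inner B : {pred nat -> V} := fun p =>
  `[< forall e : R, 0 < e -> exists N, forall m n, (N <= m)%N -> (N <= n)%N ->
      B (p m - p n) (p m - p n) < e%:C >].

Lemma sip_small u v (e : R) : B u u < (e / 4)%:C -> B v v < (e / 4)%:C ->
  B (u + v) (u + v) < e%:C.
Proof.
move=> ue ve; apply: (le_lt_trans (sip_parallelogram u v)).
rewrite (_ : e%:C = ((e / 4)%:C + (e / 4)%:C) *+ 2) ?ltrMn2r ?ltrD//.
by rewrite -!rmorphD -rmorphMn/=; congr (_%:C); field.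
Qed.

Lemma sip_scale_small (a : R[i]) (e : R) : 0 < e -> exists2 d : R, 0 < d &
  forall u, B u u < d%:C -> B (a *: u) (a *: u) < e%:C.
Proof.
move=> e0; pose c := a * a^*%C + 1.
have c0 : 0 < c by rewrite ltr_wpDl// mulcJ_ge0.
have cE : c = (complex.Re c)%:C.
  by move: c0; case: (c) => x y; rewrite ltcE/= => /andP[/eqP-> _].
exists (e / complex.Re c).
  by rewrite divr_gt0// -ltcR -cE.
move=> u ud; rewrite sipZl sipZr mulrA.
apply: (@le_lt_trans _ _ (c * B u u)).
  by rewrite ler_wpM2r ?semi_inner_ge0// lerDl.
rewrite -(@ltr_pM2l _ c)// in ud.
apply: (lt_le_trans ud); rewrite {1}cE -rmorphM/= mulrC divfK//.
by apply/eqP => Rec0; move: c0; rewrite cE Rec0 ltxx.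
Qed.

Lemma cauchy_seqs_submod : submod_closed (cauchy_seqs hB).
Proof.
split=> [|a p q]; rewrite !unfold_in.
  apply/asboolP => e e0; exists 0%N => m n _ _.
  by rewrite /= subrr sip0l ltcR.
move=> /asboolP cp /asboolP cq; apply/asboolP => e e0.
have e4 : 0 < e / 4 by rewrite divr_gt0.
have [d d0 hd] := sip_scale_small a e4.
have [N1 h1] := cp _ d0; have [N2 h2] := cq _ e4.
exists (maxn N1 N2) => m n; rewrite !geq_max => /andP[m1 m2] /andP[n1 n2].
rewrite (_ : _ - _ = a *: (p m - p n) + (q m - q n)); last first.
  by rewrite scalerBr/= opprD addrACA.
by apply: sip_small; [apply: hd; exact: h1|exact: h2].
Qed.

HB.instance Definition _ := GRing.isSubmodClosed.Build R[i] (nat -> V)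
  (cauchy_seqs hB) (GRing.submod_closed_semi cauchy_seqs_submod).

Record cauchy_seq := CauchySeq {
  cauchy_val :> nat -> V ; _ : cauchy_val \in cauchy_seqs hB }.

HB.instance Definition _ := [isSub for cauchy_val].
HB.instance Definition _ := gen_eqMixin cauchy_seq.
HB.instance Definition _ := [Choice of cauchy_seq by <:].
HB.instance Definition _ := [SubChoice_isSubLmodule of cauchy_seq by <:].

Definition null_seqs : {pred cauchy_seq} := fun p =>
  `[< forall e : R, 0 < e -> exists N, forall n, (N <= n)%N -> B (p n) (p n) < e%:C >].

Lemma null_seqs_submod : submod_closed null_seqs.
Proof.
split=> [|a p q]; rewrite !unfold_in.
  by apply/asboolP => e e0; exists 0%N => n _; rewrite /= sip0l ltcR.
move=> /asboolP np /asboolP nq; apply/asboolP => e e0.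
have e4 : 0 < e / 4 by rewrite divr_gt0.
have [d d0 hd] := sip_scale_small a e4.
have [N1 h1] := np _ d0; have [N2 h2] := nq _ e4.
exists (maxn N1 N2) => n; rewrite !geq_max => /andP[n1 n2].
by apply: sip_small; [apply: hd; exact: h1|exact: h2].
Qed.

HB.instance Definition _ := GRing.isSubmodClosed.Build R[i] cauchy_seq
  null_seqs (GRing.submod_closed_semi null_seqs_submod).

Definition completion := lquot null_seqs.

HB.instance Definition _ := GRing.Lmodule.on completion.

Lemma const_cauchy u : (fun _ : nat => u) \in cauchy_seqs hB.
Proof.
by rewrite unfold_in; apply/asboolP => e e0; exists 0%N => m n _ _; rewrite subrr sip0l ltcR.
Qed.

Definition completion_incl (u : V) : completion :=
  lproj null_seqs (CauchySeq (const_cauchy u)).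

Definition clim (u : nat -> R[i]) : R[i] :=
  limn (fun n => complex.Re (u n)) +i* limn (fun n => complex.Im (u n)).

Definition completion_ip (x y : completion) : R[i] :=
  clim (fun n => B (repr x n) (repr y n)).

End semi_inner_product.
Notation borel T := (g_sigma_algebraType (@open T)).

Definition polish_space (R : realType) (T : topologicalType) : Prop :=
  (exists D : set T, countable D /\ dense D) /\
  exists d : T -> T -> R,
    [/\ forall x y, 0 <= d x y,
        forall x y, d x y = 0 <-> x = y,
        forall x y, d x y = d y x,
        forall x y z, d x z <= d x y + d y z &
        (forall x (U : set T), nbhs x U <->
           exists2 r : R, 0 < r & [set y | d x y < r] `<=` U) /\
        (forall u : nat -> T,
           (forall e : R, 0 < e -> exists N, forall m n,
              (N <= m)%N -> (N <= n)%N -> d (u m) (u n) < e) ->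
           exists x : T, u @ \oo --> x)].

Section radon.
Context {R : realType} {T : ptopologicalType}.
Local Open Scope ereal_scope.

Definition radon_measure (sigma : set (borel T) -> \bar R) : Prop :=
  (forall K : set T, compact K -> sigma K < +oo) /\
  (forall B : set (borel T), measurable B ->
     sigma B = ereal_sup [set sigma K | K in [set K : set T | compact K /\ K `<=` B]]).

Definition nonatomic (sigma : set (borel T) -> \bar R) : Prop :=
  forall B : set (borel T), measurable B -> 0 < sigma B ->
    exists C : set (borel T),
      [/\ measurable C, C `<=` B, 0 < sigma C & sigma C < sigma B].

Lemma radon_sigma_finite (sigma : {measure set (borel T) -> \bar R}) :
  polish_space R T -> locally_compact [set: T] -> radon_measure sigma ->
  sigma_finite setT sigma.
Proof.
move=> [[D [cD dD]] [d [d0 dE dC dT [dnbhs _]]]] lcT [sfin _].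
have hT : hausdorff_space T.
  move=> x y xy; apply/dE/eqP; rewrite eq_le d0 andbT leNgt; apply/negP => xy0.
  have r0 : (0 < d x y / 2)%R by rewrite divr_gt0.
  have nb z : nbhs z [set w | d z w < d x y / 2]%R.
    by apply/dnbhs; exists (d x y / 2)%R.
  have [z [/= xz yz]] := xy _ _ (nb x) (nb y).
  move: yz; rewrite dC => yz; have := le_lt_trans (dT x z y) (ltrD xz yz).
  by rewrite -splitr ltxx.
pose ball q (n : nat) := [set w | d q w < n.+1%:R^-1]%R.
have ball_open q n : open (ball q n).
  rewrite openE => w /= qw; apply/dnbhs.
  exists (n.+1%:R^-1 - d q w)%R; first by rewrite subr_gt0.
  by move=> v /=; rewrite ltrBrDl => wv; exact: le_lt_trans (dT _ _ _) wv.
pose good (q : T * nat) := exists2 K : set T, compact K & ball q.1 q.2 `<=` K.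
pose G : set (T * nat) := (D `*` setT) `&` good.
have cG : countable G.
  apply: (@sub_countable _ _ _ (D `*` setT)); first by apply: subset_card_le; exact: subIsetl.
  by apply: countableX => //; exact: countable_setT.
have ball_fin q : G q -> measurable (ball q.1 q.2 : set (borel T)) /\ sigma (ball q.1 q.2) < +oo.
  move=> [_ [K cK bK]]; have mO (U : set T) : open U -> measurable (U : set (borel T)).
    by move=> oU; exact: sub_sigma_algebra.
  split; first by apply: mO; exact: ball_open.
  apply: le_lt_trans (sfin _ cK); apply: le_measure; rewrite ?inE//.
    by apply: mO; exact: ball_open.
  rewrite -(setCK K); apply: measurableC; apply: mO.
  by apply: closed_openC; exact: compact_closed.
have cover x : exists2 q, G q & ball q.1 q.2 x.
  have [U xU [cU clU]] := lcT x I.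
  have {}xU : nbhs x U.
    by have := xU; rewrite /within/=; apply: filterS => y; apply.
  have /dnbhs[r r0 rU] := xU.
  have [n nr] : exists n : nat, (n.+1%:R^-1 < r / 2)%R.
    by have := near_infty_natSinv_lt (PosNum (divr_gt0 r0 (ltr0Sn R 1))) => -[n _ /(_ n (leqnn _))]; exists n.
  have [q [/= xq Dq]] : ball x n `&` D !=set0.
    by apply: dD => //; exists x => /=; rewrite /ball/= (proj2 (dE x x) erefl) invr_gt0.
  exists (q, n); last by rewrite /ball /= dC.
  split => //; exists U => // w /= qw; apply: rU => /=.
  apply: le_lt_trans (dT _ q _) _; rewrite (splitr r).
  by apply: ltrD; [exact: lt_trans xq nr|exact: lt_trans qw nr].
have [f fG] : exists f : nat -> T * nat, G = range f.
  move/pfcard_geP : cG => [G0|[f]].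
    by have [q] := cover point; rewrite G0.
  by exists f; exact/esym/image_eq.
exists (fun i => ball (f i).1 (f i).2).
  apply/seteqP; split => // x _.
  by have [q] := cover x; rewrite fG => -[i _ <-] bx; exists i.
by move=> i; apply: ball_fin; rewrite fG; exists i.
Qed.
End radon.

(* A measure together with a proof of sigma-finiteness, as a bundled            *)
(* sigma-finite measure; as a set function it is mu itself.                    *)
Section measure_of_sigma_finite.
Context d (T : measurableType d) (R : realType).
Variables (mu : {measure set T -> \bar R}) (mu_sf : sigma_finite setT mu).

Definition sigma_finite_copy of sigma_finite setT mu : set T -> \bar R := mu.

HB.instance Definition _ := Measure.copy (sigma_finite_copy mu_sf) mu.

HB.instance Definition _ :=
  Measure_isSigmaFinite.Build _ _ _ (sigma_finite_copy mu_sf) mu_sf.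

Definition sigma_finite_pack : {sigma_finite_measure set T -> \bar R} :=
  sigma_finite_copy mu_sf.
End measure_of_sigma_finite.

Section product_sigma_finite.
Context d1 d2 (T1 : measurableType d1) (T2 : measurableType d2) (R : realType).
Variable m1 : {sigma_finite_measure set T1 -> \bar R}.
Variable m2 : {sigma_finite_measure set T2 -> \bar R}.
Local Open Scope ereal_scope.

Lemma product_sigma_finite : sigma_finite setT (m1 \x m2).
Proof.
have /sigma_finiteP[F [TF ndF Foo]] := sigma_finiteT m1.
have /sigma_finiteP[G [TG ndG Goo]] := sigma_finiteT m2.
exists (fun n => F n `*` G n).
  rewrite -setXTT TF TG predeqE => -[x y]; split.
    move=> [/= [n _ Fnx] [k _ Gky]]; exists (maxn n k) => //; split.
    - by move: x Fnx; exact/subsetPset/ndF/leq_maxl.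
    - by move: y Gky; exact/subsetPset/ndG/leq_maxr.
  by move=> [n _ []/= ? ?]; split; exists n.
move=> k; have [? ?] := Foo k; have [? ?] := Goo k.
split; first exact: measurableX.
by rewrite product_measure1E// lte_mul_pinfty// ge0_fin_numE.
Qed.

Definition sigma_finite_product : {sigma_finite_measure set (T1 * T2)%type -> \bar R} :=
  sigma_finite_pack product_sigma_finite.
End product_sigma_finite.

(* The n-fold product measure on n.-tuple X: the Dirac mass on the one-point    *)
(* space X^0, and the image of m (x) m^n under (x, t) |-> x :: t on X^n.+1.     *)
Section tuple_measure.
Context d (X : measurableType d) (R : realType).
Local Open Scope ereal_scope.

Definition ntuple n : measurableType (measure_tuple_display d) := n.-tuple X.

Definition tcons n (p : X * ntuple n) : ntuple n.+1 := [tuple of p.1 :: p.2].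

Lemma measurable_tcons n : measurable_fun [set: X * ntuple n] (@tcons n).
Proof. exact: measurable_cons. Qed.

Definition tcons_measure n (m : {sigma_finite_measure set X -> \bar R})
    (mn : {sigma_finite_measure set (ntuple n) -> \bar R}) :=
  pushforward (m \x mn) (@tcons n).

Section instances.
Variables (n : nat) (m : {sigma_finite_measure set X -> \bar R}).
Variable mn : {sigma_finite_measure set (ntuple n) -> \bar R}.

Let tm0 : tcons_measure m mn set0 = 0.
Proof. by rewrite /tcons_measure /pushforward preimage_set0 measure0. Qed.

Let mtcons A : measurable A -> measurable (@tcons n @^-1` A).
Proof. by move=> mA; rewrite -[X in measurable X]setTI; exact: measurable_tcons. Qed.

Let tm_ge0 A : 0 <= tcons_measure m mn A.
Proof. exact: (measure_ge0 (m \x mn)). Qed.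

Let tm_sigma_additive : semi_sigma_additive (tcons_measure m mn).
Proof.
move=> F mF tF mUF; rewrite /tcons_measure /pushforward preimage_bigcup.
apply: measure_semi_sigma_additive.
- by move=> i; exact: mtcons.
- apply/trivIsetP => i j _ _ ij; rewrite -preimage_setI.
  by move/trivIsetP : tF => /(_ _ _ _ _ ij) ->//; rewrite preimage_set0.
- by rewrite -preimage_bigcup; exact: mtcons.
Qed.

HB.instance Definition _ := isMeasure.Build _ _ _ (tcons_measure m mn)
  tm0 tm_ge0 tm_sigma_additive.

Lemma tcons_sigma_finite : sigma_finite setT (tcons_measure m mn).
Proof.
have [F TF Foo] := product_sigma_finite m mn.
pose g (t : ntuple n.+1) : X * ntuple n := (tnth t ord0, [tuple of behead t]).
have mg : measurable_fun setT g.
  apply/measurable_fun_pair; first exact: measurable_tnth.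
  exact: measurable_behead.
have gK : cancel (@tcons n) g.
  by move=> [x t]; congr pair; apply/val_inj.
exists (fun i => g @^-1` (F i)) => [|i].
  by rewrite -preimage_bigcup -TF preimage_setT.
have [mFi Fioo] := Foo i; split.
  by rewrite -[X in measurable X]setTI; exact: mg.
rewrite /tcons_measure /pushforward (_ : _ @^-1` _ = F i)//.
by apply/seteqP; split => p /=; rewrite gK.
Qed.

End instances.

Fixpoint tuple_measure (m : {sigma_finite_measure set X -> \bar R}) (n : nat) :
    {sigma_finite_measure set (ntuple n) -> \bar R} :=
  match n with
  | 0%N => @dirac _ _ ([tuple] : 0.-tuple X) R
  | k.+1 => sigma_finite_pack (tcons_sigma_finite m (tuple_measure m k))
  end.

End tuple_measure.

(* On an L2 function sqnorm is the square of the L2 norm. *)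
Section complex_functions.
Context d (X : measurableType d) (R : realType).
Variable mu : {measure set X -> \bar R}.

Definition cmeasurable (f : X -> R[i]) : Prop :=
  measurable_fun setT (fun x => complex.Re (f x)) /\
  measurable_fun setT (fun x => complex.Im (f x)).

Definition cintegral (f : X -> R[i]) : R[i] :=
  (\int[mu]_x complex.Re (f x))%R +i* (\int[mu]_x complex.Im (f x))%R.

Definition sqnorm (f : X -> R[i]) : \bar R :=
  (\int[mu]_x (complex.Re (f x) ^+ 2 + complex.Im (f x) ^+ 2)%:E)%E.

Definition L2 (f : X -> R[i]) : Prop := cmeasurable f /\ (sqnorm f < +oo)%E.

End complex_functions.

(* The disjoint union of the powers X^n is the type seq X: a function F on      *)
(* seq X stands for the sequence (F^(0), F^(1), F^(2), ...) of its restrictions *)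
(* to the sequences of length n. fclass consists of such functions modulo       *)
(* equality almost everywhere on every X^n; the Fock spaces are subsets of it.  *)
Section full_fock.
Context d (X : measurableType d) (R : realType).
Variable mu : {sigma_finite_measure set X -> \bar R}.
Implicit Type F : seq X -> R[i]^o.

Definition component (n : nat) F : n.-tuple X -> R[i] := fun t => F t.

Definition ae_zero (m : {sigma_finite_measure set X -> \bar R}) :
    {pred seq X -> R[i]^o} := fun F =>
  `[< forall n, {ae tuple_measure m n, forall t, component F t = 0} >].

Lemma ae_zero_submod : submod_closed (ae_zero mu).
Proof.
split=> [|a F G]; rewrite !unfold_in.
  by apply/asboolP => n; apply: aeW => t.
move=> /asboolP F0 /asboolP G0; apply/asboolP => n.
apply: filterS2 (F0 n) (G0 n) => t; rewrite /component => Ft Gt.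
by rewrite fctE /= [X in X + _](_ : _ = a * F t)// Ft Gt mulr0 addr0.
Qed.

HB.instance Definition _ := GRing.isSubmodClosed.Build R[i] (seq X -> R[i]^o)
  (ae_zero mu) (GRing.submod_closed_semi ae_zero_submod).

Definition fclass := lquot (ae_zero mu).

HB.instance Definition _ := GRing.Lmodule.on fclass.

Definition cls F : fclass := lproj (ae_zero mu) F.

(* a representative, all of whose components are measurable if there is one *)
Definition rep (F : fclass) : seq X -> R[i]^o :=
  xget (repr F) [set f | (forall n, cmeasurable (@component n f)) /\ cls f = F].

(* F^(n) is in L2(X^n) for all n *)
Definition fL2 (F : fclass) : Prop :=
  forall n, L2 (tuple_measure mu n) (@component n (rep F)).

(* inner product and squared norm with the weights n! of the Fock space *)
Definition fip (F G : fclass) : R[i] :=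
  clim (fun N => \sum_(n < N) n`!%:R *
    cintegral (tuple_measure mu n) (fun t => rep F t * (rep G t)^*%C)).

Definition fsqnorm (F : fclass) : \bar R :=
  (\sum_(n <oo) n`!%:R%:E *
     sqnorm (tuple_measure mu n) (@component n (rep F)))%E.

Definition truncate (n : nat) (F : fclass) : fclass :=
  cls (fun s => if (size s <= n)%N then rep F s else 0).

Definition vacuum : fclass := cls (fun s => if s is [::] then 1 else 0).

End full_fock.

Section q_symmetrization.
Variables (R : realType) (X : Type) (Q : X -> X -> R[i]).
Implicit Type F : seq X -> R[i]^o.

(* Psi_j, with 0-based j: exchange of the entries j and j.+1 *)
Definition Psi_adj (j : nat) F : seq X -> R[i]^o := fun s =>
  if drop j s is x :: y :: r then Q x y * F (take j s ++ y :: x :: r) else F s.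

Definition adj_transp (n j : nat) : 'S_n :=
  if insub j is Some a then if insub j.+1 is Some b then tperm a b else 1%g
  else 1%g.

Definition is_adj_word n (pi : 'S_n) (w : seq nat) : Prop :=
  all (fun j => j.+1 < n)%N w /\ pi = (\prod_(j <- w) adj_transp n j)%g.

Lemma adj_transpE n (a b : 'I_n) : b = a.+1 :> nat -> adj_transp n a = tperm a b.
Proof.
move=> ab; rewrite /adj_transp valK -ab valK//.
Qed.

Lemma is_adj_wordM n (p q : 'S_n) v w :
  is_adj_word p v -> is_adj_word q w -> is_adj_word (p * q)%g (v ++ w).
Proof. by move=> [vn ->] [wn ->]; split; rewrite ?all_cat ?vn// big_cat. Qed.

Lemma adj_word_tperm n (a b : 'I_n) : exists w, is_adj_word (tperm a b) w.
Proof.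
wlog ab : a b / (a < b)%N.
  move=> H; have [/H//|/H|/val_inj->] := ltngtP a b; first by rewrite tpermC.
  by exists [::]; split => //; rewrite tperm1 big_nil.
have [k kE] : exists k, (b = a + k.+1 :> nat)%N.
  by exists (b - a).-1; rewrite prednK ?subn_gt0// subnKC// ltnW.
elim: k b {ab} kE => [|k IH] b kE.
  exists [:: val a]; split; first by have := ltn_ord b; rewrite kE addn1 /= => ->.
  by rewrite big_seq1 (@adj_transpE _ a b)// kE addn1.
have cn : (a + k.+1 < n)%N by apply: leq_ltn_trans (ltn_ord b); rewrite kE leq_add2l.
pose c := Ordinal cn; have [w hw] := IH c erefl.
have hc : is_adj_word (tperm c b) [:: val c].
  split; first by have := ltn_ord b; rewrite kE addnS /= => ->.
  by rewrite big_seq1 (@adj_transpE _ c b)// kE addnS.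
exists ([:: val c] ++ (w ++ [:: val c])).
have -> : tperm a b = (tperm c b * (tperm a c * tperm c b))%g.
  rewrite -[X in (X * _)%g](tpermV c b) -[RHS]/(_ ^ _)%g tpermJ tpermL tpermD//.
    by rewrite -val_eqE /= -[X in _ != X]addn0 eqn_add2l.
  by rewrite -val_eqE /= kE -[X in _ != X]addn0 eqn_add2l.
exact: is_adj_wordM hc (is_adj_wordM hw hc).
Qed.

Lemma adj_word_ex n (pi : 'S_n) : exists w, is_adj_word pi w.
Proof.
have [ts -> _] := prod_tpermP pi.
elim: ts => [|[a b] ts [w hw]]; first by exists [::]; split => //; rewrite !big_nil.
have [v hv] := adj_word_tperm a b.
by exists (v ++ w); rewrite big_cons; exact: is_adj_wordM.
Qed.

(* The Psi_j satisfy the Coxeter relations almost everywhere, so that Psi pi    *)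
(* does not depend, up to null sets, on the word chosen for pi, and pi |-> Psi  *)
(* pi is the representation of 'S_n with Psi (j, j+1) = Psi_j. (The product of  *)
(* permutations is the library's: (p * q) i = q (p i).)                         *)
Definition adj_word n (pi : 'S_n) : seq nat :=
  xget [::] [set w | is_adj_word pi w].

Definition Psi n (pi : 'S_n) F : seq X -> R[i]^o :=
  foldr Psi_adj F (adj_word pi).

Definition Psym F : seq X -> R[i]^o := fun s =>
  (size s)`!%:R^-1 * \sum_(pi : 'S_(size s)) Psi pi F s.

End q_symmetrization.

Section marked_space.
Variables (R : realType) (T : ptopologicalType).

Definition marked : measurableType _ := (borel T * measurableTypeR R)%type.

Definition marked_measure
    (sigma : {sigma_finite_measure set (borel T) -> \bar R})
    (nu : probability (measurableTypeR R) R) :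
    {sigma_finite_measure set marked -> \bar R} :=
  sigma_finite_product sigma nu.

End marked_space.

Section noncommutative_levy.
Variables (R : realType) (T : ptopologicalType).
Variable sigma : {sigma_finite_measure set (borel T) -> \bar R}.
Variable nu : probability (measurableTypeR R) R.
Variable Q : borel T * borel T -> R[i].

Local Notation X := (marked R T).
Local Notation mu := (marked_measure sigma nu).
Local Notation vec := (fclass mu).
Implicit Types (F G H : vec) (h : X -> R) (f : T -> R) (p q : vec -> vec).

Definition B0 f : Prop :=
  [/\ measurable_fun [set: borel T] (f : borel T -> measurableTypeR R),
      exists M : R, forall t, `|f t| <= M &
      compact (closure [set t : T | f t != 0])].

Definition symmetrizer : (seq X -> R[i]^o) -> seq X -> R[i]^o :=
  Psym (fun x y : X => Q (x.1, y.1)).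

(* F is in the Fock space iff each F^(n) is in P_n L2(X^n) and the norm of F    *)
(* is finite.                                                                   *)
Definition fock : set vec :=
  [set F | (exists2 H : vec, fL2 H & F = cls mu (symmetrizer (rep H))) /\
           (fsqnorm F < +oo)%E].

Definition fock_fin : set vec :=
  [set F | fock F /\ exists n, truncate n F = F].

(* on X^k: sum over i in {0..N}^k of c_i(t_1..t_k) x_1^{i_1} ... x_k^{i_k} *)
Definition poly_in_x (N : nat)
    (c : forall k, k.-tuple 'I_N.+1 -> k.-tuple (borel T) -> R[i]) :
    seq X -> R[i]^o := fun s =>
  \sum_(i : (size s).-tuple 'I_N.+1)
    c (size s) i (map_tuple fst (in_tuple s)) *
    (\prod_(j < size s) (tnth (in_tuple s) j).2 ^+ tnth i j)%:C.

(* The domain D. One N serves for all k <= n, which is no restriction as the    *)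
(* coefficients may be 0; for k = 0 the component is an arbitrary constant.     *)
Definition domain : set vec :=
  [set F | exists (n N : nat)
     (c : forall k, k.-tuple 'I_N.+1 -> k.-tuple (borel T) -> R[i]),
     (forall k i, L2 (tuple_measure sigma k) (c k i)) /\
     F = cls mu (fun s =>
       if (size s <= n)%N then symmetrizer (poly_in_x c) s else 0)].

Definition tensor h (F : seq X -> R[i]^o) : seq X -> R[i]^o := fun s =>
  if s is x :: r then (h x)%:C * F r else 0.

Definition creation h F : vec := cls mu (symmetrizer (tensor h (rep F))).

Definition neutral h F : vec := cls mu (fun s => (\sum_(x <- s) h x)%:C * rep F s).

(* The value at F of the adjoint of p restricted to E, as an operator in the    *)
(* Fock space: the G with (p H, F) = (H, G) for all H in E (which is unique     *)
(* when E is dense in the Fock space), and 0 if there is none.                  *)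
Definition adjoint (E : set vec) p F : vec :=
  xget 0 [set G | fock G /\ forall H, E H -> fip (p H) F = fip H G].

Definition annihilation h : vec -> vec := adjoint fock_fin (creation h).

(* Operators on the domain D are represented by functions on vec that are 0     *)
(* outside D, so that two of them are equal iff they agree on D.                *)
Definition on_domain p : vec -> vec := patch (fun=> 0) domain p.

(* f (x) mu_k *)
Definition tensor_mu f (k : nat) : X -> R := fun z => f z.1 * z.2 ^+ k.

Definition field_op f : vec -> vec := on_domain (fun F =>
  creation (tensor_mu f 0) F + neutral (tensor_mu f 1) F +
  annihilation (tensor_mu f 0) F).

Definition star p : vec -> vec := on_domain (adjoint domain p).

(* the unital *-algebra generated by the field operators *)
Inductive polynomial : (vec -> vec) -> Prop :=
| polynomial_field f : B0 f -> polynomial (field_op f)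
| polynomial_one : polynomial (on_domain id)
| polynomial_add p q : polynomial p -> polynomial q -> polynomial (p + q)
| polynomial_scale (a : R[i]) p : polynomial p -> polynomial (a *: p)
| polynomial_mul p q : polynomial p -> polynomial q -> polynomial (p \o q)
| polynomial_star p : polynomial p -> polynomial (star p).

Definition polynomials : {pred vec -> vec} := fun p => `[< polynomial p >].

Lemma polynomials_submod : submod_closed polynomials.
Proof.
split=> [|a p q]; rewrite !unfold_in.
  apply/asboolP; rewrite -(scale0r (on_domain id)).
  exact/polynomial_scale/polynomial_one.
move=> /asboolP Pp /asboolP Pq; apply/asboolP.
exact/polynomial_add/Pq/polynomial_scale.
Qed.

HB.instance Definition _ := GRing.isSubmodClosed.Build R[i] (vec -> vec)
  polynomials (GRing.submod_closed_semi polynomials_submod).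

Record poly_op := PolyOp {
  poly_op_fun :> vec -> vec ; _ : poly_op_fun \in polynomials }.

HB.instance Definition _ := [isSub for poly_op_fun].
HB.instance Definition _ := gen_eqMixin poly_op.
HB.instance Definition _ := [Choice of poly_op by <:].
HB.instance Definition _ := [SubChoice_isSubLmodule of poly_op by <:].

Definition tau p : R[i] := fip (p (vacuum mu)) (vacuum mu).

Definition tau_ip (p1 p2 : poly_op) : R[i] := tau (star p2 \o p1).

Definition cyclic_vacuum : Prop :=
  forall F, fock F -> forall e : R, 0 < e ->
    exists p : poly_op, (fsqnorm (F - p (vacuum mu))%R < (e ^+ 2)%:E)%E.

(* P_0 = {p | (p, p) = 0} is the kernel of squot_proj : P -> P / P_0. *)
Definition L2tau (tau_semi_inner : semi_inner tau_ip) : lmodType R[i] :=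
  completion (squot_ipP tau_semi_inner).

Definition L2tau_incl (tau_semi_inner : semi_inner tau_ip)
    (x : squot tau_semi_inner) : L2tau tau_semi_inner :=
  completion_incl (squot_ipP tau_semi_inner) x.

Definition L2tau_ip (tau_semi_inner : semi_inner tau_ip)
    (x y : L2tau tau_semi_inner) : R[i] :=
  completion_ip x y.

Definition unitary_onto_fock (tau_semi_inner : semi_inner tau_ip)
    (U : L2tau tau_semi_inner -> vec) : Prop :=
  [/\ linear U,
      forall x, fock (U x),
      forall x y, fip (U x) (U y) = L2tau_ip x y &
      forall F, fock F -> exists x, U x = F].

End noncommutative_levy.

(* Main.v *)
(** Every p in P has its adjoint in P on the domain D, so (p1 Omega, p2 Omega) = tau (p2^* p1);
    hence p |-> p Omega is an
    isometry of P / P_0 into the complete Fock space, and only cyclicity is at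
    stake.  Replacing Q by 1 on the null set A, the symmetrizer P_n is
    conjugate, by multiplication with a function of modulus one (a gauge), to
    the symmetrization of functions.

    The vectors P_n (c(t) x_1^(i_1) ... x_n^(i_n)) span D, and D is total: by
    the exponential moment of nu, vanishing of all the integrals against
    monomials in the x_j implies vanishing of the integrals against indicators
    of rays.  Let F be orthogonal to P Omega.  For every p in P the functional
    c |-> (p P_n (c x^i), F) is bounded in c in L2(T^n), and it vanishes, by
    induction on n and then on the exponent i_1.  If i_1 = 0, one approximates
    c by sums of f(t_1) c'(t_2, ..., t_n) and uses the creation part of
    <f, xi>.  To pass from i_1 to i_1 + 1, one applies, for every cell B of a
    fine finite partition of a relatively compact set, <1_B, xi> to the vector
    with coefficient 1_B(t_1) c(t): the neutral part acting on the first
    variable gives back c x_1^(i_1 + 1), the creation part is supported near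
    the diagonal {t_1 = t_2}, which is null, and the other terms are orthogonal
    to F by induction. *)

Require Import Defs.
From HB Require Import structures.
From mathcomp Require Import all_boot all_order all_algebra.
From mathcomp Require Import fingroup perm complex.
From mathcomp Require Import ring lra.
From mathcomp Require Import all_classical all_reals all_analysis.
From mathcomp Require Import measurable_realfun.
Set Implicit Arguments.
Unset Strict Implicit.
Unset Printing Implicit Defensive.
Import Order.TTheory GRing.Theory Num.Theory.
Import numFieldNormedType.Exports.
Local Open Scope classical_set_scope.
Local Open Scope ring_scope.
Local Open Scope complex_scope.


(** The operators of the algebra are unbounded, yet each of them sends a vector P_n (c x^i) to a
    finite sum of vectors P_m (c' x^j) whose exponents depend on i alone and whose coefficients c'
    are bounded in L2 by c: the unboundedness sits in the exponents. This is where boundedness in c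
    at fixed i comes from, and why the limits in the induction are taken in the coefficients.

    What is propagated is stronger than orthogonality to F: a vector H is done when (p H, F) = 0 for
    all p in the algebra. This passes from H to <f, xi> H, so that one term of <f, xi> H can be
    isolated once the others are done. In the induction on the first exponent the remaining
    exponents stay arbitrary, because the neutral part raises them as well.

    Adjoints are defined by choice: nothing can be computed about annihilation, or about p^*, before
    totality of the domain makes them unique.

    The Fock norm is the L2 norm of a single measure, the sum of n! m^n over the powers X^n;
    completeness is then Riesz-Fischer followed by the symmetrizer, which is a contraction. *)

Section complex_modulus.
Variable R : realType.
Implicit Types z w : R[i].

(** Kept in [R], where [lra] and the limit lemmas for real sequences apply; the norm of [R[i]] takes
    its values in [R[i]]. *)
Definition cabs2 z : R := complex.Re z ^+ 2 + complex.Im z ^+ 2.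

Lemma cabs2_ge0 z : 0 <= cabs2 z.
Proof. by rewrite addr_ge0 ?sqr_ge0. Qed.

Lemma cabs2E z : (cabs2 z)%:C = z * z^*%C.
Proof. by case: z => x y; rewrite /cabs2; simpc; congr (_ +i* _); ring. Qed.

Lemma conjcM z w : (z * w)^*%C = z^*%C * w^*%C.
Proof. exact: rmorphM. Qed.

Lemma cabs2M z w : cabs2 (z * w) = cabs2 z * cabs2 w.
Proof. by case: z w => a b [c d]; rewrite /cabs2 /=; ring. Qed.

Lemma cabs2_conj z : cabs2 z^*%C = cabs2 z.
Proof. by case: z => a b; rewrite /cabs2 /=; ring. Qed.

Lemma cabs2N z : cabs2 (- z) = cabs2 z.
Proof. by case: z => a b; rewrite /cabs2 /=; ring. Qed.

Lemma cabs2_real (x : R) : cabs2 x%:C = x ^+ 2.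
Proof. by rewrite /cabs2 /=; ring. Qed.

Lemma cabs2D z w : cabs2 (z + w) <= 2 * cabs2 z + 2 * cabs2 w.
Proof.
case: z w => a b [c d]; rewrite /cabs2 /= -subr_ge0.
rewrite (_ : _ - _ = (a - c) ^+ 2 + (b - d) ^+ 2); last by ring.
by rewrite addr_ge0 ?sqr_ge0.
Qed.

Lemma cabs2_eq0 z : cabs2 z = 0 -> z = 0.
Proof.
case: z => a b; rewrite /cabs2 /= => /eqP.
by rewrite paddr_eq0 ?sqr_ge0// !sqrf_eq0 => /andP[/eqP-> /eqP->].
Qed.

Lemma cabs2_norm1 z : `|z| = 1 -> cabs2 z = 1.
Proof.
move=> z1; have : ((cabs2 z)%:C = 1 :> R[i]).
  by rewrite cabs2E -[LHS]normCK z1 expr1n.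
by move/complexI.
Qed.

Lemma Re_le_cabs2 z : complex.Re z ^+ 2 <= cabs2 z.
Proof. by rewrite lerDl sqr_ge0. Qed.

Lemma Im_le_cabs2 z : complex.Im z ^+ 2 <= cabs2 z.
Proof. by rewrite lerDr sqr_ge0. Qed.

Lemma complex_cabs2_small z w : (forall e : R, 0 < e -> cabs2 (z - w) <= e) -> z = w.
Proof.
move=> h; apply/eqP; rewrite -subr_eq0; apply/eqP/cabs2_eq0/eqP.
rewrite eq_le cabs2_ge0 andbT; apply/ler_addgt0Pr => e e0.
by rewrite add0r h.
Qed.

End complex_modulus.

Section sequences_of_squares.
Variable R : realType.

Lemma cvg_sqr0 (u : nat -> R) : (fun n => u n ^+ 2) @ \oo --> (0 : R) -> u @ \oo --> (0 : R).
Proof.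
move=> u0; apply/cvgrPdist_lt => e e0.
move/cvgrPdist_lt : u0 => /(_ (e ^+ 2)); rewrite exprn_gt0// => /(_ isT).
apply: filterS => n; rewrite !sub0r !normrN normrX.
by rewrite ltr_pXn2r ?nnegrE// ltW.
Qed.

Lemma cvg_cabs2 (z : nat -> R[i]) (l : R[i]) :
  (fun n => cabs2 (z n - l)) @ \oo --> (0 : R) ->
  (fun n => complex.Re (z n)) @ \oo --> complex.Re l /\
  (fun n => complex.Im (z n)) @ \oo --> complex.Im l.
Proof.
move=> h; split.
  apply/subr_cvg0/cvg_sqr0; apply: (squeeze_cvgr _ (cvg_cst _) h).
  by apply: nearW => n; rewrite sqr_ge0/= -raddfB; exact: Re_le_cabs2.
apply/subr_cvg0/cvg_sqr0; apply: (squeeze_cvgr _ (cvg_cst _) h).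
by apply: nearW => n; rewrite sqr_ge0/= -raddfB; exact: Im_le_cabs2.
Qed.

(** [clim] is a pair of real [limn], which have a value even for divergent sequences; convergence in
    squared modulus is what identifies it. *)
Lemma clim_cabs2 (z : nat -> R[i]) (l : R[i]) :
  (fun n => cabs2 (z n - l)) @ \oo --> (0 : R) -> clim z = l.
Proof.
move=> /cvg_cabs2[hr hi]; rewrite /clim.
by rewrite (cvg_lim _ hr)// (cvg_lim _ hi)//; case: (l).
Qed.

End sequences_of_squares.

Lemma subBB (V : zmodType) (v x y : V) : v - x - (v - y) = y - x.
Proof. by rewrite [v - x]addrC addrKA opprK addrC. Qed.

(** * Geometry of semi-inner products: Cauchy-Schwarz, limits, density *)

Section semi_inner_norm.
Variables (R : realType) (V : lmodType R[i]) (B : V -> V -> R[i]).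
Hypothesis hB : semi_inner B.

Definition nsq (u : V) : R := complex.Re (B u u).

Lemma nsqE u : B u u = (nsq u)%:C.
Proof.
by have := semi_inner_ge0 hB u; rewrite /nsq; case: (B u u) => x y; rewrite lecE/= => /andP[/eqP-> _].
Qed.

Lemma nsq_ge0 u : 0 <= nsq u.
Proof. by have := semi_inner_ge0 hB u; rewrite nsqE lecR. Qed.

Lemma sipNl u w : B (- u) w = - B u w.
Proof. by rewrite -scaleN1r (sipZl hB) mulN1r. Qed.

Lemma sipNr u w : B w (- u) = - B w u.
Proof. by rewrite -scaleN1r (sipZr hB) rmorphN1 mulN1r. Qed.

Lemma nsqN u : nsq (- u) = nsq u.
Proof. by rewrite /nsq sipNl sipNr opprK. Qed.

Lemma nsqBC u v : nsq (u - v) = nsq (v - u).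
Proof. by rewrite -nsqN opprB. Qed.

Lemma nsq0 : nsq 0 = 0.
Proof. by rewrite /nsq (sip0l hB). Qed.

Lemma nsqZ a u : nsq (a *: u) = cabs2 a * nsq u.
Proof.
apply: (@complexI R); rewrite -nsqE (sipZl hB) (sipZr hB) mulrA -cabs2E nsqE.
by rewrite -rmorphM.
Qed.

Lemma nsq_parallelogram u v :
  nsq (u + v) + nsq (u - v) = 2 * nsq u + 2 * nsq v.
Proof.
apply: (@complexI R); rewrite !rmorphD !rmorphM/= -!nsqE (sipBl hB) !(sipBr hB) (sipDl hB) !(sipDr hB).
by rewrite rmorphD/= !rmorph1; ring.
Qed.

Lemma nsqD u v : nsq (u + v) <= 2 * nsq u + 2 * nsq v.
Proof. by rewrite -nsq_parallelogram lerDl nsq_ge0. Qed.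

Lemma nsqB u v : nsq (u - v) = nsq u - 2 * complex.Re (B v u) + nsq v.
Proof.
rewrite /nsq (sipBl hB) !(sipBr hB) (semi_inner_sym hB v u).
by case: (B u u) (B v u) (B v v) => a b [c d] [e f] /=; ring.
Qed.

Lemma cauchy_schwarz u v : cabs2 (B u v) <= nsq u * nsq v.
Proof.
(* The form is only semi-definite: a null vector need not be 0, but it is orthogonal to
   everything. *)
have [v0|v0] := eqVneq (nsq v) 0.
  by rewrite (sip_nullr hB) ?nsqE ?v0// mulr0 /cabs2/= expr0n/= addr0.
have vp : 0 < nsq v by rewrite lt_neqAle eq_sym v0 nsq_ge0.
pose k := (nsq v)^-1; have kv : k%:C * (nsq v)%:C = 1 :> R[i] by rewrite -rmorphM mulVf.
pose c := B u v * k%:C.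
rewrite -subr_ge0.
(* [c *: v] is the projection of [u] on the line of [v]; the factor [nsq v] clears the
   denominator. *)
suff <- : nsq v * nsq (u - c *: v) = nsq u * nsq v - cabs2 (B u v).
  by rewrite mulr_ge0 ?nsq_ge0.
apply: (@complexI R); rewrite rmorphB !rmorphM/= -(nsqE (u - _)) cabs2E.
rewrite (sipBl hB) !(sipBr hB) !(sipZl hB) !(sipZr hB) (semi_inner_sym hB u v) !nsqE /c.
rewrite conjcM conjc_real mulrA.
move: (B u v) ((B u v)^*%C) ((nsq v)%:C) k%:C ((nsq u)%:C) kv => x y m l U kv.
(* The product [l * m] is 1 by [kv], which [ring] cannot know; the right-hand side groups the terms
   so that [kv] can be rewritten. *)
rewrite (_ : m * _ = U * m - (l * m) * (x * y) - (l * m) * (x * y) * (1 - l * m)); last by ring.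
by rewrite kv; ring.
Qed.

Definition sip_cvg (x : nat -> V) (l : V) : Prop :=
  (fun n => nsq (x n - l)) @ \oo --> (0 : R).

Lemma sip_cvgP x l : sip_cvg x l <-> forall e : R, 0 < e ->
  exists N, forall n, (N <= n)%N -> B (x n - l) (x n - l) < e%:C.
Proof.
split=> [/cvgrPdist_lt h e /h[N _ hN]|h].
  exists N => n /hN /=; rewrite sub0r normrN nsqE ltcR; exact: le_lt_trans (ler_norm _).
apply/cvgrPdist_lt => e /h[N hN]; exists N => // n /= /hN.
by rewrite sub0r normrN nsqE ltcR ger0_norm// nsq_ge0.
Qed.

Lemma sip_cvg_ip x y l m : sip_cvg x l -> sip_cvg y m ->
  (fun n => cabs2 (B (x n) (y n) - B l m)) @ \oo --> (0 : R).
Proof.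
move=> xl ym.
have hub : (fun n => 2 * (nsq (x n - l) * (2 * nsq (y n - m) + 2 * nsq m))
               + 2 * (nsq l * nsq (y n - m))) @ \oo --> (0 : R).
  rewrite [X in _ --> X](_ : _ = 2 * (0 * (2 * 0 + 2 * nsq m)) + 2 * (nsq l * 0)); last by ring.
  apply: cvgD; apply: cvgM; (try exact: cvg_cst); apply: cvgM => //; try exact: cvg_cst.
  by apply: cvgD; [apply: cvgM => //; exact: cvg_cst|exact: cvg_cst].
apply: (squeeze_cvgr _ (cvg_cst _) hub); apply: nearW => n /=.
rewrite cabs2_ge0/=.
have -> : B (x n) (y n) - B l m = B (x n - l) (y n) + B l (y n - m).
  by rewrite (sipBl hB) (sipBr hB); ring.
apply: le_trans (cabs2D _ _) _; apply: lerD; rewrite ler_pM2l//.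
  apply: le_trans (cauchy_schwarz _ _) _; apply: ler_wpM2l; first exact: nsq_ge0.
  by rewrite -{1}(subrK m (y n)) nsqD.
exact: cauchy_schwarz.
Qed.

Definition sip_cauchy (x : nat -> V) : Prop :=
  forall e : R, 0 < e -> exists N, forall m n, (N <= m)%N -> (N <= n)%N ->
    nsq (x m - x n) < e.

Lemma cauchy_seqsP x : x \in cauchy_seqs hB <-> sip_cauchy x.
Proof.
rewrite unfold_in; split=> [/asboolP h e /h[N hN]|h].
  by exists N => m n hm hn; have := hN m n hm hn; rewrite nsqE ltcR.
apply/asboolP => e /h[N hN]; exists N => m n hm hn; rewrite nsqE ltcR; exact: hN.
Qed.

Lemma sip_cvg_cauchy x l : sip_cvg x l -> sip_cauchy x.
Proof.
move=> /sip_cvgP h e e0; have [N hN] := h (e / 4) ltac:(by rewrite divr_gt0).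
exists N => m n /hN + /hN; rewrite !nsqE !ltcR => hm hn.
rewrite (_ : _ - _ = (x m - l) + (l - x n)); last by rewrite addrA subrK.
by apply: (le_lt_trans (nsqD _ _)); rewrite (nsqBC l); lra.
Qed.

Definition sip_complete : Prop := forall x, sip_cauchy x -> exists l, sip_cvg x l.

(* A minimizing sequence for the distance from v to S is Cauchy by the         *)
(* parallelogram law, and v minus its limit is orthogonal to S.                *)
Lemma perp_dense (S : V -> Prop) : sip_complete -> S 0 ->
  (forall a u v, S u -> S v -> S (a *: u + v)) ->
  (forall v, (forall s, S s -> B s v = 0) -> nsq v = 0) ->
  forall v (e : R), 0 < e -> exists2 s, S s & nsq (v - s) < e.
Proof.
move=> cB S0 SZD Sperp v e e0.
have SD u w : S u -> S w -> S (u + w) by move=> su sw; rewrite -(scale1r u); exact: SZD.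
have SZ a u : S u -> S (a *: u) by move=> su; rewrite -[a *: u]addr0; exact: SZD.
pose D := [set nsq (v - s) | s in S].
have Dinf : has_inf D.
  by split; [exists (nsq (v - 0)), 0|exists 0 => _ [s _ <-]; exact: nsq_ge0].
pose d := inf D.
have dle s : S s -> d <= nsq (v - s).
  by move=> ss; apply: ge_inf; [exact: Dinf.2|exists s].
have approx n : exists s, S s /\ nsq (v - s) < d + n.+1%:R^-1.
  have n0 : 0 < n.+1%:R^-1 :> R by rewrite invr_gt0.
  have [_ [s ss <-] h] := inf_adherent n0 Dinf.
  by exists s.
have [s /all_and2[Ss sd]] := choice approx.
have smid m n : nsq (s m - s n) <= 2 * m.+1%:R^-1 + 2 * n.+1%:R^-1.
  have := nsq_parallelogram (v - s m) (v - s n).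
  rewrite (_ : _ - _ - _ = s n - s m); last by rewrite opprB addrC addrA subrK.
  rewrite (_ : _ + _ = (2 : R[i]) *: (v - (2^-1 : R[i]) *: (s m + s n))); last first.
    rewrite scalerBr scalerA divff// scale1r scaler_nat mulr2n.
    by rewrite opprD addrACA.
  rewrite nsqZ (_ : cabs2 _ = 4); last by rewrite /cabs2/=; ring.
  (* The midpoint of two approximations lies in [S], hence at squared distance at least [d]; in the
     parallelogram law this forces the approximations together. *)
  have := dle _ (SZ 2^-1 _ (SD _ _ (Ss m) (Ss n))).
  have := sd m; have := sd n; rewrite (nsqBC (s m)).
  move: (nsq (v - s m)) (nsq (v - s n)) (nsq (s n - s m)) (nsq (v - 2^-1 *: _)) m.+1%:R^-1 n.+1%:R^-1 => a b c f x y.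
  lra.
have sC : sip_cauchy s.
  move=> e' e'0; have [N NP] : exists N : nat, N.+1%:R^-1 < e' / 4 :> R.
    have := near_infty_natSinv_lt (PosNum (divr_gt0 e'0 (ltr0Sn R 3))).
    by move=> [N _ /(_ N (leqnn N))] hN; exists N.
  exists N => m n Nm Nn; apply: le_lt_trans (smid m n) _.
  have hm k : (N <= k)%N -> k.+1%:R^-1 <= N.+1%:R^-1 :> R.
    by move=> Nk; rewrite lef_pV2 ?posrE// ler_nat.
  have := hm _ Nm; have := hm _ Nn; move: NP.
  move: (N.+1%:R^-1) (m.+1%:R^-1) (n.+1%:R^-1) => a b c; lra.
have [w sw] := cB s sC.
have Vs n : (fun n => n.+1%:R^-1) @ \oo --> (0 : R) by exact: cvg_harmonic.
have wmin : nsq (v - w) <= d.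
  have vsw : sip_cvg (fun n => v - s n) (v - w).
    rewrite /sip_cvg; apply: cvg_trans sw; apply: near_eq_cvg; apply: nearW => n /=.
    by rewrite nsqBC subBB.
  have [h _] := cvg_cabs2 (sip_cvg_ip vsw vsw).
  have h2 : (fun n => d + n.+1%:R^-1) @ \oo --> d + 0.
    by apply: cvgD; [exact: cvg_cst|exact: Vs].
  rewrite addr0 in h2; apply: ler_cvg_to h h2 _.
  by apply: nearW => n; exact/ltW/sd.
have orth t : S t -> B t (v - w) = 0.
  move=> St; apply/cabs2_eq0.
  (* [w] is only a limit of elements of [S]; the bound holds at [s n + k *: t] and passes to the
     limit. *)
  have key k : d <= nsq (v - w - k *: t).
    have vsw : sip_cvg (fun n => v - (s n + k *: t)) (v - w - k *: t).
      rewrite /sip_cvg; apply: cvg_trans sw; apply: near_eq_cvg; apply: nearW => n /=.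
      rewrite nsqBC -[v - w - _]addrA -opprD subBB.
      by rewrite [s n + _]addrC addrKA.
    have [h _] := cvg_cabs2 (sip_cvg_ip vsw vsw).
    apply: ler_cvg_to (cvg_cst d) h _.
    by apply: nearW => n; apply: dle; apply: SD => //; exact: SZ.
  set b := B t (v - w) in key *.
  have expand (r : R) : nsq (v - w - (r%:C * b^*%C) *: t) =
      nsq (v - w) - 2 * r * cabs2 b + r ^+ 2 * cabs2 b * nsq t.
    rewrite (nsqB (v - w)) nsqZ (sipZl hB) -/b cabs2M cabs2_real cabs2_conj.
    rewrite (_ : _ * _ * b = (r * cabs2 b)%:C) /=; first by ring.
    by rewrite rmorphM/= cabs2E; ring.
  have [t0|t0] := eqVneq (nsq t) 0.
    by rewrite /b (sip_null hB) ?nsqE ?t0// /cabs2/= expr0n addr0.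
  have tp : 0 < nsq t by rewrite lt_neqAle eq_sym t0 nsq_ge0.
  (* The coefficient that minimizes the quadratic polynomial of [expand]: it lowers the squared
     distance by [cabs2 b / nsq t], and [d] allows no decrease. *)
  have := key (((nsq t)^-1)%:C * b^*%C); rewrite expand.
  rewrite (_ : _ ^+ 2 * _ * _ = (nsq t)^-1 * cabs2 b); last by field.
  have b0 := cabs2_ge0 b; have ip : 0 < (nsq t)^-1 by rewrite invr_gt0.
  move=> hh; have : (nsq t)^-1 * cabs2 b <= 0 by lra.
  rewrite pmulr_rle0// => h0; apply/eqP; rewrite eq_le h0 b0//.
have vw0 := Sperp _ orth.
have : sip_cvg (fun n => v - s n) (v - w).
  rewrite /sip_cvg; apply: cvg_trans sw; apply: near_eq_cvg; apply: nearW => n /=.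
  by rewrite nsqBC subBB.
move=> vsw; have [h _] := cvg_cabs2 (sip_cvg_ip vsw vsw).
move: h => /=; rewrite -/(nsq (v - w)) vw0 => /cvgrPdist_lt /(_ e e0)[N _ /(_ N (leqnn N))].
rewrite /= sub0r normrN => hN; exists (s N) => //.
exact: le_lt_trans (ler_norm _) hN.
Qed.

End semi_inner_norm.

(** * Extension of an isometry with dense range to the completion *)

Section completion_extension.
Variables (R : realType) (V W : lmodType R[i]).
Variables (B : V -> V -> R[i]) (hB : semi_inner B).
Variables (C : W -> W -> R[i]) (hC : semi_inner C).
Variable j : V -> W.
Hypotheses (C_complete : sip_complete C) (C_definite : forall w, nsq C w = 0 -> w = 0).
Hypotheses (j_linear : linear j) (j_isometry : forall u v, C (j u) (j v) = B u v).
Hypothesis j_dense : forall w (e : R), 0 < e -> exists v, nsq C (w - j v) < e.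

Let jB u v : j (u - v) = j u - j v.
Proof. by rewrite addrC -scaleN1r j_linear scaleN1r addrC. Qed.

Let nsqj u : nsq C (j u) = nsq B u.
Proof. by rewrite /nsq j_isometry. Qed.

Lemma sip_cvg_unique x l m : sip_cvg C x l -> sip_cvg C x m -> l = m.
Proof.
move=> xl xm; apply/eqP; rewrite -subr_eq0; apply/eqP/C_definite.
apply/eqP; rewrite eq_le nsq_ge0// andbT.
have h : (fun n => 2 * nsq C (x n - l) + 2 * nsq C (x n - m)) @ \oo --> (0 : R).
  rewrite [X in _ --> X](_ : _ = 2 * 0 + 2 * 0); last by ring.
  by apply: cvgD; apply: cvgM => //; exact: cvg_cst.
apply: ler_cvg_to (cvg_cst (nsq C (l - m))) h _; apply: nearW => n.
rewrite (_ : l - m = (l - x n) + (x n - m)); last by rewrite addrA subrK.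
by apply: le_trans (nsqD hC _ _) _; rewrite (nsqBC hC l).
Qed.

Lemma sip_cvg_lin a x y l m : sip_cvg C x l -> sip_cvg C y m ->
  sip_cvg C (fun n => a *: x n + y n) (a *: l + m).
Proof.
move=> xl ym.
have h : (fun n => 2 * (cabs2 a * nsq C (x n - l)) + 2 * nsq C (y n - m)) @ \oo --> (0 : R).
  rewrite [X in _ --> X](_ : _ = 2 * (cabs2 a * 0) + 2 * 0); last by ring.
  by apply: cvgD; apply: cvgM => //; (try exact: cvg_cst); apply: cvgM => //; exact: cvg_cst.
apply: (squeeze_cvgr _ (cvg_cst _) h); apply: nearW => n /=.
rewrite nsq_ge0//= opprD addrACA -scalerBr; apply: le_trans (nsqD hC _ _) _.
by rewrite nsqZ.
Qed.

Let lim_ex (p : cauchy_seq hB) : exists l, sip_cvg C (j \o p) l.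
Proof.
apply: C_complete => e e0; have /(cauchy_seqsP hB)/(_ e e0)[N hN] := valP p.
by exists N => m n Nm Nn; rewrite /= -jB nsqj; exact: hN.
Qed.

Let U (x : completion hB) : W := sval (cid (lim_ex (generic_quotient.repr x))).

Let cproj : cauchy_seq hB -> completion hB := lproj (@null_seqs R V B hB).

Let cprojK x : cproj (generic_quotient.repr x) = x.
Proof. exact: lproj_repr. Qed.

Let lproj_null (p q : cauchy_seq hB) : cproj p = cproj q ->
  sip_cvg C (fun n => j (p n - q n)) 0.
Proof.
move/lproj_eq; rewrite unfold_in => /asboolP h; apply/(sip_cvgP hC) => e /h[N hN].
by exists N => n /hN; rewrite subr0 j_isometry.
Qed.

(** Two representatives of a class differ by a null sequence, whose image tends to 0, and limits are
    unique since [C] is definite: neither the representative nor the limit chosen in [U] matters. *)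
Let UE (p : cauchy_seq hB) l : sip_cvg C (j \o p) l -> U (cproj p) = l.
Proof.
move=> pl; rewrite /U; case: cid => m /= rm.
have h := lproj_null (cprojK (cproj p)).
apply: sip_cvg_unique rm _.
have := sip_cvg_lin 1 h pl; rewrite scaler0 add0r.
by congr (sip_cvg C _ _); apply/funext => n /=; rewrite scale1r jB subrK.
Qed.

Let U_cvg (p : cauchy_seq hB) : sip_cvg C (j \o p) (U (cproj p)).
Proof. by have [l pl] := lim_ex p; rewrite (UE pl). Qed.

Lemma completion_unitary : exists U : completion hB -> W,
  [/\ linear U, forall x y, C (U x) (U y) = completion_ip x y,
      forall w, exists x, U x = w & forall u, U (completion_incl hB u) = j u].
Proof.
exists U; split.
- move=> a x y; rewrite -(cprojK x) -(cprojK y) -linearP; apply: UE.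
  have := sip_cvg_lin a (U_cvg (generic_quotient.repr x)) (U_cvg (generic_quotient.repr y)).
  by congr (sip_cvg C _ _); apply/funext => n /=; rewrite j_linear.
- move=> x y; apply/esym/clim_cabs2; rewrite -{2}(cprojK x) -{2}(cprojK y).
  have := sip_cvg_ip hC (U_cvg (generic_quotient.repr x)) (U_cvg (generic_quotient.repr y)).
  by apply: cvg_trans; apply: near_eq_cvg; apply: nearW => n /=; rewrite j_isometry.
(* Surjectivity: a sequence [v] with [j \o v] tending to [w] is itself Cauchy, because [j] is
   isometric. *)
- move=> w; have /choice[v hv] n : exists v, nsq C (w - j v) < n.+1%:R^-1.
    by apply: j_dense; rewrite invr_gt0.
  have vw : sip_cvg C (j \o v) w.
    apply: (squeeze_cvgr _ (cvg_cst _) cvg_harmonic); apply: nearW => n /=.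
    by rewrite nsq_ge0//= (nsqBC hC) ltW// hv.
  have cv : v \in cauchy_seqs hB.
    apply/cauchy_seqsP => e e0; have [N hN] := sip_cvg_cauchy hC vw e0.
    by exists N => m n Nm Nn; rewrite -nsqj jB; exact: hN.
  by exists (cproj (CauchySeq cv)); exact: UE.
- move=> u; apply: UE; rewrite /sip_cvg.
  rewrite (_ : (fun n => _) = fun=> 0); first exact: cvg_cst.
  by apply/funext => n /=; rewrite subrr nsq0.
Qed.

End completion_extension.

(** * Complex-valued measurable, integrable and square-integrable functions *)

Section complex_measurable.
Context d (Y : measurableType d) (R : realType).
Implicit Types f g : Y -> R[i].

Lemma cmeasurable_cst (z : R[i]) : cmeasurable (fun _ : Y => z).
Proof. by split; exact: measurable_cst. Qed.

Lemma cmeasurableD f g : cmeasurable f -> cmeasurable g ->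
  cmeasurable (fun x => f x + g x).
Proof.
move=> [fr fi] [gr gi]; split.
  rewrite (_ : (fun _ => _) = (fun x => complex.Re (f x)) \+ (fun x => complex.Re (g x))).
    exact: measurable_funD.
  by apply/funext => x /=; rewrite raddfD.
rewrite (_ : (fun _ => _) = (fun x => complex.Im (f x)) \+ (fun x => complex.Im (g x))).
  exact: measurable_funD.
by apply/funext => x /=; rewrite raddfD.
Qed.

Lemma cmeasurableM f g : cmeasurable f -> cmeasurable g ->
  cmeasurable (fun x => f x * g x).
Proof.
move=> [fr fi] [gr gi]; split.
  rewrite (_ : (fun _ => _) = ((fun x => complex.Re (f x)) \* (fun x => complex.Re (g x))) \-
      ((fun x => complex.Im (f x)) \* (fun x => complex.Im (g x)))).
    by apply: measurable_funB; exact: measurable_funM.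
  by apply/funext => x /=; case: (f x) (g x) => a b [c e].
rewrite (_ : (fun _ => _) = ((fun x => complex.Re (f x)) \* (fun x => complex.Im (g x))) \+
    ((fun x => complex.Im (f x)) \* (fun x => complex.Re (g x)))).
  by apply: measurable_funD; exact: measurable_funM.
by apply/funext => x /=; case: (f x) (g x) => a b [c e].
Qed.

Lemma cmeasurableZ a f : cmeasurable f -> cmeasurable (fun x => a * f x).
Proof. by apply: cmeasurableM; exact: cmeasurable_cst. Qed.

Lemma cmeasurableB f g : cmeasurable f -> cmeasurable g ->
  cmeasurable (fun x => f x - g x).
Proof.
move=> mf /(cmeasurableZ (-1)) mg; have := cmeasurableD mf mg.
by congr cmeasurable; apply/funext => x; rewrite mulN1r.
Qed.

Lemma cmeasurable_conj f : cmeasurable f -> cmeasurable (fun x => (f x)^*%C).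
Proof.
move=> [fr fi]; split.
  by rewrite (_ : (fun _ => _) = (fun x => complex.Re (f x)))//; apply/funext => x; case: (f x).
rewrite (_ : (fun _ => _) = \- (fun x => complex.Im (f x))); first exact: measurable_funN.
by apply/funext => x /=; case: (f x).
Qed.

Lemma cmeasurable_real (f : Y -> R) : measurable_fun setT f -> cmeasurable (fun x => (f x)%:C).
Proof. by move=> mf; split => //=; exact: measurable_cst. Qed.

Lemma cmeasurable_sum (I : Type) (r : seq I) (P : pred I) (f : I -> Y -> R[i]) :
  (forall i, P i -> cmeasurable (f i)) -> cmeasurable (fun x => \sum_(i <- r | P i) f i x).
Proof.
move=> mf; elim: r => [|i r IH].
  by under eq_fun do rewrite big_nil; exact: cmeasurable_cst.
under eq_fun do rewrite big_cons; case: (boolP (P i)) => // Pi.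
by apply: cmeasurableD => //; exact: mf.
Qed.

Lemma cmeasurable_if (b : Y -> bool) f g : measurable_fun setT b ->
  cmeasurable f -> cmeasurable g -> cmeasurable (fun x => if b x then f x else g x).
Proof.
move=> mb [fr fi] [gr gi]; split.
  rewrite (_ : (fun _ => _) = fun x => if b x then complex.Re (f x) else complex.Re (g x)).
    exact: measurable_fun_ifT.
  by apply/funext => x; case: (b x).
rewrite (_ : (fun _ => _) = fun x => if b x then complex.Im (f x) else complex.Im (g x)).
  exact: measurable_fun_ifT.
by apply/funext => x; case: (b x).
Qed.

Lemma measurable_cabs2 f : cmeasurable f -> measurable_fun setT (fun x => cabs2 (f x)).
Proof. by move=> [fr fi]; apply: measurable_funD; exact: measurable_funX. Qed.

Lemma measurable_cabs2E f : cmeasurable f -> measurable_fun setT (fun x => (cabs2 (f x))%:E).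
Proof. by move=> mf; apply/measurable_EFinP; exact: measurable_cabs2. Qed.

End complex_measurable.

Lemma cmeasurable_comp d1 d2 (Y1 : measurableType d1) (Y2 : measurableType d2)
    (R : realType) (f : Y2 -> R[i]) (phi : Y1 -> Y2) :
  measurable_fun setT phi -> cmeasurable f -> cmeasurable (f \o phi).
Proof. by move=> mphi [fr fi]; split; [exact: (measurableT_comp fr)|exact: (measurableT_comp fi)]. Qed.

Section complex_integral.
Context d (Y : measurableType d) (R : realType) (mu : {measure set Y -> \bar R}).
Implicit Types f g : Y -> R[i].

Definition cintegrable f : Prop :=
  mu.-integrable setT (EFin \o (fun x => complex.Re (f x))) /\
  mu.-integrable setT (EFin \o (fun x => complex.Im (f x))).

Lemma cintegrable_cmeasurable f : cintegrable f -> cmeasurable f.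
Proof. by move=> [/measurable_int/measurable_EFinP + /measurable_int/measurable_EFinP]. Qed.

Lemma le_cintegrable f (h : Y -> R) : cmeasurable f -> mu.-integrable setT (EFin \o h) ->
  (forall x, `|complex.Re (f x)| <= h x /\ `|complex.Im (f x)| <= h x) -> cintegrable f.
Proof.
move=> [fr fi] ih fh; split; apply: (le_integrable measurableT _ _ ih).
- exact/measurable_EFinP.
- by move=> x _ /=; rewrite lee_fin; apply: le_trans (fh x).1 (ler_norm _).
- exact/measurable_EFinP.
- by move=> x _ /=; rewrite lee_fin; apply: le_trans (fh x).2 (ler_norm _).
Qed.

Lemma cintegralD f g : cintegrable f -> cintegrable g ->
  cintegral mu (fun x => f x + g x) = cintegral mu f + cintegral mu g.
Proof.
move=> [fr fi] [gr gi]; rewrite /cintegral.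
under eq_Rintegral do rewrite raddfD.
under [X in _ +i* X]eq_Rintegral do rewrite raddfD.
by rewrite !RintegralD.
Qed.

Lemma cintegrableD f g : cintegrable f -> cintegrable g -> cintegrable (fun x => f x + g x).
Proof.
move=> [fr fi] [gr gi]; split.
  apply: eq_integrable (integrableD measurableT fr gr) => //.
  by move=> x _ /=; rewrite raddfD.
apply: eq_integrable (integrableD measurableT fi gi) => //.
by move=> x _ /=; rewrite raddfD.
Qed.

Lemma cintegrableZ a f : cintegrable f -> cintegrable (fun x => a * f x).
Proof.
move=> [fr fi]; case: a => a b; split.
  apply: eq_integrable (integrableB measurableT (integrableZl measurableT a fr)
    (integrableZl measurableT b fi)) => //.
  by move=> x _ /=; rewrite -!EFinM -EFinB; case: (f x).
apply: eq_integrable (integrableD measurableT (integrableZl measurableT a fi)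
  (integrableZl measurableT b fr)) => //.
by move=> x _ /=; rewrite -!EFinM -EFinD; case: (f x).
Qed.

Lemma cintegralZ a f : cintegrable f ->
  cintegral mu (fun x => a * f x) = a * cintegral mu f.
Proof.
move=> [fr fi]; case: a => a b; rewrite /cintegral.
have aZ c (h : Y -> R) : mu.-integrable setT (EFin \o h) ->
  mu.-integrable setT (EFin \o (fun x => c * h x)).
  by move=> ih; apply: eq_integrable (integrableZl measurableT c ih).
have -> : (fun x => complex.Re (a +i* b * f x)) =
    fun x => a * complex.Re (f x) - b * complex.Im (f x).
  by apply/funext => x; case: (f x).
have -> : (fun x => complex.Im (a +i* b * f x)) =
    fun x => a * complex.Im (f x) + b * complex.Re (f x).
  by apply/funext => x; case: (f x).
by rewrite RintegralB ?RintegralD ?RintegralZl//; exact: aZ.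
Qed.

Lemma cintegral_sum (I : Type) (r : seq I) (f : I -> Y -> R[i]) :
  (forall i, cintegrable (f i)) ->
  cintegral mu (fun x => \sum_(i <- r) f i x) = \sum_(i <- r) cintegral mu (f i).
Proof.
move=> fi; suff [_ //] : cintegrable (fun x => \sum_(i <- r) f i x) /\
  cintegral mu (fun x => \sum_(i <- r) f i x) = \sum_(i <- r) cintegral mu (f i).
elim: r => [|i r [ir IH]].
  under eq_fun do rewrite big_nil; split.
    by split; exact: integrable0.
  by rewrite big_nil /cintegral /= !Rintegral_cst// !mul0r.
under eq_fun do rewrite big_cons; split; first exact: cintegrableD.
by rewrite cintegralD// big_cons IH.
Qed.

Lemma cintegral_conj f : cintegrable f ->
  cintegral mu (fun x => (f x)^*%C) = (cintegral mu f)^*%C.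
Proof.
move=> [fr fi]; rewrite /cintegral /=.
have -> : (fun x => complex.Re (f x)^*%C) = fun x => complex.Re (f x).
  by apply/funext => x; case: (f x).
have -> : (fun x => complex.Im (f x)^*%C) = fun x => (-1) * complex.Im (f x).
  by apply/funext => x; case: (f x) => a b; rewrite mulN1r.
by rewrite RintegralZl// mulN1r.
Qed.

Lemma ae_eq_Rintegral (f g : Y -> R) : measurable_fun setT f -> measurable_fun setT g ->
  {ae mu, forall x, f x = g x} -> (\int[mu]_x f x = \int[mu]_x g x)%R.
Proof.
move=> mf mg fg; congr fine; apply: ae_eq_integral => //; first exact/measurable_EFinP.
  exact/measurable_EFinP.
by apply: filterS fg => x /= + _; move=> ->.
Qed.

Lemma ae_eq_cintegral f g : cmeasurable f -> cmeasurable g ->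
  {ae mu, forall x, f x = g x} -> cintegral mu f = cintegral mu g.
Proof.
move=> [fr fi] [gr gi] fg; congr (_ +i* _); apply: ae_eq_Rintegral => //.
  by apply: filterS fg => x ->.
by apply: filterS fg => x ->.
Qed.

Lemma ae_eq_sqnorm f g : cmeasurable f -> cmeasurable g ->
  {ae mu, forall x, f x = g x} -> sqnorm mu f = sqnorm mu g.
Proof.
move=> mf mg fg; apply: ae_eq_integral => //.
- exact: measurable_cabs2E.
- exact: measurable_cabs2E.
- by apply: filterS fg => x /= + _; move=> ->.
Qed.

Lemma sqnorm_ge0 f : (0 <= sqnorm mu f)%E.
Proof. by apply: integral_ge0 => x _; rewrite lee_fin cabs2_ge0. Qed.

Lemma le_sqnorm f g : cmeasurable f -> cmeasurable g ->
  (forall x, cabs2 (f x) <= cabs2 (g x)) -> (sqnorm mu f <= sqnorm mu g)%E.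
Proof.
move=> mf mg fg; apply: ge0_le_integral => //.
- by move=> x _; rewrite lee_fin cabs2_ge0.
- exact: measurable_cabs2E.
- exact: measurable_cabs2E.
- by move=> x _; rewrite lee_fin fg.
Qed.

Lemma sqnormZ a f : cmeasurable f ->
  sqnorm mu (fun x => a * f x) = ((cabs2 a)%:E * sqnorm mu f)%E.
Proof.
move=> mf; rewrite /sqnorm -ge0_integralZl_EFin ?cabs2_ge0//; last first.
- exact: measurable_cabs2E.
- by move=> x _; rewrite lee_fin cabs2_ge0.
by apply: eq_integral => x _; rewrite -EFinM -cabs2M.
Qed.

Lemma sqnormD_le f g : cmeasurable f -> cmeasurable g ->
  (sqnorm mu (fun x => (f x + g x)%R) <= 2%:E * sqnorm mu f + 2%:E * sqnorm mu g)%E.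
Proof.
move=> mf mg; rewrite /sqnorm.
have ge0 (h : Y -> R[i]) x : setT x -> (0 <= (complex.Re (h x) ^+ 2 + complex.Im (h x) ^+ 2)%:E)%E.
  by move=> _; rewrite lee_fin cabs2_ge0.
rewrite -!ge0_integralZl_EFin//; try exact: measurable_cabs2E; try exact: ge0.
rewrite -ge0_integralD//; last first.
- by apply: emeasurable_funM => //; exact: measurable_cabs2E.
- by move=> x _; rewrite mule_ge0// ge0.
- by apply: emeasurable_funM => //; exact: measurable_cabs2E.
- by move=> x _; rewrite mule_ge0// ge0.
apply: ge0_le_integral => //.
- by move=> x _; exact: (ge0 (fun x => f x + g x)).
- by apply: measurable_cabs2E; exact: cmeasurableD.
- by apply: emeasurable_funD; apply: emeasurable_funM => //; exact: measurable_cabs2E.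
- by move=> x _; rewrite -!EFinM -EFinD lee_fin; exact: cabs2D.
Qed.

Lemma L2D f g : L2 mu f -> L2 mu g -> L2 mu (fun x => f x + g x).
Proof.
move=> [mf nf] [mg ng]; split; first exact: cmeasurableD.
apply: le_lt_trans (sqnormD_le mf mg) _.
by apply: lte_add_pinfty; apply: lte_mul_pinfty.
Qed.

Lemma L2Z a f : L2 mu f -> L2 mu (fun x => a * f x).
Proof.
move=> [mf nf]; split; first exact: cmeasurableZ.
by rewrite sqnormZ// lte_mul_pinfty// lee_fin cabs2_ge0.
Qed.

Lemma L2_0 : L2 mu (fun _ => 0).
Proof.
split; first exact: cmeasurable_cst.
rewrite /sqnorm (eq_integral (cst 0%E)) ?integral0//.
by move=> x _ /=; rewrite expr0n/= addr0.
Qed.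

Lemma L2_sum (I : Type) (r : seq I) (P : pred I) (f : I -> Y -> R[i]) :
  (forall i, P i -> L2 mu (f i)) -> L2 mu (fun x => \sum_(i <- r | P i) f i x).
Proof.
move=> Lf; elim: r => [|i r IH].
  by under eq_fun do rewrite big_nil; exact: L2_0.
under eq_fun do rewrite big_cons; case: (boolP (P i)) => // Pi.
by apply: L2D => //; exact: Lf.
Qed.

Lemma L2B f g : L2 mu f -> L2 mu g -> L2 mu (fun x => f x - g x).
Proof.
move=> Lf /(L2Z (-1)) Lg; have := L2D Lf Lg.
by congr L2; apply/funext => x; rewrite mulN1r.
Qed.

Lemma L2_le f g : cmeasurable f -> L2 mu g -> (forall x, cabs2 (f x) <= cabs2 (g x)) -> L2 mu f.
Proof. by move=> mf [mg ng] fg; split => //; apply: le_lt_trans ng; exact: le_sqnorm. Qed.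

Lemma L2_bounded_mul (M : R) h f : 0 <= M -> cmeasurable h -> (forall x, cabs2 (h x) <= M) ->
  L2 mu f -> L2 mu (fun x => h x * f x) /\
  (sqnorm mu (fun x => (h x * f x)%R) <= M%:E * sqnorm mu f)%E.
Proof.
move=> M0 mh hM [mf nf]; have mhf : cmeasurable (fun x => h x * f x) by exact: cmeasurableM.
suff le : (sqnorm mu (fun x => (h x * f x)%R) <= M%:E * sqnorm mu f)%E.
  by do 2!split => //; apply: le_lt_trans le _; rewrite lte_mul_pinfty.
rewrite /sqnorm -ge0_integralZl_EFin//; last 2 first.
- by move=> x _; rewrite lee_fin cabs2_ge0.
- exact: measurable_cabs2E.
apply: ge0_le_integral => //.
- by move=> x _; rewrite lee_fin cabs2_ge0.
- exact: measurable_cabs2E.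
- by apply: emeasurable_funM => //; exact: measurable_cabs2E.
- move=> x _; rewrite -EFinM lee_fin.
  by rewrite -/(cabs2 (h x * f x)) cabs2M ler_wpM2r ?cabs2_ge0.
Qed.

Lemma L2_integrable_cabs2 f : L2 mu f -> mu.-integrable setT (EFin \o (fun x => cabs2 (f x))).
Proof.
move=> [mf nf]; apply/integrableP; split; first exact: measurable_cabs2E.
by under eq_integral => x _ do rewrite /= ger0_norm ?cabs2_ge0//.
Qed.

Lemma L2_mul_integrable f g : L2 mu f -> L2 mu g -> cintegrable (fun x => f x * (g x)^*%C).
Proof.
move=> Lf Lg; apply: (@le_cintegrable _ (fun x => cabs2 (f x) + cabs2 (g x))).
- by apply: cmeasurableM; [exact: Lf.1|apply: cmeasurable_conj; exact: Lg.1].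
- apply: eq_integrable (integrableD measurableT (L2_integrable_cabs2 Lf) (L2_integrable_cabs2 Lg)) => //.
- move=> x; rewrite /cabs2; case: (f x) (g x) => a b [c e] /=.
  (* Each part of [f x * (g x)^*] is a sum of two real products, bounded through squares of sums and
     differences. *)
  have sq (u v : R) : 0 <= (u + v) ^+ 2 /\ 0 <= (u - v) ^+ 2 by rewrite !sqr_ge0.
  have := (sq a c, sq a e, sq b c, sq b e, (sqr_ge0 a, sqr_ge0 b, sqr_ge0 c, sqr_ge0 e)).
  move=> [[[[[? ?] [? ?]] [? ?]] [? ?]] [[[? ?] ?] ?]].
  by rewrite !ler_norml; split; apply/andP; split; lra.
Qed.

Definition cip f g : R[i] := cintegral mu (fun x => f x * (g x)^*%C).

Lemma cip_self f : L2 mu f -> cip f f = (fine (sqnorm mu f))%:C.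
Proof.
move=> Lf; rewrite /cip /cintegral /sqnorm; congr (_ +i* _).
  by congr fine; apply: eq_integral => x _; rewrite -cabs2E.
under eq_Rintegral => x _ do rewrite -cabs2E.
by rewrite /= Rintegral_cst// mul0r.
Qed.

Lemma sqnorm_fin f : L2 mu f -> (sqnorm mu f = (fine (sqnorm mu f))%:E)%E.
Proof. by move=> [mf nf]; rewrite fineK// ge0_fin_numE// sqnorm_ge0. Qed.

Definition L2_pred : {pred Y -> R[i]^o} := fun f => `[< L2 mu f >].

Lemma L2_submod : submod_closed L2_pred.
Proof.
split=> [|a f g]; rewrite !unfold_in.
  by apply/asboolP; exact: L2_0.
move=> /asboolP Lf /asboolP Lg; apply/asboolP.
exact: (L2D (L2Z a Lf) Lg).
Qed.

HB.instance Definition _ := GRing.isSubmodClosed.Build R[i] (Y -> R[i]^o) L2_pred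
  (GRing.submod_closed_semi L2_submod).

(** Functions rather than classes: [L2ip] is only semi-definite, and the geometry above is stated
    for such forms. *)
Record L2fun := MkL2fun { L2fun_val :> Y -> R[i]^o ; _ : L2fun_val \in L2_pred }.

HB.instance Definition _ := [isSub for L2fun_val].
HB.instance Definition _ := gen_eqMixin L2fun.
HB.instance Definition _ := [Choice of L2fun by <:].
HB.instance Definition _ := [SubChoice_isSubLmodule of L2fun by <:].

Lemma L2funP (f : L2fun) : L2 mu f.
Proof. by case: f => f /=; rewrite unfold_in => /asboolP. Qed.

Definition mkL2 f (Lf : L2 mu f) : L2fun := @MkL2fun f (asboolT Lf).

Definition L2ip (f g : L2fun) : R[i] := cip f g.

Lemma L2ip_semi_inner : semi_inner L2ip.
Proof.
split=> [w a f g|f g|f].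
- rewrite /L2ip /cip -cintegralZ; last by apply: L2_mul_integrable; exact: L2funP.
  rewrite -cintegralD; last 2 first.
  + by apply: cintegrableZ; apply: L2_mul_integrable; exact: L2funP.
  + by apply: L2_mul_integrable; exact: L2funP.
  by congr cintegral; apply/funext => x; rewrite /= mulrDl -mulrA.
- rewrite /L2ip /cip -cintegral_conj; last by apply: L2_mul_integrable; exact: L2funP.
  by congr cintegral; apply/funext => x; rewrite conjcM conjcK mulrC.
- by rewrite /L2ip cip_self ?lecR ?fine_ge0 ?sqnorm_ge0//; exact: L2funP.
Qed.

Lemma nsq_L2 (f : L2fun) : nsq L2ip f = fine (sqnorm mu f).
Proof. by rewrite /nsq /L2ip cip_self//; exact: L2funP. Qed.

End complex_integral.

(** * Completeness of L2 and a form of dominated convergence *)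

Lemma cvgn_sqr_increments (R : realType) (u : nat -> R) (C : R) :
  (forall k, 4 ^+ k * (u k.+1 - u k) ^+ 2 <= C) -> cvgn u.
Proof.
move=> uC; have C0 : 0 <= C by apply: le_trans (uC 0%N); rewrite mulr_ge0 ?sqr_ge0// exprn_ge0.
suff h : cvgn [normed series (fun k => u k.+1 - u k)].
  have /(is_cvgD (is_cvg_cst (u 0%N))) := normed_cvg h.
  rewrite (_ : _ + _ = u)//; apply/funext => n.
  by rewrite /GRing.add/= seriesEnat/= telescope_sumr// addrC subrK.
(* The increments are at most the root of [C] times 2^-k, and [C + 1] is a bound for that root. *)
apply: (@series_le_cvg _ _ (geometric (C + 1) 2^-1)) => //=.
- by move=> n; rewrite mulr_ge0 ?addr_ge0// exprn_ge0.
- move=> k; have p0 : 0 < 2 ^+ k :> R by rewrite exprn_gt0.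
  rewrite exprVn ler_pdivlMr//; have := uC k.
  rewrite (_ : 4 = 2 * 2 :> R); last by rewrite -natrM.
  rewrite exprMn -(real_normK (num_real (_ - _))).
  have := normr_ge0 (u k.+1 - u k); move: (`|_|) (2 ^+ k) p0 => a p; nra.
- apply: is_cvg_geometric_series; rewrite ger0_norm ?invr_ge0//.
  by rewrite invf_lt1// ltr1n.
Qed.

Section riesz_fischer.
Context d (Y : measurableType d) (R : realType) (mu : {measure set Y -> \bar R}).

Lemma sqnorm_L2B (f g : L2fun mu) :
  sqnorm mu (fun t => f t - g t) = (nsq (@L2ip _ _ _ mu) (f - g))%:E.
Proof. by rewrite nsq_L2 -sqnorm_fin//; exact: L2funP. Qed.

(* A rapidly Cauchy subsequence y satisfies \int \sum_k 4^k |y_(k+1) - y_k|^2 < oo, *)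
(* so it converges wherever this sum is finite.                                *)
Lemma riesz_fischer : sip_complete (@L2ip _ _ _ mu).
Proof.
move=> x xC.
(* The rate 8^-k leaves the summable 2^-k after the weight 4^k. *)
have /choice[N /all_and2[kN hN]] k : exists N, (k <= N)%N /\
    forall m n, (N <= m)%N -> (N <= n)%N -> nsq (@L2ip _ _ _ mu) (x m - x n) < (8 ^+ k)^-1.
  have [|N hN] := xC (8 ^+ k)^-1; first by rewrite invr_gt0 exprn_gt0.
  exists (maxn k N); split=> [|m n]; first exact: leq_maxl.
  by rewrite !geq_max => /andP[_ Nm] /andP[_ Nn]; exact: hN.
(* The running maximum: the bound of every rank [i <= k] is available at [y k]. *)
pose M k := (\max_(i < k.+1) N i)%N; pose y k := x (M k).
have NM k : (N k <= M k)%N by rewrite /M; exact: (leq_bigmax (Ordinal (ltnSn k))).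
have NMS k : (N k <= M k.+1)%N.
  by rewrite /M; exact: (@leq_bigmax _ (fun i : 'I_k.+2 => N i) (Ordinal (ltnW (ltnSn k.+1)))).
have yM i k : (i <= k)%N -> (N i <= M k)%N.
  by move=> ik; exact: (@leq_bigmax _ (fun i : 'I_k.+1 => N i) (Ordinal (ik : (i < k.+1)%N))).
have my k : cmeasurable (y k) by have [] := L2funP (y k).
pose D k t := (4 ^+ k * cabs2 (y k.+1 t - y k t))%:E.
have D0 k t : (0 <= D k t)%E by rewrite lee_fin mulr_ge0 ?cabs2_ge0// exprn_ge0.
have mD k : measurable_fun setT (D k).
  apply/measurable_EFinP; apply: measurable_funM => //.
  by apply: measurable_cabs2; exact: cmeasurableB.
pose h t := (\sum_(k <oo) D k t)%E.
have h_ge0 t : (0 <= h t)%E by apply: nneseries_ge0 => k _ _; exact: D0.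
have mh : measurable_fun setT h.
  by apply: (ge0_emeasurable_sum (h := D) (P := predT)) => // k t _ _; exact: D0.
have ih : (\int[mu]_t h t < +oo)%E.
  rewrite integral_nneseries//.
  apply: (@le_lt_trans _ _ (\sum_(k <oo) (2 / (2 ^ (k + 1))%:R)%:E)%E).
    apply: lee_nneseries => [k _ _|k _]; first by apply: integral_ge0 => t _; exact: D0.
    rewrite /D; under eq_integral do rewrite EFinM.
    rewrite ge0_integralZl_EFin ?exprn_ge0//; last first.
    - by apply: measurable_cabs2E; exact: cmeasurableB.
    - by move=> t _; rewrite lee_fin cabs2_ge0.
    rewrite [X in (_ * X)%E](_ : _ = (nsq (@L2ip _ _ _ mu) (y k.+1 - y k))%:E); last exact: sqnorm_L2B.
    rewrite -EFinM lee_fin.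
    have := hN k _ _ (NMS k) (NM k); rewrite -/(y k) -/(y k.+1) => /ltW hk.
    apply: (@le_trans _ _ (4 ^+ k * (8 ^+ k)^-1)); first by rewrite ler_wpM2l// exprn_ge0.
    rewrite (_ : 8 = 4 * 2 :> R); last by rewrite -natrM.
    rewrite exprMn addn1 natrX exprS invfM mulrA divff ?mul1r ?invfM ?mulrA ?divff ?mul1r//.
  by rewrite (cvg_lim _ (@cvg_geometric_eseries_half R 2 0))// ltry.
have hfin : {ae mu, forall t, (h t < +oo)%E}.
  have /(integrable_ae measurableT) : mu.-integrable setT h.
    by apply/integrableP; split => //; under eq_integral => t _ do rewrite gee0_abs ?h_ge0//.
  by apply: filterS => t /(_ I); rewrite ge0_fin_numE.
(* Set to 0 on the null set where [h] is infinite, so that the sequence converges everywhere and its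
   limit is measurable. *)
pose z k t : R[i] := if (h t < +oo)%E then y k t else 0.
have mz k : cmeasurable (z k).
  by apply: cmeasurable_if => //; apply: measurable_fun_lte => //; exact: measurable_cst.
have zcvg t : cvgn (fun k => complex.Re (z k t)) /\ cvgn (fun k => complex.Im (z k t)).
  rewrite /z; case: (boolP (h t < +oo)%E) => ht; last by split; exact: is_cvg_cst.
  have hE k : 4 ^+ k * cabs2 (y k.+1 t - y k t) <= fine (h t).
    rewrite -lee_fin fineK ?ge0_fin_numE//.
    apply: le_trans (nneseries_lim_ge k.+1 _); last by move=> *; exact: D0.
    rewrite big_nat_recr//= -[leLHS]add0e; apply: leeD => //.
    by apply: sume_ge0 => i _; exact: D0.
  have h0 : 0 <= fine (h t) by rewrite fine_ge0.
  by split; apply: (@cvgn_sqr_increments _ _ (fine (h t))) => // k; apply: le_trans (hE k);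
    rewrite -raddfB ler_wpM2l ?exprn_ge0 ?Re_le_cabs2 ?Im_le_cabs2.
pose g t : R[i] := limn (fun k => complex.Re (z k t)) +i* limn (fun k => complex.Im (z k t)).
have mg : cmeasurable g.
  split; [apply: (@measurable_fun_cvg _ _ _ _ (fun k t => complex.Re (z k t)))
         |apply: (@measurable_fun_cvg _ _ _ _ (fun k t => complex.Im (z k t)))].
  - by move=> k; have [] := mz k.
  - by move=> t _; exact: (zcvg t).1.
  - by move=> k; have [] := mz k.
  - by move=> t _; exact: (zcvg t).2.
(* Fatou's lemma carries a bound on the distances from [x n] to [y] over to the limit [g]; the shift
   by [i] discards the initial terms, which are not controlled. *)
have key (e : R) i n : (forall k, (i <= k)%N -> nsq (@L2ip _ _ _ mu) (x n - y k) <= e) ->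
    (sqnorm mu (fun t => x n t - g t)%R <= e%:E)%E.
  move=> hk; pose F k t := (cabs2 (x n t - z (i + k)%N t))%:E.
  have mF k : measurable_fun setT (F k).
    by apply: measurable_cabs2E; apply: cmeasurableB; [exact: (L2funP (x n)).1|exact: mz].
  have FE t : limn_einf (F ^~ t) = (cabs2 (x n t - g t))%:E.
    have [cr ci] := zcvg t.
    have shift (u : nat -> R) (l : R) : u @ \oo --> l -> (fun k => u (i + k)%N) @ \oo --> l.
      by move=> ul; apply: cvg_comp ul; exact: cvg_addnl.
    apply: (cvg_limn_einf_sup _).1; apply: cvg_EFin; first exact: nearW.
    pose u k := complex.Re (z k t); pose v k := complex.Im (z k t).
    rewrite (_ : fine \o _ = fun k => (complex.Re (x n t) - u (i + k)%N) ^+ 2 +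
      (complex.Im (x n t) - v (i + k)%N) ^+ 2); last first.
      by apply/funext => k /=; rewrite /cabs2 !raddfB.
    rewrite /cabs2 !raddfB/=; have ur := shift _ _ cr; have vi := shift _ _ ci.
    by apply: cvgD; rewrite !expr2; apply: cvgM; apply: cvgB => //; exact: cvg_cst.
  apply: (@le_trans _ _ (\int[mu]_t limn_einf (F ^~ t))%E).
    by under [leRHS]eq_integral do rewrite FE.
  apply: le_trans (fatou _ _ _ _) _ => //; first by move=> k t _; rewrite lee_fin cabs2_ge0.
  rewrite limn_einf_lim; apply: lime_le; first exact: is_cvg_einfs.
  apply: nearW => k; apply: (@le_trans _ _ (\int[mu]_t F k t)%E).
    by apply: ereal_inf_lbound; exists k => //=.
  rewrite -[leLHS]/(sqnorm mu (fun t => x n t - z (i + k)%N t)).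
  rewrite (@ae_eq_sqnorm _ _ _ _ _ (fun t => x n t - y (i + k)%N t)).
  - by rewrite sqnorm_L2B lee_fin hk// leq_addr.
  - by apply: cmeasurableB; [exact: (L2funP (x n)).1|exact: mz].
  - by apply: cmeasurableB; [exact: (L2funP (x n)).1|exact: my].
  - by apply: filterS hfin => t ht; rewrite /z ht.
have Lg : L2 mu g.
  have Lxg : L2 mu (fun t => x (M 0%N) t - g t).
    split; first by apply: cmeasurableB => //; exact: (L2funP (x _)).1.
    apply: (@le_lt_trans _ _ 1%E); last exact: ltry.
    apply: (key 1 0%N) => k _; have := hN 0%N _ _ (NM 0%N) (yM _ _ (leq0n k)).
    by rewrite expr0 invr1 => /ltW.
  have := L2B (L2funP (x (M 0%N))) Lxg; congr L2; apply/funext => t.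
  by rewrite opprB addrC subrK.
exists (mkL2 Lg); apply/(sip_cvgP (L2ip_semi_inner mu)) => e e0.
have [N0 hN0] := xC (e / 2) ltac:(by rewrite divr_gt0).
exists N0 => n N0n; rewrite (nsqE (L2ip_semi_inner mu)) ltcR.
apply: (@le_lt_trans _ _ (e / 2)); last by rewrite ltr_pdivrMr// ltr_pMr// ltr1n.
rewrite -lee_fin -sqnorm_L2B; apply: (key _ N0) => k N0k.
by apply/ltW/hN0 => //; apply: leq_trans N0k (leq_trans (kN k) (NM k)).
Qed.

End riesz_fischer.

(** The dominated convergence used for cutoffs and near the diagonal, where the functions vanish at
    almost every point from some rank on. *)
Lemma sqnorm_eventually0 d (Y : measurableType d) (R : realType)
    (mu : {measure set Y -> \bar R}) (f : nat -> Y -> R[i]) (g : Y -> R[i]) :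
  (forall n, cmeasurable (f n)) -> L2 mu g -> (forall n x, cabs2 (f n x) <= cabs2 (g x)) ->
  {ae mu, forall x, exists N, forall n, (N <= n)%N -> f n x = 0} ->
  (fun n => fine (sqnorm mu (f n))) @ \oo --> (0 : R).
Proof.
move=> mf Lg fg f0; pose F n x := (cabs2 (f n x))%:E.
have [| | | |_ _] := @dominated_convergence _ _ _ mu setT measurableT F (cst 0%E)
    (EFin \o (fun x => cabs2 (g x))) _ (measurable_cst _).
- by move=> n; exact: measurable_cabs2E.
- apply: filterS f0 => x [N hN] _; apply: cvg_near_cst.
  by exists N => // n /= /hN fn0; rewrite /F fn0 /cabs2/= expr0n addr0.
- exact: L2_integrable_cabs2.
- by apply: aeW => x n _; rewrite gee0_abs lee_fin ?cabs2_ge0 ?fg.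
by rewrite integral0 => /fine_cvgP[_].
Qed.

(** * Functions whose integrals vanish over a pi-system *)

Section vanishing.
Context d (Y : measurableType d) (R : realType) (mu : {measure set Y -> \bar R}).

(** The argument is local: inside each [E n], where [u] is integrable, the sets with vanishing
    integral form a Dynkin class containing [G]. Countably many [E n] then cover the space. *)
Lemma ae_eq0_pi_system (G : set (set Y)) (E : nat -> set Y) (u : Y -> R) :
  @measurable _ Y = <<s G >> -> setI_closed G -> (forall n, G (E n)) ->
  \bigcup_n E n = setT ->
  (forall A, G A -> mu.-integrable A (EFin \o u)) ->
  (forall A, G A -> (\int[mu]_(x in A) (u x)%:E = 0)%E) ->
  {ae mu, forall x, u x = 0}.
Proof.
move=> mG GI GE TE iu u0.
have Gm A : G A -> measurable A by rewrite mG; exact: sub_sigma_algebra.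
have mE n : measurable (E n) by exact: Gm.
have En n : {ae mu, forall x, E n x -> u x = 0}.
  have iS S : measurable S -> S `<=` E n -> mu.-integrable S (EFin \o u).
    by move=> mS SE; apply: integrableS (iu _ (GE n)).
  have PS S : measurable S -> (\int[mu]_(x in S `&` E n) (u x)%:E = 0)%E.
    rewrite mG; move: S.
    apply: (dynkin_induction (P := fun S => \int[mu]_(x in S `&` E n) (u x)%:E = 0)%E mG GI).
    - by rewrite setTI u0.
    - by move=> A GA; rewrite u0//; exact: GI.
    - move=> A mA hA; have := u0 _ (GE n).
      have EA : E n = (A `&` E n) `|` (~` A `&` E n) by rewrite -setIUl setUv setTI.
      rewrite {1}EA integral_setU//; first by rewrite hA add0e.
      + exact: measurableI.
      + by apply: measurableI => //; exact: measurableC.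
      + by rewrite -EA; exact: measurable_int (iu _ (GE n)).
      + by rewrite disj_set2E; apply/eqP; rewrite setIACA setICr set0I.
    - move=> F mF tF hF; rewrite setI_bigcupl integral_bigcup//.
      + by apply: eseries0 => k _ _; exact: hF.
      + by apply: trivIset_setIr.
      + by move=> k; apply: measurableI => //; exact: mF.
      + apply: iS; last by move=> x [k _ []].
        by apply: bigcup_measurable => k _; apply: measurableI => //; exact: mF.
  have : ae_eq mu (E n) (EFin \o u) (cst 0%E).
    apply: integral_ae_eq => //; first exact: iu.
    by move=> S SE mS; rewrite integral0; have := PS _ mS; rewrite setIidl.
  by apply: filterS => x /= h /h[].
have /ae_foralln := En.
apply: filterS => x h.
have [n _ Enx] : (\bigcup_n E n) x by rewrite TE.
exact: h Enx.
Qed.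

End vanishing.

(** * From vanishing moments to vanishing integrals over rays *)

Section exponential_bounds.
Variable R : realType.

Lemma series_exp_coeff_le (x : R) n : 0 <= x -> series (exp_coeff x) n <= expR x.
Proof.
move=> x0; rewrite /expR; apply: nondecreasing_cvgn_le; last exact: is_cvg_series_exp_coeff.
by apply: nondecreasing_series => i _ _; exact: exp_coeff_ge0.
Qed.

Lemma exprn_le_expR (x : R) n : 0 <= x -> x ^+ n <= n`!%:R * expR x.
Proof.
move=> x0; have n0 : 0 < n`!%:R :> R by rewrite ltr0n fact_gt0.
rewrite mulrC -ler_pdivrMr//; apply: le_trans (series_exp_coeff_le n.+1 x0).
rewrite seriesEord /= big_ord_recr/= lerDr; apply: sumr_ge0 => i _; exact: exp_coeff_ge0.
Qed.

(** Uniform in [n]: this dominates the Taylor sums of the sine. *)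
Lemma norm_series_sin_coeff_le (x : R) n : `|series (sin_coeff x) n| <= expR `|x|.
Proof.
apply: le_trans (series_exp_coeff_le n (normr_ge0 x)).
rewrite !seriesEord/=; apply: le_trans (ler_norm_sum _ _ _) _.
apply: ler_sum => i _; rewrite /sin_coeff/= /exp_coeff/= !normrM normfV normrX.
rewrite normrN1 expr1n mulr1 (@ger0_norm _ i`!%:R)// ler_wpM2r// ?invr_ge0// normrX.
by rewrite ger0_norm// ler_piMl ?exprn_ge0//; case: odd.
Qed.

(* 1 - (1 - N u) <= (1 - u)^N (1 + u)^N <= 1 bound the smoothed step functions  *)
Lemma step_cvg (v : R) : 0 <= v <= 1 ->
  (fun n => (1 - v ^+ n) ^+ (n * 2 ^ n)%N) @ \oo --> ((v < 2^-1)%R%:R : R).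
Proof.
move=> /andP[v0 v1].
have u01 n : 0 <= v ^+ n <= 1 by rewrite exprn_ge0//= exprn_ile1.
have bern (u : R) N : -1 <= u -> 1 + N%:R * u <= (1 + u) ^+ N.
  move=> u1; elim: N => [|N IH]; first by rewrite mul0r addr0 expr0.
  rewrite exprS -natr1; apply: (@le_trans _ _ ((1 + u) * (1 + N%:R * u))).
    have : 0 <= N%:R * u ^+ 2 by rewrite mulr_ge0 ?sqr_ge0.
    by move: (N%:R) => M; nra.
  by rewrite ler_wpM2l//; move: u1; rewrite -subr_ge0 opprK addrC.
have le1 n : 0 <= (1 - v ^+ n) ^+ (n * 2 ^ n)%N <= 1.
  have /andP[a b] := u01 n; rewrite exprn_ge0 ?exprn_ile1 ?subr_ge0//.
  by rewrite lerBlDr lerDl.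
(* With N = n 2^n, the product N v^n is n (2 v)^n: it tends to 0 below 1/2 and is at least n from
   1/2 on. Bernoulli turns the first into a lower bound tending to 1, the second into the upper
   bound 1 / (n + 1). *)
have [vlt|vge] := ltP v 2^-1.
- pose r := 2 * v; have r0 : 0 <= r by rewrite /r mulr_ge0.
  have r1 : r < 1 by rewrite /r; lra.
  have nr : (fun n => n%:R * r ^+ n) @ \oo --> (0 : R).
    (* Bernoulli bounds n t^n by 1 / (1 - t), and n r^n is t^n times n t^n. *)
    pose t := Num.sqrt r; have t0 : 0 <= t by exact: sqrtr_ge0.
    have tr : t ^+ 2 = r by rewrite sqr_sqrtr.
    have t1 : t < 1 by rewrite -(@ltr_pXn2r _ 2) ?nnegrE// tr expr1n.
    have tn : (fun n => (1 - t)^-1 * t ^+ n) @ \oo --> ((1 - t)^-1 * 0 : R).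
      by apply: cvgM; [exact: cvg_cst|apply: cvg_expr; rewrite ger0_norm].
    rewrite mulr0 in tn; apply: (squeeze_cvgr _ (cvg_cst _) tn); apply: nearW => n.
    rewrite mulr_ge0 ?exprn_ge0//= -tr -exprM mulnC exprM expr2 mulrA ler_wpM2r ?exprn_ge0//.
    have t1' : 0 < 1 - t by rewrite subr_gt0.
    rewrite -[leRHS]mul1r ler_pdivlMr//.
    apply: (@le_trans _ _ (t ^+ n * (1 + n%:R * (1 - t)))).
      have := exprn_ge0 n t0; move: (t ^+ n) (n%:R) => a b; lra.
    apply: (@le_trans _ _ (t ^+ n * (1 + (1 - t)) ^+ n)).
      by rewrite ler_wpM2l ?exprn_ge0//; apply: bern; lra.
    rewrite -exprMn exprn_ile1//; nra.
  have lb : (fun n => 1 - n%:R * r ^+ n) @ \oo --> (1 - 0 : R).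
    by apply: cvgB => //; exact: cvg_cst.
  rewrite subr0 in lb; apply: (squeeze_cvgr _ lb (cvg_cst _)); apply: nearW => n.
  have /andP[_ ->] := le1 n; rewrite andbT.
  have := bern (- v ^+ n) (n * 2 ^ n)%N; rewrite lerN2 => /(_ (andP (u01 n)).2).
  apply: le_trans; rewrite mulrN lerD2l lerN2 /r exprMn natrM natrX mulrA.
  by rewrite lexx.
- have ub : (fun n => n.+1%:R^-1) @ \oo --> (0 : R) by exact: cvg_harmonic.
  apply: (squeeze_cvgr _ (cvg_cst _) ub); apply: nearW => n.
  have /andP[-> _] := le1 n => /=.
  have /andP[a b] := u01 n; set N := (n * 2 ^ n)%N.
  have p0 : 0 < (1 + v ^+ n) ^+ N by rewrite exprn_gt0// ltr_wpDr.
  have : (1 - v ^+ n) ^+ N * (1 + v ^+ n) ^+ N <= 1.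
    rewrite -exprMn exprn_ile1//; move: (v ^+ n) a b => u; nra.
  rewrite -ler_pdivlMr// mul1r => /le_trans; apply.
  rewrite lef_pV2 ?posrE//; apply: le_trans (bern _ _ _); last by lra.
  rewrite -natr1 addrC lerD2l /N natrM natrX -mulrA ler_peMr//.
  by rewrite -exprMn exprn_ege1//; lra.
Qed.

End exponential_bounds.

Section moments.
Context d (Y : measurableType d) (R : realType) (mu : {measure set Y -> \bar R}).
Variables (y g : Y -> R) (delta : R).
Hypotheses (my : measurable_fun setT y) (mg : measurable_fun setT g) (delta0 : 0 < delta).
Hypothesis ig : mu.-integrable setT (EFin \o (fun x => `|g x| * expR (delta * `|y x|))).
Hypothesis moments0 : forall k, (\int[mu]_x (g x * y x ^+ k)%:E = 0)%E.

(** One half of the exponential weight absorbs the powers of [y], the other half the function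
    [phi]. *)
Let half := delta / 2.
Let half0 : 0 < half. Proof. by rewrite divr_gt0. Qed.

Let integrable_gy k (phi : Y -> R) : measurable_fun setT phi ->
  (forall x, `|phi x| <= expR (half * `|y x|)) ->
  mu.-integrable setT (EFin \o (fun x => g x * y x ^+ k * phi x)).
Proof.
move=> mphi hphi; pose C := k`!%:R * half^-1 ^+ k.
apply: (le_integrable measurableT _ _ (integrableZl measurableT C ig)).
  by apply/measurable_EFinP; do !apply: measurable_funM => //; exact: measurable_funX.
have C0 : 0 <= C by rewrite mulr_ge0// exprn_ge0// invr_ge0 ltW.
move=> x _ /=; rewrite lee_fin [leRHS]normrM (ger0_norm C0) [leLHS]normrM [X in X * _]normrM.
rewrite [X in _ <= _ * X]normrM normr_id (ger0_norm (expR_ge0 _)) normrX.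
rewrite mulrCA -mulrA ler_wpM2l//.
have -> : delta * `|y x| = half * `|y x| + half * `|y x|.
  by rewrite -mulrDl -splitr.
rewrite expRD mulrA ler_pM// ?exprn_ge0//.
have := @exprn_le_expR _ (half * `|y x|) k; rewrite exprMn.
rewrite mulr_ge0 ?(ltW half0)// => /(_ isT) h.
by rewrite /C mulrAC exprVn ler_pdivlMr ?exprn_gt0// mulrC.
Qed.

(** All powers [k] are included: multiplying [phi] by a Taylor sum of a sine only raises the power
    of [y], so the property reproduces itself. *)
Let killed (phi : Y -> R) := [/\ measurable_fun setT phi, forall x, `|phi x| <= 1 &
  forall k, (\int[mu]_x (g x * y x ^+ k * phi x)%:E = 0)%E].

Let one_le_exp x : 1 <= expR (half * `|y x|).
Proof. by rewrite -expR0 ler_expR mulr_ge0 ?(ltW half0). Qed.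

Let killed_sin h phi : `|h| <= half -> killed phi -> killed (fun x => phi x * sin (h * y x)).
Proof.
move=> hh [mphi phi1 phi0].
have mhy : measurable_fun setT (fun x => h * y x) by exact: measurable_funM.
have msin : measurable_fun setT (fun x => sin (h * y x)).
  by apply: measurableT_comp mhy; apply: continuous_measurable_fun; exact: continuous_sin.
split=> [|x|k]; first exact: measurable_funM.
  by rewrite normrM mulr_ile1// sin_max.
pose S n x := series (sin_coeff (h * y x)) n.
have mS n : measurable_fun setT (S n).
  rewrite /S; under eq_fun do rewrite seriesEord/=; apply: measurable_sum => i.
  by apply: measurable_funM => //; apply: measurable_funM => //; exact: measurable_funX.
have Sle n x : `|S n x| <= expR (half * `|y x|).
  apply: le_trans (norm_series_sin_coeff_le _ _) _.
  by rewrite ler_expR normrM ler_wpM2r.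
pose F n x := (g x * y x ^+ k * (phi x * S n x))%:E.
have F0 n : (\int[mu]_x F n x = 0)%E.
  pose c (i : nat) : R := (odd i)%:R * (-1) ^+ i.-1./2 * h ^+ i / i`!%:R.
  rewrite (_ : F n = fun x => (\sum_(i < n) (c i)%:E * (g x * y x ^+ (k + i) * phi x)%:E)%E); last first.
    apply/funext => x; rewrite /F /S seriesEord/=.
    under [in RHS]eq_bigr do rewrite -EFinM.
    rewrite sumEFin; congr EFin; rewrite mulrA mulr_sumr; apply: eq_bigr => i _.
    by rewrite /sin_coeff /c/= exprMn exprD; ring.
  have ii (i : 'I_n) : mu.-integrable setT (fun x => (g x * y x ^+ (k + i) * phi x)%:E).
    by apply: integrable_gy => // x; apply: le_trans (phi1 x) (one_le_exp x).
  rewrite integral_sum//; last by move=> i; exact: integrableZl.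
  by apply: big1 => i _; rewrite integralZl// phi0 mule0.
have Fle x n : `|phi x * S n x| <= expR (half * `|y x|).
  by rewrite normrM; apply: le_trans (Sle n x); rewrite ler_piMl.
have iD : mu.-integrable setT (EFin \o (fun x => `|g x * y x ^+ k * expR (half * `|y x|)|)).
  apply: integrable_norm; apply: integrable_gy => [|x].
    apply: measurableT_comp; first exact: measurable_expR.
    by apply: measurable_funM => //; exact: measurableT_comp.
  by rewrite ger0_norm ?expR_ge0.
have [| | | |_ _] := @dominated_convergence _ _ _ mu setT measurableT F
    (fun x => (g x * y x ^+ k * (phi x * sin (h * y x)))%:E) _ _ _ _ iD.
- by move=> n; apply/measurable_EFinP; do !apply: measurable_funM => //; exact: measurable_funX.
- by apply/measurable_EFinP; do !apply: measurable_funM => //; exact: measurable_funX.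
- apply: aeW => x _; apply: cvg_EFin; first exact: nearW.
  apply: cvgM; first exact: cvg_cst.
  apply: cvgM; first exact: cvg_cst.
  by rewrite sin.unlock; exact: is_cvg_series_sin_coeff.
- apply: aeW => x n _; rewrite /F /= lee_fin !normrM ler_wpM2l//.
  rewrite -normrM; apply: le_trans (Fle x n) _; exact: ler_norm.
under eq_fun do rewrite F0.
by move/cvg_lim => <-//; rewrite lim_cst.
Qed.

Let killed_lim (phi : nat -> Y -> R) (psi : Y -> R) :
  (forall n, measurable_fun setT (phi n)) -> (forall n x, `|phi n x| <= 1) ->
  (forall n, (\int[mu]_x (g x * phi n x)%:E = 0)%E) ->
  (forall x, phi ^~ x @ \oo --> psi x) ->
  [/\ measurable_fun setT psi, forall x, `|psi x| <= 1 & (\int[mu]_x (g x * psi x)%:E = 0)%E].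
Proof.
move=> mphi phi1 phi0 phipsi.
have mpsi : measurable_fun setT psi by apply: (measurable_fun_cvg mphi) => x _; exact: phipsi.
have psi1 x : `|psi x| <= 1.
  apply: (ler_cvg_to (cvg_norm (phipsi x)) (cvg_cst (1 : R))).
  by apply: nearW => n.
split=> //.
have iD : mu.-integrable setT (EFin \o (fun x => `|g x|)).
  apply: (le_integrable measurableT _ _ ig).
    by apply/measurable_EFinP; exact: measurableT_comp.
  move=> x _ /=; rewrite lee_fin !normr_id normrM normr_id ler_peMr//.
  by rewrite ger0_norm ?expR_ge0// -expR0 ler_expR mulr_ge0// ltW.
have [| | | |_ _] := @dominated_convergence _ _ _ mu setT measurableT
    (fun n x => (g x * phi n x)%:E) (fun x => (g x * psi x)%:E) _ _ _ _ iD.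
- by move=> n; apply/measurable_EFinP; exact: measurable_funM.
- by apply/measurable_EFinP; exact: measurable_funM.
- apply: aeW => x _; apply: cvg_EFin; first exact: nearW.
  by apply: cvgM => //; exact: cvg_cst.
- by apply: aeW => x n _; rewrite /= lee_fin normrM ler_piMr.
under eq_fun do rewrite phi0.
by move/cvg_lim => <-//; rewrite lim_cst.
Qed.

(* The vanishing of the moments passes to bounded functions times sin (h y) for *)
(* small h by Taylor expansion, hence to polynomials in sin (h y), whose        *)
(* bounded pointwise limits include the indicators of {sin (h y) > sin (h a)}.  *)
Lemma moments0_ray a : (\int[mu]_x (g x * (a < y x)%R%:R)%:E = 0)%E.
Proof.
have ksin h j : `|h| <= half -> killed (fun x => sin (h * y x) ^+ j).
  move=> hh; elim: j => [|j IH].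
    split=> [|x|k]; first exact: measurable_cst.
      by rewrite expr0 normr1.
    by under eq_integral do rewrite mulr1; exact: moments0.
  have [m b z] := killed_sin hh IH.
  by split=> [|x|k]; (under eq_fun do rewrite exprSr) || (under eq_integral do rewrite exprSr) || rewrite exprSr.
have kpoly h (p : {poly R}) : `|h| <= half -> (\int[mu]_x (g x * p.[sin (h * y x)])%:E = 0)%E.
  move=> hh.
  have ij j : mu.-integrable setT (EFin \o (fun x => g x * sin (h * y x) ^+ j)).
    have [m b _] := ksin h j hh; have := @integrable_gy 0%N _ m.
    under eq_fun do rewrite expr0 mulr1; apply=> x.
    exact: le_trans (b x) (one_le_exp x).
  under eq_integral do rewrite horner_coef mulr_sumr -sumEFin.
  rewrite integral_sum//; last first.
    move=> j; apply: eq_integrable (integrableZl measurableT p`_j (ij j)) => // x _ /=.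
    by rewrite -EFinM; congr EFin; ring.
  apply: big1 => j _; under eq_integral => x _ do
    rewrite mulrCA EFinM.
  rewrite integralZl//; last exact: ij.
  have [_ _ /(_ 0%N)] := ksin h j hh; under eq_integral do rewrite expr0 mulr1.
  by move=> ->; rewrite mule0.
have mhy h : measurable_fun setT (fun x => sin (h * y x)).
  apply: (measurableT_comp (f := sin)); last exact: measurable_funM.
  by apply: continuous_measurable_fun; exact: continuous_sin.
have kstep h : `|h| <= half ->
    [/\ measurable_fun setT (fun x => (sin (h * a) < sin (h * y x))%R%:R : R),
    forall x, `|(sin (h * a) < sin (h * y x))%R%:R : R| <= 1 &
    (\int[mu]_x (g x * (sin (h * a) < sin (h * y x))%R%:R)%:E = 0)%E].
  (* An affine function of the sine with values in [0, 1] that is below 1/2 exactly where the sine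
     exceeds [sin (h * a)]; composed with [step_cvg] it gives polynomials in the sine. *)
  move=> hh; pose v x := 2^-1 + (sin (h * a) - sin (h * y x)) / 4.
  have v01 x : 0 <= v x <= 1.
    have := sin_max (h * a); have := sin_max (h * y x); rewrite !ler_norml /v => /andP[? ?] /andP[? ?].
    by apply/andP; split; lra.
  pose p n : {poly R} := (1 - ((2^-1 + sin (h * a) / 4)%:P - (4^-1)%:P * 'X) ^+ n) ^+ (n * 2 ^ n)%N.
  have pE n x : (p n).[sin (h * y x)] = (1 - v x ^+ n) ^+ (n * 2 ^ n)%N.
    rewrite /p !(horner_exp, hornerD, hornerN, hornerM, hornerC, hornerX) /v.
    by congr ((1 - _ ^+ _) ^+ _); ring.
  apply: (killed_lim (phi := fun n x => (1 - v x ^+ n) ^+ (n * 2 ^ n)%N)).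
  - move=> n; apply: measurable_funX; apply: measurable_funB => //; apply: measurable_funX.
    by apply: measurable_funD => //; apply: measurable_funM => //; exact: measurable_funB.
  - move=> n x; have /andP[a0 b1] : 0 <= v x ^+ n <= 1.
      by have /andP[? ?] := v01 x; rewrite exprn_ge0//= exprn_ile1.
    rewrite ger0_norm ?exprn_ge0 ?subr_ge0// exprn_ile1 ?subr_ge0//.
    by rewrite lerBlDr lerDl.
  - by move=> n; under eq_integral do rewrite -pE; exact: kpoly.
  - move=> x; have := step_cvg (v01 x).
    suff -> : (v x < 2^-1) = (sin (h * a) < sin (h * y x)) by [].
    by rewrite /v; apply/idP/idP => ?; lra.
have [N hN] : exists N : nat, N.+1%:R^-1 <= half.
  have := near_infty_natSinv_lt (PosNum half0) => -[N _ /(_ N (leqnn N))] /= hN.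
  by exists N; exact: ltW.
(* A null sequence inside the range of [h] allowed by the exponential weight. *)
pose h n : R := (N + n).+1%:R^-1.
have hh n : `|h n| <= half.
  rewrite ger0_norm ?invr_ge0//; apply: le_trans hN.
  by rewrite lef_pV2 ?posrE// ler_nat ltnS leq_addr.
have [||||_ _] := @killed_lim (fun n x => (sin (h n * a) < sin (h n * y x))%R%:R)
  (fun x => (a < y x)%R%:R) => //.
- by move=> n; have [] := kstep _ (hh n).
- by move=> n x; have [] := kstep _ (hh n).
- by move=> n; have [] := kstep _ (hh n).
move=> x; apply: cvg_near_cst.
have [M hM] : exists M : nat, `|a| + `|y x| <= M%:R :> R.
  by exists (Num.bound (`|a| + `|y x|)); apply/ltW/archi_boundP/addr_ge0.
(* Once both arguments lie between -pi/2 and pi/2, where the sine increases, comparing the sines is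
   comparing [a] with [y x]: the indicators are eventually constant. *)
exists M => // n /= Mn; congr (nat_of_bool _)%:R.
have h0 : 0 < h n by rewrite invr_gt0.
have small z : `|z| <= M%:R -> h n * z \in `[- (pi / 2), pi / 2].
  move=> zM; rewrite in_itv/= -ler_norml normrM (ger0_norm (ltW h0)).
  apply: (@le_trans _ _ 1); last by rewrite ler_pdivlMr// mul1r; exact: pi_ge2.
  rewrite mulrC ler_pdivrMr// mul1r; apply: le_trans zM _.
  by rewrite ler_nat; apply: leq_trans Mn _; apply/leqW/leq_addl.
rewrite ltr_sin ?small ?ltr_pM2l//.
- by apply: le_trans hM; rewrite lerDl.
- by apply: le_trans hM; rewrite lerDr.
Qed.

End moments.

(** * Exchanges of neighbouring coordinates and the product measures *)

Section adjacent_swap.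
Variable X : Type.

(** Recursive on the position, so that an exchange behind the head reduces to one in the tail; past
    the end it is the identity, as in [Psi_adj]. *)
Fixpoint swapn (j : nat) (s : seq X) : seq X :=
  match j, s with
  | 0%N, x :: y :: r => y :: x :: r
  | j'.+1, x :: r => x :: swapn j' r
  | _, _ => s
  end.

Lemma size_swapn j s : size (swapn j s) = size s.
Proof. by elim: j s => [|j IH] [|x [|y r]]//=; rewrite IH. Qed.

Lemma swapnK j : involutive (swapn j).
Proof. by elim: j => [|j IH] [|x [|y r]]//=; rewrite ?IH; case: j {IH}. Qed.

Lemma nth_swapn x0 j s i : (j.+1 < size s)%N ->
  nth x0 (swapn j s) i =
  nth x0 s (if i == j then j.+1 else if i == j.+1 then j else i).
Proof.
elim: j s i => [|j IH] [|x [|y r]]//= [|[|i]]//= js; rewrite ?IH ?eqSS//.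
  by case: (eqVneq 0%N j) => [<-|].
by case: eqVneq => // _; case: eqVneq.
Qed.

Lemma swapn_out j s : (size s <= j.+1)%N -> swapn j s = s.
Proof. by elim: j s => [|j IH] [|x [|y r]]//= h; rewrite IH. Qed.

Lemma swapnE j s : swapn j s =
  if drop j s is x :: y :: r then take j s ++ y :: x :: r else s.
Proof.
elim: j s => [|j IH] [|x r]//=.
by rewrite IH; case: (drop j r) => [|a [|b l]].
Qed.

Definition swapt n j (t : n.-tuple X) : n.-tuple X :=
  @Tuple n X (swapn j t) (introT eqP (etrans (size_swapn j t) (size_tuple t))).

Lemma swapt_tcons n j x (t : n.-tuple X) :
  swapt j.+1 [tuple of x :: t] = [tuple of x :: swapt j t].
Proof. exact/val_inj. Qed.

End adjacent_swap.

Lemma map_swapn (X Z : Type) (f : X -> Z) j s : map f (swapn j s) = swapn j (map f s).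
Proof. by elim: j s => [|j IH] [|x [|y r]]//=; rewrite IH. Qed.

Lemma measurable_swapt d (X : measurableType d) n j :
  measurable_fun setT (@swapt X n j).
Proof.
apply/measurable_fun_tnthP => i.
have [jn|jn] := ltnP j.+1 n; last first.
  rewrite (_ : _ \o _ = fun t => tnth t i); first exact: measurable_tnth.
  apply/funext => t /=; congr tnth; apply: val_inj => /=.
  by rewrite swapn_out// size_tuple.
pose k := if i == j :> nat then j.+1 else if i == j.+1 :> nat then j else i.
have kn : (k < n)%N by rewrite /k; do !case: ifP => //; rewrite ltnW.
rewrite (_ : _ \o _ = fun t => tnth t (Ordinal kn)); first exact: measurable_tnth.
apply/funext => t /=; have x0 := tnth t i.
by rewrite (tnth_nth x0) [RHS](tnth_nth x0)/= nth_swapn// size_tuple.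
Qed.

Section tuple_integral.
Context d (X : measurableType d) (R : realType) (m : {sigma_finite_measure set X -> \bar R}).
Local Open Scope ereal_scope.

Lemma tuple_measure0_integral (f : ntuple X 0 -> \bar R) : measurable_fun setT f ->
  \int[tuple_measure m 0]_t f t = f [tuple].
Proof. by move=> mf; rewrite integral_dirac// diracT mul1e. Qed.

Lemma measurable_tcons_comp n (f : ntuple X n.+1 -> \bar R) : measurable_fun setT f ->
  measurable_fun setT (fun z : X * ntuple X n => f (tcons z)).
Proof. by move=> mf; apply: measurableT_comp => //; exact: measurable_tcons. Qed.

Lemma measurable_tcons_pair n x (f : ntuple X n.+1 -> \bar R) : measurable_fun setT f ->
  measurable_fun setT (fun t : ntuple X n => f (tcons (x, t))).
Proof.
move=> mf; apply: measurableT_comp => //; apply: measurable_cons => //.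
exact: measurable_id.
Qed.

Lemma ge0_integral_tcons n (f : ntuple X n.+1 -> \bar R) : measurable_fun setT f ->
  (forall t, 0 <= f t) ->
  \int[tuple_measure m n.+1]_t f t =
  \int[m \x tuple_measure m n]_z f (tcons z).
Proof.
move=> mf f0.
rewrite (_ : \int[_]_t f t = \int[pushforward (m \x tuple_measure m n) (@tcons _ X n)]_t f t)//.
by rewrite ge0_integral_pushforward//; exact: measurable_tcons.
Qed.

Lemma ge0_integral_tcons1 n (f : ntuple X n.+1 -> \bar R) : measurable_fun setT f ->
  (forall t, 0 <= f t) ->
  \int[tuple_measure m n.+1]_t f t =
  \int[m]_x \int[tuple_measure m n]_t f (tcons (x, t)).
Proof.
move=> mf f0; rewrite ge0_integral_tcons//.
by rewrite (fubini_tonelli1 (fun z => f (tcons z)))//; exact: measurable_tcons_comp.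
Qed.

Lemma ge0_integral_tcons2 n (f : ntuple X n.+1 -> \bar R) : measurable_fun setT f ->
  (forall t, 0 <= f t) ->
  \int[tuple_measure m n.+1]_t f t =
  \int[tuple_measure m n]_t \int[m]_x f (tcons (x, t)).
Proof.
move=> mf f0; rewrite ge0_integral_tcons//.
by rewrite (fubini_tonelli2 (fun z => f (tcons z)))//; exact: measurable_tcons_comp.
Qed.

Lemma integrable_tcons n (f : ntuple X n.+1 -> \bar R) :
  (tuple_measure m n.+1).-integrable setT f ->
  (m \x tuple_measure m n).-integrable setT (fun z => f (tcons z)).
Proof.
move=> /integrableP[mf fi]; apply/integrableP; split; first exact: measurable_tcons_comp.
move: fi; rewrite (ge0_integral_tcons (f := abse \o f))//; first exact: measurableT_comp.
by move=> t /=; exact: abse_ge0.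
Qed.

Lemma integral_tcons n (f : ntuple X n.+1 -> \bar R) :
  (tuple_measure m n.+1).-integrable setT f ->
  \int[tuple_measure m n.+1]_t f t = \int[m \x tuple_measure m n]_z f (tcons z).
Proof.
move=> fi; have /measurable_int mf := fi.
rewrite integralE [RHS]integralE; congr (_ - _).
  rewrite (ge0_integral_tcons (measurable_funepos mf)); last by move=> t; exact: funepos_ge0.
  by apply: eq_integral => z _; rewrite !funeposE.
rewrite (ge0_integral_tcons (measurable_funeneg mf)); last by move=> t; exact: funeneg_ge0.
by apply: eq_integral => z _; rewrite !funenegE.
Qed.

(** Behind the head, the head is the outer variable of integration and the induction hypothesis
    applies to the tail; at the head this is Tonelli for the two outer variables. *)
Lemma ge0_integral_swapt n j (f : ntuple X n -> \bar R) : measurable_fun setT f ->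
  (forall t, 0 <= f t) ->
  \int[tuple_measure m n]_t f (swapt j t) = \int[tuple_measure m n]_t f t.
Proof.
elim: n j f => [|n IH] j f mf f0.
  by apply: eq_integral => t _; congr f; apply: val_inj; rewrite /= (tuple0 t)/=; case: j.
have mfs k : measurable_fun setT (fun t => f (swapt k t)).
  by apply: measurableT_comp => //; exact: measurable_swapt.
case: j => [|j]; last first.
  apply: etrans (ge0_integral_tcons1 (mfs j.+1) _) _ => //; apply/esym.
  apply: etrans (ge0_integral_tcons1 mf f0) _; apply/esym/eq_integral => x _.
  under eq_integral do rewrite /tcons swapt_tcons.
  by rewrite (IH j (fun t => f (tcons (x, t))))//; exact: measurable_tcons_pair.
case: n IH f mf f0 mfs => [|n] IH f mf f0 mfs.
  apply: eq_integral => t _; congr f; apply: val_inj => /=.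
  by case: t => -[|x []].
have m2 (h : ntuple X n.+2 -> \bar R) : measurable_fun setT h ->
    measurable_fun setT (fun z : (X * X) * ntuple X n => h (tcons (z.1.1, tcons (z.1.2, z.2)))).
  move=> mh; apply: measurableT_comp => //.
  apply: measurable_cons; first exact: (measurableT_comp measurable_fst measurable_fst).
  rewrite /=; apply: measurable_cons; first exact: (measurableT_comp measurable_snd measurable_fst).
  exact: measurable_snd.
have E (h : ntuple X n.+2 -> \bar R) : measurable_fun setT h -> (forall t, 0 <= h t) ->
    \int[tuple_measure m n.+2]_t h t =
    \int[m]_x \int[m]_y \int[tuple_measure m n]_t h (tcons (x, tcons (y, t))).
  move=> mh h0; rewrite ge0_integral_tcons1//; apply: eq_integral => x _.
  by rewrite ge0_integral_tcons1//; exact: measurable_tcons_pair.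
apply: etrans (E _ (mfs 0%N) _) _; first by move=> t; exact: f0.
apply/esym; apply: etrans (E _ mf f0) _; apply/esym.
pose g (z : X * X) := \int[tuple_measure m n]_t f (tcons (z.1, tcons (z.2, t))).
have mg : measurable_fun setT g.
  exact: (@measurable_fun_fubini_tonelli_F _ _ [the measurableType _ of (X * X)%type] (ntuple X n) R (tuple_measure m n) _ (m2 f mf) (fun z => f0 _)).
have g0 z : 0 <= g z by apply: integral_ge0.
transitivity (\int[m]_x \int[m]_y g (y, x)).
  apply: eq_integral => x _; apply: eq_integral => y _; apply: eq_integral => t _.
  by congr f; apply: val_inj.
exact/esym/(fubini_tonelli g mg g0).
Qed.

Lemma tuple_measure_swapt n j (A : set (ntuple X n)) : measurable A ->
  tuple_measure m n (@swapt X n j @^-1` A) = tuple_measure m n A.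
Proof.
move=> mA; have mB : measurable (@swapt X n j @^-1` A).
  by rewrite -[X in measurable X]setTI; exact: measurable_swapt.
have := @ge0_integral_swapt n j (EFin \o \1_A).
rewrite [X in _ -> _ -> _ = X]integral_indic// setIT => <-//.
- rewrite -[in LHS](setIT (_ @^-1` A)) -integral_indic//.
- by apply/measurable_EFinP; exact: measurable_indic.
- by move=> t; rewrite lee_fin.
Qed.

Lemma integral_swapt n j (f : ntuple X n -> \bar R) :
  measurable_fun setT f ->
  \int[tuple_measure m n]_t f (swapt j t) = \int[tuple_measure m n]_t f t.
Proof.
move=> mf; rewrite integralE [RHS]integralE; congr (_ - _).
  rewrite -(ge0_integral_swapt j (measurable_funepos mf)); last by move=> t; exact: funepos_ge0.
  by apply: eq_integral => z _; rewrite !funeposE.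
rewrite -(ge0_integral_swapt j (measurable_funeneg mf)); last by move=> t; exact: funeneg_ge0.
by apply: eq_integral => z _; rewrite !funenegE.
Qed.

Lemma ae_swapt n j (P : ntuple X n -> Prop) :
  {ae tuple_measure m n, forall t, P t} -> {ae tuple_measure m n, forall t, P (swapt j t)}.
Proof.
move=> [N [mN N0 sN]]; exists (@swapt X n j @^-1` N); split.
- by rewrite -[X in measurable X]setTI; exact: measurable_swapt.
- by rewrite tuple_measure_swapt.
- by move=> t /= nP; exact: sN.
Qed.

Lemma ae_behead n (P : ntuple X n -> Prop) :
  {ae tuple_measure m n, forall t, P t} ->
  {ae tuple_measure m n.+1, forall t : n.+1.-tuple X, P [tuple of behead t]}.
Proof.
have mb : measurable_fun setT (fun t : ntuple X n.+1 => [tuple of behead t] : ntuple X n).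
  exact: measurable_behead.
move=> [N [mN N0 sN]]; exists ((fun t : ntuple X n.+1 => [tuple of behead t]) @^-1` N); split.
- by rewrite -[X in measurable X]setTI; exact: mb.
- rewrite /tuple_measure/= -/(tuple_measure m n) /sigma_finite_pack/=.
  rewrite /sigma_finite_copy /tcons_measure /pushforward.
  rewrite (_ : _ @^-1` _ = setT `*` N); first by rewrite product_measure1E// N0 mule0.
  have bK x (t : ntuple X n) : [tuple of behead (tcons (x, t))] = t by exact/val_inj.
  by apply/seteqP; split=> -[x t] /=; rewrite bK// => -[].
- by move=> t /= nP; exact: sN.
Qed.

(** Makes a change of the kernel on [A] invisible to every exchange: by Tonelli at the head, and as
    a cylinder set over the tail otherwise. *)
Lemma ae_adjacent (A : set (X * X)) n j : measurable A -> (m \x m) A = 0 ->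
  {ae tuple_measure m n, forall t : n.-tuple X,
    if drop j t is x :: y :: r then ~ A (x, y) else True}.
Proof.
move=> mA A0; elim: j n => [|j IH] [|n]; try by apply: aeW => t; case: (val t) (size_tuple t).
  case: n => [|n]; first by apply: aeW => t; case: t => -[|x []].
  pose p (t : ntuple X n.+2) : X * X := (tnth t ord0, tnth t (lift ord0 ord0)).
  have mp : measurable_fun setT p by apply: measurable_fun_pair; exact: measurable_tnth.
  have mpA : measurable (p @^-1` A) by rewrite -[X in measurable X]setTI; exact: mp.
  exists (p @^-1` A); split => //; last first.
    by case=> -[|x [|y r]] // i /= nA; apply: contrapT => npA; apply: nA; exact: npA.
  have := @integral_indic _ _ _ (tuple_measure m n.+2) setT measurableT _ mpA.
  rewrite setIT => <-.
  pose f : ntuple X n.+2 -> \bar R := EFin \o \1_(p @^-1` A).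
  have mf : measurable_fun setT f by apply/measurable_EFinP; exact: measurable_indic.
  have f0 t : 0 <= f t by rewrite lee_fin.
  rewrite -[LHS]/(\int[tuple_measure m n.+2]_t f t) ge0_integral_tcons1//.
  pose c := tuple_measure m n setT.
  transitivity (\int[m]_x \int[m]_y ((\1_A (x, y))%:E * c)).
    apply: eq_integral => x _; rewrite ge0_integral_tcons1//; last exact: measurable_tcons_pair.
    apply: eq_integral => y _; rewrite /f /=.
    under eq_integral do rewrite (_ : \1_(p @^-1` A) _ = \1_A (x, y) :> R)//.
    by rewrite integral_cst.
  have mA1 : measurable_fun setT (fun z : X * X => (\1_A z)%:E * c).
    by apply: emeasurable_funM => //; apply/measurable_EFinP; exact: measurable_indic.
  have c0 : 0 <= c by exact: measure_ge0.
  have A10 z : 0 <= (\1_A z)%:E * c by rewrite mule_ge0 ?lee_fin.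
  rewrite -(fubini_tonelli1 (fun z : X * X => (\1_A z)%:E * c))//.
  rewrite (ge0_ae_eq_integral _ (g := cst 0)) ?integral0//.
  exists A; split => // z /= nz; apply: contrapT => nA; apply: nz => _.
  by rewrite indicE memNset// mul0e.
have := ae_behead (IH n); apply: filterS => t.
by case: t => -[|x r] i.
Qed.

End tuple_integral.

(** * The disjoint union of the powers as one measure space *)

Definition fseq (X : Type) := seq X.

Section seq_measurable.
Context d (X : measurableType d).

(** The sigma-algebra of the disjoint union of the X^n, whose instances are attached to the alias
    [fseq]. *)
Definition fseq_measurable (A : set (fseq X)) : Prop :=
  forall n, measurable ((fun t : ntuple X n => tval t) @^-1` A).

Let fseq_measurable0 : fseq_measurable set0.
Proof. by move=> n; rewrite preimage_set0; exact: measurable0. Qed.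

Let fseq_measurableC A : fseq_measurable A -> fseq_measurable (~` A).
Proof. by move=> mA n; rewrite preimage_setC; exact: (measurableC (mA n)). Qed.

Let fseq_measurable_bigcup (F : (set (fseq X))^nat) : (forall i, fseq_measurable (F i)) ->
  fseq_measurable (\bigcup_i F i).
Proof. by move=> mF n; rewrite preimage_bigcup; apply: bigcup_measurable => i _; exact: mF. Qed.

HB.instance Definition _ := Choice.on (fseq X).
HB.instance Definition _ := isPointed.Build (fseq X) [::].
HB.instance Definition _ := @isMeasurable.Build default_measure_display (fseq X)
  fseq_measurable fseq_measurable0 fseq_measurableC fseq_measurable_bigcup.

Definition mfseq : measurableType _ := fseq X.

Lemma fseq_measurableP (A : set mfseq) : measurable A <-> fseq_measurable A.
Proof. by []. Qed.

Definition seq_of_tuple n (t : ntuple X n) : mfseq := tval t.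

Lemma measurable_seq_of_tuple n : measurable_fun setT (@seq_of_tuple n).
Proof. by move=> _ A /fseq_measurableP mA; rewrite setTI; exact: mA. Qed.

Lemma measurable_fseq d' (Z : measurableType d') (f : mfseq -> Z) :
  (forall n, measurable_fun setT (fun t : ntuple X n => f t)) -> measurable_fun setT f.
Proof.
move=> mf _ A mA; rewrite setTI; apply/fseq_measurableP => n.
by have := mf n measurableT A mA; rewrite setTI.
Qed.

Lemma cmeasurable_fseq (R : realType) (F : mfseq -> R[i]) :
  cmeasurable F <-> forall n, cmeasurable (@component _ X R n F).
Proof.
split=> [mF n|mF].
  exact: (cmeasurable_comp (@measurable_seq_of_tuple n) mF).
by split; apply: measurable_fseq => n; have [] := mF n.
Qed.

Variables (R : realType) (m : {sigma_finite_measure set X -> \bar R}).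

Definition fact_nng n : {nonneg R} := NngNum (ler0n R n`!).

Definition seq_measure n : {measure set mfseq -> \bar R} :=
  @measure_function_pushforward__canonical__measure_function_Measure _ _ _ _ _
    (tuple_measure m n) _ (@measurable_seq_of_tuple n).

Definition fock_summand n : {measure set mfseq -> \bar R} := mscale (fact_nng n) (seq_measure n).

(* sum over n of n! m^n, on the disjoint union of the X^n *)
Definition fock_measure : {measure set mfseq -> \bar R} := mseries fock_summand 0.

Lemma ge0_integral_fock_measure (f : mfseq -> \bar R) : measurable_fun setT f ->
  (forall s, 0 <= f s)%E -> (\int[fock_measure]_s f s =
  \sum_(n <oo) n`!%:R%:E * \int[tuple_measure m n]_t f (seq_of_tuple t))%E.
Proof.
move=> mf f0; rewrite ge0_integral_measure_series//; apply: eq_eseriesr => n _.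
rewrite ge0_integral_mscale// ge0_integral_pushforward//.
exact: measurable_seq_of_tuple.
Qed.

Lemma sqnorm_fock_measure (F : seq X -> R[i]^o) : (forall n, cmeasurable (@component _ X R n F)) ->
  sqnorm fock_measure (F : mfseq -> R[i]) =
  (\sum_(n <oo) n`!%:R%:E * sqnorm (tuple_measure m n) (@component _ X R n F))%E.
Proof.
move=> /cmeasurable_fseq mF; rewrite /sqnorm ge0_integral_fock_measure//.
  exact: (measurable_cabs2E mF).
by move=> s; rewrite lee_fin cabs2_ge0.
Qed.

Let fock_Rintegral_ge0 (f : mfseq -> R) : (forall s, 0 <= f s) ->
  fock_measure.-integrable setT (EFin \o f) ->
  (forall n, (tuple_measure m n).-integrable setT (fun t => (f (seq_of_tuple t))%:E)) /\
  (fun N => \sum_(n < N) n`!%:R * \int[tuple_measure m n]_t f (seq_of_tuple t))%R @ \oo -->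
  (\int[fock_measure]_s f s)%R.
Proof.
move=> f0 fi; have /measurable_int mf := fi.
have fE := ge0_integral_fock_measure mf (fun s => f0 s).
have ffin := integrable_fin_num measurableT fi.
pose J n := (\int[tuple_measure m n]_t (f (seq_of_tuple t))%:E)%E.
have J0 n : (0 <= J n)%E by apply: integral_ge0 => t _; rewrite lee_fin.
have nJ0 n : (0 <= n`!%:R%:E * J n)%E by rewrite mule_ge0// lee_fin.
have Jfin n : (J n < +oo)%E.
  have : (n`!%:R%:E * J n < +oo)%E.
    apply: (@le_lt_trans _ _ (\int[fock_measure]_s (f s)%:E)%E); last first.
      by rewrite ltey_eq ffin.
    rewrite [leRHS]fE; apply: le_trans (nneseries_lim_ge n.+1 _); last by move=> *; exact: nJ0.
    rewrite big_nat_recr//= -[leLHS]add0e; apply: leeD => //.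
    by apply: sume_ge0 => i _; exact: nJ0.
  by rewrite !ltey; apply: contraNN => /eqP ->; rewrite gt0_muley// lte_fin ltr0n fact_gt0.
split=> [n|].
  apply/integrableP; split; first exact: measurableT_comp mf (@measurable_seq_of_tuple n).
  by under eq_integral do rewrite gee0_abs ?lee_fin//; exact: Jfin.
have JE n : J n = (fine (J n))%:E by rewrite fineK// ge0_fin_numE.
have : (fun N => \sum_(0 <= n < N) n`!%:R%:E * J n)%E @ \oo --> (\int[fock_measure]_s (f s)%:E)%E.
  by rewrite [X in _ --> X]fE; apply: is_cvg_nneseries => n _ _; exact: nJ0.
rewrite -[X in _ --> X](fineK ffin) => /fine_cvgP[_].
apply: cvg_trans; apply: near_eq_cvg; apply: nearW => N /=.
rewrite big_mkord (eq_bigr (fun n : 'I_N => (n`!%:R * fine (J n))%:E)) ?sumEFin//.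
by move=> i _; rewrite [J i in LHS]JE -EFinM.
Qed.

Lemma fock_Rintegral (f : mfseq -> R) : fock_measure.-integrable setT (EFin \o f) ->
  (fun N => \sum_(n < N) n`!%:R * \int[tuple_measure m n]_t f (seq_of_tuple t))%R @ \oo -->
  (\int[fock_measure]_s f s)%R.
Proof.
move=> fi; pose p s := Num.max (f s) 0; pose q s := Num.max (- f s) 0.
have mf : measurable_fun setT f by have /measurable_int/measurable_EFinP := fi.
have fE s : f s = p s - q s by rewrite /p /q; case: (leP (f s) 0); case: (leP (- f s) 0); lra.
have mp : measurable_fun setT p by apply: measurable_maxr => //; exact: measurable_cst.
have mq : measurable_fun setT q.
  by apply: measurable_maxr; [exact: measurable_funN|exact: measurable_cst].
have le s : `|p s| <= `|f s| /\ `|q s| <= `|f s|.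
  rewrite /p /q; case: (leP (f s) 0); case: (leP (- f s) 0); rewrite ?normrN ?normr0; split => //; lra.
have ip : fock_measure.-integrable setT (EFin \o p).
  apply: (le_integrable measurableT _ _ fi); first exact/measurable_EFinP.
  by move=> s _ /=; rewrite lee_fin (le s).1.
have iq : fock_measure.-integrable setT (EFin \o q).
  apply: (le_integrable measurableT _ _ fi); first exact/measurable_EFinP.
  by move=> s _ /=; rewrite lee_fin (le s).2.
have p0 s : 0 <= p s by rewrite /p le_max lexx orbT.
have q0 s : 0 <= q s by rewrite /q le_max lexx orbT.
have [ipn pl] := fock_Rintegral_ge0 p0 ip; have [iqn ql] := fock_Rintegral_ge0 q0 iq.
rewrite (_ : \int[_]_s f s = \int[fock_measure]_s p s - \int[fock_measure]_s q s)%R; last first.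
  by rewrite -RintegralB//; apply: eq_Rintegral => s _; rewrite fE.
apply: cvg_trans (cvgB pl ql); apply: near_eq_cvg; apply: nearW => N /=.
rewrite -[LHS]/(_ - _) -sumrB; apply: eq_bigr => n _; rewrite -mulrBr -RintegralB//.
by congr (_ * _); apply: eq_Rintegral => t _; rewrite fE.
Qed.

(** Integrability over the union makes the partial sums in [fip] converge, so that the inner product
    of the Fock space becomes an honest integral. *)
Lemma fock_cintegral (f : mfseq -> R[i]) : cintegrable fock_measure f ->
  cintegral fock_measure f =
  clim (fun N => \sum_(n < N) n`!%:R * cintegral (tuple_measure m n) (fun t => f (seq_of_tuple t))).
Proof.
move=> [fr fi]; rewrite /clim; congr (_ +i* _); apply/esym/cvg_lim => //.
  apply: cvg_trans (fock_Rintegral fr); apply: near_eq_cvg; apply: nearW => N /=.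
  rewrite raddf_sum; apply: eq_bigr => n _ /=.
  by rewrite -[n`!%:R in RHS](rmorph_nat (real_complex R)) /= mul0r subr0.
apply: cvg_trans (fock_Rintegral fi); apply: near_eq_cvg; apply: nearW => N /=.
rewrite raddf_sum; apply: eq_bigr => n _ /=.
by rewrite -[n`!%:R in RHS](rmorph_nat (real_complex R)) /= mul0r addr0.
Qed.

End seq_measurable.

(** * Permutations of tuples, the gauge and the algebra of the symmetrizer *)

Section permuted_tuple.
Variable X : Type.

Definition permt n (p : 'S_n) (t : n.-tuple X) : n.-tuple X := [tuple tnth t (p i) | i < n].

Lemma permtM n (p q : 'S_n) t : permt p (permt q t) = permt (p * q)%g t.
Proof. by apply: eq_from_tnth => i; rewrite !tnth_mktuple permM. Qed.

Lemma permt1 n (t : n.-tuple X) : permt 1%g t = t.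
Proof. by apply: eq_from_tnth => i; rewrite tnth_mktuple perm1. Qed.

Lemma swapt_permt n j (t : n.-tuple X) : (j.+1 < n)%N -> swapt j t = permt (adj_transp n j) t.
Proof.
move=> jn; pose a := Ordinal (ltnW jn); pose b := Ordinal jn.
rewrite (@adj_transpE _ a b erefl); apply: eq_from_tnth => i; rewrite tnth_mktuple.
have x0 := tnth t i; rewrite !(tnth_nth x0)/= nth_swapn ?size_tuple//.
case: tpermP => [->|->|/eqP ia /eqP ib] /=; first by rewrite eqxx.
  by rewrite eqxx; case: eqP => // /eqP; rewrite eqn_leq ltnn.
by rewrite (negPf ia : (i == j :> nat) = false) (negPf ib : (i == j.+1 :> nat) = false).
Qed.

Lemma permt_lift n (p : 'S_n) x (t : n.-tuple X) :
  permt (lift_perm ord0 ord0 p) [tuple of x :: t] = [tuple of x :: permt p t].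
Proof.
apply: eq_from_tnth => i; rewrite tnth_mktuple.
have [->|] := eqVneq i ord0; first by rewrite lift_perm_id !tnth0.
by rewrite eq_sym => /unlift_some[j -> _]; rewrite lift_perm_lift !tnthS tnth_mktuple.
Qed.

Definition swapw (s : seq X) (w : seq nat) : seq X := foldl (fun s j => swapn j s) s w.

(** The first letter of the word acts first and therefore stands rightmost in the product by
    [permtM]; as transpositions are involutions, this reversed product is the inverse. *)
Lemma swapw_permt n (w : seq nat) (t : n.-tuple X) : all (fun j => j.+1 < n)%N w ->
  swapw t w = permt ((\prod_(j <- w) adj_transp n j)^-1)%g t.
Proof.
elim: w t => [|j w IH] t; first by rewrite big_nil invg1 permt1.
rewrite [all _ _]/= => /andP[jn wn]; rewrite [swapw _ _]/= big_cons invMg -permtM.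
rewrite -[swapn j t]/(tval (swapt j t)) IH// swapt_permt//; congr (tval (permt _ (permt _ _))).
rewrite (@adj_transpE _ (Ordinal (ltnW jn)) (Ordinal jn) erefl); exact/esym/tpermV.
Qed.

End permuted_tuple.

Lemma permt_perm_eq (X : eqType) n (p : 'S_n) (t : n.-tuple X) : perm_eq (permt p t) t.
Proof. by apply/tuple_permP; exists p. Qed.

Section symmetrizer.
Variables (R : realType) (X : pointedType) (Q : X -> X -> R[i]).
Implicit Types (F G : seq X -> R[i]^o) (s : seq X).

(** The default 1 goes with [swapn] being the identity past the end, so that [Psi_adjE] holds for
    every position. *)
Definition qfac j s : R[i] := if drop j s is x :: y :: _ then Q x y else 1.

Lemma Psi_adjE j F s : Psi_adj Q j F s = qfac j s * F (swapn j s).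
Proof.
by rewrite /Psi_adj /qfac swapnE; case: (drop j s) => [|x [|y r]]; rewrite ?mul1r.
Qed.

Lemma Psym_tupleE n F (t : n.-tuple X) :
  Psym Q F t = n`!%:R^-1 * \sum_(pi : 'S_n) Psi Q pi F t.
Proof. by case: t => s i; have E : size s = n := eqP i; subst n. Qed.

Lemma adj_wordP n (pi : 'S_n) : is_adj_word pi (adj_word pi).
Proof. by have [w hw] := adj_word_ex pi; exact: (xgetPex [::] (ex_intro _ w hw)). Qed.

Hypothesis Qinv : forall x y, Q x y * Q y x = 1.
Hypothesis Qxx : forall x, Q x x = 1.

(* A choice of one element in every pair {x, y}; it depends on the set only.   *)
Definition pair_first (x y : X) : X := xget point [set z | z = x \/ z = y].

(** A solution of g (y, x) = Q x y g (x, y): 1 for one order of the pair, and the value forced by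
    the equation for the other. The choice claims no measurability; the gauge cancels from the
    pointwise identities in which it serves. *)
Definition rgauge (x y : X) : R[i] := if `[< pair_first x y = x >] then 1 else Q y x.

Lemma rgauge_swap x y : rgauge y x = Q x y * rgauge x y.
Proof.
have pfC : pair_first y x = pair_first x y.
  by congr xget; apply/seteqP; split=> z /= [|]; (try by left); by right.
have [->|xy] := pselect (x = y); first by rewrite Qxx mul1r.
have : pair_first x y = x \/ pair_first x y = y.
  by apply: (@xgetPex _ point [set z | z = x \/ z = y]); exists x; left.
rewrite /rgauge pfC; case: asboolP => h1; case: asboolP => h2.
- by case: xy; rewrite -h2.
- by rewrite Qinv.
- by rewrite mulr1.
- by case.
Qed.

Lemma rgauge_neq0 x y : rgauge x y != 0.
Proof.
rewrite /rgauge; case: ifP => _; first exact: oner_neq0.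
by apply/negP => /eqP q0; have /eqP := Qinv x y; rewrite q0 mulr0 eq_sym oner_eq0.
Qed.

(* Multiplication by the gauge turns the Psi_j into exchanges of coordinates,  *)
(* hence the symmetrizer into the symmetrization of functions.                 *)
Fixpoint gauge s : R[i] :=
  if s is x :: r then (\prod_(y <- r) rgauge x y) * gauge r else 1.

Lemma gauge_neq0 s : gauge s != 0.
Proof.
elim: s => [|x r IH] /=; first exact: oner_neq0.
by rewrite mulf_neq0// prodf_seq_neq0; apply/allP => y _; rewrite rgauge_neq0.
Qed.

Lemma perm_swapn j s : perm_eq (swapn j s) s.
Proof.
elim: j s => [|j IH] [|x [|y r]]//=; rewrite ?perm_cons ?IH//.
by rewrite -[y :: _]/([:: y] ++ [:: x] ++ r) -[x :: y :: r]/([:: x] ++ [:: y] ++ r) perm_catCA.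
Qed.

(** An exchange of neighbours reverses the order of a single pair, so exactly one factor [rgauge]
    changes. *)
Lemma gauge_swapn j s : gauge (swapn j s) = qfac j s * gauge s.
Proof.
elim: j s => [|j IH] [|x r]; rewrite /qfac/= ?mul1r//.
  case: r => [|y r]; rewrite /= ?mul1r// !big_cons rgauge_swap; ring.
by rewrite -/(qfac j r) (perm_big _ (perm_swapn j r))/= IH; ring.
Qed.

Lemma gauge_Psi_adj j F s : gauge s * Psi_adj Q j F s = gauge (swapn j s) * F (swapn j s).
Proof. by rewrite Psi_adjE gauge_swapn mulrCA mulrA. Qed.

Lemma gauge_word w F s :
  gauge s * foldr (Psi_adj Q) F w s = gauge (swapw s w) * F (swapw s w).
Proof. by elim: w s => [|j w IH] s//=; rewrite gauge_Psi_adj IH. Qed.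

Lemma gauge_Psi n (pi : 'S_n) F (t : n.-tuple X) :
  gauge t * Psi Q pi F t = gauge (permt pi^-1%g t) * F (permt pi^-1%g t).
Proof. by have [wn piE] := adj_wordP pi; rewrite gauge_word swapw_permt// -piE. Qed.

Lemma gauge_Psym n F (t : n.-tuple X) :
  gauge t * Psym Q F t = n`!%:R^-1 * \sum_(pi : 'S_n) gauge (permt pi t) * F (permt pi t).
Proof.
rewrite Psym_tupleE mulrCA mulr_sumr (reindex_inj invg_inj); congr (_ * _).
by apply: eq_bigr => pi _; rewrite gauge_Psi invgK.
Qed.

Lemma gauge_inj a b s : gauge s * a = gauge s * b -> a = b.
Proof. by move/(mulfI (gauge_neq0 s)). Qed.

Let fact0 n : n`!%:R != 0 :> R[i].
Proof. by rewrite pnatr_eq0 -lt0n fact_gt0. Qed.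

Let averageE n (x : R[i]) : n`!%:R^-1 * \sum_(p : 'S_n) x = x.
Proof. by rewrite sumr_const card_Sn -[x *+ _]mulr_natl mulrA mulVf// mul1r. Qed.

Lemma Psym_id F : Psym Q (Psym Q F) = Psym Q F.
Proof.
apply/funext => s; apply: (@gauge_inj _ _ s).
rewrite -[s]/(tval (in_tuple s)); set t := in_tuple s; set n := size s in t *.
rewrite !gauge_Psym; under eq_bigr do rewrite gauge_Psym.
rewrite -mulr_sumr; congr (_ * _).
rewrite (eq_bigr (fun=> \sum_(pi : 'S_n) gauge (permt pi t) * F (permt pi t))).
  exact: averageE.
move=> p _; rewrite [RHS](reindex_inj (mulIg p)).
by apply: eq_bigr => q _; rewrite permtM.
Qed.

Definition prepend (h : X -> R) F : seq X -> R[i]^o := fun s =>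
  if s is x :: r then (h x)%:C * F r else 0.

(** In the gauge the inner symmetrizer averages over the permutations fixing the first position, and
    the average over the whole group absorbs that over a subgroup. *)
Lemma Psym_prepend (h : X -> R) F :
  Psym Q (prepend h (Psym Q F)) = Psym Q (prepend h F).
Proof.
apply/funext => s; apply: (@gauge_inj _ _ s).
rewrite -[s]/(tval (in_tuple s)); move: (in_tuple s); case: (size s) => [|n] t.
  by rewrite !gauge_Psym; congr (_ * _); apply: eq_bigr => p _; rewrite [permt p t]tuple0.
rewrite !gauge_Psym; congr (_ * _).
pose T (u : n.+1.-tuple X) := gauge u * prepend h F u.
have E (u : n.+1.-tuple X) : gauge u * prepend h (Psym Q F) u =
    n`!%:R^-1 * \sum_(p : 'S_n) T (permt (lift_perm ord0 ord0 p) u).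
  case/tupleP: u => x u; rewrite /T; under eq_bigr do rewrite permt_lift.
  transitivity ((\prod_(y <- u) rgauge x y * (h x)%:C) * (gauge u * Psym Q F u) : R[i]).
    by rewrite /=; ring.
  rewrite gauge_Psym mulrCA; congr (_ * _); rewrite mulr_sumr; apply: eq_bigr => p _.
  by rewrite -(perm_big _ (permt_perm_eq p u)) /=; ring.
under eq_bigr do rewrite E.
rewrite -mulr_sumr exchange_big/= (eq_bigr (fun=> \sum_(p : 'S_n.+1) T (permt p t))).
  exact: averageE.
move=> q _; rewrite [RHS](reindex_inj (mulgI (lift_perm ord0 ord0 q))).
by apply: eq_bigr => p _; rewrite permtM.
Qed.

Lemma Psym_mul (phi : seq X -> R[i]) F :
  (forall n (p : 'S_n) (t : n.-tuple X), phi (permt p t) = phi t) ->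
  Psym Q (fun s => phi s * F s) = (fun s => phi s * Psym Q F s).
Proof.
move=> phiP; apply/funext => s; apply: (@gauge_inj _ _ s).
transitivity (phi s * (gauge s * Psym Q F s) : R[i]); last by ring.
rewrite -[s]/(tval (in_tuple s)) !gauge_Psym mulrCA; congr (_ * _).
by rewrite mulr_sumr; apply: eq_bigr => p _; rewrite phiP; ring.
Qed.

(** In the gauge a word acts only through the permutation that it spells. This gives independence of
    the chosen word without manipulating Coxeter relations. *)
Lemma Psi_word_eq n (pi : 'S_n) w F (t : n.-tuple X) : is_adj_word pi w ->
  foldr (Psi_adj Q) F w t = Psi Q pi F t.
Proof.
move=> [wn piE]; apply: (@gauge_inj _ _ t).
by rewrite gauge_Psi gauge_word swapw_permt// piE.
Qed.

End symmetrizer.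

(** * The symmetrizer as a self-adjoint contraction of L2 *)

Section symmetrizer_L2.
Context d (X : measurableType d) (R : realType) (m : {sigma_finite_measure set X -> \bar R}).
Variable Q : X -> X -> R[i].
Hypothesis mQ : cmeasurable (fun z : X * X => Q z.1 z.2).
Hypothesis Qherm : forall x y, Q y x = (Q x y)^*%C.
Hypothesis Qabs : forall x y, cabs2 (Q x y) = 1.
Hypothesis Qxx : forall x, Q x x = 1.
Implicit Types F G : seq X -> R[i]^o.

Lemma Q_inv x y : Q x y * Q y x = 1.
Proof. by rewrite (Qherm x y) -cabs2E Qabs. Qed.

Definition cmeas F : Prop := forall n, cmeasurable (@component _ X R n F).

Lemma cabs2_qfac j s : cabs2 (qfac Q j s) = 1.
Proof.
rewrite /qfac; case: (drop j s) => [|x [|y r]]; rewrite ?Qabs//;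
by rewrite /cabs2/= expr1n expr0n addr0.
Qed.

Lemma qfac_swapn j s : qfac Q j (swapn j s) = (qfac Q j s)^*%C.
Proof.
have c1 : 1 = 1^*%C :> R[i] by rewrite rmorph1.
elim: j s => [|j IH] [|x r] //; last exact: IH.
by case: r => [|y r]; [exact: c1|exact: Qherm].
Qed.

Lemma cmeasurable_qfac j n : cmeasurable (fun t : ntuple X n => qfac Q j t).
Proof.
have [jn|jn] := ltnP j.+1 n; last first.
  rewrite (_ : (fun _ => _) = fun=> 1); first exact: cmeasurable_cst.
  apply/funext => t; rewrite /qfac; case E : (drop j t) => [|x [|y r]]//.
  have := size_drop j t; rewrite E size_tuple /= => h.
  have : (n - j <= 1)%N by rewrite leq_subLR addn1.
  by rewrite -h.
pose a := Ordinal (ltnW jn); pose b := Ordinal jn.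
rewrite (_ : (fun _ => _) = fun t => Q (tnth t a) (tnth t b)); last first.
  apply/funext => t; rewrite /qfac; have x0 := tnth t a.
  rewrite (drop_nth x0) ?size_tuple 1?ltnW// (drop_nth x0) ?size_tuple//.
  by rewrite !(tnth_nth x0).
apply: (cmeasurable_comp (phi := fun t : ntuple X n => (tnth t a, tnth t b)) _ mQ).
by apply: measurable_fun_pair; exact: measurable_tnth.
Qed.

Lemma cmeas_Psi_adj j F : cmeas F -> cmeas (Psi_adj Q j F).
Proof.
move=> mF n; rewrite (_ : component _ = fun t => qfac Q j t * component F (swapt j t)).
  apply: cmeasurableM; first exact: cmeasurable_qfac.
  by apply: cmeasurable_comp (mF n); exact: measurable_swapt.
by apply/funext => t; rewrite /component Psi_adjE.
Qed.

Lemma cmeas_word w F : cmeas F -> cmeas (foldr (Psi_adj Q) F w).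
Proof. by move=> mF; elim: w => //= j w; exact: cmeas_Psi_adj. Qed.

Lemma component_Psym n F : component (Psym Q F) =
  (fun t : n.-tuple X => n`!%:R^-1 * \sum_(pi : 'S_n) component (Psi Q pi F) t).
Proof. by apply/funext => t; rewrite /component Psym_tupleE. Qed.

Lemma cmeas_Psym F : cmeas F -> cmeas (Psym Q F).
Proof.
move=> mF n; rewrite component_Psym; apply: cmeasurableZ; apply: cmeasurable_sum => pi _.
exact: cmeas_word.
Qed.

Lemma cintegral_swapt n j (H : ntuple X n -> R[i]) : cmeasurable H ->
  cintegral (tuple_measure m n) (fun t => H (swapt j t)) = cintegral (tuple_measure m n) H.
Proof.
move=> [Hr Hi]; congr (_ +i* _); congr fine.
  exact: (integral_swapt m j ((measurable_EFinP _ _).2 Hr)).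
exact: (integral_swapt m j ((measurable_EFinP _ _).2 Hi)).
Qed.

Local Notation ip n F G := (cip (tuple_measure m n) (@component _ X R n F) (@component _ X R n G)).
Local Notation nrm n F := (sqnorm (tuple_measure m n) (@component _ X R n F)).

(** Changing variables by the exchange preserves the product measure and conjugates [qfac]. *)
Lemma ip_Psi_adj n j F G : cmeas F -> cmeas G ->
  ip n (Psi_adj Q j F) G = ip n F (Psi_adj Q j G).
Proof.
move=> mF mG; rewrite /cip -(cintegral_swapt j); last first.
  apply: cmeasurableM; first exact: cmeas_Psi_adj.
  exact: (cmeasurable_conj (mG n)).
congr cintegral; apply/funext => t; rewrite /component !Psi_adjE conjcM /=.
by rewrite swapnK qfac_swapn mulrAC mulrA mulrC mulrA mulrAC.
Qed.

Lemma ip_word n w F G : cmeas F -> cmeas G ->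
  ip n (foldr (Psi_adj Q) F w) G = ip n F (foldr (Psi_adj Q) G (rev w)).
Proof.
move=> mF; elim: w G => [|j w IH] G mG //=.
rewrite ip_Psi_adj//; last exact: cmeas_word.
by rewrite IH ?rev_cons -?cats1 ?foldr_cat//; exact: cmeas_Psi_adj.
Qed.

Lemma nrm_Psi_adj n j F : cmeas F -> nrm n (Psi_adj Q j F) = nrm n F.
Proof.
move=> mF; rewrite /sqnorm -[RHS](integral_swapt m j); last exact: (measurable_cabs2E (mF n)).
apply: eq_integral => t _; congr EFin; rewrite -!/(cabs2 _).
by rewrite /component Psi_adjE cabs2M cabs2_qfac mul1r.
Qed.

Lemma nrm_word n w F : cmeas F -> nrm n (foldr (Psi_adj Q) F w) = nrm n F.
Proof.
by move=> mF; elim: w => //= j w <-; rewrite nrm_Psi_adj//; exact: cmeas_word.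
Qed.

Lemma rev_adj_word n (pi : 'S_n) w : is_adj_word pi w -> is_adj_word pi^-1%g (rev w).
Proof.
move=> [wn ->]; split; first by rewrite all_rev.
elim: w wn => [|j w IH]; first by rewrite /= !big_nil invg1.
rewrite [all _ _]/= => /andP[jn wn]; rewrite big_cons invMg IH// rev_cons -cats1 big_cat big_seq1/=.
by congr (_ * _)%g; rewrite (@adj_transpE _ (Ordinal (ltnW jn)) (Ordinal jn) erefl) tpermV.
Qed.

Lemma L2_Psi n (pi : 'S_n) F : cmeas F -> L2 (tuple_measure m n) (@component _ X R n F) ->
  L2 (tuple_measure m n) (@component _ X R n (Psi Q pi F)).
Proof. by move=> mF [_ nF]; split; [exact: cmeas_word|rewrite nrm_word]. Qed.

Lemma ip_Psi n (pi : 'S_n) F G : cmeas F -> cmeas G ->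
  ip n (Psi Q pi F) G = ip n F (Psi Q pi^-1%g G).
Proof.
move=> mF mG; rewrite ip_word//; congr cip; apply/funext => t.
by apply: (Psi_word_eq Q_inv Qxx); apply: rev_adj_word; exact: adj_wordP.
Qed.

(** The squared modulus of an average is at most the average of the squared moduli, and every [Psi]
    preserves the norm. Norms may be infinite here, so the bound can itself establish
    integrability. *)
Lemma nrm_Psym_le n F : cmeas F -> (nrm n (Psym Q F) <= nrm n F)%E.
Proof.
move=> mF; have n0 : n`!%:R != 0 :> R by rewrite pnatr_eq0 -lt0n fact_gt0.
have mPi (pi : 'S_n) : cmeasurable (@component _ X R n (Psi Q pi F)) by exact: cmeas_word.
have jensen (z : 'S_n -> R[i]) :
    cabs2 (n`!%:R^-1 * \sum_pi z pi) <= n`!%:R^-1 * \sum_pi cabs2 (z pi).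
  pose a := n`!%:R^-1 * \sum_pi z pi : R[i].
  (* Nonnegativity of the variance around the mean [a]. *)
  have : 0 <= \sum_(pi : 'S_n) cabs2 (z pi - a) by apply: sumr_ge0 => pi _; exact: cabs2_ge0.
  have -> : \sum_(pi : 'S_n) cabs2 (z pi - a) = \sum_pi cabs2 (z pi) - n`!%:R * cabs2 a.
    have E pi : cabs2 (z pi - a) = cabs2 (z pi) + cabs2 a - 2 * (complex.Re a * complex.Re (z pi) + complex.Im a * complex.Im (z pi)).
      by case: (z pi) (a) => x y [u v]; rewrite /cabs2 /=; ring.
    under eq_bigr do rewrite E.
    rewrite sumrB big_split/= sumr_const card_Sn.
    have -> : \sum_i 2 * (complex.Re a * complex.Re (z i) + complex.Im a * complex.Im (z i)) =
        2 * (complex.Re a * (\sum_i complex.Re (z i)) + complex.Im a * (\sum_i complex.Im (z i))).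
      by rewrite [in RHS]mulr_sumr [X in _ + X]mulr_sumr -big_split/= mulr_sumr.
    have az : \sum_pi z pi = n`!%:R * a by rewrite mulrA divff ?mul1r// pnatr_eq0 -lt0n fact_gt0.
    have nR : n`!%:R = (n`!%:R : R)%:C :> R[i] by rewrite rmorph_nat.
    rewrite -!raddf_sum az nR; case: (a) => u v; rewrite /cabs2/= -mulr_natl; ring.
  rewrite subr_ge0 -/a => h; rewrite -(@ler_pM2l _ n`!%:R) ?ltr0n ?fact_gt0//.
  by rewrite mulrA divff// mul1r.
apply: (@le_trans _ _ (\int[tuple_measure m n]_t
    (n`!%:R^-1 * \sum_(pi : 'S_n) cabs2 (component (Psi Q pi F) t))%:E)%E).
  apply: ge0_le_integral => //.
  - by move=> t _; rewrite lee_fin cabs2_ge0.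
  - exact: (measurable_cabs2E (cmeas_Psym mF n)).
  - apply/measurable_EFinP; apply: measurable_funM => //; apply: measurable_sum => pi.
    exact: measurable_cabs2.
  - by move=> t _; rewrite lee_fin component_Psym; exact: jensen.
under eq_integral do rewrite EFinM -sumEFin.
rewrite ge0_integralZl_EFin ?invr_ge0//; last 2 first.
- by move=> t _; apply: sume_ge0 => pi _; rewrite lee_fin cabs2_ge0.
- by apply: emeasurable_sum => pi; exact: measurable_cabs2E.
rewrite ge0_integral_sum//; last 2 first.
- by move=> pi; exact: measurable_cabs2E.
- by move=> pi t _; rewrite lee_fin cabs2_ge0.
rewrite (eq_bigr (fun=> nrm n F)); last by move=> pi _; rewrite -(nrm_word n (adj_word pi) mF).
have -> : (\sum_(i : 'S_n) nrm n F = n`!%:R%:E * nrm n F)%E.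
  rewrite -(card_Sn n) -sum1_card natr_sum -sumEFin ge0_sume_distrl//.
  by apply: eq_bigr => i _; rewrite mul1e.
by rewrite muleA -EFinM mulVf// mul1e.
Qed.

Lemma L2_Psym n F : cmeas F -> L2 (tuple_measure m n) (@component _ X R n F) ->
  L2 (tuple_measure m n) (@component _ X R n (Psym Q F)).
Proof.
move=> mF [_ nF]; split; first exact: cmeas_Psym.
exact: le_lt_trans (nrm_Psym_le n mF) nF.
Qed.

Lemma cipZl n a (f g : ntuple X n -> R[i]) : L2 (tuple_measure m n) f -> L2 (tuple_measure m n) g ->
  cip (tuple_measure m n) (fun t => a * f t) g = a * cip (tuple_measure m n) f g.
Proof.
move=> Lf Lg; rewrite /cip -cintegralZ; last exact: L2_mul_integrable.
by congr cintegral; apply/funext => t; rewrite mulrA.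
Qed.

Lemma cip_suml n (I : finType) (f : I -> ntuple X n -> R[i]) g :
  (forall i, L2 (tuple_measure m n) (f i)) -> L2 (tuple_measure m n) g ->
  cip (tuple_measure m n) (fun t => \sum_i f i t) g = \sum_i cip (tuple_measure m n) (f i) g.
Proof.
move=> Lf Lg; rewrite /cip -cintegral_sum; last by move=> i; exact: L2_mul_integrable.
by congr cintegral; apply/funext => t; rewrite mulr_suml.
Qed.

Lemma cip_conj n (f g : ntuple X n -> R[i]) : L2 (tuple_measure m n) f -> L2 (tuple_measure m n) g ->
  cip (tuple_measure m n) g f = (cip (tuple_measure m n) f g)^*%C.
Proof.
move=> Lf Lg; rewrite /cip -cintegral_conj; last exact: L2_mul_integrable.
by congr cintegral; apply/funext => t; rewrite conjcM conjcK mulrC.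
Qed.

Lemma ip_Psym n F G : cmeas F -> cmeas G ->
  L2 (tuple_measure m n) (@component _ X R n F) -> L2 (tuple_measure m n) (@component _ X R n G) ->
  ip n (Psym Q F) G = ip n F (Psym Q G).
Proof.
move=> mF mG LF LG; have LPF pi := L2_Psi pi mF LF; have LPG pi := L2_Psi pi mG LG.
rewrite [RHS]cip_conj//; last exact: L2_Psym.
rewrite !component_Psym !cipZl//; try exact: L2_sum.
rewrite !cip_suml// conjcM (_ : (n`!%:R^-1)^*%C = n`!%:R^-1 :> R[i]); last first.
  by rewrite -[_^*%C]/(conjc _) fmorphV rmorph_nat.
congr (_ * _); rewrite (rmorph_sum (@conjc R)) (reindex_inj invg_inj).
apply: eq_bigr => pi _; rewrite -[LHS]/(ip n (Psi Q pi^-1%g F) G) ip_Psi// invgK.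
exact: cip_conj.
Qed.

End symmetrizer_L2.

(** * Classes of functions and their representatives *)

Section fock_classes.
Context d (X : measurableType d) (R : realType) (m : {sigma_finite_measure set X -> \bar R}).
Implicit Types (f g : seq X -> R[i]^o) (F G : fclass m).

Lemma cls_eqP f g : cls m f = cls m g <->
  forall n, {ae tuple_measure m n, forall t : n.-tuple X, f t = g t}.
Proof.
rewrite /cls; split=> [/lproj_eq|h].
  rewrite unfold_in => /asboolP h n; apply: filterS (h n) => t.
  by rewrite /component /= => /eqP; rewrite subr_eq0 => /eqP.
apply/lproj_eq; rewrite unfold_in; apply/asboolP => n; apply: filterS (h n) => t.
by rewrite /component => fg; apply/eqP; rewrite subr_eq0; apply/eqP.
Qed.

Lemma clsD f g : cls m (f + g) = cls m f + cls m g.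
Proof. exact: lprojD. Qed.

Lemma clsZ a f : cls m (a *: f) = a *: cls m f.
Proof. exact: linearZ. Qed.

Lemma cls0 : cls m 0 = 0.
Proof. by rewrite -(scale0r (0 : seq X -> R[i]^o)) clsZ scale0r. Qed.

Lemma clsN f : cls m (- f) = - cls m f.
Proof. by rewrite -scaleN1r clsZ scaleN1r. Qed.

Lemma clsB f g : cls m (f - g) = cls m f - cls m g.
Proof. by rewrite clsD clsN. Qed.

Lemma cls_sum (I : Type) (r : seq I) (P : pred I) (f : I -> seq X -> R[i]^o) :
  cls m (\sum_(i <- r | P i) f i) = \sum_(i <- r | P i) cls m (f i).
Proof. exact: linear_sum. Qed.

Let repP F : (exists f, cmeas f /\ cls m f = F) -> cmeas (rep F) /\ cls m (rep F) = F.
Proof. rewrite /rep; case: xgetP => [f _ [mf fF]|nex] [g [mg gF]] //; by case: (nex g). Qed.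

Lemma cls_rep F : cls m (rep F) = F.
Proof.
have [/repP[]//|nex] := pselect (exists f, cmeas f /\ cls m f = F).
rewrite /rep xgetPN; first exact: lproj_repr.
by move=> f [mf fF]; apply: nex; exists f.
Qed.

Lemma cmeas_rep_cls f : cmeas f -> cmeas (rep (cls m f)).
Proof. by move=> mf; apply: (repP _).1; exists f. Qed.

Lemma rep_cls_ae f n : {ae tuple_measure m n, forall t : n.-tuple X, rep (cls m f) t = f t}.
Proof. by have /cls_eqP := cls_rep (cls m f). Qed.

Definition fockL2 f : Prop := L2 (fock_measure m) (f : mfseq X -> R[i]).

Lemma fockL2_cmeas f : fockL2 f -> cmeas f.
Proof. by move=> [/cmeasurable_fseq]. Qed.

Lemma sqnorm_component_cls f n : cmeas f ->
  sqnorm (tuple_measure m n) (@component _ X R n (rep (cls m f))) =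
  sqnorm (tuple_measure m n) (@component _ X R n f).
Proof. by move=> mf; exact: (ae_eq_sqnorm (cmeas_rep_cls mf n) (mf n) (rep_cls_ae f n)). Qed.

Lemma fsqnorm_cls f : cmeas f -> fsqnorm (cls m f) = sqnorm (fock_measure m) (f : mfseq X -> R[i]).
Proof.
move=> mf; rewrite sqnorm_fock_measure//; apply: eq_eseriesr => n _.
by rewrite sqnorm_component_cls.
Qed.

Lemma fip_cls f g : cmeas f -> cmeas g -> fip (cls m f) (cls m g) =
  clim (fun N => \sum_(n < N) n`!%:R *
    cip (tuple_measure m n) (@component _ X R n f) (@component _ X R n g)).
Proof.
move=> mf mg; rewrite /fip; congr clim; apply/funext => N; apply: eq_bigr => n _; congr (_ * _).
apply: ae_eq_cintegral.
- exact: (cmeasurableM (cmeas_rep_cls mf n) (cmeasurable_conj (cmeas_rep_cls mg n))).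
- exact: (cmeasurableM (mf n) (cmeasurable_conj (mg n))).
- by apply: filterS2 (rep_cls_ae f n) (rep_cls_ae g n) => t -> ->.
Qed.

Lemma fip_cls_L2 f g : fockL2 f -> fockL2 g ->
  fip (cls m f) (cls m g) = cip (fock_measure m) (f : mfseq X -> R[i]) (g : mfseq X -> R[i]).
Proof.
move=> Lf Lg; rewrite fip_cls; [|exact: fockL2_cmeas|exact: fockL2_cmeas].
by rewrite /cip fock_cintegral//; exact: L2_mul_integrable.
Qed.

Lemma fockL2_component f n : fockL2 f -> L2 (tuple_measure m n) (@component _ X R n f).
Proof.
move=> Lf; have mf := fockL2_cmeas Lf; split; first exact: (mf n).
have := Lf.2; rewrite sqnorm_fock_measure// => foo.
have nn k : (0 <= k`!%:R%:E * sqnorm (tuple_measure m k) (@component _ X R k f))%E.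
  by rewrite mule_ge0 ?lee_fin// sqnorm_ge0.
have : (n`!%:R%:E * sqnorm (tuple_measure m n) (@component _ X R n f) < +oo)%E.
  apply: le_lt_trans foo; apply: le_trans (nneseries_lim_ge n.+1 _); last by move=> *; exact: nn.
  by rewrite big_nat_recr//= -[leLHS]add0e; apply: leeD => //; apply: sume_ge0 => i _; exact: nn.
by rewrite !ltey; apply: contraNN => /eqP ->; rewrite gt0_muley// lte_fin ltr0n fact_gt0.
Qed.

Lemma fockL2_le f g : cmeas f -> fockL2 g ->
  (forall n, (sqnorm (tuple_measure m n) (@component _ X R n f) <=
              sqnorm (tuple_measure m n) (@component _ X R n g))%E) ->
  fockL2 f /\ (sqnorm (fock_measure m) (f : mfseq X -> R[i]) <=
    sqnorm (fock_measure m) (g : mfseq X -> R[i]))%E.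
Proof.
move=> mf Lg fg; have mg := fockL2_cmeas Lg.
suff le : (sqnorm (fock_measure m) (f : mfseq X -> R[i]) <=
    sqnorm (fock_measure m) (g : mfseq X -> R[i]))%E.
  by split=> //; split; [exact/cmeasurable_fseq|exact: le_lt_trans le Lg.2].
rewrite !sqnorm_fock_measure//; apply: lee_nneseries => [n _ _|n _].
  by rewrite mule_ge0 ?lee_fin// sqnorm_ge0.
by rewrite lee_wpmul2l ?lee_fin.
Qed.

Lemma fockL2_single n f : (forall s, size s != n -> f s = 0) ->
  L2 (tuple_measure m n) (@component _ X R n f) ->
  fockL2 f /\ (sqnorm (fock_measure m) (f : mfseq X -> R[i]) =
    n`!%:R%:E * sqnorm (tuple_measure m n) (@component _ X R n f))%E.
Proof.
move=> f0 Lf.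
have fk k : k != n -> @component _ X R k f = fun=> 0.
  by move=> kn; apply/funext => t; rewrite /component f0// size_tuple.
have mf : cmeas f.
  move=> k; have [->|kn] := eqVneq k n; first by have [] := Lf.
  by rewrite fk//; exact: cmeasurable_cst.
have z k : sqnorm (tuple_measure m k) (fun=> 0) = 0%E.
  rewrite /sqnorm (eq_integral (cst 0%E)) ?integral0//.
  by move=> t _ /=; rewrite expr0n/= addr0.
have E : (sqnorm (fock_measure m) (f : mfseq X -> R[i]) =
    n`!%:R%:E * sqnorm (tuple_measure m n) (@component _ X R n f))%E.
  rewrite sqnorm_fock_measure// (@nneseries_split _ _ 0 n.+1)/=; last first.
    by move=> k _; rewrite mule_ge0 ?lee_fin// sqnorm_ge0.
  rewrite add0n eseries0 ?adde0; last first.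
    by move=> k nk _; rewrite fk ?gtn_eqF// z ?mule0.
  rewrite big_mkord big_ord_recr/= big1 ?add0e// => k _.
  by rewrite fk ?ltn_eqF// z ?mule0.
split=> //; split; first exact/cmeasurable_fseq.
by rewrite E lte_mul_pinfty ?lee_fin//; have [] := Lf.
Qed.

Lemma sqnorm0_cls f : fockL2 f ->
  sqnorm (fock_measure m) (f : mfseq X -> R[i]) = 0%E -> cls m f = 0.
Proof.
move=> Lf f0; have mf := fockL2_cmeas Lf; rewrite -cls0; apply/cls_eqP => n.
have nn k : (0 <= k`!%:R%:E * sqnorm (tuple_measure m k) (@component _ X R k f))%E.
  by rewrite mule_ge0 ?lee_fin// sqnorm_ge0.
have n0 : sqnorm (tuple_measure m n) (@component _ X R n f) = 0%E.
  have : (n`!%:R%:E * sqnorm (tuple_measure m n) (@component _ X R n f) <= 0)%E.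
    rewrite -f0 sqnorm_fock_measure//.
    apply: le_trans (nneseries_lim_ge n.+1 _); last by move=> *; exact: nn.
    by rewrite big_nat_recr//= -[leLHS]add0e; apply: leeD => //; apply: sume_ge0 => i _; exact: nn.
  rewrite pmule_rle0 ?lte_fin ?ltr0n ?fact_gt0// => h; apply/eqP; rewrite eq_le h.
  exact: sqnorm_ge0.
have := (ae_eq_integral_abs (tuple_measure m n) measurableT (measurable_cabs2E (mf n))).1.
move=> h; have {h}/h : (\int[tuple_measure m n]_t `|(cabs2 (component f t))%:E| = 0)%E.
  by rewrite -[RHS]n0; apply: eq_integral => t _; rewrite gee0_abs// lee_fin cabs2_ge0.
apply: filterS => t /= /(_ I) [] h; exact: cabs2_eq0 h.
Qed.

Variables (A : set (X * X)) (Q1 Q2 : X -> X -> R[i]).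
Hypotheses (mA : measurable A) (A0 : (m \x m)%E A = 0%E).
Hypothesis Q12 : forall x y, ~ A (x, y) -> Q1 x y = Q2 x y.

(** Exchanges preserve null sets, and the two kernels differ only on one: on classes, neither the
    representative nor the values of the kernel on [A] are visible. *)
Lemma cls_Psi_adj j f g : cls m f = cls m g -> cls m (Psi_adj Q1 j f) = cls m (Psi_adj Q2 j g).
Proof.
move=> /cls_eqP fg; apply/cls_eqP => n.
apply: filterS2 (ae_swapt j (fg n)) (ae_adjacent n j mA A0) => t.
rewrite !Psi_adjE /qfac /= => ->.
by case: (drop j t) => [|x [|y r]]// /Q12 ->.
Qed.

Lemma cls_Psym f g : cls m f = cls m g -> cls m (Psym Q1 f) = cls m (Psym Q2 g).
Proof.
move=> fg; apply/cls_eqP => n.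
have h w : cls m (foldr (Psi_adj Q1) f w) = cls m (foldr (Psi_adj Q2) g w).
  by elim: w => //= j w; exact: cls_Psi_adj.
have H : forall pi : 'S_n, {ae tuple_measure m n, forall t : n.-tuple X, Psi Q1 pi f t = Psi Q2 pi g t}.
  by move=> pi; have /cls_eqP := h (adj_word pi).
have : {ae tuple_measure m n, forall t : n.-tuple X, forall pi : 'S_n, Psi Q1 pi f t = Psi Q2 pi g t}.
  suff : {ae tuple_measure m n, forall t : n.-tuple X, forall pi, pi \in enum 'S_n -> Psi Q1 pi f t = Psi Q2 pi g t}.
    by apply: filterS => t ht pi; apply: ht; rewrite mem_enum.
  (* There are finitely many permutations, so their exceptional sets are collected one at a time. *)
  elim: (enum 'S_n) => [|p r IH]; first by apply: aeW.
  apply: filterS2 (H p) IH => t hp hr pi; rewrite inE => /predU1P[->//|]; exact: hr.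
apply: filterS => t ht; rewrite !Psym_tupleE; congr (_ * _); apply: eq_bigr => pi _; exact: ht.
Qed.

End fock_classes.

(** * The Fock space as a Hilbert space *)

Section submodule_type.
Variables (K : pzRingType) (V : lmodType K) (S : {pred V}) (hS : submod_closed S).

Definition sub_pred of submod_closed S : {pred V} := S.

HB.instance Definition _ := GRing.isSubmodClosed.Build K V (sub_pred hS)
  (GRing.submod_closed_semi hS).

(** The Fock space is a set of classes, while the geometry of forms is stated for whole modules;
    this turns a submodule into a module. *)
Record submodule := Submodule { submodule_val :> V ; _ : submodule_val \in sub_pred hS }.

HB.instance Definition _ := [isSub for submodule_val].
HB.instance Definition _ := gen_eqMixin submodule.
HB.instance Definition _ := [Choice of submodule by <:].
HB.instance Definition _ := [SubChoice_isSubLmodule of submodule by <:].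

End submodule_type.

Lemma Psym_linear (R : realType) (X : Type) (Q : X -> X -> R[i]) : linear (Psym Q).
Proof.
move=> a F G.
have wE w s : foldr (Psi_adj Q) (a *: F + G) w s =
    a * foldr (Psi_adj Q) F w s + foldr (Psi_adj Q) G w s.
  elim: w s => [//|j w IH] s /=; rewrite /Psi_adj; case: (drop j s) => [|x [|y r]]//.
  by rewrite IH mulrDr mulrCA.
apply/funext => s; rewrite /Psym fctE.
under eq_bigr => pi _ do rewrite /Psi wE.
rewrite big_split /= mulrDr -mulr_sumr mulrCA; congr (_ + _).
Qed.

Record q_kernel (R : realType) (T : ptopologicalType)
    (sigma : {sigma_finite_measure set (borel T) -> \bar R})
    (A : set (borel T * borel T)) (Q : borel T * borel T -> R[i]) : Prop := QKernel {
  q_kernel_domain : measurable A;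
  q_kernel_sym : forall s t, A (s, t) -> A (t, s);
  q_kernel_diag : forall t, A (t, t);
  q_kernel_null : (sigma \x sigma)%E A = 0%E;
  q_kernel_measurable :
    measurable_fun (~` A) (fun z => complex.Re (Q z) : measurableTypeR R) /\
    measurable_fun (~` A) (fun z => complex.Im (Q z) : measurableTypeR R);
  q_kernel_circle : forall z, ~ A z -> `|Q z| = 1;
  q_kernel_hermitian : forall s t, ~ A (s, t) -> Q (s, t) = (Q (t, s))^*%C }.

Section levy_fock.
Variables (R : realType) (T : ptopologicalType).
Variable sigma : {sigma_finite_measure set (borel T) -> \bar R}.
Variable nu : probability (measurableTypeR R) R.
Variables (A : set (borel T * borel T)) (Q : borel T * borel T -> R[i]).

Local Notation X := (marked R T).
Local Notation mu := (marked_measure sigma nu).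
Local Notation vec := (fclass mu).

(* Q made total: its values on A do not affect the classes of functions.       *)
Definition Qtot (s t : borel T) : R[i] := if `[< A (s, t) >] then 1 else Q (s, t).

Definition Qmark (x y : X) : R[i] := Qtot x.1 y.1.

Definition fsym : (seq X -> R[i]^o) -> seq X -> R[i]^o := Psym Qmark.

Hypothesis HQ : q_kernel sigma A Q.

Let mA : measurable A. Proof. by case: HQ. Qed.
Let A_sym s t : A (s, t) -> A (t, s). Proof. by case: HQ => _ h *; exact: h. Qed.
Let A_diag t : A (t, t). Proof. by case: HQ. Qed.
Let A_null : (sigma \x sigma)%E A = 0%E. Proof. by case: HQ. Qed.
Let mQ : measurable_fun (~` A) (fun z => complex.Re (Q z) : measurableTypeR R) /\
  measurable_fun (~` A) (fun z => complex.Im (Q z) : measurableTypeR R).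
Proof. by case: HQ. Qed.
Let Q_circle z : ~ A z -> `|Q z| = 1. Proof. by case: HQ => _ _ _ _ _ h _; exact: h. Qed.
Let Q_hermitian s t : ~ A (s, t) -> Q (s, t) = (Q (t, s))^*%C.
Proof. by case: HQ => _ _ _ _ _ _; exact. Qed.

Lemma Qtot_herm s t : Qtot t s = (Qtot s t)^*%C.
Proof.
rewrite /Qtot; case: asboolP => [/A_sym Ast|nA]; case: asboolP => [Ats|nA'] //.
- by rewrite rmorph1.
- by case: nA; exact: A_sym.
- exact: Q_hermitian.
Qed.

Lemma cabs2_Qtot s t : cabs2 (Qtot s t) = 1.
Proof.
rewrite /Qtot; case: asboolP => [_|/Q_circle/cabs2_norm1//].
by rewrite /cabs2/= expr1n expr0n addr0.
Qed.

Lemma Qtot_diag t : Qtot t t = 1.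
Proof. by rewrite /Qtot asboolT. Qed.

Lemma cmeasurable_Qtot : cmeasurable (fun z : borel T * borel T => Qtot z.1 z.2).
Proof.
have mb : measurable_fun setT (fun z : borel T * borel T => `[< A z >]).
  apply: (measurable_fun_bool true); rewrite setTI.
  rewrite (_ : _ @^-1` _ = A)//; apply/seteqP; split=> z /=; first by move/asboolP.
  by move=> Az; rewrite asboolT.
have F0 : setT `&` (fun z : borel T * borel T => `[< A z >]) @^-1` [set false] = ~` A.
  rewrite setTI; apply/seteqP; split=> z /=; first by move/asboolPn.
  by move=> Az; apply/asboolPn.
split.
- rewrite (_ : (fun _ => _) = fun z => if `[< A z >] then 1 else complex.Re (Q z)).
    by apply: measurable_fun_if => //; rewrite F0; exact: mQ.1.
  by apply/funext => -[s t]; rewrite /Qtot; case: asboolP.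
- rewrite (_ : (fun _ => _) = fun z => if `[< A z >] then 0 else complex.Im (Q z)).
    by apply: measurable_fun_if => //; rewrite F0; exact: mQ.2.
  by apply/funext => -[s t]; rewrite /Qtot; case: asboolP.
Qed.

Lemma cmeasurable_Qmark : cmeasurable (fun z : X * X => Qmark z.1 z.2).
Proof.
apply: (cmeasurable_comp (phi := fun z : X * X => (z.1.1, z.2.1)) _ cmeasurable_Qtot).
apply: measurable_fun_pair.
  exact: (measurableT_comp measurable_fst measurable_fst).
exact: (measurableT_comp measurable_fst measurable_snd).
Qed.

Lemma Qmark_herm (x y : X) : Qmark y x = (Qmark x y)^*%C. Proof. exact: Qtot_herm. Qed.
Lemma Qmark_abs (x y : X) : cabs2 (Qmark x y) = 1. Proof. exact: cabs2_Qtot. Qed.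
Lemma Qmark_diag (x : X) : Qmark x x = 1. Proof. exact: Qtot_diag. Qed.
Lemma Qmark_inv (x y : X) : Qmark x y * Qmark y x = 1. Proof. exact: (Q_inv Qmark_herm Qmark_abs). Qed.

Let AX : set (X * X) := (fun z : X * X => (z.1.1, z.2.1)) @^-1` A.

Let mAX : measurable AX.
Proof.
rewrite -[X in measurable X]setTI.
have : measurable_fun setT (fun z : X * X => (z.1.1, z.2.1) : borel T * borel T).
  apply: measurable_fun_pair.
    exact: (measurableT_comp measurable_fst measurable_fst).
  exact: (measurableT_comp measurable_fst measurable_snd).
exact.
Qed.

Lemma integral_fst_marked (f : borel T -> \bar R) : measurable_fun setT f ->
  (forall t, 0 <= f t)%E -> (\int[mu]_x f x.1 = \int[sigma]_t f t)%E.
Proof.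
move=> mf f0.
rewrite -[LHS]/(\int[(sigma \x nu)%E]_x f x.1)%E.
rewrite (fubini_tonelli1 (fun x : X => f x.1))//; last first.
  by apply: measurableT_comp => //; exact: measurable_fst.
apply: eq_integral => t _; rewrite /fubini_F/= integral_cst//.
by rewrite [X in (_ * X)%E](_ : _ = 1%E) ?mule1//; exact: probability_setT.
Qed.

Let AX_null : (mu \x mu)%E AX = 0%E.
Proof.
rewrite /product_measure1.
have mx t : measurable (xsection A t) by exact: measurable_xsection.
rewrite (_ : (_ \o _) = fun x : X => sigma (xsection A x.1)); last first.
  apply/funext => x /=; rewrite (_ : xsection AX x = xsection A x.1 `*` setT); last first.
    apply/seteqP; split=> y; rewrite /xsection/= !inE; last by case.
    by move=> h; split => //=; rewrite inE.
  rewrite -[LHS]/((sigma \x nu)%E _) product_measure1E//.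
  by rewrite [X in (_ * X)%E](_ : _ = 1%E) ?mule1//; exact: probability_setT.
rewrite (integral_fst_marked (f := fun t => sigma (xsection A t)))//.
exact: measurable_fun_xsection.
Qed.

Lemma cls_symmetrizer f g : cls mu f = cls mu g -> cls mu (symmetrizer Q f) = cls mu (fsym g).
Proof.
apply: (cls_Psym (A := AX)) => // x y nA.
by rewrite /Qmark /Qtot asboolF//; exact: nA.
Qed.

(** Fixed by the symmetrizer at every point, not just almost everywhere, so that identities between
    functions can be rewritten before passing to classes. *)
Definition sym_rep (f : seq X -> R[i]^o) : Prop := fockL2 mu f /\ fsym f = f.

Lemma fockL2_fsym f : fockL2 mu f -> fockL2 mu (fsym f) /\
  (sqnorm (fock_measure mu) (fsym f : mfseq X -> R[i]) <= sqnorm (fock_measure mu) (f : mfseq X -> R[i]))%E.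
Proof.
move=> Lf; have mf := fockL2_cmeas Lf; apply: fockL2_le => //.
  exact: (cmeas_Psym cmeasurable_Qmark mf).
by move=> n; exact: (nrm_Psym_le (Q := Qmark) mu cmeasurable_Qmark Qmark_abs n mf).
Qed.

Lemma sym_rep_fsym f : fockL2 mu f -> sym_rep (fsym f).
Proof. by move=> /fockL2_fsym[Lf _]; split => //; exact: (Psym_id Qmark_inv Qmark_diag). Qed.

(** By idempotence the symmetrization of any representative serves as [f], and a fixed function is
    its own symmetrization; [cls_symmetrizer] trades [Q] for its total version. *)
Lemma fockP (F : vec) : fock Q F <-> exists f, sym_rep f /\ F = cls mu f.
Proof.
split=> [[[H LH ->] fin]|[f [[Lf Pf] ->]]].
  have mH : cmeas (rep H) by move=> n; have [] := LH n.
  have mP := cmeas_Psym cmeasurable_Qmark mH.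
  have E := cls_symmetrizer (erefl (cls mu (rep H))).
  exists (fsym (rep H)); split => //; split; last exact: (Psym_id Qmark_inv Qmark_diag).
  split; first exact/cmeasurable_fseq.
  by rewrite -(fsqnorm_cls mu mP) -E.
have mf := fockL2_cmeas Lf; split; last by rewrite (fsqnorm_cls mu mf); exact: Lf.2.
exists (cls mu f); last by rewrite (cls_symmetrizer (cls_rep (cls mu f))) Pf.
by move=> n; split; [exact: (cmeas_rep_cls mu mf n)|rewrite (sqnorm_component_cls mu n mf); exact: (fockL2_component n Lf).2].
Qed.

Lemma fock_cls f : sym_rep f -> fock Q (cls mu f).
Proof. by move=> sf; apply/fockP; exists f. Qed.


Lemma sym_repZD a f g : sym_rep f -> sym_rep g -> sym_rep (a *: f + g).
Proof.
move=> [Lf Pf] [Lg Pg]; split; first exact: (L2D (L2Z a Lf) Lg).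
by rewrite /fsym Psym_linear -/(fsym f) -/(fsym g) Pf Pg.
Qed.

Lemma sym_rep0 : sym_rep 0.
Proof.
split; first exact: L2_0.
by have := Psym_linear Qmark (-1) 0 0; rewrite !scaleN1r !addNr.
Qed.

Lemma fock_submod : submod_closed (fun F : vec => `[< fock Q F >]).
Proof.
split; rewrite ?unfold_in.
  by apply/asboolP; rewrite -(cls0 mu); apply: fock_cls; exact: sym_rep0.
move=> a F G /asboolP/fockP[f [sf ->]] /asboolP/fockP[g [sg ->]].
by apply/asboolP; rewrite -clsZ -clsD; apply: fock_cls; exact: sym_repZD.
Qed.

Lemma fockZD a (F G : vec) : fock Q F -> fock Q G -> fock Q (a *: F + G).
Proof. by move=> /asboolT hF /asboolT hG; have /asboolP := fock_submod.2 a F G hF hG. Qed.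

Lemma fock0 : fock Q (0 : vec).
Proof. exact: (asboolW fock_submod.1). Qed.

Lemma fip_linear a (F G H : vec) : fock Q F -> fock Q G -> fock Q H ->
  fip (a *: F + G) H = a * fip F H + fip G H.
Proof.
move=> /fockP[f [[Lf _] ->]] /fockP[g [[Lg _] ->]] /fockP[h [[Lh _] ->]].
rewrite -clsZ -clsD !fip_cls_L2//; last exact: (L2D (L2Z a Lf) Lg).
exact: (semi_inner_linear (L2ip_semi_inner (fock_measure mu)) (mkL2 Lh) a (mkL2 Lf) (mkL2 Lg)).
Qed.

Lemma fip_conj (F G : vec) : fock Q F -> fock Q G -> fip G F = (fip F G)^*%C.
Proof.
move=> /fockP[f [[Lf _] ->]] /fockP[g [[Lg _] ->]]; rewrite !fip_cls_L2//.
exact: (semi_inner_sym (L2ip_semi_inner (fock_measure mu)) (mkL2 Lf) (mkL2 Lg)).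
Qed.

Lemma fip_self (F : vec) : fock Q F -> (fsqnorm F < +oo)%E /\ fip F F = (fine (fsqnorm F))%:C.
Proof.
move=> /fockP[f [[Lf _] ->]]; rewrite fip_cls_L2// cip_self// (fsqnorm_cls mu (fockL2_cmeas Lf)).
by split => //; exact: Lf.2.
Qed.

Lemma fsqnorm_ge0 (F : vec) : (0 <= fsqnorm F)%E.
Proof. by apply: nneseries_ge0 => n _ _; rewrite mule_ge0 ?lee_fin// sqnorm_ge0. Qed.

Lemma fip_definite (F : vec) : fock Q F -> fip F F = 0 -> F = 0.
Proof.
move=> fF; have [foo ->] := fip_self fF; move: fF.
move=> /fockP[f [[Lf _] FE]] []; rewrite FE in foo *; move=> h; apply: sqnorm0_cls => //.
rewrite -(fsqnorm_cls mu (fockL2_cmeas Lf)).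
by rewrite -[LHS]fineK ?ge0_fin_numE ?fsqnorm_ge0// h.
Qed.

Definition fock_space := submodule fock_submod.

Definition fock_ip (F G : fock_space) : R[i] := fip (val F) (val G).

Lemma fock_spaceP (F : fock_space) : fock Q (val F).
Proof. by case: F => F /= /asboolP. Qed.

Definition mk_fock (F : vec) (fF : fock Q F) : fock_space := Submodule (asboolT fF : F \in sub_pred fock_submod).

Lemma fock_ip_semi_inner : semi_inner fock_ip.
Proof.
split=> [w a f g|f g|f].
- by rewrite /fock_ip fip_linear//; exact: fock_spaceP.
- by rewrite /fock_ip fip_conj//; exact: fock_spaceP.
- rewrite /fock_ip (fip_self _).2; last exact: fock_spaceP.
  by rewrite lecR fine_ge0// fsqnorm_ge0.
Qed.

Lemma nsq_fock F : (nsq fock_ip F)%:E = fsqnorm (val F).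
Proof.
have [foo E] := fip_self (fock_spaceP F).
by rewrite /nsq /fock_ip E /= fineK// ge0_fin_numE// fsqnorm_ge0.
Qed.

Lemma fock_ip_definite (F : fock_space) : nsq fock_ip F = 0 -> F = 0.
Proof.
move=> F0; apply/val_inj/fip_definite; first exact: fock_spaceP.
by rewrite -[LHS]/(fock_ip F F) (nsqE fock_ip_semi_inner) F0.
Qed.

Lemma fock_ip_complete : sip_complete fock_ip.
Proof.
move=> x xC.
have /choice[f /all_and2[sf xE]] n : exists f, sym_rep f /\ val (x n) = cls mu f.
  by apply/fockP; exact: fock_spaceP.
have nE g (Lg : fockL2 mu g) : (nsq (@L2ip _ _ _ (fock_measure mu)) (mkL2 Lg))%:E = fsqnorm (cls mu g).
  by rewrite nsq_L2 -sqnorm_fin// (fsqnorm_cls mu (fockL2_cmeas Lg)).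
pose y n : L2fun (fock_measure mu) := mkL2 (sf n).1.
have yx m n : nsq (@L2ip _ _ _ (fock_measure mu)) (y m - y n) = nsq fock_ip (x m - x n).
  have LB : fockL2 mu (f m - f n) by exact: (L2B (sf m).1 (sf n).1).
  apply: EFin_inj; rewrite nsq_fock raddfB/= !xE -clsB -(nE _ LB).
  by congr ((nsq _ _)%:E); exact/val_inj.
have [l yl] : exists l, sip_cvg (@L2ip _ _ _ (fock_measure mu)) y l.
  by apply: riesz_fischer => e e0; have [N hN] := xC e e0; exists N => m n Nm Nn; rewrite yx; exact: hN.
have Ll : fockL2 mu l := L2funP l.
(* The limit in L2 need not be fixed by the symmetrizer. Symmetrizing it keeps the convergence,
   since [fsym] is a contraction fixing every [f n]. *)
have sPl : sym_rep (fsym l) := sym_rep_fsym Ll.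
exists (mk_fock (fock_cls sPl)).
apply: (squeeze_cvgr _ (cvg_cst (0 : R)) yl); apply: nearW => n.
rewrite nsq_ge0 ?/=; last exact: fock_ip_semi_inner.
rewrite -lee_fin nsq_fock raddfB/= xE -clsB.
have LB : fockL2 mu (f n - l) by exact: (L2B (sf n).1 Ll).
have -> : f n - fsym l = fsym (f n - l).
  have := Psym_linear Qmark (-1) l (f n); rewrite -!/(fsym _) (sf n).2 !scaleN1r.
  by rewrite [in X in fsym X]addrC => ->; rewrite addrC.
have [LP le] := fockL2_fsym LB.
rewrite (fsqnorm_cls mu (fockL2_cmeas LP)).
apply: le_trans le _; rewrite nsq_L2 -sqnorm_fin//; exact: (L2funP (y n - l)).
Qed.

End levy_fock.

(** * Monomials in the marks with square-integrable coefficients *)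

Section monomials.
Variables (R : realType) (T : ptopologicalType).
Variable sigma : {sigma_finite_measure set (borel T) -> \bar R}.
Variable nu : probability (measurableTypeR R) R.

Local Notation X := (marked R T).
Local Notation mu := (marked_measure sigma nu).
Local Notation coef := (seq (borel T) -> R[i]^o).

(** The weights are arbitrary functions, not just powers, because the powers will be replaced by
    indicators of rays one coordinate at a time. *)
Definition wprod (w : nat -> R -> R) (s : seq X) : R := \prod_(j < size s) w j (nth point s j).2.

Lemma wprod_cons w x s : wprod w (x :: s) = w 0%N x.2 * wprod (fun j => w j.+1) s.
Proof. by rewrite /wprod big_ord_recl. Qed.

Lemma measurable_wprod n (w : nat -> R -> R) :
  (forall j, measurable_fun setT (w j : measurableTypeR R -> measurableTypeR R)) ->
  measurable_fun setT (fun t : ntuple X n => wprod w t).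
Proof.
move=> mw; rewrite (_ : (fun _ => _) = fun t : ntuple X n => \prod_(j <- enum 'I_n) w j (tnth t j).2).
  elim: (enum 'I_n) => [|j r IH].
    by under eq_fun do rewrite big_nil; exact: measurable_cst.
  under eq_fun do rewrite big_cons; apply: measurable_funM IH.
  apply: (measurableT_comp (mw j)).
  exact: (measurableT_comp measurable_snd (measurable_tnth j)).
apply/funext => t; rewrite /wprod big_enum /= -(big_mkord xpredT (fun j => w j (nth point t j).2)).
rewrite size_tuple big_mkord; apply: eq_bigr => j _; congr (w _ _.2).
exact/esym/tnth_nth.
Qed.

Lemma measurable_map_fst n : measurable_fun setT (fun t : ntuple X n => map_tuple fst t : ntuple (borel T) n).
Proof.
apply/measurable_fun_tnthP => j; rewrite (_ : _ \o _ = fun t : ntuple X n => (tnth t j).1).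
  exact: (measurableT_comp measurable_fst (measurable_tnth j)).
by apply/funext => t /=; rewrite tnth_map.
Qed.

Lemma ge0_integral_marked (g : borel T -> \bar R) (w : R -> R) :
  measurable_fun setT g -> (forall t, 0 <= g t)%E ->
  measurable_fun setT (w : measurableTypeR R -> measurableTypeR R) -> (forall x, 0 <= w x) ->
  (\int[mu]_z (g z.1 * (w z.2)%:E) = \int[nu]_x (w x)%:E * \int[sigma]_t g t)%E.
Proof.
move=> mg g0 mw w0.
rewrite -[LHS]/(\int[(sigma \x nu)%E]_z (g z.1 * (w z.2)%:E))%E.
have mgw : measurable_fun setT (fun z : X => g z.1 * (w z.2)%:E)%E.
  apply: emeasurable_funM; first exact: (measurableT_comp mg measurable_fst).
  by apply/measurable_EFinP; exact: (measurableT_comp mw measurable_snd).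
rewrite (fubini_tonelli1 (fun z : X => g z.1 * (w z.2)%:E)%E)//; last first.
  by move=> z; rewrite mule_ge0 ?lee_fin.
rewrite /fubini_F /=.
have w1 : (0 <= \int[nu]_x (w x)%:E)%E by apply: integral_ge0 => x _; rewrite lee_fin.
rewrite -ge0_integralZl//.
apply: eq_integral => t _; rewrite muleC ge0_integralZl//; first exact/measurable_EFinP.
by move=> x _; rewrite lee_fin.
Qed.

Lemma ge0_integral_weighted n (w : nat -> R -> R) (g : ntuple (borel T) n -> R) :
  (forall j, measurable_fun setT (w j : measurableTypeR R -> measurableTypeR R)) ->
  (forall j x, 0 <= w j x) -> measurable_fun setT g -> (forall t, 0 <= g t) ->
  (\int[tuple_measure mu n]_t (g (map_tuple fst t) * wprod w t)%:E =
   \prod_(j < n) \int[nu]_x (w j x)%:E * \int[tuple_measure sigma n]_t (g t)%:E)%E.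
Proof.
elim: n w g => [|n IH] w g mw w0 mg g0.
  rewrite big_ord0 mul1e !tuple_measure0_integral.
  - by rewrite /wprod big_ord0 mulr1; congr (g _)%:E; exact/val_inj.
  - exact/measurable_EFinP.
  - apply/measurable_EFinP/measurable_funM; first exact: (measurableT_comp mg (@measurable_map_fst 0)).
    exact: measurable_wprod.
have wp0 k (v : nat -> R -> R) (s : k.-tuple X) : (forall j x, 0 <= v j x) -> 0 <= wprod v s.
  by move=> v0; apply: prodr_ge0 => j _.
have mF : measurable_fun setT (fun t : ntuple X n.+1 => (g (map_tuple fst t) * wprod w t)%:E).
  apply/measurable_EFinP/measurable_funM; last exact: measurable_wprod.
  exact: (measurableT_comp mg (@measurable_map_fst _)).
rewrite (ge0_integral_tcons1 _ mF); last by move=> t; rewrite lee_fin mulr_ge0 ?wp0.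
have mG : measurable_fun setT (fun t : ntuple (borel T) n.+1 => (g t)%:E) by exact/measurable_EFinP.
rewrite (ge0_integral_tcons1 _ mG); last by move=> t; rewrite lee_fin.
pose c := (\prod_(j < n) \int[nu]_x (w j.+1 x)%:E)%E.
pose h (x : borel T) := (\int[tuple_measure sigma n]_r (g (tcons (x, r)))%:E)%E.
have mh : measurable_fun setT h.
  apply: (measurable_fun_fubini_tonelli_F (fun z : borel T * ntuple (borel T) n => (g (tcons z))%:E)).
    exact: (measurable_tcons_comp mG).
  by move=> z; move: (g0 (tcons z)); rewrite -lee_fin.
have h0 x : (0 <= h x)%E by apply: integral_ge0 => r _; rewrite lee_fin.
have c0 : (0 <= c)%E by apply: prode_ge0 => j _; apply: integral_ge0 => x _; rewrite lee_fin.
transitivity (\int[mu]_z ((c * h z.1) * (w 0%N z.2)%:E))%E.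
  apply: eq_integral => z _.
  rewrite (_ : (\int[tuple_measure mu n]_r _)%E = (\int[tuple_measure mu n]_r ((w 0%N z.2)%:E *
      (g (tcons (z.1, map_tuple fst r)) * wprod (fun j => w j.+1) r)%:E)))%E; last first.
    apply: eq_integral => r _; rewrite -EFinM; congr EFin; rewrite wprod_cons mulrCA.
    by congr (_ * (g _ * _)); exact/val_inj.
  rewrite ge0_integralZl_EFin//; last 2 first.
  - by move=> r _; rewrite lee_fin mulr_ge0 ?wp0.
  - apply/measurable_EFinP/measurable_funM; last exact: measurable_wprod.
    have mgz : measurable_fun setT (fun r : ntuple (borel T) n => g (tcons (z.1, r))).
      by apply/measurable_EFinP; exact: (measurable_tcons_pair z.1 mG).
    exact: (measurableT_comp mgz (@measurable_map_fst _)).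
  rewrite (IH (fun j => w j.+1) (fun r => g (tcons (z.1, r))))//; last first.
    by apply/measurable_EFinP; exact: (measurable_tcons_pair z.1 mG).
  by rewrite muleC.
rewrite (ge0_integral_marked (g := fun t => (c * h t)%E))//; last 2 first.
- by apply: emeasurable_funM => //; exact: measurable_cst.
- by move=> t; exact: mule_ge0.
by rewrite ge0_integralZl// big_ord_recl/= muleA.
Qed.

Definition L2c (n : nat) (c : coef) : Prop := L2 (tuple_measure sigma n) (@component _ (borel T) R n c).

Lemma sqnorm_weighted n (w : nat -> R -> R) (c : ntuple (borel T) n -> R[i]) :
  (forall j, measurable_fun setT (w j : measurableTypeR R -> measurableTypeR R)) ->
  cmeasurable c ->
  cmeasurable (fun t : ntuple X n => c (map_tuple fst t) * (wprod w t)%:C) /\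
  (sqnorm (tuple_measure mu n) (fun t => (c (map_tuple fst t) * (wprod w t)%:C)%R) =
   \prod_(j < n) \int[nu]_x (w j x ^+ 2)%:E * sqnorm (tuple_measure sigma n) c)%E.
Proof.
move=> mw mc; split.
  apply: cmeasurableM; first exact: (cmeasurable_comp (@measurable_map_fst n) mc).
  by apply: cmeasurable_real; exact: measurable_wprod.
rewrite -(ge0_integral_weighted (w := fun j x => w j x ^+ 2) (g := fun t => cabs2 (c t)))//.
- apply: eq_integral => t _; congr EFin; rewrite -/(cabs2 _) cabs2M cabs2_real.
  by rewrite /wprod prodrXl.
- by move=> j; exact: (measurable_funX _ (mw j)).
- by move=> j x; exact: sqr_ge0.
- exact: measurable_cabs2.
- by move=> t; exact: cabs2_ge0.
Qed.

(** The degree is [size i], and the function is 0 in the others. Coefficients of all degrees share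
    the type of functions on sequences, which avoids dependent types when operators change the
    degree. *)
Definition mon (i : seq nat) (c : coef) : seq X -> R[i]^o := fun s =>
  if size s == size i then c (map fst s) * (wprod (fun j x => x ^+ nth 0%N i j) s)%:C else 0.

Lemma component_mon i c : @component _ X R (size i) (mon i c) =
  fun t => component c (map_tuple fst t) * (wprod (fun j x => x ^+ nth 0%N i j) t)%:C.
Proof. by apply/funext => t; rewrite /component /mon size_tuple eqxx. Qed.

Lemma mon_out i c s : size s != size i -> mon i c s = 0.
Proof. by rewrite /mon => /negPf->. Qed.

Lemma mon_linear i a c c' : mon i (a *: c + c') = a *: mon i c + mon i c'.
Proof.
apply/funext => s; rewrite !fctE /mon; case: eqP => _; last by rewrite [RHS]addr0 [RHS]mulr0.
exact: (etrans (mulrDl _ _ _) (congr1 (+%R^~ _) (esym (mulrA _ _ _)))).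
Qed.

Lemma mon0 i : mon i 0 = 0.
Proof. by apply/funext => s; rewrite /mon; case: eqP => // _; exact: mul0r. Qed.

Hypothesis nu_exp_moment : exists2 eps : R, 0 < eps &
  (\int[nu]_x (expR (eps * `|x : R|))%:E < +oo)%E.

Lemma exp_weight : exists2 delta : R, 0 < delta &
  forall k, (\int[nu]_x ((x ^+ k * expR (delta * `|x : R|)) ^+ 2)%:E < +oo)%E.
Proof.
(* Squaring doubles the exponent eps/4 to eps/2; the remaining eps/2 pays for the power x^(2k), with
   [C] the constant of [exprn_le_expR]. *)
have [eps eps0 hI] := nu_exp_moment; exists (eps / 4); first by rewrite divr_gt0.
move=> k; pose C := (2 * k)`!%:R / (eps / 2) ^+ (2 * k).
have e2 : 0 < eps / 2 by rewrite divr_gt0.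
have C0 : 0 <= C by rewrite divr_ge0// exprn_ge0// ltW.
have mE a : measurable_fun setT (fun x : measurableTypeR R => expR (a * `|x|)).
  apply: (measurableT_comp (@measurable_expR R)); exact: measurable_funM.
apply: (@le_lt_trans _ _ (\int[nu]_x (C%:E * (expR (eps * `|x : R|))%:E))%E).
  apply: ge0_le_integral => //.
  - by move=> x _; rewrite lee_fin sqr_ge0.
  - by apply/measurable_EFinP/measurable_funX/measurable_funM => //; exact: measurable_funX.
  - by apply/measurable_EFinP/measurable_funM => //; exact: mE.
  move=> x _; rewrite -EFinM lee_fin exprMn -expRM_natl -exprM mulnC.
  rewrite (_ : eps * `|x| = eps / 2 * `|x| + 2%:R * (eps / 4 * `|x|)); last by field.
  rewrite expRD [C * _]mulrA ler_wpM2r ?expR_ge0// /C mulrAC ler_pdivlMr ?exprn_gt0//.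
  rewrite (_ : x ^+ _ = `|x| ^+ (2 * k)); last by rewrite -normrX ger0_norm// exprM exprn_ge0// sqr_ge0.
  rewrite -exprMn mulrC; apply: exprn_le_expR.
  by rewrite mulr_ge0 ?normr_ge0// ltW.
have mEE := (measurable_EFinP _ _).2 (mE eps).
by rewrite ge0_integralZl_EFin// lte_mul_pinfty// lee_fin.
Qed.

Lemma moment_fin k : (\int[nu]_x ((x ^+ k) ^+ 2)%:E < +oo)%E.
Proof.
have [delta d0 hd] := exp_weight; apply: le_lt_trans (hd k).
apply: ge0_le_integral => //.
- by move=> x _; rewrite lee_fin sqr_ge0.
- by apply/measurable_EFinP; do 2 apply: measurable_funX; exact: measurable_id.
- apply/measurable_EFinP/measurable_funX/measurable_funM; first exact: measurable_funX.
  apply: (measurableT_comp (@measurable_expR R)); exact: measurable_funM.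
move=> x _; rewrite lee_fin exprMn ler_peMr ?sqr_ge0// exprn_ege1// -expR0 ler_expR.
by rewrite mulr_ge0// ltW.
Qed.

Definition monK (i : seq nat) : R :=
  (size i)`!%:R * fine (\prod_(j < size i) \int[nu]_x ((x ^+ nth 0%N i j) ^+ 2)%:E)%E.

Lemma mon_L2 i c : L2c (size i) c -> fockL2 mu (mon i c) /\
  (sqnorm (fock_measure mu) (mon i c : mfseq X -> R[i]) =
   (monK i)%:E * sqnorm (tuple_measure sigma (size i)) (component c))%E.
Proof.
move=> [mc nc].
have mw (j : nat) : measurable_fun setT
    ((fun x => x ^+ nth 0%N i j) : measurableTypeR R -> measurableTypeR R) by exact: measurable_funX.
have [mm E] := sqnorm_weighted mw mc.
have P0 : (0 <= \prod_(j < size i) \int[nu]_x ((x ^+ nth 0%N i j) ^+ 2)%:E)%E.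
  by apply: prode_ge0 => j _; apply: integral_ge0 => x _; rewrite lee_fin sqr_ge0.
have Pfin : (\prod_(j < size i) \int[nu]_x ((x ^+ nth 0%N i j) ^+ 2)%:E)%E \is a fin_num.
  apply: prode_fin_num => j _; rewrite ge0_fin_numE ?moment_fin//.
  by apply: integral_ge0 => x _; rewrite lee_fin sqr_ge0.
have Lm : L2 (tuple_measure mu (size i)) (@component _ X R (size i) (mon i c)).
  rewrite component_mon; split => //; rewrite E -(fineK Pfin) lte_mul_pinfty ?lee_fin ?fine_ge0//.
have [LF NE] := fockL2_single (@mon_out i c) Lm.
by split => //; rewrite NE component_mon E muleA -(fineK Pfin) -EFinM.
Qed.

Lemma monK_ge0 i : 0 <= monK i.
Proof.
rewrite mulr_ge0// fine_ge0//.
by apply: prode_ge0 => j _; apply: integral_ge0 => x _; rewrite lee_fin sqr_ge0.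
Qed.

Inductive monsum : (seq X -> R[i]^o) -> Prop :=
| monsum0 : monsum 0
| monsum_cons i c g : L2c (size i) c -> monsum g -> monsum (mon i c + g).

Lemma monsum_mon i c : L2c (size i) c -> monsum (mon i c).
Proof. by move=> Lc; rewrite -[mon i c]addr0; apply: monsum_cons => //; exact: monsum0. Qed.

Lemma monsumD g h : monsum g -> monsum h -> monsum (g + h).
Proof. by move=> mg mh; elim: mg => [|i c g' Lc _ IH]; rewrite ?add0r// -addrA; exact: monsum_cons. Qed.

Lemma monsumZ a g : monsum g -> monsum (a *: g).
Proof.
elim=> [|i c g' Lc _ IH]; first by rewrite scaler0; exact: monsum0.
rewrite scalerDr -[a *: mon i c]addr0 -(mon0 i) -mon_linear addr0.
by apply: monsum_cons IH; exact: (L2Z a Lc).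
Qed.

Lemma monsum_sum (I : Type) (r : seq I) (P : pred I) (g : I -> seq X -> R[i]^o) :
  (forall k, P k -> monsum (g k)) -> monsum (\sum_(k <- r | P k) g k).
Proof.
by move=> mg; elim/big_ind: _ => //; [exact: monsum0|exact: monsumD].
Qed.

Lemma monsum_fockL2 g : monsum g -> fockL2 mu g.
Proof.
elim=> [|i c g' Lc _ IH]; first exact: L2_0.
by apply: L2D IH; exact: (mon_L2 Lc).1.
Qed.

End monomials.

Section zip_product.
Variables (R : realType) (T : ptopologicalType).
Local Notation X := (marked R T).

(** A product over pairs (point, exponent) does not depend on their order, so exchanging points
    amounts to exchanging exponents. *)
Lemma wprod_zip (i : seq nat) (s : seq X) : size s = size i ->
  wprod (fun j x => x ^+ nth 0%N i j) s = \prod_(z <- zip s i) z.1.2 ^+ z.2.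
Proof.
elim: s i => [|x s IH] [|a i]//= => [_|[]/IH E]; first by rewrite /wprod big_ord0 big_nil.
by rewrite wprod_cons big_cons /= E.
Qed.

Lemma zip_swapn (U V : Type) j (s : seq U) (i : seq V) : size s = size i ->
  zip (swapn j s) i = swapn j (zip s (swapn j i)).
Proof.
elim: j s i => [|j IH] [|x s] [|a i]//= [E]; last by rewrite IH.
by case: s i E => [|y s] [|b i].
Qed.

Lemma big_swapn (U : Type) (F : U -> R) j (s : seq U) :
  \prod_(x <- swapn j s) F x = \prod_(x <- s) F x.
Proof.
elim: j s => [|j IH] [|x s]//=; last by rewrite !big_cons IH.
by case: s => [|y s]//; rewrite !big_cons mulrCA.
Qed.

Lemma wprod_swapn j (i : seq nat) (s : seq X) : size s = size i ->
  wprod (fun k x => x ^+ nth 0%N i k) (swapn j s) = wprod (fun k x => x ^+ nth 0%N (swapn j i) k) s.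
Proof.
by move=> E; rewrite !wprod_zip ?size_swapn// zip_swapn// big_swapn.
Qed.

End zip_product.

(** * The domain as the span of symmetrized monomials *)

Section domain.
Variables (R : realType) (T : ptopologicalType).
Variable sigma : {sigma_finite_measure set (borel T) -> \bar R}.
Variable nu : probability (measurableTypeR R) R.
Variables (A : set (borel T * borel T)) (Q : borel T * borel T -> R[i]).
Hypothesis HQ : q_kernel sigma A Q.
Hypothesis Hnu : exists2 eps : R, 0 < eps &
  (\int[nu]_x (expR (eps * `|x : R|))%:E < +oo)%E.

Local Notation X := (marked R T).
Local Notation mu := (marked_measure sigma nu).
Local Notation vec := (fclass mu).
Local Notation coef := (seq (borel T) -> R[i]^o).
Local Notation P := (fsym A Q).
Local Notation Psi_mon := (Psi_adj (Qmark A Q)).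
Local Notation Psi_coef := (Psi_adj (Qtot A Q)).

Lemma Psi_adj_mon j i c : Psi_mon j (mon i c) = mon (swapn j i) (Psi_coef j c).
Proof.
apply/funext => s; rewrite Psi_adjE /mon !size_swapn; case: eqP => [E|_]; last exact: mulr0.
rewrite Psi_adjE wprod_swapn// map_swapn.
have -> : qfac (Qmark A Q) j s = qfac (Qtot A Q) j (map fst s).
  by rewrite /qfac -map_drop; case: (drop j s) => [|x [|y r]].
exact: mulrA.
Qed.

Lemma Psi_word_mon w i c :
  foldr Psi_mon (mon i c) w = mon (foldr (@swapn nat) i w) (foldr Psi_coef c w).
Proof. by elim: w => //= j w ->; exact: Psi_adj_mon. Qed.

Lemma size_swapn_word w (i : seq nat) : size (foldr (@swapn nat) i w) = size i.
Proof. by elim: w => //= j w; rewrite size_swapn. Qed.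

Definition mon_index i (pi : 'S_(size i)) : seq nat := foldr (@swapn nat) i (adj_word pi).

Definition mon_coef (i : seq nat) (c : coef) (pi : 'S_(size i)) : coef := foldr Psi_coef c (adj_word pi).

Lemma fsym_mon i c : P (mon i c) =
  (size i)`!%:R^-1 *: \sum_(pi : 'S_(size i)) mon (mon_index pi) (mon_coef c pi).
Proof.
apply/funext => s; rewrite fctE fct_sumE.
have [E|ne] := eqVneq (size s) (size i); last first.
  rewrite big1 => [|pi _]; last by rewrite mon_out// size_swapn_word.
  rewrite [RHS]mulr0 /fsym /Psym big1 ?mulr0// => pi _.
  by rewrite /Psi Psi_word_mon mon_out// size_swapn_word.
have [t ->] : exists t : (size i).-tuple X, s = t by exists (Tuple (introT eqP E)).
rewrite /fsym Psym_tupleE; congr (_ * _); apply: eq_bigr => pi _.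
by rewrite /Psi Psi_word_mon.
Qed.

Definition coef_of k (c : k.-tuple (borel T) -> R[i]) : coef := fun r =>
  if insub r is Some t then c t else 0.

Lemma L2c_coef_of k (c : k.-tuple (borel T) -> R[i]) :
  L2 (tuple_measure sigma k) c -> L2c sigma k (coef_of c).
Proof.
by rewrite /L2c (_ : component _ = c)//; apply/funext => t; rewrite /component /coef_of valK.
Qed.

Lemma L2c_mon_coef i c (pi : 'S_(size i)) : L2c sigma (size i) c ->
  L2c sigma (size i) (mon_coef c pi) /\
  sqnorm (tuple_measure sigma (size i)) (component (mon_coef c pi)) =
  sqnorm (tuple_measure sigma (size i)) (component c).
Proof.
move=> [mc nc].
(* [L2c] concerns a single degree, while the lemmas on words ask for measurability in all degrees:
   [c] is cut off outside degree [size i]. *)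
pose c0 : coef := coef_of (@component _ (borel T) R (size i) c).
have mc0 : cmeas c0.
  move=> k; have [->|ki] := eqVneq k (size i).
    rewrite (_ : component c0 = component c)//.
    by apply/funext => t; rewrite /c0 /component /coef_of valK.
  rewrite (_ : component c0 = fun=> 0); first exact: cmeasurable_cst.
  apply/funext => t; rewrite /c0 /component /coef_of insubF// size_tuple.
  exact/negbTE.
have E0 : @component _ (borel T) R (size i) c0 = component c.
  by apply/funext => t; rewrite /c0 /component /coef_of valK.
have mQ : cmeasurable (fun z : borel T * borel T => Qtot A Q z.1 z.2) := cmeasurable_Qtot HQ.
have EW w (t : (size i).-tuple (borel T)) : foldr Psi_coef c w t = foldr Psi_coef c0 w t.
  elim: w t => [|j w IH] t /=; first by rewrite -[RHS]/(component c0 t) E0.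
  by rewrite !Psi_adjE -[swapn j t]/(val (swapt j t)) IH.
have EP : @component _ (borel T) R (size i) (mon_coef c pi) =
    component (foldr Psi_coef c0 (adj_word pi)).
  by apply/funext => t; exact: EW.
have nE := nrm_word sigma (Q := Qtot A Q) mQ (cabs2_Qtot HQ) (size i) (adj_word pi) mc0.
by rewrite /L2c /L2 EP nE E0; split => //; split => //; exact: (cmeas_word mQ _ mc0).
Qed.

Lemma cut_fsym n F : (fun s => if (size s <= n)%N then P F s else 0) =
  P (fun s => if (size s <= n)%N then F s else 0 : R[i]^o).
Proof.
have := Psym_mul (phi := fun s => (size s <= n)%N%:R : R[i]) (Qmark_inv HQ) (Qmark_diag HQ) F.
have E (G : seq X -> R[i]^o) : (fun s => ((size s <= n)%N%:R : R[i]) * G s) =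
    (fun s => if (size s <= n)%N then G s else 0).
  by apply/funext => s; case: (size s <= n)%N; rewrite (mul0r, mul1r).
by rewrite !E /fsym => ->// k p t; rewrite !size_tuple.
Qed.

Lemma poly_in_x_mon N (c : forall k, k.-tuple 'I_N.+1 -> k.-tuple (borel T) -> R[i]) n :
  (fun s => if (size s <= n)%N then poly_in_x c s else 0) =
  \sum_(k < n.+1) \sum_(i : k.-tuple 'I_N.+1) mon (map val i) (coef_of (c k i)) :> (seq X -> R[i]^o).
Proof.
have wE k (i : k.-tuple 'I_N.+1) (t : k.-tuple X) :
    mon (map val i) (coef_of (c k i)) t = c k i (map_tuple fst t) *
    (\prod_(j < k) (tnth t j).2 ^+ tnth i j)%:C.
  rewrite /mon size_map !size_tuple eqxx /coef_of (_ : map fst t = val (map_tuple fst t))// valK.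
  congr (_ * _%:C); rewrite /wprod size_tuple; apply: eq_bigr => j _.
  rewrite (tnth_nth point) (tnth_nth (tnth i j)) (nth_map (tnth i j)) ?size_tuple//.
apply/funext => s; rewrite fct_sumE.
have [sn|sn] := leqP (size s) n; last first.
  rewrite big1// => k _; rewrite fct_sumE big1// => i _; rewrite mon_out//.
  by rewrite size_map size_tuple gtn_eqF// (leq_ltn_trans _ sn)// -ltnS ltn_ord.
have sn1 : (size s < n.+1)%N by [].
rewrite (bigD1 (Ordinal sn1))//= [X in _ + X]big1 ?addr0 => [|k ks]; last first.
  rewrite fct_sumE big1// => i _; rewrite mon_out// size_map size_tuple.
  by rewrite eq_sym; move: ks; rewrite -val_eqE.
rewrite fct_sumE /poly_in_x; apply: eq_bigr => i _.
by rewrite (wE _ i (in_tuple s)).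
Qed.

Lemma monsum_poly_in_x g : monsum sigma g -> exists n0 N0, forall n N, (n0 <= n)%N -> (N0 <= N)%N ->
  exists c : forall k, k.-tuple 'I_N.+1 -> k.-tuple (borel T) -> R[i],
    (forall k i, L2 (tuple_measure sigma k) (c k i)) /\
    g = (fun s => if (size s <= n)%N then poly_in_x c s else 0).
Proof.
elim=> [|i c g' Lc _ [n0 [N0 IH]]].
  exists 0%N, 0%N => n N _ _; exists (fun _ _ _ => 0); split=> [k i|]; first exact: L2_0.
  apply/funext => s; rewrite /poly_in_x big1 ?if_same// => i _; exact: mul0r.
exists (maxn n0 (size i)), (maxn N0 (\max_(a <- i) a)) => n N.
rewrite !geq_max => /andP[n0n inn] /andP[N0N iN].
have [c' [Lc' g'E]] := IH _ _ n0n N0N.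
have iN' a : a \in i -> (a <= N)%N by move=> ai; apply: leq_trans iN; rewrite (big_rem a)//= leq_max leqnn.
exists (fun k (t : k.-tuple 'I_N.+1) (r : k.-tuple (borel T)) => (if map val (val t) == i then c r else 0) + c' k t r); split=> [k t|].
  apply: L2D => //; case: eqP => [ti|_]; last exact: L2_0.
  have ki : k = size i by rewrite -ti size_map size_tuple.
  by move: t ti; rewrite ki.
apply/funext => s; rewrite fctE g'E; have [sn|sn] := leqP (size s) n; last first.
  by rewrite mon_out ?addr0// gtn_eqF// (leq_ltn_trans inn).
rewrite /poly_in_x [RHS](eq_bigr (fun t : (size s).-tuple 'I_N.+1 =>
  (if map val (val t) == i then c (map fst s) else 0) * (\prod_(j < size s) (tnth (in_tuple s) j).2 ^+ tnth t j)%:C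
  + c' (size s) t (map_tuple fst (in_tuple s)) * (\prod_(j < size s) (tnth (in_tuple s) j).2 ^+ tnth t j)%:C)); last first.
  by move=> t _; exact: mulrDl.
rewrite big_split /=; congr (_ + _); rewrite /mon.
case: eqP => [si|nsi]; last first.
  rewrite big1// => t _; case: eqP => [ti|_]; last exact: mul0r.
  by case: nsi; rewrite -ti size_map size_tuple.
(* The only tuple of exponents that contributes; [inord] is faithful because [N] bounds the entries
   of [i]. *)
pose t0 : (size s).-tuple 'I_N.+1 := [tuple inord (nth 0%N i j) | j < size s].
have t0i : map val t0 = i.
  apply: (@eq_from_nth _ 0%N); rewrite size_map size_tuple// => j js.
  rewrite (nth_map ord0) ?size_tuple// -[j]/(val (Ordinal js)) -tnth_nth tnth_mktuple /= inordK// ltnS iN'//.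
  by rewrite mem_nth// -si.
rewrite (bigD1 t0)//= t0i eqxx [X in _ + X]big1 ?addr0 => [|t tt0]; last first.
  case: eqP => [ti|_]; last exact: mul0r.
  case/eqP: tt0; apply/val_inj/(inj_map val_inj); by rewrite -[RHS]/(map val t0) t0i.
congr (_ * _%:C); rewrite /wprod; apply: eq_bigr => j _; rewrite (tnth_nth point); congr (_ ^+ _).
by rewrite -{1}t0i (nth_map ord0) ?size_tuple// -tnth_nth.
Qed.

Lemma domainP (F : vec) : domain Q F <-> exists g, monsum sigma g /\ F = cls mu (P g).
Proof.
split=> [[n [N [c [Lc ->]]]]|[g [mg ->]]].
  exists (fun s => if (size s <= n)%N then poly_in_x c s else 0); split; last first.
    rewrite -cut_fsym; apply/cls_eqP => k.
    have /cls_eqP := cls_symmetrizer (nu := nu) HQ (erefl (cls mu (poly_in_x c))).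
    by move=> /(_ k); apply: filterS => t; case: ifP.
  rewrite poly_in_x_mon; apply: monsum_sum => k _; apply: monsum_sum => i _.
  by apply: monsum_mon; rewrite size_map size_tuple; exact: L2c_coef_of.
have [n [N /(_ n N (leqnn _) (leqnn _))[c [Lc gE]]]] := monsum_poly_in_x mg.
exists n, N, c; split => //; rewrite gE -cut_fsym.
apply/cls_eqP => k.
have /cls_eqP := cls_symmetrizer (nu := nu) HQ (erefl (cls mu (poly_in_x c))).
by move=> /(_ k); apply: filterS => t; case: ifP.
Qed.

End domain.

(** * Boxes as a generating pi-system on powers *)

Section tuple_boxes.
Context d (Y : measurableType d) (R : realType).
Variable m : {sigma_finite_measure set Y -> \bar R}.
Variables (n : nat) (G : set (set Y)) (E : nat -> set Y).

Definition box (B : 'I_n -> set Y) : set (ntuple Y n) := [set t | forall j, B j (tnth t j)].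

Lemma measurable_box B : (forall j, measurable (B j)) -> measurable (box B).
Proof.
move=> mB; rewrite (_ : box B = \bigcap_(j in [set: 'I_n]) ((fun t : ntuple Y n => tnth t j) @^-1` B j)).
  apply: fin_bigcap_measurable => // j _; rewrite -[X in measurable X]setTI.
  exact: (measurable_tnth j).
by apply/seteqP; split => t /= h j; [move=> _|]; exact: h.
Qed.

Hypotheses (mG : @measurable _ Y = <<s G >>) (GI : setI_closed G) (GE : forall k, G (E k)).
Hypotheses (E_mono : forall k l, (k <= l)%N -> E k `<=` E l) (E_cover : \bigcup_k E k = setT).

(* Boxes with sides in G generate the sigma-algebra of Y^n.                    *)
Lemma ae_eq0_boxes (u : ntuple Y n -> R) :
  (forall B, (forall j, G (B j)) -> (tuple_measure m n).-integrable (box B) (EFin \o u)) ->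
  (forall B, (forall j, G (B j)) -> (\int[tuple_measure m n]_(x in box B) (u x)%:E = 0)%E) ->
  {ae tuple_measure m n, forall x, u x = 0}.
Proof.
move=> iu u0; pose GB : set (set (ntuple Y n)) := [set S | exists2 B, (forall j, G (B j)) & S = box B].
have Gm B : G B -> measurable B by rewrite mG; exact: sub_sigma_algebra.
have E_all (t : ntuple Y n) : exists N, forall j, E N (tnth t j).
  have /choice[f hf] j : exists k, E k (tnth t j).
    by have : [set: Y] (tnth t j) by []; rewrite -E_cover => -[k _ ?]; exists k.
  exists (\max_(j < n) f j)%N => j; apply: E_mono (hf j); exact: leq_bigmax.
apply: (@ae_eq0_pi_system _ _ _ _ GB (fun k => box (fun=> E k))).
- apply/seteqP; split=> [S mS|]; last first.
    apply: smallest_sub; first exact: sigma_algebra_measurable.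
    by move=> _ [B GB' ->]; apply: measurable_box => j; exact: Gm.
  pose f (t : g_sigma_algebraType GB) : ntuple Y n := t.
  have mf : measurable_fun setT f.
    apply/measurable_fun_tnthP => j; apply: (@measurability _ _ _ _ setT _ G) => //.
    move=> _ [C GC <-]; rewrite setTI.
    (* A cylinder is not itself a box with sides in [G]; it is the increasing union of those whose
       other sides are [E k]. *)
    rewrite (_ : _ @^-1` C = \bigcup_k box (fun i => if i == j then C else E k)).
      apply: bigcupT_measurable => k; apply: sub_sigma_algebra.
      by exists (fun i => if i == j then C else E k) => // i; case: eqP.
    apply/seteqP; split=> [t /= Ct|t [k _ /(_ j)]]; last by rewrite eqxx.
    by have [N hN] := E_all t; exists N => // i; case: eqP => [->|].
  by have := mf measurableT S mS; rewrite setTI.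
- move=> _ _ [B1 G1 ->] [B2 G2 ->]; exists (fun j => B1 j `&` B2 j) => [j|]; first exact: GI.
  apply/seteqP; split=> t; first by case=> h1 h2 j; split; [exact: h1|exact: h2].
  by move=> h; split => j; case: (h j).
- by move=> k; exists (fun=> E k).
- by apply/seteqP; split => // t _; have [N hN] := E_all t; exists N.
- by move=> _ [B GB' ->]; exact: iu.
- by move=> _ [B GB' ->]; exact: u0.
Qed.

End tuple_boxes.

(** * Elements of the domain, among them the vacuum *)

Section domain_elements.
Variables (R : realType) (T : ptopologicalType).
Variable sigma : {sigma_finite_measure set (borel T) -> \bar R}.
Variable nu : probability (measurableTypeR R) R.
Variables (A : set (borel T * borel T)) (Q : borel T * borel T -> R[i]).
Hypothesis HQ : q_kernel sigma A Q.
Hypothesis Hnu : exists2 eps : R, 0 < eps &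
  (\int[nu]_x (expR (eps * `|x : R|))%:E < +oo)%E.

Local Notation X := (marked R T).
Local Notation mu := (marked_measure sigma nu).
Local Notation vec := (fclass mu).
Local Notation coef := (seq (borel T) -> R[i]^o).
Local Notation P := (fsym A Q).

Definition dmonom i (c : coef) : vec := cls mu (P (mon i c)).

Lemma fsym_linear : linear (P : (seq X -> R[i]^o) -> _).
Proof. exact: Psym_linear. Qed.

Lemma fsymD f g : P (f + g) = P f + P g :> (seq X -> R[i]^o).
Proof. by have := fsym_linear 1 f g; rewrite !scale1r. Qed.

Lemma fsym0 : P 0 = 0 :> (seq X -> R[i]^o).
Proof. by have := fsym_linear (-1) 0 0; rewrite !scaleN1r !addNr. Qed.

Lemma dmon_linear i : linear (dmonom i).
Proof. by move=> a c c'; rewrite /dmonom mon_linear fsym_linear clsD clsZ. Qed.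

Lemma dmon0 i : dmonom i 0 = 0.
Proof. by rewrite /dmonom mon0 fsym0 cls0. Qed.

Lemma domain_ind (K : vec -> Prop) : K 0 ->
  (forall i c F, L2c sigma (size i) c -> domain Q F -> K F -> K (dmonom i c + F)) ->
  forall F, domain Q F -> K F.
Proof.
move=> K0 KS F /(domainP HQ)[g [mg ->]].
elim: mg => [|i c g' Lc mg' IH]; first by rewrite fsym0 cls0.
by rewrite fsymD clsD; apply: KS => //; apply/(domainP HQ); exists g'.
Qed.

Lemma domain0 : domain Q (0 : vec).
Proof. by apply/(domainP HQ); exists 0; split; [exact: monsum0|rewrite fsym0 cls0]. Qed.

Lemma domain_dmon i c : L2c sigma (size i) c -> domain Q (dmonom i c).
Proof. by move=> Lc; apply/(domainP HQ); exists (mon i c); split => //; exact: monsum_mon. Qed.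

Lemma domainZD a (F H : vec) : domain Q F -> domain Q H -> domain Q (a *: F + H).
Proof.
move=> /(domainP HQ)[f [mf ->]] /(domainP HQ)[h [mh ->]]; apply/(domainP HQ).
exists (a *: f + h); split; first by apply: monsumD => //; exact: monsumZ.
by rewrite fsym_linear clsD clsZ.
Qed.

Lemma domainD (F H : vec) : domain Q F -> domain Q H -> domain Q (F + H).
Proof. by move=> dF dH; have := domainZD 1 dF dH; rewrite scale1r. Qed.

Lemma domain_sym_rep (F : vec) : domain Q F -> exists f, [/\ sym_rep sigma nu A Q f, F = cls mu f &
  exists n, forall s, (n < size s)%N -> f s = 0].
Proof.
move=> /(domainP HQ)[g [mg ->]]; exists (P g); split => //.
  by apply: sym_rep_fsym => //; exact: monsum_fockL2.
have [n hn] : exists n, forall s, (n < size s)%N -> g s = 0.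
  elim: mg => [|i c g' _ _ [n hn]]; first by exists 0%N.
  exists (maxn n (size i)) => s; rewrite gtn_max => /andP[ns si].
  by rewrite fctE hn// mon_out ?addr0// gtn_eqF.
exists n => s ns; have -> : g = (fun s => if (size s <= n)%N then g s else 0).
  by apply/funext => r; case: leqP => // /hn.
by rewrite -(cut_fsym HQ) leqNgt ns.
Qed.

Lemma domain_fock (F : vec) : domain Q F -> fock Q F.
Proof. by move=> /domain_sym_rep[f [sf -> _]]; exact: (fock_cls HQ). Qed.

Lemma truncate_cls n f : truncate n (cls mu f) = cls mu (fun s => if (size s <= n)%N then f s else 0).
Proof.
by apply/cls_eqP => k; apply: filterS (rep_cls_ae mu f k) => t ->.
Qed.

Lemma domain_fin (F : vec) : domain Q F -> fock_fin Q F.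
Proof.
move=> dF; split; first exact: domain_fock.
have [f [_ -> [n fn]]] := domain_sym_rep dF; exists n; rewrite truncate_cls; congr cls.
by apply/funext => s; case: leqP => // /fn.
Qed.

Lemma fsqnorm_dmon_le i c : L2c sigma (size i) c ->
  (fsqnorm (dmonom i c) <= (monK nu i)%:E * sqnorm (tuple_measure sigma (size i)) (component c))%E.
Proof.
move=> Lc; have [Lm <-] := mon_L2 Hnu Lc; have [LP le] := fockL2_fsym HQ Lm.
by rewrite /dmonom (fsqnorm_cls mu (fockL2_cmeas LP)).
Qed.

Lemma L2c_vacuum : L2c sigma 0 (fun=> 1).
Proof.
split; first exact: cmeasurable_cst.
by rewrite /sqnorm tuple_measure0_integral//= ltry.
Qed.

Lemma vacuum_dmon : vacuum mu = dmonom [::] (fun=> 1).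
Proof.
rewrite /vacuum /dmonom fsym_mon; congr cls; apply/funext => s; rewrite fctE fct_sumE.
have card1 : \sum_(pi : 'S_0) (1 : R[i]) = 1 by rewrite sumr_const card_Sn.
have wE w (c : coef) : foldr (Psi_adj (Qtot A Q)) c w [::] = c [::] by elim: w => //= j w.
have iE w : foldr (@swapn nat) [::] w = [::] by elim: w => //= j w ->; case: j.
case: s => [|x s]; last first.
  by rewrite big1 ?[RHS]mulr0// => pi _; rewrite mon_out// /mon_index iE.
rewrite (eq_bigr (fun=> 1)) => [|pi _].
  by rewrite card1 fact0 invr1 [RHS]mul1r.
by rewrite /mon /mon_index iE/= /mon_coef wE /wprod big_ord0; exact: mul1r.
Qed.

Lemma domain_vacuum : domain Q (vacuum mu).
Proof. by rewrite vacuum_dmon; apply: domain_dmon; exact: L2c_vacuum. Qed.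

End domain_elements.

Lemma complex_eq (R : realType) (z w : R[i]) : complex.Re z = complex.Re w ->
  complex.Im z = complex.Im w -> z = w.
Proof. by case: z w => a b [c d] /= -> ->. Qed.

Lemma ReM_real (R : realType) (a : R) (z : R[i]) : complex.Re (a%:C * z) = a * complex.Re z.
Proof. by case: z => x y /=; rewrite mul0r subr0. Qed.

Lemma ImM_real (R : realType) (a : R) (z : R[i]) : complex.Im (a%:C * z) = a * complex.Im z.
Proof. by case: z => x y /=; rewrite mul0r addr0. Qed.

Lemma cintegral_eq0 d (Y : measurableType d) (R : realType) (m : {measure set Y -> \bar R})
    (f : Y -> R[i]) : cintegrable m f -> cintegral m f = 0 <->
  ((\int[m]_x (complex.Re (f x))%:E = 0)%E /\ (\int[m]_x (complex.Im (f x))%:E = 0)%E).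
Proof.
move=> [ir ii]; split=> [[hr hi]|[hr hi]]; last first.
  by rewrite /cintegral /Rintegral hr hi.
split; [rewrite -[LHS]fineK; last exact: (integrable_fin_num _ ir)
       |rewrite -[LHS]fineK; last exact: (integrable_fin_num _ ii)] => //.
  by congr EFin; exact: hr.
by congr EFin; exact: hi.
Qed.

Lemma fip_cls_single d (X : measurableType d) (R : realType)
    (m : {sigma_finite_measure set X -> \bar R}) k (f g : seq X -> R[i]^o) :
  cmeas f -> cmeas g -> (forall s, size s != k -> f s = 0) ->
  fip (cls m f) (cls m g) =
  k`!%:R * cip (tuple_measure m k) (@component _ X R k f) (@component _ X R k g).
Proof.
move=> mf mg f0; rewrite fip_cls//; apply: clim_cabs2.
apply: cvg_near_cst; exists k.+1 => // N /= kN.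
rewrite (bigD1 (Ordinal kN))//= big1 ?addr0 ?subrr ?cabs2_real ?expr0n// => n nk.
rewrite /cip (_ : (fun _ => _) = fun=> 0); last first.
  by apply/funext => t; rewrite /component f0 ?mul0r// size_tuple; move: nk; rewrite -val_eqE.
by rewrite /cintegral /Rintegral !integral0_eq ?mulr0.
Qed.

(** * Totality: from monomials to indicators of marked boxes *)

Section totality.
Variables (R : realType) (T : ptopologicalType).
Variable sigma : {sigma_finite_measure set (borel T) -> \bar R}.
Variable nu : probability (measurableTypeR R) R.

Local Notation X := (marked R T).
Local Notation mu := (marked_measure sigma nu).
Local Notation coef := (seq (borel T) -> R[i]^o).

Definition weight_upd (w : nat -> R -> R) (m : nat) (v : R -> R) : nat -> R -> R :=
  fun j => if j == m then v else w j.

Definition admissible (w : nat -> R -> R) : Prop := forall j,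
  measurable_fun setT (w j : measurableTypeR R -> measurableTypeR R) /\
  (\int[nu]_x (w j x ^+ 2)%:E < +oo)%E.

Lemma admissible_upd w m v : admissible w ->
  measurable_fun setT (v : measurableTypeR R -> measurableTypeR R) ->
  (\int[nu]_x (v x ^+ 2)%:E < +oo)%E -> admissible (weight_upd w m v).
Proof. by move=> aw mv iv j; rewrite /weight_upd; case: eqP. Qed.

Lemma wprod_upd w m v (s : seq X) : (m < size s)%N ->
  wprod (weight_upd w m v) s = v (nth point s m).2 * wprod (weight_upd w m (fun=> 1)) s.
Proof.
move=> ms; pose j0 := Ordinal ms; rewrite /wprod (bigD1 j0) //= [in RHS](bigD1 j0) //=.
rewrite /weight_upd eqxx mul1r; congr (_ * _).
by apply: eq_bigr => j; rewrite -val_eqE /= => /negPf ->.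
Qed.

Lemma L2_weighted n w c : admissible w -> L2 (tuple_measure sigma n) c ->
  L2 (tuple_measure mu n) (fun t => c (map_tuple fst t) * (wprod w t)%:C).
Proof.
move=> aw [mc nc]; have [mm E] := sqnorm_weighted sigma nu (fun j => (aw j).1) mc.
split => //; rewrite E.
have P0 j : (0 <= \int[nu]_x (w j x ^+ 2)%:E)%E.
  by apply: integral_ge0 => x _; rewrite lee_fin sqr_ge0.
have Pfin : (\prod_(j < n) \int[nu]_x (w j x ^+ 2)%:E)%E \is a fin_num.
  by apply: prode_fin_num => j _; rewrite ge0_fin_numE//; exact: (aw j).2.
by rewrite -(fineK Pfin) lte_mul_pinfty ?lee_fin ?fine_ge0//; apply: prode_ge0 => j _.
Qed.

Hypothesis Hnu : exists2 eps : R, 0 < eps &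
  (\int[nu]_x (expR (eps * `|x : R|))%:E < +oo)%E.

Lemma weight_upd_ray w m (a : R) : admissible w -> admissible (weight_upd w m (fun x => (a < x)%R%:R)).
Proof.
move=> aw.
have mray : measurable_fun setT (fun x : measurableTypeR R => (a < x)%R%:R : measurableTypeR R).
rewrite (_ : (fun _ => _) = \1_(`]a, +oo[%classic)); first exact: measurable_indic.
by apply/funext => x; rewrite indicE; congr (nat_of_bool _)%:R; apply/idP/idP; rewrite inE/= in_itv/= andbT.
apply: admissible_upd => //; apply: (@le_lt_trans _ _ (\int[nu]_x (1%:E : \bar R))%E).
  apply: ge0_le_integral => //.
  - by apply/measurable_EFinP; exact: (measurable_funX 2 mray).
  - by move=> x _; rewrite lee_fin; case: (a < x); rewrite ?expr1n// expr0n.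
by rewrite integral_cst// mul1e (le_lt_trans (probability_le1 _ _))// ltry.
Qed.

Lemma admissible_ray (a : R) m : admissible (weight_upd (fun _ _ => 1) m (fun x => (a < x)%R%:R)).
Proof.
apply: weight_upd_ray => j; split; first exact: measurable_cst.
have := moment_fin Hnu 0; congr (_ < _)%E.
Qed.

Section fixed_degree.
Variables (k : nat) (d : ntuple X k -> R[i]) (Ld : L2 (tuple_measure mu k) d).

Definition annihilates (w : nat -> R -> R) (c : ntuple (borel T) k -> R[i]) : Prop :=
  cintegral (tuple_measure mu k) (fun t => c (map_tuple fst t) * (wprod w t)%:C * (d t)^*%C) = 0.

Lemma annihilates_integrable w c : admissible w -> L2 (tuple_measure sigma k) c ->
  cintegrable (tuple_measure mu k) (fun t => c (map_tuple fst t) * (wprod w t)%:C * (d t)^*%C).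
Proof. by move=> aw Lc; exact: (L2_mul_integrable (L2_weighted aw Lc) Ld). Qed.

(** [moments0_ray] applied on X^k to the mark at place [m], with the real or imaginary part of all
    remaining factors as the function [g]. An exponential weight at place [m] is still
    square-integrable, which gives the integrability required there. *)
Lemma annihilates_ray w m c : admissible w -> (m < k)%N -> L2 (tuple_measure sigma k) c ->
  (forall p, annihilates (weight_upd w m (fun x => x ^+ p)) c) ->
  forall a, annihilates (weight_upd w m (fun x => (a < x)%R%:R)) c.
Proof.
move=> aw mk Lc h a.
have [delta delta0 hdelta] := exp_weight Hnu.
pose w1 := weight_upd w m (fun=> 1).
pose F t := c (map_tuple fst t) * (wprod w1 t)%:C * (d t)^*%C.
pose y (t : ntuple X k) := (nth point t m).2.
have FE v : (fun t : ntuple X k => c (map_tuple fst t) * (wprod (weight_upd w m v) t)%:C * (d t)^*%C) =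
    (fun t => (v (y t))%:C * F t).
  apply/funext => t; rewrite wprod_upd ?size_tuple// -/w1 -/(y t).
  have -> : (v (y t) * wprod w1 t)%:C = (v (y t))%:C * (wprod w1 t)%:C :> R[i] by exact: rmorphM.
  rewrite /F; move: (c _) ((v _)%:C) ((wprod _ _)%:C) ((d t)^*%C) => p q r s.
  by rewrite mulrCA !mulrA.
have my : measurable_fun setT y.
  rewrite (_ : y = fun t => (tnth t (Ordinal mk)).2).
    exact: (measurableT_comp measurable_snd (measurable_tnth _)).
  by apply/funext => t; rewrite /y (tnth_nth point).
have mE : measurable_fun setT (fun x : measurableTypeR R => expR (delta * `|x|)).
  by apply: (measurableT_comp (@measurable_expR R)); exact: measurable_funM.
have aE : admissible (weight_upd w m (fun x => expR (delta * `|x|))).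
  apply: admissible_upd => //.
  have := hdelta 0%N; congr (_ < _)%E; apply: eq_integral => x _.
  by rewrite expr0 mul1r.
have aP p : admissible (weight_upd w m (fun x => x ^+ p)).
  by apply: admissible_upd => //; exact: moment_fin.
have aR : admissible (weight_upd w m (fun x => (a < x)%R%:R)) by exact: weight_upd_ray.
have mF : cmeasurable F.
  have a1 : admissible w1.
    by have := aP 0%N; congr admissible; apply/funext => j; rewrite /w1 /weight_upd; case: eqP => // _;
      apply/funext => x; rewrite expr0.
  exact: cintegrable_cmeasurable (annihilates_integrable a1 Lc).
have := annihilates_integrable aE Lc; rewrite FE => -[iEr iEi].
(* Real and imaginary parts are treated at once: only their homogeneity under real scalars is
   used. *)
have key (part : R[i] -> R) : (forall r z, part (r%:C * z) = r * part z) ->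
    measurable_fun setT (fun t => part (F t)) ->
    (tuple_measure mu k).-integrable setT (EFin \o (fun t => part ((expR (delta * `|y t|))%:C * F t))) ->
    (forall p, \int[tuple_measure mu k]_t (part ((y t ^+ p)%:C * F t))%:E = 0)%E ->
    (\int[tuple_measure mu k]_t (part ((a < y t)%R%:R%:C * F t))%:E = 0)%E.
  move=> pM mpF iE mom.
  have -> : (fun t => (part ((a < y t)%R%:R%:C * F t))%:E) = (fun t => (part (F t) * (a < y t)%R%:R)%:E).
    by apply/funext => t; rewrite pM mulrC.
  apply: (moments0_ray (delta := delta)) => //.
    apply: eq_integrable (integrable_norm iE) => // t _ /=.
    by rewrite pM normrM ger0_norm ?expR_ge0// mulrC.
  by move=> p; rewrite -(mom p); apply: eq_integral => t _; rewrite pM mulrC.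
rewrite /annihilates FE; apply/cintegral_eq0.
  by rewrite -(FE (fun x => (a < x)%R%:R)); exact: annihilates_integrable.
have mom p : (\int[tuple_measure mu k]_t (complex.Re ((y t ^+ p)%:C * F t))%:E = 0)%E /\
    (\int[tuple_measure mu k]_t (complex.Im ((y t ^+ p)%:C * F t))%:E = 0)%E.
  have := h p; rewrite /annihilates FE => /cintegral_eq0; apply.
  by rewrite -(FE (fun x => x ^+ p)); exact: annihilates_integrable.
split; apply: key.
- exact: ReM_real.
- exact: mF.1.
- exact: iEr.
- by move=> p; exact: (mom p).1.
- exact: ImM_real.
- exact: mF.2.
- exact: iEi.
- by move=> p; exact: (mom p).2.
Qed.


(* One coordinate after the other, monomials are replaced by indicators of rays. *)
Lemma annihilates_rays c (a : nat -> R) : L2 (tuple_measure sigma k) c ->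
  (forall i : nat -> nat, annihilates (fun j x => x ^+ i j) c) ->
  annihilates (fun j x => (a j < x)%R%:R) c.
Proof.
(* Hybrid weights: rays in the first [m] coordinates, powers in the others. The exponents stay
   general in the induction, since each passage to a ray consumes all powers in its coordinate. *)
move=> Lc h; pose w m (i : nat -> nat) j x : R := if (j < m)%N then (a j < x)%R%:R else x ^+ i j.
have aw m i : admissible (w m i).
  move=> j; rewrite /w; case: (j < m)%N.
    have aR := admissible_ray (a j) j; have [] := aR j; by rewrite /weight_upd eqxx.
  by split; [exact: measurable_funX|exact: moment_fin].
have claim m i : (m <= k)%N -> annihilates (w m i) c.
  elim: m i => [|m IH] i mk; first exact: h.
  have -> : w m.+1 i = weight_upd (w m i) m (fun x => (a m < x)%R%:R).
    apply/funext => j; apply/funext => x; rewrite /w /weight_upd ltnS.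
    by case: (ltngtP j m) => // ->.
  apply: annihilates_ray => // p.
  have -> : weight_upd (w m i) m (fun x => x ^+ p) = w m (fun j => if j == m then p else i j).
    apply/funext => j; apply/funext => x; rewrite /w /weight_upd.
    by case: (ltngtP j m) => // ->.
  by apply: IH; exact: ltnW.
have := claim k (fun=> 0%N) (leqnn k); rewrite /annihilates.
congr (cintegral _ _ = _); apply/funext => t; congr (_ * _%:C * _).
by rewrite /wprod; apply: eq_bigr => j _; rewrite /w -[X in (_ < X)%N](size_tuple t) ltn_ord.
Qed.

End fixed_degree.


Definition exhaustion (K : nat -> set (borel T)) : Prop :=
  [/\ forall n, measurable (K n), forall k l, (k <= l)%N -> K k `<=` K l,
      \bigcup_n K n = setT & forall n, (sigma (K n) < +oo)%E].

Lemma tuple_measure_box_fin n (B : set (borel T)) : measurable B -> (sigma B < +oo)%E ->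
  (tuple_measure sigma n (box (fun _ : 'I_n => B)) < +oo)%E.
Proof.
move=> mB fB; elim: n => [|n IH].
  by rewrite /= /dirac ltry.
rewrite -[ltLHS]/((sigma \x tuple_measure sigma n)%E (@tcons _ _ n @^-1` box (fun=> B))).
rewrite (_ : _ @^-1` _ = B `*` box (fun _ : 'I_n => B)).
  by rewrite product_measure1E//; [rewrite lte_mul_pinfty// ge0_fin_numE//|exact: measurable_box].
apply/seteqP; split=> -[x t] /=.
  move=> h; split => [|j]; first by have := h ord0; rewrite tnth0.
  by have := h (lift ord0 j); rewrite tnthS.
move=> [Bx h] j; have [->|[j' ->]] : j = ord0 \/ exists j', j = lift ord0 j'.
- by case: (unliftP ord0 j) => [j' ->|->]; [right; exists j'|left].
- by rewrite tnth0.
- by rewrite tnthS; exact: h.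
Qed.

Variable K : nat -> set (borel T).
Hypothesis HK : exhaustion K.

(** The sets [K n] will be relatively compact, so that indicators of bounded sets are admissible
    test functions. *)
Definition bounded_set (B : set (borel T)) : Prop := measurable B /\ exists n, B `<=` K n.

Lemma L2_box n (B : 'I_n -> set (borel T)) : (forall j, bounded_set (B j)) ->
  L2 (tuple_measure sigma n) (fun t => (\1_(box B) t)%:C).
Proof.
have [mK K_mono _ finK] := HK; move=> bB.
have mB : measurable (box B) by apply: measurable_box => j; exact: (bB j).1.
split; first by apply: cmeasurable_real; exact: measurable_indic.
have /choice[f hf] j : exists N, B j `<=` K N by exact: (bB j).2.
pose N := (\max_(j < n) f j)%N.
apply: le_lt_trans (tuple_measure_box_fin n (mK N) (finK N)).
rewrite /sqnorm (eq_integral (fun t => (\1_(box B) t)%:E)); last first.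
  by move=> t _; rewrite /= expr0n/= addr0 indicE; case: (_ \in _); rewrite ?expr1n ?expr0n.
rewrite integral_indic// setIT; apply: le_measure; rewrite ?inE//.
  by apply: measurable_box => j; exact: mK.
by move=> t h j; apply: (K_mono (f j)); [exact: leq_bigmax|apply: hf; exact: h].
Qed.

(** Rays open to the right suffice in the marks: they generate the Borel sets and are closed under
    intersection. *)
Definition marked_boxes : set (set X) :=
  [set S | exists B a, bounded_set B /\ S = B `*` [set x | a < x]].

Lemma mray (a : R) : measurable ([set x | a < x] : set (measurableTypeR R)).
Proof.
rewrite (_ : [set x | a < x] = `]a, +oo[%classic); first exact: measurable_itv.
by apply/seteqP; split=> x /=; rewrite in_itv/= andbT.
Qed.

Lemma K_bounded n : bounded_set (K n).
Proof. by have [mK _ _ _] := HK; split => //; exists n. Qed.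

Lemma g_sigma_marked_boxes : @measurable _ X = <<s marked_boxes >>.
Proof.
have [mK K_mono cK _] := HK.
apply/seteqP; split=> [S mS|]; last first.
  apply: smallest_sub; first exact: sigma_algebra_measurable.
  by move=> _ [B [a [[mB _] ->]]]; apply: measurableX => //; exact: mray.
(* The identity written by components: its measurability into the product is checked one component
   at a time. *)
pose f (t : g_sigma_algebraType marked_boxes) : X := ((t : X).1, (t : X).2).
have arch (x : R) : exists n, - n%:R < x.
  exists (Num.bound `|x|); rewrite ltrNl; apply: le_lt_trans (archi_boundP (normr_ge0 x)).
  by rewrite -normrN ler_norm.
have cov (t : T) N : exists2 n, (N <= n)%N & K n t.
  have : [set: borel T] t by []; rewrite -cK => -[n _ Kn].
  by exists (maxn N n); [exact: leq_maxl|apply: K_mono Kn; exact: leq_maxr].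
have mf : measurable_fun setT f.
  apply: measurable_fun_pair.
    move=> _ B mB; rewrite setTI.
    rewrite (_ : _ @^-1` B = \bigcup_n ((B `&` K n) `*` [set x | - n%:R < x])).
      apply: bigcupT_measurable => n; apply: sub_sigma_algebra; exists (B `&` K n), (- n%:R).
      by split => //; split; [exact: measurableI|exists n; exact: subIsetr].
    apply/seteqP; split=> [[t x] /= Bt|[t x] [n _ /= [[Bt _] _]]//].
    have [N hN] := arch x; have [n Nn Kn] := cov t N.
    by exists n => //; split => //=; apply: le_lt_trans hN; rewrite lerN2 ler_nat.
  apply: (@measurability _ _ _ _ setT _ [set S | exists a : R, S = `]a, +oo[%classic]).
    exact: RGenOInfty.measurableE.
  move=> _ [_ [a ->] <-]; rewrite setTI.
  rewrite (_ : _ @^-1` _ = \bigcup_n (K n `*` [set x | a < x])).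
    apply: bigcupT_measurable => n; apply: sub_sigma_algebra; exists (K n), a.
    by split => //; exact: K_bounded.
  apply/seteqP; split=> [[t x]|[t x] [n _ [_ /=]]]; rewrite /= in_itv/= andbT// => ax.
  by have [n _ Kn] := cov t 0%N; exists n.
have := mf measurableT S mS; rewrite setTI (_ : f @^-1` S = S)//.
by apply/seteqP; split => -[t x].
Qed.

Lemma ae_eq0_marked n (d : ntuple X n -> R[i]) : L2 (tuple_measure mu n) d ->
  (forall (i : nat -> nat) c, L2 (tuple_measure sigma n) c -> annihilates d (fun j x => x ^+ i j) c) ->
  {ae tuple_measure mu n, forall t, d t = 0}.
Proof.
have [mK K_mono cK _] := HK; move=> Ld h.
have H (B : 'I_n -> set X) : (forall j, marked_boxes (B j)) ->
    cintegrable (tuple_measure mu n) (fun t => (\1_(box B) t)%:C * (d t)^*%C) /\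
    cintegral (tuple_measure mu n) (fun t => (\1_(box B) t)%:C * (d t)^*%C) = 0.
  move=> hB; have /choice[C /choice[a hC]] j : exists C a, bounded_set C /\ B j = C `*` [set x | a < x].
    exact: hB.
  pose a' j := if insub j is Some j' then a j' else 0.
  have Lb : L2 (tuple_measure sigma n) (fun t => (\1_(box C) t)%:C) by apply: L2_box => j; exact: (hC j).1.
  have E : (fun t : ntuple X n => (\1_(box B) t)%:C * (d t)^*%C) =
      (fun t => (\1_(box C) (map_tuple fst t))%:C * (wprod (fun j x => (a' j < x)%R%:R) t)%:C * (d t)^*%C).
    apply/funext => t; congr (_ * _); rewrite -rmorphM; congr _%:C.
    have -> : wprod (fun j x => (a' j < x)%R%:R) t = \prod_(j < n) (a j < (tnth t j).2)%R%:R.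
      rewrite /wprod size_tuple; apply: eq_bigr => j _.
      by rewrite /a' valK (tnth_nth point).
    rewrite !indicE; have [/set_mem tB|/negP tB] := boolP (t \in box B).
      rewrite mem_set ?mul1r; last first.
        by move=> j; have := tB j; rewrite (hC j).2 tnth_map => -[].
      by rewrite big1// => j _; have := tB j; rewrite (hC j).2 => -[_ /= ->].
    have [/set_mem tC|//] := boolP (map_tuple fst t \in box C); last by rewrite mul0r.
    rewrite mul1r; have [j nj] : exists j, ~ (a j < (tnth t j).2).
      apply: contra_notP tB => /forallNP nj; rewrite inE => j; rewrite (hC j).2.
      by split; [have := tC j; rewrite tnth_map|apply: contrapT; exact: nj].
    by rewrite (bigD1 j)//= (negPf (introN idP nj)) mul0r.
  rewrite E; split.
    apply: (annihilates_integrable Ld _ Lb) => j.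
    by have := admissible_ray (a' j) j j; rewrite /weight_upd eqxx.
  exact: (@annihilates_rays n d Ld _ a' Lb (fun i => h i _ Lb)).
have Re0 (part : R[i] -> R) : (forall r z, part (r%:C * z) = r * part z) ->
    (forall B : 'I_n -> set X, (forall j, marked_boxes (B j)) ->
      (tuple_measure mu n).-integrable setT (EFin \o (fun t => part ((\1_(box B) t)%:C * (d t)^*%C))) /\
      (\int[tuple_measure mu n]_t (part ((\1_(box B) t)%:C * (d t)^*%C))%:E = 0)%E) ->
    {ae tuple_measure mu n, forall t, part (d t)^*%C = 0}.
  move=> pM hp.
  have mB (B : 'I_n -> set X) : (forall j, marked_boxes (B j)) -> measurable (box B).
    move=> hB; apply: measurable_box => j; rewrite g_sigma_marked_boxes.
    by apply: sub_sigma_algebra; exact: hB.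
  have E (B : 'I_n -> set X) : (EFin \o (fun t => part (d t)^*%C)) \_ (box B) =
      (fun t => (part ((\1_(box B) t)%:C * (d t)^*%C))%:E).
    apply/funext => t; rewrite patchE indicE pM.
    by case: (_ \in _); rewrite (mul1r, mul0r).
  apply: (ae_eq0_boxes (G := marked_boxes) (E := fun k => K k `*` [set x | - k%:R < x])).
  - exact: g_sigma_marked_boxes.
  - move=> _ _ [B1 [a1 [[m1 [n1 K1]] ->]]] [B2 [a2 [[m2 _] ->]]].
    exists (B1 `&` B2), (Num.max a1 a2); split.
      by split; [exact: measurableI|exists n1 => t [/K1]].
    apply/seteqP; split=> -[t x] /=; rewrite gt_max.
      by move=> [[? h1] [? h2]]; split => //; rewrite h1 h2.
    by move=> [[? ?] /andP[]].
  - by move=> k; exists (K k), (- k%:R); split => //; exact: K_bounded.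
  - move=> k l kl [t x] /= [Kt kx]; split; first exact: K_mono Kt.
    by apply: le_lt_trans kx; rewrite lerN2 ler_nat.
  - apply/seteqP; split => // -[t x] _.
    have : [set: borel T] t by []; rewrite -cK => -[N _ KN].
    exists (maxn N (Num.bound `|x|)) => //; split => /=.
      by apply: K_mono KN; exact: leq_maxl.
    rewrite ltrNl; apply: (@lt_le_trans _ _ (Num.bound `|x|)%:R).
      by apply: le_lt_trans (archi_boundP (normr_ge0 x)); rewrite -normrN ler_norm.
    by rewrite ler_nat leq_maxr.
  - move=> B hB; apply/(integrable_mkcond _ (mB _ hB)); rewrite E; exact: (hp B hB).1.
  - by move=> B hB; rewrite integral_mkcond E; exact: (hp B hB).2.
have hr := Re0 (@complex.Re R) (@ReM_real R).
have hi := Re0 (@complex.Im R) (@ImM_real R).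
apply: filterS2 (hr _) (hi _) => [t rt it|B hB|B hB].
- by apply: complex_eq; [move: rt; case: (d t)|move: it; case: (d t) => x y /= /eqP; rewrite oppr_eq0 => /eqP].
- by have [[? ?]] := H B hB; move=> /cintegral_eq0[].
- by have [[? ?]] := H B hB; move=> /cintegral_eq0[].
Qed.

End totality.

(** * Totality of the domain in the Fock space *)

Section totality_of_the_domain.
Variables (R : realType) (T : ptopologicalType).
Variable sigma : {sigma_finite_measure set (borel T) -> \bar R}.
Variable nu : probability (measurableTypeR R) R.
Variables (A : set (borel T * borel T)) (Q : borel T * borel T -> R[i]).
Hypothesis HQ : q_kernel sigma A Q.
Hypothesis Hnu : exists2 eps : R, 0 < eps &
  (\int[nu]_x (expR (eps * `|x : R|))%:E < +oo)%E.

Local Notation X := (marked R T).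
Local Notation mu := (marked_measure sigma nu).
Local Notation vec := (fclass mu).
Local Notation coef := (seq (borel T) -> R[i]^o).
Local Notation P := (fsym A Q).

Lemma ip_fsym n f g : cmeas f -> cmeas g ->
  L2 (tuple_measure mu n) (@component _ X R n f) -> L2 (tuple_measure mu n) (@component _ X R n g) ->
  cip (tuple_measure mu n) (@component _ X R n (P f)) (@component _ X R n g) =
  cip (tuple_measure mu n) (@component _ X R n f) (@component _ X R n (P g)).
Proof.
move=> mf mg Lf Lg.
exact: (ip_Psym (m := mu) (cmeasurable_Qmark HQ) (Qmark_herm HQ) (Qmark_abs HQ) (Qmark_diag HQ)).
Qed.

Lemma fsym_out i c s : size s != size i -> P (mon i c) s = 0.
Proof.
move=> si; rewrite fsym_mon fctE fct_sumE big1 ?[LHS]mulr0// => pi _.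
by rewrite mon_out// size_swapn_word.
Qed.

Lemma fip_dmon i c g : L2c sigma (size i) c -> cmeas g ->
  L2 (tuple_measure mu (size i)) (@component _ X R (size i) g) ->
  fip (dmonom sigma nu A Q i c) (cls mu g) = (size i)`!%:R *
    cip (tuple_measure mu (size i)) (@component _ X R (size i) (mon i c))
      (@component _ X R (size i) (P g)).
Proof.
move=> Lc mg Lg; have [Lm _] := mon_L2 Hnu Lc; have mm := fockL2_cmeas Lm.
have mP := cmeas_Psym (cmeasurable_Qmark HQ) mm.
apply: etrans (@fip_cls_single _ _ _ mu (size i) _ _ mP mg (@fsym_out i c)) _.
by congr (_ * _); apply: ip_fsym => //; exact: fockL2_component.
Qed.

Variable K : nat -> set (borel T).
Hypothesis HK : exhaustion sigma K.

(** As [D] has a representative fixed by the self-adjoint symmetrizer, orthogonality to symmetrized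
    monomials is orthogonality to all monomials, symmetric or not. *)
Lemma domain_total (D : vec) : fock Q D -> (forall H : vec, domain Q H -> fip H D = 0) -> D = 0.
Proof.
move=> /(fockP HQ)[d [[Ld Pd] ->]] h; rewrite -cls0; apply/cls_eqP => n.
have Ldn := fockL2_component n Ld.
have := ae_eq0_marked Hnu HK (d := @component _ X R n d) Ldn.
apply => i c Lc; pose ii := mkseq i n; have sii : size ii = n by rewrite size_mkseq.
have Lco : L2c sigma (size ii) (coef_of c) by rewrite sii; exact: L2c_coef_of.
have := h _ (domain_dmon nu HQ Lco).
rewrite (fip_dmon Lco (fockL2_cmeas Ld) (fockL2_component _ Ld)).
rewrite Pd => /eqP; rewrite mulf_eq0 pnatr_eq0 -leqn0 leqNgt fact_gt0/= => /eqP.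
rewrite /annihilates /cip sii; congr (_ = _); congr cintegral; apply/funext => t; congr (_ * _).
rewrite /component /mon size_tuple sii eqxx; congr (_ * _%:C).
  by rewrite /coef_of (_ : map fst t = val (map_tuple fst t))// valK.
rewrite /wprod size_tuple; apply: eq_bigr => j _.
by rewrite nth_mkseq.
Qed.

End totality_of_the_domain.

(** * Bounded maps between spaces of coefficients *)

Section coefficient_maps.
Context d (Y : measurableType d) (R : realType).
Variable m : {sigma_finite_measure set Y -> \bar R}.
Local Notation coef := (seq Y -> R[i]^o).
Local Notation L2n n c := (L2 (tuple_measure m n) (@component _ Y R n c)).
Local Notation sqn n c := (sqnorm (tuple_measure m n) (@component _ Y R n c)).

(** The consequences of membership in B_0 on which the estimates rest; in this form they also make
    sense on the marked space. *)
Definition test (f : Y -> R) : Prop :=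
  [/\ measurable_fun setT f, exists M, forall t, `|f t| <= M & (\int[m]_t (f t ^+ 2)%:E < +oo)%E].

Definition coef_bounded (i j : nat) (B : coef -> coef) : Prop :=
  exists2 C : R, 0 <= C & forall c, L2n i c -> L2n j (B c) /\ (sqn j (B c) <= C%:E * sqn i c)%E.

Lemma coef_bounded_comp i j k B B' : coef_bounded i j B -> coef_bounded j k B' ->
  coef_bounded i k (B' \o B).
Proof.
move=> [C C0 hB] [C' C'0 hB']; exists (C' * C); first exact: mulr_ge0.
move=> c /hB[Lc nc]; have [Lc' nc'] := hB' _ Lc; split => //.
by apply: le_trans nc' _; rewrite EFinM -muleA; exact: lee_wpmul2l.
Qed.

Lemma coef_bounded_scale i j a B : coef_bounded i j B -> coef_bounded i j (fun c => a *: B c).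
Proof.
move=> [C C0 hB]; exists (cabs2 a * C); first by rewrite mulr_ge0 ?cabs2_ge0.
move=> c /hB[Lc nc]; split; first exact: (L2Z a Lc).
rewrite (_ : component _ = fun t => a * component (B c) t)// sqnormZ; last exact: Lc.1.
by rewrite EFinM -muleA lee_wpmul2l// lee_fin cabs2_ge0.
Qed.

Definition fcons (f : Y -> R) (c : coef) : coef := fun r =>
  if r is t :: r' then (f t)%:C * c r' else 0.

Definition fmul (l : nat) (f : Y -> R) (c : coef) : coef := fun r => (f (nth point r l))%:C * c r.

Definition contr (f : Y -> R) (c : coef) : coef := fun r =>
  cintegral m (fun t => (f t)%:C * c (t :: r)).

Lemma coef_bounded_fcons n f : test f -> coef_bounded n n.+1 (fcons f).
Proof.
move=> [mf _ nf]; have I0 : (0 <= \int[m]_t (f t ^+ 2)%:E)%E.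
  by apply: integral_ge0 => t _; rewrite lee_fin sqr_ge0.
exists (fine (\int[m]_t (f t ^+ 2)%:E)); first exact: fine_ge0.
have If : (\int[m]_t (f t ^+ 2)%:E)%E = (fine (\int[m]_t (f t ^+ 2)%:E))%:E.
  by rewrite fineK// ge0_fin_numE.
move=> c [mc nc].
have E : @component _ Y R n.+1 (fcons f c) =
    fun t => (f (tnth t ord0))%:C * component c [tuple of behead t].
  by apply/funext => t; case: t => -[|x s] i.
have mm : cmeasurable (@component _ Y R n.+1 (fcons f c)).
  rewrite E; apply: cmeasurableM.
    by apply: cmeasurable_real; exact: (measurableT_comp mf (measurable_tnth _)).
  by apply: cmeasurable_comp mc; exact: measurable_behead.
have NE : sqn n.+1 (fcons f c) = (\int[m]_t (f t ^+ 2)%:E * sqn n c)%E.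
  rewrite /sqnorm (ge0_integral_tcons1 _ (measurable_cabs2E mm)); last by move=> t; rewrite lee_fin cabs2_ge0.
  have mf2 : measurable_fun setT (fun t => (f t ^+ 2)%:E).
    by apply/measurable_EFinP; exact: measurable_funX.
  have c0 : (0 <= sqn n c)%E by exact: sqnorm_ge0.
  rewrite -ge0_integralZr//; last by move=> t _; rewrite lee_fin sqr_ge0.
  have mc2 := measurable_cabs2E mc.
  apply: eq_integral => x _; rewrite -ge0_integralZl_EFin ?sqr_ge0//; last by move=> r _; rewrite lee_fin cabs2_ge0.
  by apply: eq_integral => r _; rewrite -EFinM; congr EFin; rewrite -!/(cabs2 _) -cabs2_real -cabs2M.
split; last by rewrite NE {1}If.
by split => //; rewrite NE If lte_mul_pinfty// lee_fin fine_ge0.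
Qed.

Lemma coef_bounded_fmul n l f : test f -> (l < n)%N -> coef_bounded n n (fmul l f).
Proof.
move=> [mf [M hM] _] ln; exists (M ^+ 2); first exact: sqr_ge0.
move=> c Lc.
have E : (fun t : ntuple Y n => (f (nth point t l))%:C) = fun t => (f (tnth t (Ordinal ln)))%:C.
  by apply/funext => t; rewrite (tnth_nth point).
apply: (L2_bounded_mul (h := fun t : ntuple Y n => (f (nth point t l))%:C)) Lc; first exact: sqr_ge0.
  by rewrite E; apply: cmeasurable_real; exact: (measurableT_comp mf (measurable_tnth _)).
by move=> t; rewrite cabs2_real -real_normK ?num_real// lerXn2r ?nnegrE// (le_trans _ (hM point)).
Qed.

Lemma L2_test f : test f -> L2 m (fun t => (f t)%:C).
Proof.
move=> [mf _ nf]; split; first exact: cmeasurable_real.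
by rewrite /sqnorm; under eq_integral do rewrite /= expr0n/= addr0.
Qed.

(** Cauchy-Schwarz. The added 1 keeps the constant positive, so the right-hand side is infinite, and
    the bound trivial, whenever [u] is not in L2; sections are in L2 only almost everywhere. *)
Lemma cabs2_cintegral_le f (u : Y -> R[i]) : test f -> cmeasurable u ->
  ((cabs2 (cintegral m (fun t => (f t)%:C * u t)))%:E <=
   (fine (\int[m]_t (f t ^+ 2)%:E) + 1)%:E * sqnorm m u)%E.
Proof.
move=> tf mu; have Lf := L2_test tf.
have I0 : (0 <= \int[m]_t (f t ^+ 2)%:E)%E by apply: integral_ge0 => t _; rewrite lee_fin sqr_ge0.
have C0 : 0 < fine (\int[m]_t (f t ^+ 2)%:E) + 1 by rewrite ltr_wpDl// fine_ge0.
have [uoo|] := ltP (sqnorm m u) +oo%E; last first.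
  by rewrite leye_eq => /eqP ->; rewrite gt0_muley ?leey// lte_fin.
have Lu : L2 m u by [].
have Lu' : L2 m (fun t => (u t)^*%C).
  by apply: L2_le (cmeasurable_conj mu) Lu _ => t; rewrite cabs2_conj.
have := cauchy_schwarz (L2ip_semi_inner m) (mkL2 Lf) (mkL2 Lu').
rewrite !nsq_L2 /L2ip /cip/=.
rewrite (_ : cintegral _ _ = cintegral m (fun t => (f t)%:C * u t)); last first.
  by congr cintegral; apply/funext => t; rewrite conjcK.
have -> : sqnorm m (fun t => (u t)^*%C) = sqnorm m u.
  by apply: eq_integral => t _; rewrite -!/(cabs2 _) cabs2_conj.
have -> : sqnorm m (fun t => (f t)%:C) = (\int[m]_t (f t ^+ 2)%:E)%E.
  by apply: eq_integral => t _; rewrite /= expr0n/= addr0.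
rewrite (sqnorm_fin Lu) -EFinM lee_fin => /le_trans; apply.
by apply: (ler_wpM2r (fine_ge0 (sqnorm_ge0 m u))); rewrite lerDl.
Qed.

Lemma measurable_partial_integral n (F : Y * ntuple Y n -> \bar R) : measurable_fun setT F ->
  measurable_fun setT (fun r => \int[m]_t F (t, r))%E.
Proof.
move=> mF; rewrite (_ : (fun _ => _) = fun r =>
  (\int[m]_t (F^\+) (t, r) - \int[m]_t (F^\-) (t, r))%E).
  apply: emeasurable_funB.
    exact: (measurable_fun_fubini_tonelli_G (m1 := m) _ (measurable_funepos mF) (fun z => funepos_ge0 F z)).
  exact: (measurable_fun_fubini_tonelli_G (m1 := m) _ (measurable_funeneg mF) (fun z => funeneg_ge0 F z)).
apply/funext => r; rewrite integralE.
by congr (_ - _)%E; apply: eq_integral => t _; rewrite ?funeposE ?funenegE.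
Qed.

Lemma cmeasurable_tcons_fst n (c : coef) (r : ntuple Y n) : cmeasurable (@component _ Y R n.+1 c) ->
  cmeasurable (fun t => c (t :: r)).
Proof.
move=> mc; have mr : measurable_fun setT (fun t : Y => tcons (t, r)).
  by apply: measurable_cons => //; exact: measurable_id.
exact: (cmeasurable_comp mr mc).
Qed.

Lemma cmeasurable_contr n f c : measurable_fun setT f -> cmeasurable (@component _ Y R n.+1 c) ->
  cmeasurable (@component _ Y R n (contr f c)).
Proof.
move=> mf mc.
have mF : cmeasurable (fun z : Y * ntuple Y n => (f z.1)%:C * c (z.1 :: z.2)).
  apply: cmeasurableM.
    by apply: cmeasurable_real; exact: (measurableT_comp mf measurable_fst).
  exact: (cmeasurable_comp (@measurable_tcons _ Y n) mc).
split; rewrite /component /contr /=.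
- apply: (measurableT_comp (fine_measurable measurableT)).
  exact: (measurable_partial_integral ((measurable_EFinP _ _).2 mF.1)).
- apply: (measurableT_comp (fine_measurable measurableT)).
  exact: (measurable_partial_integral ((measurable_EFinP _ _).2 mF.2)).
Qed.

Lemma coef_bounded_contr n f : test f -> coef_bounded n.+1 n (contr f).
Proof.
move=> tf; have [mf _ _] := tf.
have I0 : (0 <= \int[m]_t (f t ^+ 2)%:E)%E by apply: integral_ge0 => t _; rewrite lee_fin sqr_ge0.
set C := fine (\int[m]_t (f t ^+ 2)%:E) + 1.
have C0 : 0 <= C by rewrite addr_ge0// fine_ge0.
exists C => // c [mc nc]; have mcon := cmeasurable_contr mf mc.
have le : (sqn n (contr f c) <= C%:E * sqn n.+1 c)%E.
  rewrite [X in (_ <= _ * X)%E]/sqnorm (ge0_integral_tcons2 _ (measurable_cabs2E mc)); last first.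
    by move=> t; rewrite lee_fin cabs2_ge0.
  rewrite -ge0_integralZl_EFin//; last 2 first.
  - by move=> r _; apply: integral_ge0 => t _; rewrite lee_fin cabs2_ge0.
  - apply: (measurable_partial_integral (F := fun z => (cabs2 (component c (tcons z)))%:E)).
    exact: (measurable_tcons_comp (measurable_cabs2E mc)).
  apply: ge0_le_integral => //.
  - by move=> r _; rewrite lee_fin cabs2_ge0.
  - exact: measurable_cabs2E.
  - apply: emeasurable_funM => //.
    apply: (measurable_partial_integral (F := fun z => (cabs2 (component c (tcons z)))%:E)).
    exact: (measurable_tcons_comp (measurable_cabs2E mc)).
  move=> r _; apply: (cabs2_cintegral_le (u := fun t => c (t :: r))) => //.
  exact: cmeasurable_tcons_fst mc.
split => //; split => //; apply: le_lt_trans le _.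
by rewrite lte_mul_pinfty// lee_fin.
Qed.

End coefficient_maps.

(** * Fubini for complex functions on powers and on the marked space *)

Section complex_fubini.
Context d (Y : measurableType d) (R : realType).
Variable m : {sigma_finite_measure set Y -> \bar R}.

Lemma Rintegral_tcons n (F : ntuple Y n.+1 -> R) :
  (tuple_measure m n.+1).-integrable setT (EFin \o F) ->
  measurable_fun setT (fun r : ntuple Y n => (\int[m]_x F (tcons (x, r)))%R) /\
  (\int[tuple_measure m n.+1]_t F t = \int[tuple_measure m n]_r \int[m]_x F (tcons (x, r)))%R.
Proof.
move=> iF; have mF : measurable_fun setT (EFin \o F) by exact: measurable_int iF.
have iFt := integrable_tcons iF.
have mG : measurable_fun setT (fun r : ntuple Y n => (\int[m]_x (F (tcons (x, r)))%:E)%E).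
  apply: (@measurable_partial_integral _ _ _ m _ (fun z => (F (tcons z))%:E)).
  exact: measurable_tcons_comp mF.
have mGf := measurableT_comp (fine_measurable measurableT) mG.
split; first exact: mGf.
rewrite /Rintegral (integral_tcons iF) -(integral21_prod_meas1 iFt); congr fine.
apply: ae_eq_integral => //; first exact/measurable_EFinP.
have := ae_integrable2 iFt; apply: filterS => r ir _.
by rewrite /fubini_G fineK//; exact: (integrable_fin_num _ ir).
Qed.

Lemma cintegral_tcons n (F : ntuple Y n.+1 -> R[i]) : cintegrable (tuple_measure m n.+1) F ->
  cmeasurable (fun r : ntuple Y n => cintegral m (fun x => F (tcons (x, r)))) /\
  cintegral (tuple_measure m n.+1) F =
  cintegral (tuple_measure m n) (fun r => cintegral m (fun x => F (tcons (x, r)))).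
Proof.
move=> [ir ii]; have [mr er] := Rintegral_tcons ir; have [mi ei] := Rintegral_tcons ii.
by split; [split|rewrite /cintegral er ei].
Qed.

End complex_fubini.

Section marked_product.
Variables (R : realType) (T : ptopologicalType).
Variable sigma : {sigma_finite_measure set (borel T) -> \bar R}.
Variable nu : probability (measurableTypeR R) R.
Local Notation X := (marked R T).
Local Notation mu := (marked_measure sigma nu).

Lemma Rintegral_marked (g : borel T -> R) (w : measurableTypeR R -> R) :
  sigma.-integrable setT (EFin \o g) -> nu.-integrable setT (EFin \o w) ->
  mu.-integrable setT (EFin \o (fun z : X => w z.2 * g z.1)) /\
  (\int[mu]_z (w z.2 * g z.1) = (\int[nu]_x w x) * (\int[sigma]_t g t))%R.
Proof.
move=> ig iw; have mg := measurable_int _ ig; have mw := measurable_int _ iw.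
have [/integrableP[_ ng] /integrableP[_ nw]] := (ig, iw).
have mgw : measurable_fun setT (EFin \o (fun z : X => w z.2 * g z.1)).
  apply/measurable_EFinP/measurable_funM.
    exact: (measurableT_comp ((measurable_EFinP _ _).1 mw) measurable_snd).
  exact: (measurableT_comp ((measurable_EFinP _ _).1 mg) measurable_fst).
have i12 : mu.-integrable setT (EFin \o (fun z : X => w z.2 * g z.1)).
  apply/integrableP; split=> //.
  rewrite (_ : (\int[mu]_z _)%E = (\int[mu]_z ((fun t => `|(g t)%:E|) z.1 * (`|w z.2|)%:E))%E); last first.
    by apply: eq_integral => z _; rewrite /= -EFinM normrM mulrC.
  rewrite (ge0_integral_marked sigma nu (g := fun t => `|(g t)%:E|%E) (w := fun x => `|w x|)) //.
  - by apply: lte_mul_pinfty => //; [exact: integral_ge0|rewrite ge0_fin_numE//; exact: integral_ge0].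
  - exact: (measurableT_comp _ mg).
  - exact: (measurableT_comp (@normr_measurable R setT) ((measurable_EFinP _ _).1 mw)).
split => //; rewrite /Rintegral -fineM; last 2 first.
- exact: (integrable_fin_num _ iw).
- exact: (integrable_fin_num _ ig).
congr fine; rewrite -[LHS]/(\int[(sigma \x nu)%E]_z (w z.2 * g z.1)%:E)%E.
rewrite -(integral12_prod_meas1 (m1 := sigma) (m2 := nu) i12) /fubini_F /=.
have wfin := integrable_fin_num measurableT iw.
rewrite -(fineK wfin) -integralZl//; apply: eq_integral => t _.
rewrite (fineK wfin) muleC -integralZl//.
by apply: eq_integral => x _; rewrite -EFinM mulrC.
Qed.

Lemma cintegral_marked (g : borel T -> R[i]) (w : measurableTypeR R -> R) :
  cintegrable sigma g -> nu.-integrable setT (EFin \o w) ->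
  cintegrable mu (fun z : X => (w z.2)%:C * g z.1) /\
  cintegral mu (fun z : X => (w z.2)%:C * g z.1) = (\int[nu]_x w x)%R%:C * cintegral sigma g.
Proof.
move=> [gr gi] iw; have [i1 e1] := Rintegral_marked gr iw; have [i2 e2] := Rintegral_marked gi iw.
have E1 : (fun z : X => complex.Re ((w z.2)%:C * g z.1)) = (fun z : X => w z.2 * complex.Re (g z.1)).
  by apply/funext => z; rewrite ReM_real.
have E2 : (fun z : X => complex.Im ((w z.2)%:C * g z.1)) = (fun z : X => w z.2 * complex.Im (g z.1)).
  by apply/funext => z; rewrite ImM_real.
split; first by split; rewrite ?E1 ?E2.
apply: complex_eq; first by rewrite ReM_real /cintegral /= E1 e1.
by rewrite ImM_real /cintegral /= E2 e2.
Qed.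

End marked_product.

(** * Creation and neutral operators on monomials *)

Section operators.
Variables (R : realType) (T : ptopologicalType).
Variable sigma : {sigma_finite_measure set (borel T) -> \bar R}.
Variable nu : probability (measurableTypeR R) R.
Variables (A : set (borel T * borel T)) (Q : borel T * borel T -> R[i]).
Hypothesis HQ : q_kernel sigma A Q.
Hypothesis Hnu : exists2 eps : R, 0 < eps &
  (\int[nu]_x (expR (eps * `|x : R|))%:E < +oo)%E.

Local Notation X := (marked R T).
Local Notation mu := (marked_measure sigma nu).
Local Notation vec := (fclass mu).
Local Notation coef := (seq (borel T) -> R[i]^o).
Local Notation P := (fsym A Q).
Local Notation dmon := (dmonom sigma nu A Q).

Definition moment (k : nat) : R := (\int[nu]_x (x ^+ k))%R.

Lemma moment_integrable k : nu.-integrable setT (EFin \o (fun x : measurableTypeR R => x ^+ k)).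
Proof.
have one : nu.-integrable setT (EFin \o (fun x : measurableTypeR R => 1 + (x ^+ k) ^+ 2)).
  apply/integrableP; split.
    by apply/measurable_EFinP/measurable_funD => //; do 2 apply: measurable_funX; exact: measurable_id.
  apply: (@le_lt_trans _ _ (\int[nu]_x (1%:E + ((x ^+ k) ^+ 2)%:E))%E).
    by under eq_integral do rewrite /= ger0_norm ?addr_ge0 ?sqr_ge0// EFinD.
  have m2 : measurable_fun setT (fun x : measurableTypeR R => ((x ^+ k) ^+ 2)%:E).
    by apply/measurable_EFinP; do 2 apply: measurable_funX; exact: measurable_id.
  have p2 (x : measurableTypeR R) : setT x -> (0 <= ((x ^+ k) ^+ 2)%:E)%E by rewrite lee_fin sqr_ge0.
  rewrite ge0_integralD//.
  rewrite integral_cst// mul1e lte_add_pinfty ?(moment_fin Hnu)//.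
  by rewrite (le_lt_trans (probability_le1 _ _))// ltry.
apply: le_integrable one => //.
  by apply/measurable_EFinP/measurable_funX; exact: measurable_id.
move=> x _; rewrite /= lee_fin (@ger0_norm _ (1 + _)) ?addr_ge0 ?sqr_ge0//.
rewrite -[in leRHS](real_normK (num_real _)); have := normr_ge0 (x ^+ k); move: `|_| => y; nra.
Qed.

Section fixed_test.
Variable f : borel T -> R.
Hypothesis tf : test sigma f.

Lemma test_tensor_mu : test mu (tensor_mu f 0 : X -> R).
Proof.
have [mf [M hM] nf] := tf.
have E : (tensor_mu f 0 : X -> R) = fun z => f z.1 by apply/funext => z; rewrite /tensor_mu expr0 mulr1.
rewrite E; split; first exact: (measurableT_comp mf measurable_fst).
  by exists M.
rewrite (integral_fst_marked sigma nu (f := fun t => (f t ^+ 2)%:E))//.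
  by apply/measurable_EFinP; exact: measurable_funX.
by move=> t; rewrite lee_fin sqr_ge0.
Qed.

Lemma fockL2_cut (g : seq X -> R[i]^o) N : (forall s, (N < size s)%N -> g s = 0) ->
  (forall n, L2 (tuple_measure mu n) (@component _ X R n g)) -> fockL2 mu g.
Proof.
move=> g0 Lg.
have -> : g = (fun s => \sum_(k < N.+1) (if size s == k then g s else 0)).
  apply/funext => s; have [sN|/g0 gs] := leqP (size s) N; last first.
    by rewrite gs big1// => k _; case: eqP.
  rewrite (bigD1 (Ordinal (sN : (size s < N.+1)%N)))//= eqxx big1 ?addr0// => k.
  by rewrite -val_eqE /= eq_sym => /negPf ->.
apply: L2_sum => k _; apply: (fockL2_single (n := k) _ _).1 => [s /negPf->//|].
rewrite (_ : component _ = component g)//.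
by apply/funext => t; rewrite /component size_tuple eqxx.
Qed.

Lemma fock_fin_rep (H : vec) : fock_fin Q H -> exists h, [/\ sym_rep sigma nu A Q h, H = cls mu h &
  exists N, forall s, (N < size s)%N -> h s = 0].
Proof.
move=> [/(fockP HQ)[h [[Lh Ph] ->]] [N]]; rewrite truncate_cls => E.
exists (fun s => if (size s <= N)%N then h s else 0); split => //.
- split.
    apply: (@fockL2_cut _ N) => [s|n]; first by rewrite ltnNge => /negPf ->.
    have mb : measurable_fun setT (fun t : ntuple X n => (size t <= N)%N).
      rewrite (_ : (fun _ => _) = fun=> (n <= N)%N); first exact: measurable_cst.
      by apply/funext => t; rewrite size_tuple.
    apply: L2_le (fockL2_component n Lh) _.
      apply: (cmeasurable_if mb); last exact: cmeasurable_cst.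
      exact: (fockL2_cmeas Lh).
    move=> t; rewrite /component; case: ifP => // _.
    by rewrite /cabs2/= expr0n addr0; exact: cabs2_ge0.
  by rewrite -(cut_fsym HQ) Ph.
- by exists N => s; rewrite ltnNge => /negPf ->.
Qed.

(** Creation is defined through a representative and symmetrizes the result; by [Psym_prepend] the
    symmetrizer already applied to [g] can then be dropped. *)
Lemma creation_cls h g : creation Q h (cls mu (P g)) = cls mu (P (prepend h g)) :> vec.
Proof.
apply: etrans (congr1 (cls mu) (Psym_prepend (Qmark_inv HQ) (Qmark_diag HQ) h g)).
apply: (cls_symmetrizer HQ); apply/cls_eqP => -[|n]; first by apply: aeW => t; rewrite (tuple0 t).
have := ae_behead (@rep_cls_ae _ _ _ mu (P g) n); apply: filterS => -[[|x s] i]//= ->.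
by [].
Qed.

Lemma prepend_mon i c : prepend (tensor_mu f 0 : X -> R) (mon i c) = mon (0%N :: i) (fcons f c).
Proof.
apply/funext => -[|x s] //; rewrite /= /mon eqSS; case: eqP => _; last exact: mulr0.
by rewrite wprod_cons /tensor_mu !expr0 mulr1 mul1r; exact: mulrA.
Qed.

Lemma creation_dmon i c : creation Q (tensor_mu f 0) (dmon i c) = dmon (0%N :: i) (fcons f c).
Proof. by rewrite /dmonom creation_cls prepend_mon. Qed.

Lemma neutral_cls h g : neutral h (cls mu (P g)) =
  cls mu (P (fun s => (\sum_(x <- s) h x)%:C * g s)) :> vec.
Proof.
rewrite /fsym (Psym_mul (Qmark_inv HQ) (Qmark_diag HQ)).
  apply/cls_eqP => n; have := @rep_cls_ae _ _ _ mu (P g) n.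
  by apply: filterS => t ->.
by move=> n p t; congr _%:C; apply: perm_big; exact: permt_perm_eq.
Qed.

Lemma neutral_dmon i c : neutral (tensor_mu f 1) (dmon i c) =
  \sum_(l < size i) dmon (incr_nth i l) (fmul l f c).
Proof.
rewrite /dmonom neutral_cls.
have -> : (fun s => (\sum_(x <- s) tensor_mu f 1 x)%:C * mon i c s) =
    \sum_(l < size i) mon (incr_nth i l) (fmul l f c) :> (seq X -> R[i]^o).
  apply/funext => s; rewrite fct_sumE.
  have [si|si] := eqVneq (size s) (size i); last first.
    rewrite mon_out// [LHS]mulr0 big1// => l _.
    by rewrite mon_out// size_incr_nth ltn_ord.
  rewrite (big_nth point) big_mkord si rmorph_sum mulr_suml; apply: eq_bigr => l _.
  rewrite /mon size_incr_nth ltn_ord si eqxx /fmul (nth_map point) ?si//.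
  have -> : wprod (fun j x => x ^+ nth 0%N (incr_nth i l) j) s =
      (nth point s l).2 * wprod (fun j x => x ^+ nth 0%N i j) s.
    have ls : (l < size s)%N by rewrite si.
    pose l0 := Ordinal ls; rewrite /wprod (bigD1 l0) //= [in RHS](bigD1 l0) //= mulrA.
    rewrite nth_incr_nth eqxx addnC addn1 exprS; congr (_ * _).
    apply: eq_bigr => j; rewrite -val_eqE /= nth_incr_nth eq_sym => /negPf ->.
    by [].
  rewrite /tensor_mu expr1 !rmorphM /=.
  exact: mulrACA.
by rewrite (big_morph P (fsymD A Q) (fsym0 A Q)) cls_sum.
Qed.

(** Justifies integrating out the first point. Since [nu] is a probability, an unmarked function has
    the same norm on the marked space, and Tonelli makes almost every section square-integrable. *)
Lemma ae_section_L2 k (c : coef) : L2c sigma k.+1 c ->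
  {ae tuple_measure mu k, forall r : ntuple X k, L2 sigma (fun t => c (t :: map fst r))}.
Proof.
move=> Lc; have [mc nc] := Lc.
have aw : admissible nu (fun _ _ => 1).
  by move=> j; split; [exact: measurable_cst|have := moment_fin Hnu 0].
have [mF nF] := L2_weighted aw Lc.
have w1 (s : seq X) : wprod (fun _ _ => 1) s = 1 :> R by rewrite /wprod big1.
have mFc : cmeasurable (fun t : ntuple X k.+1 => c (map fst t)).
  by move: mF; congr cmeasurable; apply/funext => t; rewrite w1 mulr1.
have mG := measurable_cabs2E mFc.
have fin : (\int[tuple_measure mu k]_r \int[mu]_x (cabs2 (c (map fst (tcons (x, r)))))%:E < +oo)%E.
  rewrite -(ge0_integral_tcons2 mu mG); last by move=> t; rewrite lee_fin cabs2_ge0.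
  by move: nF; congr (_ < _)%E; apply: eq_integral => t _; rewrite w1 mulr1.
have mI : measurable_fun setT (fun r : ntuple X k => (\int[mu]_x (cabs2 (c (map fst (tcons (x, r)))))%:E)%E).
  apply: (@measurable_partial_integral _ _ _ mu _ (fun z => (cabs2 (c (map fst (tcons z))))%:E)).
  exact: (measurable_tcons_comp mG).
have iI : (tuple_measure mu k).-integrable setT
    (fun r : ntuple X k => (\int[mu]_x (cabs2 (c (map fst (tcons (x, r)))))%:E)%E).
  apply/integrableP; split => //; under eq_integral => r _.
    rewrite gee0_abs; last by apply: integral_ge0 => x _; rewrite lee_fin cabs2_ge0.
    over.
  exact: fin.
have := integrable_ae measurableT iI; apply: filterS => r /(_ I) finr.
have msec : cmeasurable (fun t : borel T => c (t :: map fst r)).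
  exact: (cmeasurable_tcons_fst (map_tuple fst r) mc).
split => //; rewrite /sqnorm.
rewrite -(integral_fst_marked sigma nu (f := fun t => (cabs2 (c (t :: map fst r)))%:E)).
- by rewrite -ge0_fin_numE//; apply: integral_ge0 => x _; rewrite lee_fin cabs2_ge0.
- exact: measurable_cabs2E.
- by move=> t; rewrite lee_fin cabs2_ge0.
Qed.

(** Fubini in the first point: its location contracts [f] with [c], and its mark contributes a
    moment of [nu]. *)
Lemma ip_prepend_mon a j c h : L2c sigma (size j).+1 c -> cmeas h ->
  L2 (tuple_measure mu (size j)) (@component _ X R (size j) h) ->
  cip (tuple_measure mu (size j).+1) (@component _ X R _ (prepend (tensor_mu f 0 : X -> R) h))
    (@component _ X R _ (mon (a :: j) c)) =
  cip (tuple_measure mu (size j)) (@component _ X R _ h)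
    (@component _ X R _ (mon j ((moment a)%:C *: contr sigma f c))).
Proof.
move=> Lc mh Lh.
have [C0 _ /(_ _ Lh)[Lp _]] := coef_bounded_fcons (size j) test_tensor_mu.
have [Lm _] := mon_L2 Hnu (i := a :: j) Lc.
have Lmc := fockL2_component (size j).+1 Lm.
have iF := L2_mul_integrable Lp Lmc.
have [mI E] := cintegral_tcons iF; apply: (etrans E) => {E}.
have [C _ hB] := coef_bounded_contr (size j) tf.
have [Lcc _] := hB _ Lc.
have Lcz : L2c sigma (size j) ((moment a)%:C *: contr sigma f c) by exact: (L2Z (moment a)%:C Lcc).
have [Lmm _] := mon_L2 Hnu Lcz.
have mR := cintegrable_cmeasurable (L2_mul_integrable Lh (fockL2_component (size j) Lmm)).
apply: ae_eq_cintegral => //.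
have := ae_section_L2 Lc; apply: filterS => r Lr.
pose u t := (f t)%:C * (c (t :: map fst r))^*%C.
have iu : cintegrable sigma u by exact: (L2_mul_integrable (L2_test tf) Lr).
have [iv eq1] := cintegral_marked iu (moment_integrable a).
pose z : R[i] := h r * (wprod (fun k x => x ^+ nth 0%N j k) r)%:C.
transitivity (cintegral mu (fun x : X => z * ((x.2 ^+ a)%:C * u x.1))).
  congr cintegral; apply/funext => x; rewrite /component /= /mon /= size_tuple eqxx wprod_cons /=.
  rewrite /tensor_mu expr0 mulr1 !conjcM conjc_real /u /z rmorphM.
  have mul5 (p q v w y : R[i]) : p * q * (v * (w * y)) = q * y * (w * (p * v)) by ring.
  exact: mul5.
rewrite cintegralZ// eq1 /component /mon size_tuple eqxx -/(moment a) /z.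
rewrite (_ : ((moment a)%:C *: contr sigma f c) (map fst r) = (moment a)%:C * contr sigma f c (map fst r))//.
have -> : cintegral sigma u = (contr sigma f c (map fst r))^*%C.
  rewrite /contr -cintegral_conj.
    by congr cintegral; apply/funext => t; rewrite conjcM conjc_real.
  have Lrc : L2 sigma (fun t => (c (t :: map fst r))^*%C).
    by apply: L2_le (cmeasurable_conj Lr.1) Lr _ => t; rewrite cabs2_conj.
  have := L2_mul_integrable (L2_test tf) Lrc.
  by congr cintegrable; apply/funext => t; rewrite conjcK.
rewrite !conjcM !conjc_real.
have mul4 (p q v w : R[i]) : p * q * (v * w) = p * (v * w * q) by ring.
exact: mul4.
Qed.

End fixed_test.

End operators.

(** * The annihilation operator on monomials *)

Section annihilation.
Variables (R : realType) (T : ptopologicalType).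
Variable sigma : {sigma_finite_measure set (borel T) -> \bar R}.
Variable nu : probability (measurableTypeR R) R.
Variables (A : set (borel T * borel T)) (Q : borel T * borel T -> R[i]).
Hypothesis HQ : q_kernel sigma A Q.
Hypothesis Hnu : exists2 eps : R, 0 < eps &
  (\int[nu]_x (expR (eps * `|x : R|))%:E < +oo)%E.
Variable K : nat -> set (borel T).
Hypothesis HK : exhaustion sigma K.

Local Notation X := (marked R T).
Local Notation mu := (marked_measure sigma nu).
Local Notation vec := (fclass mu).
Local Notation coef := (seq (borel T) -> R[i]^o).
Local Notation P := (fsym A Q).
Local Notation dmon := (dmonom sigma nu A Q).
Local Notation comp n g := (@component _ X R n g).

Lemma fip_linear_r a (F G H : vec) : fock Q F -> fock Q G -> fock Q H ->
  fip H (a *: F + G) = a^*%C * fip H F + fip H G.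
Proof.
move=> fF fG fH; rewrite (fip_conj HQ (fockZD HQ a fF fG) fH) (fip_linear HQ)//.
have conjcD (z w : R[i]) : (z + w)^*%C = z^*%C + w^*%C by exact: rmorphD.
have e1 := fip_conj HQ fF fH; have e2 := fip_conj HQ fG fH.
by move: e1 e2; move: (fip H F) (fip H G) => x y -> ->; rewrite conjcD conjcM.
Qed.

Lemma fipDl (F G H : vec) : fock Q F -> fock Q G -> fock Q H -> fip (F + G) H = fip F H + fip G H.
Proof. by move=> fF fG fH; have := fip_linear HQ 1 fF fG fH; rewrite scale1r mul1r. Qed.

Lemma fipDr (F G H : vec) : fock Q F -> fock Q G -> fock Q H -> fip H (F + G) = fip H F + fip H G.
Proof. by move=> fF fG fH; have := fip_linear_r 1 fF fG fH; rewrite scale1r rmorph1 mul1r. Qed.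

Lemma fip0l (H : vec) : fock Q H -> fip 0 H = 0.
Proof.
move=> fH; have f0 := fock0 nu HQ; apply: (addrI (fip 0 H)).
by rewrite -fipDl// !addr0.
Qed.

Lemma fip0r (H : vec) : fock Q H -> fip H 0 = 0.
Proof. by move=> fH; rewrite (fip_conj HQ (fock0 nu HQ) fH) fip0l// rmorph0. Qed.

Lemma fockD (F G : vec) : fock Q F -> fock Q G -> fock Q (F + G).
Proof. by move=> fF fG; have := fockZD HQ 1 fF fG; rewrite scale1r. Qed.

Lemma fip_suml (I : finType) (F : I -> vec) (H : vec) : (forall k, fock Q (F k)) -> fock Q H ->
  fip (\sum_k F k) H = \sum_k fip (F k) H.
Proof.
move=> fF fH; suff [] : fock Q (\sum_k F k) /\ fip (\sum_k F k) H = \sum_k fip (F k) H by [].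
elim/big_ind2: _ => [|F1 a F2 b [f1 <-] [f2 <-]|k _].
- by split; [exact: (fock0 nu HQ)|exact: fip0l].
- by split; [exact: fockD|exact: fipDl].
- by split.
Qed.

Lemma domain_sum (I : finType) (F : I -> vec) : (forall k, domain Q (F k)) -> domain Q (\sum_k F k).
Proof.
move=> dF; elim/big_ind: _ => //; first exact: (domain0 nu HQ).
by move=> F1 F2; exact: (domainD HQ).
Qed.

(* The domain is total, so that adjoints are unique. *)
Lemma adjoint_eq (E : set vec) p (F G : vec) : domain Q `<=` E -> fock Q G ->
  (forall H, E H -> fock Q H) ->
  (forall H, E H -> fip (p H) F = fip H G) -> adjoint Q E p F = G.
Proof.
move=> dE fG Ef hG; rewrite /adjoint; set S := [set _ | _].
have SG : S G by split.
have [fG' hG'] : S (xget 0 S) by exact: (xgetPex 0 (ex_intro _ G SG)).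
apply/eqP; rewrite -subr_eq0; apply/eqP; apply: (domain_total HQ Hnu HK).
  by rewrite addrC -scaleN1r; exact: (fockZD HQ).
move=> H dH; have fH := Ef _ (dE _ dH).
rewrite addrC -scaleN1r fip_linear_r// -(hG _ (dE _ dH)) -(hG' _ (dE _ dH)).
have -> : (-1)^*%C = -1 :> R[i] by rewrite rmorphN rmorph1.
by rewrite mulN1r addNr.
Qed.

Section fixed_test.
Variable f : borel T -> R.
Hypothesis tf : test sigma f.

Local Notation cr := (creation Q (tensor_mu f 0) : vec -> vec).
Local Notation an := (annihilation Q (tensor_mu f 0) : vec -> vec).
Local Notation ne := (neutral (tensor_mu f 1) : vec -> vec).

(** In the pairing with a created vector the Fock weight n! cancels the 1/n! of the symmetrizer,
    while the weight (n-1)! of the lower degree has to be divided out. The mark of the removed point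
    is integrated to a moment. *)
Definition ann_coef (i : seq nat) (c : coef) (pi : 'S_(size i)) : coef :=
  ((size i).-1`!%:R^-1 * (moment nu (head 0%N (mon_index pi)))%:C) *: contr sigma f (mon_coef A Q c pi).

Definition ann_dmon (i : seq nat) (c : coef) : vec :=
  if i is [::] then 0 else \sum_(pi : 'S_(size i)) dmon (behead (mon_index pi)) (ann_coef c pi).

Lemma size_behead_mon_index i (pi : 'S_(size i)) : size (behead (mon_index pi)) = (size i).-1.
Proof. by rewrite size_behead size_swapn_word. Qed.

Lemma L2c_ann_coef i c pi : i != [::] -> L2c sigma (size i) c ->
  L2c sigma (size i).-1 (@ann_coef i c pi).
Proof.
case: i pi => // a i pi _ Lc; have [Lp _] := L2c_mon_coef HQ pi Lc.
have [C _ hB] := coef_bounded_contr (size i) tf; have [Lcc _] := hB _ Lp.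
exact: (L2Z _ Lcc).
Qed.

Lemma domain_ann_dmon i c : L2c sigma (size i) c -> domain Q (ann_dmon i c).
Proof.
case: i => [|a i] Lc; first exact: (domain0 nu HQ).
apply: domain_sum => pi; apply: (domain_dmon nu HQ); rewrite size_behead_mon_index.
exact: L2c_ann_coef.
Qed.

Lemma L2_prepend h n : fockL2 mu h -> L2 (tuple_measure mu n) (comp n (prepend (tensor_mu f 0 : X -> R) h)).
Proof.
case: n => [|n] Lh.
  rewrite (_ : component _ = fun=> 0); first exact: L2_0.
  by apply/funext => t; rewrite /component (tuple0 t).
have [C _ hB] := coef_bounded_fcons n (test_tensor_mu nu tf).
exact: (hB _ (fockL2_component n Lh)).1.
Qed.

Lemma fockL2_prepend h N : fockL2 mu h -> (forall s, (N < size s)%N -> h s = 0) ->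
  fockL2 mu (prepend (tensor_mu f 0 : X -> R) h).
Proof.
move=> Lh h0; apply: (@fockL2_cut _ _ _ _ _ N.+1) => [[|x s]//= sN|n]; last exact: L2_prepend.
by rewrite h0// mulr0.
Qed.

Lemma creation_fock (H : vec) : fock_fin Q H -> fock Q (cr H).
Proof.
move=> /(fock_fin_rep HQ)[h [[Lh Ph] -> [N hN]]]; rewrite -Ph (creation_cls nu HQ).
by apply: (fock_cls HQ); apply: (sym_rep_fsym HQ); exact: fockL2_prepend hN.
Qed.

Lemma ip_mon_prepend k (j : seq nat) (c : coef) h : size j = k.+1 -> L2c sigma k.+1 c ->
  fockL2 mu h ->
  cip (tuple_measure mu k.+1) (comp _ (mon j c)) (comp _ (prepend (tensor_mu f 0 : X -> R) h)) =
  (moment nu (head 0%N j))%:C *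
    cip (tuple_measure mu k) (comp _ (mon (behead j) (contr sigma f c))) (comp _ h).
Proof.
case: j => [|a j]//= [<-] Lc Lh.
have [Lm _] := mon_L2 (i := a :: j) Hnu Lc.
have [C _ hB] := coef_bounded_contr (size j) tf; have [Lcc _] := hB _ Lc.
have Lcz : L2c sigma (size j) ((moment nu a)%:C *: contr sigma f c) by exact: (L2Z _ Lcc).
have [Lmz _] := mon_L2 Hnu Lcz; have [Lmc _] := mon_L2 (i := j) Hnu Lcc.
rewrite (cip_conj (L2_prepend _ Lh) (fockL2_component _ Lm)).
rewrite (ip_prepend_mon Hnu tf a Lc (fockL2_cmeas Lh) (fockL2_component _ Lh)).
rewrite -(cip_conj (fockL2_component _ Lh) (fockL2_component _ Lmz)).
rewrite -(cipZl _ (fockL2_component _ Lmc) (fockL2_component _ Lh)); congr cip.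
apply/funext => t; rewrite /component.
by have := mon_linear j (moment nu a)%:C (contr sigma f c) 0; rewrite mon0 !addr0 => ->.
Qed.

(** Both sides are conjugated to bring the monomial into the first slot. There the symmetrizer is
    moved onto it and expanded by [fsym_mon], and each permuted monomial loses its first point by
    [ip_mon_prepend]. *)
Lemma creation_ann_dmon i c (H : vec) : L2c sigma (size i) c -> fock_fin Q H ->
  fip (cr H) (dmon i c) = fip H (ann_dmon i c).
Proof.
move=> Lc fiH; have fcH := creation_fock fiH; have [fH _] := fiH.
have dA := domain_ann_dmon Lc; have fA := domain_fock HQ Hnu dA.
have dM := domain_dmon nu HQ Lc; have fM := domain_fock HQ Hnu dM.
rewrite (fip_conj HQ fM fcH) (fip_conj HQ fA fH); congr (_^*)%C.
have [h [[Lh Ph] HE [N hN]]] := fock_fin_rep HQ fiH.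
pose pp := prepend (tensor_mu f 0 : X -> R) h.
have Lpp : fockL2 mu pp by exact: fockL2_prepend hN.
have crE : cr H = cls mu (P pp) by rewrite HE -{1}Ph (creation_cls nu HQ).
have [LPp _] := fockL2_fsym HQ Lpp.
have [Lm _] := mon_L2 Hnu Lc.
rewrite crE (fip_dmon HQ Hnu Lc (fockL2_cmeas LPp) (fockL2_component _ LPp)).
rewrite /fsym (Psym_id (Qmark_inv HQ) (Qmark_diag HQ)) -/(fsym A Q pp).
rewrite -(ip_fsym HQ (fockL2_cmeas Lm) (fockL2_cmeas Lpp) (fockL2_component _ Lm) (fockL2_component _ Lpp)).
have Lmp (pi : 'S_(size i)) : L2 (tuple_measure mu (size i)) (comp _ (mon (mon_index pi) (mon_coef A Q c pi))).
  have [Lp _] := L2c_mon_coef HQ pi Lc; rewrite -(size_swapn_word (adj_word pi) i) in Lp.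
  exact: (fockL2_component _ (mon_L2 Hnu Lp).1).
have E1 : (size i)`!%:R * cip (tuple_measure mu (size i)) (comp _ (P (mon i c))) (comp _ pp) =
    \sum_(pi : 'S_(size i)) cip (tuple_measure mu (size i)) (comp _ (mon (mon_index pi) (mon_coef A Q c pi))) (comp _ pp).
  rewrite -cip_suml//; last exact: fockL2_component.
  rewrite -cipZl//; [|exact: fockL2_component (fockL2_fsym HQ Lm).1|exact: fockL2_component].
  congr cip; apply/funext => t; rewrite /component fsym_mon fctE fct_sumE.
  by rewrite [LHS]mulrA divff ?mul1r// pnatr_eq0 -lt0n fact_gt0.
rewrite E1 {E1}; case: i c Lc dA fA dM fM Lm Lmp => [|a i] c Lc dA fA dM fM Lm Lmp.
  rewrite fip0l// big1// => pi _; rewrite /cip (_ : (fun _ => _) = fun=> 0).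
    by rewrite /cintegral /Rintegral !integral0_eq.
  apply/funext => t; have -> : comp 0%N pp t = 0 by rewrite /component (tuple0 t).
  by rewrite rmorph0 mulr0.
have fD (pi : 'S_(size (a :: i))) : fock Q (dmon (behead (mon_index pi)) (ann_coef c pi)).
  apply: (domain_fock HQ Hnu); apply: (domain_dmon nu HQ).
  by rewrite size_behead_mon_index; exact: L2c_ann_coef.
have -> : ann_dmon (a :: i) c =
  \sum_(pi : 'S_(size (a :: i))) dmon (behead (mon_index pi)) (ann_coef c pi) by [].
rewrite (fip_suml fD fH).
apply: eq_bigr => pi _; have [Lp _] := L2c_mon_coef HQ pi Lc.
have Lac := @L2c_ann_coef (a :: i) c pi isT Lc; rewrite [_.-1]/= in Lac.
have sb : size (behead (mon_index pi)) = size i by rewrite size_behead_mon_index.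
rewrite (ip_mon_prepend (k := size i)) ?size_swapn_word//.
have Lac' : L2c sigma (size (behead (mon_index pi))) (ann_coef c pi) by rewrite sb.
rewrite HE (fip_dmon HQ Hnu Lac' (fockL2_cmeas Lh) (fockL2_component _ Lh)) Ph sb.
have [C _ hB] := coef_bounded_contr (size i) tf; have [Lcc _] := hB _ Lp.
have Lcc' : L2c sigma (size (behead (mon_index pi))) (contr sigma f (mon_coef A Q c pi)) by rewrite sb.
have [Lmc _] := mon_L2 Hnu Lcc'.
set al : R[i] := (size i)`!%:R^-1 * (moment nu (head 0%N (mon_index pi)))%:C.
have -> : comp (size i) (mon (behead (mon_index pi)) (ann_coef c pi)) =
    fun t => al * comp (size i) (mon (behead (mon_index pi)) (contr sigma f (mon_coef A Q c pi))) t.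
  apply/funext => t; rewrite /component /ann_coef.
  by have := mon_linear (behead (mon_index pi)) al (contr sigma f (mon_coef A Q c pi)) 0; rewrite mon0 !addr0 => ->.
rewrite cipZl; [|exact: fockL2_component|exact: fockL2_component].
by rewrite !mulrA divff ?mul1r// pnatr_eq0 -lt0n fact_gt0.
Qed.

(** Nothing is known about the chosen adjoint until a candidate is exhibited; the candidate is built
    by additivity from the monomials and then identified by [adjoint_eq]. *)
Lemma annihilation_ann (F : vec) : domain Q F -> domain Q (an F) /\
  forall H, fock_fin Q H -> fip (cr H) F = fip H (an F).
Proof.
move=> dF; suff [G [dG hG]] : exists G, domain Q G /\ forall H : vec, fock_fin Q H -> fip (cr H) F = fip H G.
  have -> : an F = G.
    apply: adjoint_eq => //; [exact: (domain_fin HQ Hnu)|exact: (domain_fock HQ Hnu)|by move=> H []].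
  by [].
move: F dF; apply: (domain_ind HQ).
  exists 0; split; first exact: (domain0 nu HQ).
  by move=> H fH; rewrite !fip0r//; [exact: fH.1|exact: creation_fock].
move=> i c F Lc dF [G [dG hG]]; exists (ann_dmon i c + G); split.
  by apply: (domainD HQ) => //; exact: domain_ann_dmon.
move=> H fH; have fcH := creation_fock fH; have [fH0 _] := fH.
have fM := domain_fock HQ Hnu (domain_dmon nu HQ Lc); have fF := domain_fock HQ Hnu dF.
have fA := domain_fock HQ Hnu (domain_ann_dmon Lc); have fG := domain_fock HQ Hnu dG.
have e1 := creation_ann_dmon Lc fH; have e2 := hG H fH.
apply: etrans (fipDr fM fF fcH) _; apply: etrans (esym (fipDr fA fG fH0)).
exact: (congr2 +%R e1 e2).
Qed.

Lemma annihilation_dmon i c : L2c sigma (size i) c -> an (dmon i c) = ann_dmon i c.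
Proof.
move=> Lc; apply: adjoint_eq.
- exact: (domain_fin HQ Hnu).
- exact: (domain_fock HQ Hnu (domain_ann_dmon Lc)).
- by move=> H [].
- by move=> H fH; exact: creation_ann_dmon.
Qed.

End fixed_test.

End annihilation.

(** * The *-algebra acting on the domain *)

Section polynomial_operators.
Variables (R : realType) (T : ptopologicalType).
Variable sigma : {sigma_finite_measure set (borel T) -> \bar R}.
Variable nu : probability (measurableTypeR R) R.
Variables (A : set (borel T * borel T)) (Q : borel T * borel T -> R[i]).
Hypothesis HQ : q_kernel sigma A Q.
Hypothesis Hnu : exists2 eps : R, 0 < eps &
  (\int[nu]_x (expR (eps * `|x : R|))%:E < +oo)%E.
Variable K : nat -> set (borel T).
Hypothesis HK : exhaustion sigma K.

Local Notation X := (marked R T).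
Local Notation mu := (marked_measure sigma nu).
Local Notation vec := (fclass mu).
Local Notation coef := (seq (borel T) -> R[i]^o).
Local Notation P := (fsym A Q).
Local Notation dmon := (dmonom sigma nu A Q).

Lemma on_domainE p (F : vec) : domain Q F -> on_domain Q p F = p F.
Proof. by move=> dF; rewrite /on_domain /patch mem_set. Qed.

Lemma on_domain_out p (F : vec) : ~ domain Q F -> on_domain Q p F = 0.
Proof. by move=> dF; rewrite /on_domain /patch memNset. Qed.

Definition domain_linear (p : vec -> vec) : Prop := forall a F G,
  domain Q F -> domain Q G -> p (a *: F + G) = a *: p F + p G.

Lemma domain_linear0 p : domain_linear p -> p 0 = 0.
Proof.
move=> lp; have d0 := domain0 nu HQ; have := lp (-1) 0 0 d0 d0.
by rewrite !scaleN1r !addNr.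
Qed.

Lemma domain_linearD p F G : domain_linear p -> domain Q F -> domain Q G -> p (F + G) = p F + p G.
Proof. by move=> lp dF dG; have := lp 1 F G dF dG; rewrite !scale1r. Qed.

(** Records the shape of the vector and not just a bound for its norm: a bound at each exponent
    would not survive the next, unbounded operator, whereas finite sums of monomials with boundedly
    changed coefficients are stable under composition. *)
Inductive cmap (n : nat) : (coef -> vec) -> Prop :=
| cmap_zero : cmap n (fun=> 0)
| cmap_dmon j B : coef_bounded sigma n (size j) B -> cmap n (fun c => dmon j (B c))
| cmap_add p q : cmap n p -> cmap n q -> cmap n (fun c => p c + q c)
| cmap_ext p q : (forall c, L2c sigma n c -> p c = q c) -> cmap n p -> cmap n q.

Lemma cmap_sum n (I : finType) (p : I -> coef -> vec) :
  (forall k, cmap n (p k)) -> cmap n (fun c => \sum_k p k c).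
Proof.
move=> hp; elim: (index_enum I) => [|k r IH].
  by apply: cmap_ext (cmap_zero n) => c _; rewrite big_nil.
by apply: cmap_ext (cmap_add (hp k) IH) => c _; rewrite big_cons.
Qed.

Lemma cmap_domain n p c : cmap n p -> L2c sigma n c -> domain Q (p c).
Proof.
move=> hp Lc; elim: hp => [|j B [C _ hB]|p1 q1 _ d1 _ d2|p1 q1 pq _].
- exact: (domain0 nu HQ).
- by apply: (domain_dmon nu HQ); have [] := hB _ Lc.
- exact: (domainD HQ).
- by rewrite -pq.
Qed.

Lemma cmap_precomp n m B p : coef_bounded sigma n m B -> cmap m p -> cmap n (p \o B).
Proof.
move=> hB; elim=> [|j B' hB'|p1 q1 _ d1 _ d2|p1 q1 pq _ IH].
- exact: cmap_zero.
- exact: (cmap_dmon (coef_bounded_comp hB hB')).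
- exact: (cmap_add d1 d2).
- by have [C _ hC] := hB; apply: cmap_ext IH => c Lc /=; apply: pq; have [] := hC _ Lc.
Qed.

Definition domain_cmap (p : vec -> vec) : Prop := forall i, cmap (size i) (fun c => p (dmon i c)).

Lemma cmap_postcomp n p r : domain_linear r -> domain_cmap r -> cmap n p -> cmap n (r \o p).
Proof.
move=> lr cr; elim=> [|j B' hB'|p1 q1 h1 d1 h2 d2|p1 q1 pq _ IH].
- by apply: cmap_ext (cmap_zero n) => c _ /=; rewrite domain_linear0.
- exact: (cmap_precomp hB' (cr j)).
- apply: cmap_ext (cmap_add d1 d2) => c Lc /=.
  by rewrite domain_linearD//; exact: (@cmap_domain n).
- by apply: cmap_ext IH => c Lc /=; rewrite pq.
Qed.

Lemma domain_closed p F : domain_linear p -> domain_cmap p -> domain Q F -> domain Q (p F).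
Proof.
move=> lp cp; move: F; apply: (domain_ind HQ).
  by rewrite domain_linear0//; exact: (domain0 nu HQ).
move=> i c F Lc dF dpF; rewrite domain_linearD//; last exact: (domain_dmon nu HQ).
by apply: (domainD HQ) => //; exact: (cmap_domain (cp i) Lc).
Qed.

Lemma op_linear (p : vec -> vec) (phi : (seq X -> R[i]^o) -> seq X -> R[i]^o) : linear phi ->
  (forall g, p (cls mu (P g)) = cls mu (P (phi g))) -> domain_linear p.
Proof.
move=> lphi pE a _ _ /(domainP HQ)[f [_ ->]] /(domainP HQ)[g [_ ->]].
by rewrite -clsZ -clsD -(fsym_linear A Q) !pE lphi (fsym_linear A Q) clsD clsZ.
Qed.

Section fixed_test.
Variable f : borel T -> R.
Hypothesis tf : test sigma f.

Local Notation cr := (creation Q (tensor_mu f 0) : vec -> vec).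
Local Notation an := (annihilation Q (tensor_mu f 0) : vec -> vec).
Local Notation ne := (neutral (tensor_mu f 1) : vec -> vec).

Lemma creation_linear : domain_linear cr.
Proof.
apply: (op_linear (phi := prepend (tensor_mu f 0 : X -> R))) => [a g g'|g]; last exact: (creation_cls nu HQ).
apply/funext => -[|x s]; first by rewrite !fctE /= [RHS]addr0 [RHS]mulr0.
have muladd (u v w z : R[i]) : u * (v * w + z) = v * (u * w) + u * z by ring.
exact: muladd.
Qed.

Lemma neutral_linear : domain_linear ne.
Proof.
apply: (op_linear (phi := fun g s => (\sum_(x <- s) tensor_mu f 1 x)%:C * g s)) => [a g g'|g].
  apply/funext => s; have muladd (u v w z : R[i]) : u * (v * w + z) = v * (u * w) + u * z by ring.
  exact: muladd.
exact: (neutral_cls nu HQ).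
Qed.

Lemma annihilation_linear : domain_linear an.
Proof.
move=> a F G dF dG.
have [dF' hF] := annihilation_ann HQ Hnu HK tf dF; have [dG' hG] := annihilation_ann HQ Hnu HK tf dG.
have [fF fG] := (domain_fock HQ Hnu dF, domain_fock HQ Hnu dG).
have [fF' fG'] := (domain_fock HQ Hnu dF', domain_fock HQ Hnu dG').
apply: (adjoint_eq HQ Hnu HK).
- exact: (domain_fin HQ Hnu).
- exact: (fockZD HQ).
- by move=> H [].
move=> H fH; have fcH := creation_fock HQ tf fH; have [fH0 _] := fH.
have e1 := fip_linear_r HQ a fF fG fcH; have e2 := fip_linear_r HQ a fF' fG' fH0.
apply: (etrans e1); apply: etrans (esym e2).
by move: (hF H fH) (hG H fH) => {e1 e2} -> ->.
Qed.

Lemma creation_cmap : domain_cmap cr.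
Proof.
move=> i; apply: cmap_ext (cmap_dmon (j := 0%N :: i) (coef_bounded_fcons (size i) tf)) => c _.
by rewrite (creation_dmon nu HQ).
Qed.

Lemma neutral_cmap : domain_cmap ne.
Proof.
move=> i; apply: (@cmap_ext _ (fun c => \sum_(l < size i) dmon (incr_nth i l) (fmul l f c))) => [c _|].
  by rewrite (neutral_dmon nu HQ).
apply: cmap_sum => l; apply: cmap_dmon; rewrite size_incr_nth ltn_ord.
exact: coef_bounded_fmul.
Qed.

Lemma annihilation_cmap : domain_cmap an.
Proof.
move=> i; apply: (@cmap_ext _ (fun c => ann_dmon sigma nu A Q f i c)) => [c Lc|].
  by rewrite (annihilation_dmon HQ Hnu HK).
case: i => [|a i]; first exact: cmap_zero.
apply: cmap_sum => pi; apply: cmap_dmon; rewrite size_behead_mon_index.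
apply: coef_bounded_scale; apply: (@coef_bounded_comp _ _ _ _ _ (size i).+1) (coef_bounded_contr (size i) tf).
exists 1 => // c Lc; have [Lp nE] := L2c_mon_coef HQ pi Lc.
by split => //; rewrite mul1e nE.
Qed.

Lemma field_opE (F : vec) : domain Q F -> field_op Q f F = cr F + ne F + an F.
Proof. by move=> dF; rewrite /field_op on_domainE. Qed.

Lemma field_linear : domain_linear (field_op Q f).
Proof.
move=> a F G dF dG; have dFG := domainZD HQ a dF dG.
rewrite !field_opE// creation_linear// neutral_linear// annihilation_linear//.
by rewrite !scalerDr [X in X + _ = _]addrACA [LHS]addrACA.
Qed.

Lemma field_cmap : domain_cmap (field_op Q f).
Proof.
move=> i; have h := cmap_add (cmap_add (creation_cmap i) (neutral_cmap i)) (annihilation_cmap i).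
apply: cmap_ext h => c Lc; rewrite field_opE//.
exact: (domain_dmon nu HQ).
Qed.

Lemma neutral_sym (H F : vec) : domain Q H -> domain Q F -> fip (ne H) F = fip H (ne F).
Proof.
move=> /(domainP HQ)[g [mg ->]] /(domainP HQ)[g' [mg' ->]].
have [Lg _] := fockL2_fsym HQ (monsum_fockL2 Hnu mg).
have [Lg' _] := fockL2_fsym HQ (monsum_fockL2 Hnu mg').
pose phi (s : seq X) : R[i] := (\sum_(x <- s) tensor_mu f 1 x)%:C.
have E h : ne (cls mu (P h)) = cls mu (fun s => phi s * P h s).
  apply: etrans (neutral_cls nu HQ _ _) _; congr cls.
  apply: (Psym_mul (Qmark_inv HQ) (Qmark_diag HQ)).
  by move=> n p t; congr _%:C; apply: perm_big; exact: permt_perm_eq.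
have mphi h : fockL2 mu (P h) -> cmeas (fun s => phi s * P h s).
  move=> Lh n; apply: (@cmeasurableM _ _ _ (fun t : ntuple X n => phi t)); last exact: (fockL2_cmeas Lh).
  apply: cmeasurable_real.
  rewrite (_ : (fun _ => _) = fun t : ntuple X n => \sum_(j < n) (tensor_mu f 1 (tnth t j))); last first.
    by apply/funext => t; rewrite big_tuple.
  apply: measurable_sum => j.
  have [mf _ _] := tf.
  have mt : measurable_fun setT (tensor_mu f 1 : X -> measurableTypeR R).
    apply: measurable_funM; first exact: (measurableT_comp mf measurable_fst).
    by apply: measurable_funX; exact: measurable_snd.
  exact: (measurableT_comp mt (measurable_tnth j)).
have e1 := fip_cls mu (mphi _ Lg) (fockL2_cmeas Lg').
have e2 := fip_cls mu (fockL2_cmeas Lg) (mphi _ Lg').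
rewrite !E; apply: (etrans e1); apply: etrans (esym e2) => {e1 e2}.
congr clim; apply/funext => N; apply: eq_bigr => n _; congr (_ * _); congr cintegral.
apply/funext => t; have phiR : (phi t)^*%C = phi t by exact: conjc_real.
have mulJ (x y z : R[i]) : x^*%C = x -> x * y * z^*%C = y * (x * z)^*%C.
  by move=> xr; rewrite conjcM xr mulrCA mulrA.
exact: mulJ phiR.
Qed.

End fixed_test.

Definition adjoint_pair (p q : vec -> vec) : Prop := forall H F, domain Q H -> domain Q F ->
  fip (p H) F = fip H (q F).

Record nice (p : vec -> vec) : Prop := Nice {
  nice_poly : Defs.polynomial Q p;
  nice_out : forall F, ~ domain Q F -> p F = 0;
  nice_linear : domain_linear p;
  nice_cmap : domain_cmap p }.

Lemma nice_domain p F : nice p -> domain Q F -> domain Q (p F).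
Proof. by move=> [_ _ lp cp]; exact: domain_closed. Qed.

Lemma adjoint_pair_sym p q : nice p -> nice q -> adjoint_pair p q -> adjoint_pair q p.
Proof.
move=> np nq pq H F dH dF; have [dqH dpF] := (nice_domain nq dH, nice_domain np dF).
rewrite (fip_conj HQ (domain_fock HQ Hnu dF) (domain_fock HQ Hnu dqH)).
rewrite -(pq F H dF dH).
exact: esym (fip_conj HQ (domain_fock HQ Hnu dpF) (domain_fock HQ Hnu dH)).
Qed.

Lemma star_eq p q : nice q -> adjoint_pair p q -> star Q p = q.
Proof.
move=> nq pq; apply/funext => F; have [dF|dF] := pselect (domain Q F); last first.
  by rewrite /star on_domain_out// (nice_out nq).
have sub : domain Q `<=` (domain Q : set vec) by [].
have fqF := domain_fock HQ Hnu (nice_domain nq dF).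
have := @adjoint_eq _ _ _ _ _ _ HQ Hnu _ HK (domain Q) p F (q F) sub fqF.
move=> <-; last 2 first.
- by move=> H; exact: (domain_fock HQ Hnu).
- by move=> H dH; exact: pq.
exact: on_domainE.
Qed.

Lemma nice_field f : B0 f -> test sigma (f : borel T -> R) -> nice (field_op Q f) /\
  adjoint_pair (field_op Q f) (field_op Q f).
Proof.
move=> bf tf; split.
  split; [exact: polynomial_field|by move=> F /on_domain_out; apply|exact: field_linear|exact: field_cmap].
move=> H F dH dF; have eH := field_opE f dH; have eF := field_opE f dF.
rewrite eH eF => {eH eF}.
have dcH := domain_closed (creation_linear f) (creation_cmap tf) dH.
have dcF := domain_closed (creation_linear f) (creation_cmap tf) dF.
have dnH := domain_closed (neutral_linear f) (neutral_cmap tf) dH.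
have dnF := domain_closed (neutral_linear f) (neutral_cmap tf) dF.
have [daH haH] := annihilation_ann HQ Hnu HK tf dH; have [daF haF] := annihilation_ann HQ Hnu HK tf dF.
have fock_ := domain_fock HQ Hnu.
have e1 := haF H (domain_fin HQ Hnu dH).
have e2 := neutral_sym tf dH dF.
have e3 := haH F (domain_fin HQ Hnu dF).
have e3' := etrans (fip_conj HQ (fock_ _ dF) (fock_ _ daH)) (etrans (congr1 _ (esym e3))
  (esym (fip_conj HQ (fock_ _ dcF) (fock_ _ dH)))).
apply: etrans (fipDl HQ (fockD HQ (fock_ _ dcH) (fock_ _ dnH)) (fock_ _ daH) (fock_ _ dF)) _.
apply: etrans (congr1 (+%R^~ _) (fipDl HQ (fock_ _ dcH) (fock_ _ dnH) (fock_ _ dF))) _.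
apply: etrans (esym (fipDr HQ (fockD HQ (fock_ _ dcF) (fock_ _ dnF)) (fock_ _ daF) (fock_ _ dH))).
apply: etrans (esym (congr1 (+%R^~ _) (fipDr HQ (fock_ _ dcF) (fock_ _ dnF) (fock_ _ dH)))).
have sum6 (x1 x2 x3 y1 y2 y3 : R[i]) : x1 = y3 -> x2 = y2 -> x3 = y1 -> x1 + x2 + x3 = y1 + y2 + y3.
  by move=> -> -> ->; ring.
exact: sum6 e1 e2 e3'.
Qed.

Hypothesis B0_test : forall f : T -> R, B0 f -> test sigma (f : borel T -> R).

(** The induction carries an adjoint that is itself a nice element of the algebra. Uniqueness then
    identifies [star p] with it, and the case of [star] only exchanges the two. *)
Lemma polynomial_nice p : Defs.polynomial Q p -> exists q, [/\ nice p, nice q & adjoint_pair p q].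
Proof.
elim=> [f bf||p1 p2 _ [q1 [n1 m1 a1]] _ [q2 [n2 m2 a2]]|a p1 _ [q1 [n1 m1 a1]]
       |p1 p2 _ [q1 [n1 m1 a1]] _ [q2 [n2 m2 a2]]|p1 _ [q1 [n1 m1 a1]]].
- by exists (field_op Q f); have [nf af] := nice_field bf (B0_test bf).
- have n1 : nice (on_domain Q id).
    split; [exact: polynomial_one|by move=> F /on_domain_out; apply| |].
      by move=> a F G dF dG; rewrite !on_domainE//; exact: (domainZD HQ).
    move=> i; apply: (@cmap_ext _ (dmon i)) => [c Lc|].
      by rewrite on_domainE//; exact: (domain_dmon nu HQ).
    apply: (@cmap_dmon _ i id); exists 1 => // c Lc; split => //; by rewrite mul1e.
  exists (on_domain Q id); split; [exact: n1|exact: n1|].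
  move=> H F dH dF; have e1 := on_domainE id dH; have e2 := on_domainE id dF.
  by rewrite e1 e2.
- have nadd u v : nice u -> nice v -> nice (u + v).
    move=> [pu ou lu cu] [pv ov lv cv]; split; first exact: polynomial_add.
    + by move=> F dF; rewrite fctE ou// ov// addr0.
    + by move=> b F G dF dG; rewrite !fctE lu// lv// scalerDr addrACA.
    + by move=> i; exact: (cmap_add (cu i) (cv i)).
  exists (q1 + q2); split; [exact: nadd|exact: nadd|].
  move=> H F dH dF; have fock_ := domain_fock HQ Hnu.
  have e1 := fipDl HQ (fock_ _ (nice_domain n1 dH)) (fock_ _ (nice_domain n2 dH)) (fock_ _ dF).
  have e2 := fipDr HQ (fock_ _ (nice_domain m1 dF)) (fock_ _ (nice_domain m2 dF)) (fock_ _ dH).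
  apply: (etrans e1); apply: etrans (esym e2).
  exact: (congr2 +%R (a1 H F dH dF) (a2 H F dH dF)).
- have nscale b u : nice u -> nice (b *: u).
    move=> [pu ou lu cu]; split; first exact: polynomial_scale.
    + by move=> F dF; rewrite fctE ou// scaler0.
    + by move=> b' F G dF dG; rewrite !fctE lu// scalerDr !scalerA mulrC.
    + have lb : domain_linear (fun F : vec => b *: F).
        by move=> b' F G dF dG; rewrite scalerDr !scalerA mulrC.
      have cb : domain_cmap (fun F : vec => b *: F).
        move=> i; apply: (@cmap_ext _ (fun c => dmon i (b *: c))) => [c _|].
          by have := dmon_linear sigma nu A Q i b c 0; rewrite dmon0 !addr0 => ->.
        apply: cmap_dmon; apply: coef_bounded_scale; exists 1 => // c Lc; split => //; by rewrite mul1e.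
      by move=> i; exact: (cmap_postcomp lb cb (cu i)).
  exists (a^*%C *: q1); split; [exact: nscale|exact: nscale|].
  move=> H F dH dF; have fock_ := domain_fock HQ Hnu.
  have f0 := fock0 nu HQ.
  have e1 := fip_linear HQ a (fock_ _ (nice_domain n1 dH)) f0 (fock_ _ dF).
  have e2 := fip_linear_r HQ a^*%C (fock_ _ (nice_domain m1 dF)) f0 (fock_ _ dH).
  rewrite !addr0 (fip0l HQ (fock_ _ dF)) addr0 in e1.
  rewrite !addr0 (fip0r HQ (fock_ _ dH)) addr0 conjcK in e2.
  apply: (etrans e1); apply: etrans (esym e2).
  exact: (congr1 ( *%R a) (a1 H F dH dF)).
- have ncomp u v : nice u -> nice v -> nice (u \o v).
    move=> nu' nv; have [pu ou lu cu] := nu'; have [pv ov lv cv] := nv; split; first exact: polynomial_mul.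
    + by move=> F dF; rewrite /= ov// (domain_linear0 lu).
    + by move=> b F G dF dG; rewrite /= lv// lu//; exact: nice_domain.
    + by move=> i; exact: (cmap_postcomp lu cu (cv i)).
  exists (q2 \o q1); split; [exact: ncomp|exact: ncomp|].
  move=> H F dH dF; apply: etrans (a1 _ _ (nice_domain n2 dH) dF) _.
  exact: (a2 _ _ dH (nice_domain m1 dF)).
- have sE := star_eq m1 a1; exists p1; rewrite sE.
  by split; [exact: m1|exact: n1|exact: adjoint_pair_sym n1 m1 a1].
Qed.

End polynomial_operators.

Lemma cae_eq0_boxes d (Y : measurableType d) (R : realType) (m : {sigma_finite_measure set Y -> \bar R})
    n (G : set (set Y)) (E : nat -> set Y) (v : ntuple Y n -> R[i]) :
  @measurable _ Y = <<s G >> -> setI_closed G -> (forall k, G (E k)) ->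
  (forall k l, (k <= l)%N -> E k `<=` E l) -> \bigcup_k E k = setT ->
  (forall B : 'I_n -> set Y, (forall j, G (B j)) ->
    cintegrable (tuple_measure m n) (fun t => (\1_(box B) t)%:C * (v t)^*%C) /\
    cintegral (tuple_measure m n) (fun t => (\1_(box B) t)%:C * (v t)^*%C) = 0) ->
  {ae tuple_measure m n, forall t, v t = 0}.
Proof.
move=> mG GI GE E_mono E_cover H.
have part0 (part : R[i] -> R) : (forall r z, part (r%:C * z) = r * part z) ->
    (forall B : 'I_n -> set Y, (forall j, G (B j)) ->
      (tuple_measure m n).-integrable setT (EFin \o (fun t => part ((\1_(box B) t)%:C * (v t)^*%C))) /\
      (\int[tuple_measure m n]_t (part ((\1_(box B) t)%:C * (v t)^*%C))%:E = 0)%E) ->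
    {ae tuple_measure m n, forall t, part (v t)^*%C = 0}.
  move=> pM hp.
  have mB (B : 'I_n -> set Y) : (forall j, G (B j)) -> measurable (box B).
    by move=> hB; apply: measurable_box => j; rewrite mG; apply: sub_sigma_algebra; exact: hB.
  have EB (B : 'I_n -> set Y) : (EFin \o (fun t => part (v t)^*%C)) \_ (box B) =
      (fun t => (part ((\1_(box B) t)%:C * (v t)^*%C))%:E).
    by apply/funext => t; rewrite patchE indicE pM; case: (_ \in _); rewrite (mul1r, mul0r).
  apply: (ae_eq0_boxes (G := G) (E := E)) => // B hB.
    by apply/(integrable_mkcond _ (mB _ hB)); rewrite EB; exact: (hp B hB).1.
  by rewrite integral_mkcond EB; exact: (hp B hB).2.
have hr := part0 (@complex.Re R) (@ReM_real R).
have hi := part0 (@complex.Im R) (@ImM_real R).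
apply: filterS2 (hr _) (hi _) => [t rt it|B hB|B hB].
- by apply: complex_eq; [move: rt; case: (v t)|move: it; case: (v t) => x y /= /eqP; rewrite oppr_eq0 => /eqP].
- by have [[? ?]] := H B hB; move=> /cintegral_eq0[].
- by have [[? ?]] := H B hB; move=> /cintegral_eq0[].
Qed.

(** * Cyclicity of the vacuum: induction on degree and first exponent *)

Section cyclicity.
Variables (R : realType) (T : ptopologicalType).
Variable sigma : {sigma_finite_measure set (borel T) -> \bar R}.
Variable nu : probability (measurableTypeR R) R.
Variables (A : set (borel T * borel T)) (Q : borel T * borel T -> R[i]).
Hypothesis HQ : q_kernel sigma A Q.
Hypothesis Hnu : exists2 eps : R, 0 < eps &
  (\int[nu]_x (expR (eps * `|x : R|))%:E < +oo)%E.
Variable K : nat -> set (borel T).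
Hypothesis HK : exhaustion sigma K.
Hypothesis B0_test : forall f : T -> R, B0 f -> test sigma (f : borel T -> R).
Hypothesis B0_indic : forall B : set (borel T), bounded_set K B -> B0 (\1_B : T -> R).
Variable V : nat -> set (borel T).
Hypothesis mV : forall k, measurable (V k).
Hypothesis V_sep : forall s t, s <> t -> exists k, V k s /\ ~ V k t.

Local Notation X := (marked R T).
Local Notation mu := (marked_measure sigma nu).
Local Notation vec := (fclass mu).
Local Notation coef := (seq (borel T) -> R[i]^o).
Local Notation P := (fsym A Q).
Local Notation dmon := (dmonom sigma nu A Q).
Local Notation nice := (@nice R T sigma nu A Q).
Local Notation sqn n c := (sqnorm (tuple_measure sigma n) (@component _ (borel T) R n c)).

Lemma fsqnormD (F G : vec) : fock Q F -> fock Q G ->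
  (fsqnorm (F + G)%R <= 2%:E * fsqnorm F + 2%:E * fsqnorm G)%E.
Proof.
move=> fF fG; have := nsqD (fock_ip_semi_inner nu HQ) (mk_fock HQ fF) (mk_fock HQ fG).
have e1 : (nsq (@fock_ip _ _ sigma nu A Q HQ) (mk_fock HQ fF))%:E = fsqnorm F by exact: nsq_fock.
have e2 : (nsq (@fock_ip _ _ sigma nu A Q HQ) (mk_fock HQ fG))%:E = fsqnorm G by exact: nsq_fock.
have e3 : (nsq (@fock_ip _ _ sigma nu A Q HQ) (mk_fock HQ fF + mk_fock HQ fG))%:E = fsqnorm (F + G)%R.
  exact: nsq_fock.
have gen (x y z : R) (u v w : \bar R) : x%:E = u -> y%:E = v -> z%:E = w ->
    z <= 2 * x + 2 * y -> (w <= 2%:E * u + 2%:E * v)%E.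
  by move=> <- <- <-; rewrite -!EFinM -EFinD lee_fin.
exact: gen e1 e2 e3.
Qed.

Lemma cmap_bound n (p : coef -> vec) : cmap A Q n p -> exists2 C : R, 0 <= C &
  forall c, L2c sigma n c -> (fsqnorm (p c) <= C%:E * sqn n c)%E.
Proof.
elim=> [|j B [C C0 hB]|p1 q1 h1 [C1 C10 b1] h2 [C2 C20 b2]|p1 q1 pq _ [C C0 b]].
- exists 0 => // c _; rewrite mul0e.
  have [foo e] := fip_self HQ (fock0 nu HQ); have e0 := fip0l HQ (fock0 nu HQ).
  have ffin : fsqnorm (0 : vec) \is a fin_num by rewrite ge0_fin_numE// fsqnorm_ge0.
  by rewrite -(fineK ffin); have [->] := etrans (esym e) e0.
- exists (monK nu j * C); first by rewrite mulr_ge0 ?monK_ge0.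
  move=> c /hB[Lc le]; apply: le_trans (fsqnorm_dmon_le HQ Hnu Lc) _.
  by rewrite [(monK nu j * C)%:E]EFinM -muleA; apply: lee_wpmul2l; rewrite ?lee_fin ?monK_ge0.
- exists (2 * C1 + 2 * C2); first by rewrite addr_ge0// mulr_ge0.
  move=> c Lc.
  have f1 := domain_fock HQ Hnu (cmap_domain HQ h1 Lc).
  have f2 := domain_fock HQ Hnu (cmap_domain HQ h2 Lc).
  apply: le_trans (fsqnormD f1 f2) _.
  have S0 : (0 <= sqn n c)%E by exact: sqnorm_ge0.
  rewrite [(2 * C1 + 2 * C2)%:E]EFinD ge0_muleDl ?lee_fin ?mulr_ge0//; apply: leeD.
    by rewrite [(2 * C1)%:E]EFinM -muleA; apply: lee_wpmul2l => //; exact: b1.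
  by rewrite [(2 * C2)%:E]EFinM -muleA; apply: lee_wpmul2l => //; exact: b2.
- by exists C => // c Lc; have := b c Lc; rewrite (pq c Lc).
Qed.

Variable G : vec.
Hypothesis fG : fock Q G.

Lemma functional_bound p i : nice p -> exists2 C : R, 0 <= C &
  forall c, L2c sigma (size i) c -> cabs2 (fip (p (dmon i c)) G) <= C * fine (sqn (size i) c).
Proof.
move=> np; have [C C0 hC] := cmap_bound (nice_cmap np i).
pose g := nsq (@fock_ip _ _ sigma nu A Q HQ) (mk_fock HQ fG).
have g0 : 0 <= g by exact: (nsq_ge0 (fock_ip_semi_inner nu HQ)).
exists (C * g); first exact: mulr_ge0.
move=> c Lc; have fF := domain_fock HQ Hnu (nice_domain HQ np (domain_dmon nu HQ Lc)).
apply: le_trans (cauchy_schwarz (fock_ip_semi_inner nu HQ) (mk_fock HQ fF) (mk_fock HQ fG)) _.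
rewrite -/g mulrAC; apply: ler_wpM2r => //.
have e1 : (nsq (@fock_ip _ _ sigma nu A Q HQ) (mk_fock HQ fF))%:E = fsqnorm (p (dmon i c)) by exact: nsq_fock.
by rewrite -lee_fin e1 EFinM -(sqnorm_fin Lc); exact: hC.
Qed.

Definition killed (F : vec) : Prop := forall p, nice p -> fip (p F) G = 0.

Lemma killed_linear a F H : domain Q F -> domain Q H -> killed F -> killed H -> killed (a *: F + H).
Proof.
move=> dF dH kF kH p np; rewrite (nice_linear np)//.
have f1 := domain_fock HQ Hnu (nice_domain HQ np dF).
have f2 := domain_fock HQ Hnu (nice_domain HQ np dH).
by apply: etrans (fip_linear HQ a f1 f2 fG) _; rewrite (kF p np) (kH p np) mulr0 addr0.
Qed.

Lemma killedD F H : domain Q F -> domain Q H -> killed F -> killed H -> killed (F + H).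
Proof. by move=> dF dH kF kH; have := killed_linear 1 dF dH kF kH; rewrite scale1r. Qed.

Lemma killedB F H : domain Q F -> domain Q H -> killed F -> killed H -> killed (F - H).
Proof. by move=> dF dH kF kH; have := killed_linear (-1) dH dF kH kF; rewrite scaleN1r addrC. Qed.

Lemma killed0 : killed 0.
Proof. by move=> p np; rewrite (domain_linear0 HQ (nice_linear np)); exact: (fip0l HQ fG). Qed.

Lemma killed_sum (I : finType) (F : I -> vec) : (forall k, domain Q (F k) /\ killed (F k)) ->
  killed (\sum_k F k).
Proof.
move=> h; suff [] : domain Q (\sum_k F k) /\ killed (\sum_k F k) by [].
elim/big_ind: _ => [|F1 F2 [d1 k1] [d2 k2]|k _]; last exact: h.
  by split; [exact: (domain0 nu HQ)|exact: killed0].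
by split; [exact: (domainD HQ)|exact: killedD].
Qed.

(** Composing [p] with a field operator stays in the algebra, which is why [killed] quantifies over
    all [p]. *)
Lemma killed_field f F : B0 f -> domain Q F -> killed F -> killed (field_op Q f F).
Proof.
move=> bf dF kF p np; have [q [nq _ _]] := polynomial_nice HQ Hnu HK B0_test
  (polynomial_mul (nice_poly np) (polynomial_field sigma nu Q bf)).
exact: (kF _ nq).
Qed.

(** For each [p] the functional is continuous in the coefficient, so killed coefficients form a
    closed set. In the tolerance, [C + 1] replaces [C], which may be 0. *)
Lemma killed_approx i c : L2c sigma (size i) c ->
  (forall e : R, 0 < e -> exists c', [/\ L2c sigma (size i) c', killed (dmon i c') &
    fine (sqn (size i) (c - c')) < e]) -> killed (dmon i c).
Proof.
move=> Lc h p np; have [C C0 hC] := functional_bound i np.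
apply: complex_cabs2_small => e e0; rewrite subr0.
have [c' [Lc' kc' small]] := h (e / (C + 1)) ltac:(by rewrite divr_gt0// ltr_wpDl).
have LB : L2c sigma (size i) (c - c') by exact: (L2B Lc Lc').
have -> : fip (p (dmon i c)) G = fip (p (dmon i (c - c'))) G.
  have dB := domain_dmon nu HQ LB; have dc' := domain_dmon nu HQ Lc'.
  have -> : dmon i c = dmon i (c - c') + dmon i c'.
    have := dmon_linear sigma nu A Q i 1 (c - c') c'; rewrite !scale1r subrK => <-//.
  rewrite (domain_linearD (nice_linear np) dB dc').
  have f1 := domain_fock HQ Hnu (nice_domain HQ np dB).
  have f2 := domain_fock HQ Hnu (nice_domain HQ np dc').
  by apply: etrans (fipDl HQ f1 f2 fG) _; rewrite (kc' p np) addr0.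
apply: le_trans (hC _ LB) _.
apply: (@le_trans _ _ (C * (e / (C + 1)))); first by rewrite ler_wpM2l// ltW.
by rewrite mulrCA ler_piMr ?(ltW e0)// ler_pdivrMr ?mul1r ?lerDl// ltr_wpDl.
Qed.

Definition kills n : Prop := forall i c, size i = n -> L2c sigma n c -> killed (dmon i c).

Lemma kills_ann (f : borel T -> R) i c : test sigma f -> (forall m, (m < size i)%N -> kills m) ->
  L2c sigma (size i) c -> killed (ann_dmon sigma nu A Q f i c).
Proof.
move=> tf; case: i => [|a i] h Lc; first exact: killed0.
apply: killed_sum => pi; have La := L2c_ann_coef nu HQ tf pi isT Lc.
split; first by apply: (domain_dmon nu HQ); rewrite size_behead_mon_index.
by apply: (h (size i)) => //; rewrite size_behead_mon_index.
Qed.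

Lemma field_dmon (f : borel T -> R) i c : test sigma f -> L2c sigma (size i) c ->
  field_op Q f (dmon i c) = dmon (0%N :: i) (fcons f c) +
    \sum_(l < size i) dmon (incr_nth i l) (fmul l f c) + ann_dmon sigma nu A Q f i c.
Proof.
move=> tf Lc; have dc := domain_dmon nu HQ Lc; rewrite (field_opE f dc).
have e1 := creation_dmon nu HQ f i c; have e2 := neutral_dmon nu HQ f i c.
by have e3 := annihilation_dmon HQ Hnu HK tf Lc; rewrite -e1 -e2 -e3.
Qed.

(** Only the creation part of the field operator raises the degree; the image vector and its two
    other parts are killed by induction, so the creation part is too. *)
Lemma killed_fcons (f : borel T -> R) i c : B0 f -> (forall m, (m <= size i)%N -> kills m) ->
  L2c sigma (size i) c -> killed (dmon (0%N :: i) (fcons f c)).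
Proof.
move=> bf h Lc; have tf := B0_test bf.
have dc := domain_dmon nu HQ Lc.
have [C _ hB] := coef_bounded_fcons (size i) tf.
have dA := domain_ann_dmon nu HQ tf Lc.
have dN : domain Q (\sum_(l < size i) dmon (incr_nth i l) (fmul l f c)).
  apply: (domain_sum HQ) => l; apply: (domain_dmon nu HQ); rewrite size_incr_nth ltn_ord.
  by have [C' _ hB'] := coef_bounded_fmul tf (ltn_ord l); have [] := hB' _ Lc.
have kA : killed (ann_dmon sigma nu A Q f i c) by apply: kills_ann => // m /ltnW; exact: h.
have kN : killed (\sum_(l < size i) dmon (incr_nth i l) (fmul l f c)).
  apply: killed_sum => l; have [C' _ hB'] := coef_bounded_fmul tf (ltn_ord l).
  have [Ll _] := hB' _ Lc.
  split; first by apply: (domain_dmon nu HQ); rewrite size_incr_nth ltn_ord.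
  by apply: (h (size i)); rewrite ?size_incr_nth ?ltn_ord.
have kF := killed_field bf dc (h _ (leqnn _) i c erefl Lc).
have dC : domain Q (dmon (0%N :: i) (fcons f c)).
  by apply: (domain_dmon nu HQ) => /=; have [] := hB _ Lc.
rewrite (field_dmon tf Lc) in kF.
have dCN := domainD HQ dC dN.
have := killedB (domainD HQ dCN dA) dA kF kA; rewrite addrK => kCN.
by have := killedB dCN dN kCN kN; rewrite addrK.
Qed.


Lemma dmon_ext i (c c' : coef) : (forall t : (size i).-tuple (borel T), c t = c' t) -> dmon i c = dmon i c'.
Proof.
move=> cc; rewrite /dmonom; congr (cls _ (P _)); apply/funext => s; rewrite /mon.
case: eqP => // E; congr (_ * _).
by have := cc (Tuple (introT eqP (etrans (size_map fst s) E))).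
Qed.

Lemma ae_eq0_bounded_boxes n (v : ntuple (borel T) n -> R[i]) : L2 (tuple_measure sigma n) v ->
  (forall B : 'I_n -> set (borel T), (forall j, bounded_set K (B j)) ->
    cip (tuple_measure sigma n) (fun t => (\1_(box B) t)%:C) v = 0) ->
  {ae tuple_measure sigma n, forall t, v t = 0}.
Proof.
have [mK K_mono cK _] := HK; move=> Lv h.
apply: (@cae_eq0_boxes _ _ _ _ _ (bounded_set K) K) => //.
- apply/seteqP; split=> [B mB|]; last first.
    by apply: smallest_sub; [exact: sigma_algebra_measurable|move=> B []].
  have -> : B = \bigcup_k (B `&` K k) by rewrite -setI_bigcupr cK setIT.
  pose f (t : g_sigma_algebraType (bounded_set K)) : borel T := t.
  have : measurable (\bigcup_k (B `&` K k) : set (g_sigma_algebraType (bounded_set K))).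
    apply: bigcupT_measurable => k; apply: sub_sigma_algebra.
    by split; [exact: measurableI|exists k; exact: subIsetr].
  by [].
- move=> B1 B2 [m1 [n1 K1]] [m2 _]; split; first exact: measurableI.
  by exists n1 => t [/K1].
- by move=> k; split => //; exists k.
- by move=> B hB; split; [exact: L2_mul_integrable (L2_box HK hB) Lv|exact: h].
Qed.

(** The killed coefficients form a subspace of L2(T^(n+1)) containing the indicators of bounded
    boxes, because these factor through the first variable. Nothing is orthogonal to all of these,
    so the subspace is dense. *)
Lemma kills_head0 n : (forall m, (m <= n)%N -> kills m) -> forall i c, size i = n ->
  L2c sigma n.+1 c -> killed (dmon (0%N :: i) c).
Proof.
move=> kn i c si Lc.
have co_lin a u v : coef_of (fun t : n.+1.-tuple (borel T) => a * u t + v t) =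
    a *: coef_of u + coef_of v :> coef.
  apply/funext => r; rewrite !fctE /coef_of; case: insubP => // _.
  by rewrite [RHS]addr0 [RHS]mulr0.
have dco (s : L2fun (tuple_measure sigma n.+1)) : L2c sigma (size (0%N :: i)) (coef_of (s : n.+1.-tuple (borel T) -> R[i])).
  by rewrite /= si; apply: L2c_coef_of; exact: L2funP.
pose S (s : L2fun (tuple_measure sigma n.+1)) := killed (dmon (0%N :: i) (coef_of (s : n.+1.-tuple (borel T) -> R[i]))).
have S0 : S 0.
  rewrite /S (_ : coef_of _ = 0) ?dmon0; first exact: killed0.
  by apply/funext => r; rewrite /coef_of; case: insubP.
have SZD a u v : S u -> S v -> S (a *: u + v).
  move=> Su Sv; rewrite /S (_ : coef_of _ = a *: coef_of (u : n.+1.-tuple (borel T) -> R[i]) + coef_of (v : n.+1.-tuple (borel T) -> R[i])).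
    rewrite dmon_linear.
    exact: (killed_linear a (domain_dmon nu HQ (dco u)) (domain_dmon nu HQ (dco v)) Su Sv).
  exact: co_lin.
have Sperp v : (forall s, S s -> @L2ip _ _ _ (tuple_measure sigma n.+1) s v = 0) ->
    nsq (@L2ip _ _ _ (tuple_measure sigma n.+1)) v = 0.
  move=> hv; have v0 : {ae tuple_measure sigma n.+1, forall t, v t = 0}.
    apply: (ae_eq0_bounded_boxes (L2funP v)) => B hB.
    have LB := L2_box HK hB; apply: (hv (mkL2 LB)); rewrite /S.
    pose B' j := B (lift ord0 j).
    have LB' : L2c sigma (size i) (coef_of (fun t : n.-tuple (borel T) => (\1_(box B') t)%:C)).
      by rewrite si; apply: L2c_coef_of; apply: (L2_box HK) => j; exact: hB.
    rewrite (dmon_ext (c' := fcons (\1_(B ord0)) (coef_of (fun t : n.-tuple (borel T) => (\1_(box B') t)%:C)))).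
      by apply: killed_fcons LB'; [exact: (B0_indic (hB ord0))|rewrite si].
    rewrite /= si => t; rewrite {1}/coef_of valK /=; case: t => -[|x s]// ss.
    have sn : size s == n by [].
    rewrite [RHS]/= /coef_of insubT -rmorphM; congr _%:C; rewrite !indicE -natrM mulnb; congr (nat_of_bool _)%:R.
    apply/idP/idP => [/set_mem h|/andP[/set_mem hx /set_mem hs]].
      apply/andP; split; rewrite inE; first by have := h ord0; rewrite (tnth_nth x).
      by move=> j; have := h (lift ord0 j); rewrite !(tnth_nth x).
    rewrite inE => j; have [->|[j' ->]] : j = ord0 \/ exists j', j = lift ord0 j'.
    - by case: (unliftP ord0 j) => [j' ->|->]; [right; exists j'|left].
    - by rewrite (tnth_nth x).
    - by have := hs j'; rewrite !(tnth_nth x).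
  rewrite nsq_L2 (ae_eq_sqnorm (L2funP v).1 (cmeasurable_cst _ 0) v0).
  by rewrite /sqnorm integral0_eq// => t _; rewrite /= expr0n/= addr0.
apply: killed_approx => [|e e0]; first by rewrite /= si.
have Lc' : L2 (tuple_measure sigma n.+1) (@component _ (borel T) R n.+1 c) := Lc.
have [s Ss small] := perp_dense (L2ip_semi_inner _) (@riesz_fischer _ _ _ (tuple_measure sigma n.+1)) S0 SZD Sperp (mkL2 Lc') e0.
exists (coef_of (s : n.+1.-tuple (borel T) -> R[i])); split; [exact: dco|exact: Ss|].
rewrite /= si (_ : component _ = fun t => mkL2 Lc' t - s t); first by rewrite sqnorm_L2B.
have cE (t : n.+1.-tuple (borel T)) : coef_of (s : n.+1.-tuple (borel T) -> R[i]) t = s t by rewrite /coef_of valK.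
by apply/funext => t; exact: (congr1 (fun z : R[i] => c t - z) (cE t)).
Qed.

Definition signature (m : nat) (t : borel T) : {ffun 'I_m -> bool} := [ffun k : 'I_m => `[< V k t >]].

(** The pieces of the finite partition of [K r] by the first [m] sets [V k]; by [V_sep] two distinct
    points lie in different pieces once [m] is large. *)
Definition cell (r m : nat) (v : {ffun 'I_m -> bool}) : set (borel T) :=
  [set t | K r t /\ signature m t = v].

Lemma bounded_cell r m v : bounded_set K (@cell r m v).
Proof.
have [mK _ _ _] := HK; split; last by exists r => t [].
rewrite (_ : cell r v = K r `&` \bigcap_(k in [set: 'I_m]) (if v k then V k else ~` V k)).
  apply: measurableI => //; apply: fin_bigcap_measurable => // k _.
  by case: (v k); [exact: mV|apply: measurableC; exact: mV].
apply/seteqP; split=> t [Kt h]; split=> //.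
  by move=> k _; rewrite -h ffunE; case: asboolP.
apply/ffunP => k; have := h k I; rewrite ffunE; case: (v k) => hk; first exact: asboolT.
exact: asboolF.
Qed.

Lemma cell_sum r m x y : \sum_(v : {ffun 'I_m -> bool}) (\1_(cell r v) x * \1_(cell r v) y : R) =
  \1_(K r) x * (\1_(K r) y * (signature m x == signature m y)%:R).
Proof.
rewrite (bigD1 (signature m x))//= big1 ?addr0 => [|v vx]; last first.
  rewrite indicE memNset ?mul0r// => -[_ xv]; by rewrite xv eqxx in vx.
rewrite !indicE -!natrM !mulnb; congr (nat_of_bool _)%:R.
apply/idP/idP => [/andP[/set_mem[Kx _] /set_mem[Ky yx]]|/and3P[/set_mem Kx /set_mem Ky /eqP xy]].
  by rewrite !mem_set// yx eqxx.
by apply/andP; split; rewrite inE.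
Qed.

(** The creation parts summed over the cells. By [off_diagonalE] the result lives where the first
    two points share a cell, a set that shrinks to the diagonal as [m] grows. *)
Definition off_diagonal (r m : nat) (c : coef) : coef :=
  \sum_(v : {ffun 'I_m -> bool}) fcons (\1_(cell r v)) (fmul 0 (\1_(@cell r m v)) c).

Lemma off_diagonalE r m c x y s : off_diagonal r m c [:: x, y & s] =
  (\1_(K r) x * (\1_(K r) y * (signature m x == signature m y)%:R))%:C * c (y :: s).
Proof.
rewrite /off_diagonal fct_sumE -cell_sum rmorph_sum mulr_suml; apply: eq_bigr => v _.
by rewrite rmorphM; exact: mulrA.
Qed.

(** At distinct points the coefficient vanishes as soon as some [V k] separates them, and the
    diagonal is null because it lies in [A]. The domination is by the single creation coefficient
    with [\1_(K r)]. *)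
Lemma off_diagonal_cvg n r c : L2c sigma n.+1 c ->
  (fun m => fine (sqn n.+2 (off_diagonal r m c))) @ \oo --> (0 : R).
Proof.
move=> Lc; have [mK K_mono cK _] := HK.
have bK : B0 (\1_(K r) : T -> R) by apply: B0_indic; exact: K_bounded HK r.
have [C _ hB] := coef_bounded_fcons n.+1 (B0_test bK); have [Lg _] := hB _ Lc.
apply: (sqnorm_eventually0 _ Lg).
- move=> m; have : L2c sigma n.+2 (off_diagonal r m c); last by case.
  rewrite /L2c (_ : component _ = fun t => \sum_(v : {ffun 'I_m -> bool}) component (fcons (\1_(cell r v)) (fmul 0 (\1_(@cell r m v)) c)) t).
    apply: L2_sum => v _; have tv := B0_test (B0_indic (bounded_cell r v)).
    have [C1 _ h1] := coef_bounded_fmul tv (ltn0Sn n); have [C2 _ h2] := coef_bounded_fcons n.+1 tv.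
    by have [L1 _] := h1 _ Lc; have [] := h2 _ L1.
  by apply/funext => t; rewrite /component /off_diagonal fct_sumE.
- move=> m t; case: t => -[|x [|y s]]// i.
  rewrite /component [tval _]/= off_diagonalE /= !cabs2M !cabs2_real ler_wpM2r ?cabs2_ge0// !indicE.
  by case: (_ \in _); case: (_ \in _); case: (_ == _); rewrite ?(mul1r, mul0r, mulr0, expr1n, expr0n).
have := ae_adjacent n.+2 0 (q_kernel_domain HQ) (q_kernel_null HQ); apply: filterS.
move=> -[[|x [|y s]]// i] /= nA.
have xy : x <> y by move=> E; apply: nA; rewrite E; exact: (q_kernel_diag HQ).
have [k [Vx Vy]] := V_sep xy; exists k.+1 => m km.
rewrite /component [tval _]/= off_diagonalE (_ : (signature m x == signature m y) = false) ?mulr0 ?mul0r//.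
apply/eqP => /ffunP/(_ (Ordinal km)); rewrite !ffunE /= asboolT// asboolF//.
Qed.

Lemma kills_head_cut n a r : (forall m, (m <= n)%N -> kills m) ->
  (forall i c, size i = n -> L2c sigma n.+1 c -> killed (dmon (a :: i) c)) ->
  forall i c, size i = n -> L2c sigma n.+1 c ->
  killed (dmon (a.+1 :: i) (fmul 0 (\1_(K r)) c)).
Proof.
move=> kn ka i c si Lc.
have tv m v := B0_test (B0_indic (@bounded_cell r m v)).
have Lv m v : L2c sigma n.+1 (fmul 0 (\1_(@cell r m v)) c).
  by have [C1 _ h1] := coef_bounded_fmul (tv m v) (ltn0Sn n); have [] := h1 _ Lc.
have Lvv m v : L2c sigma n.+1 (fmul 0 (\1_(@cell r m v)) (fmul 0 (\1_(@cell r m v)) c)).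
  by have [C1 _ h1] := coef_bounded_fmul (tv m v) (ltn0Sn n); have [] := h1 _ (Lv m v).
have Lf m v : L2c sigma n.+2 (fcons (\1_(@cell r m v)) (fmul 0 (\1_(@cell r m v)) c)).
  by have [C2 _ h2] := coef_bounded_fcons n.+1 (tv m v); have [] := h2 _ (Lv m v).
have dD m v : domain Q (dmon [:: 0%N, a & i] (fcons (\1_(@cell r m v)) (fmul 0 (\1_(@cell r m v)) c))).
  by apply: (domain_dmon nu HQ); rewrite /= si.
have dN m v : domain Q (dmon (a.+1 :: i) (fmul 0 (\1_(@cell r m v)) (fmul 0 (\1_(@cell r m v)) c))).
  by apply: (domain_dmon nu HQ); rewrite /= si.
(* In the field operator applied to one cell, the neutral terms at later places keep the head
   exponent [a] and the annihilation term has lower degree; subtracting them leaves the creation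
   term and the wanted one. *)
have key m v : killed (dmon [:: 0%N, a & i] (fcons (\1_(@cell r m v)) (fmul 0 (\1_(@cell r m v)) c)) +
    dmon (a.+1 :: i) (fmul 0 (\1_(@cell r m v)) (fmul 0 (\1_(@cell r m v)) c))).
  have Lvi : L2c sigma (size (a :: i)) (fmul 0 (\1_(@cell r m v)) c) by rewrite /= si.
  have kF := killed_field (B0_indic (bounded_cell r v)) (domain_dmon nu HQ Lvi) (ka _ _ si (Lv m v)).
  rewrite (field_dmon (tv m v) Lvi) in kF; move: kF; rewrite [size _]/= big_ord_recl.
  set D := dmon _ (fcons _ _); set N := dmon (incr_nth (a :: i) (@ord0 (size i))) _.
  set M := \sum_(l < size i) _; set An := ann_dmon _ _ _ _ _ _ _.
  have dA : domain Q An by exact: domain_ann_dmon.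
  have kA : killed An by apply: kills_ann => // k; rewrite /= si ltnS; exact: kn.
  have hM (l : 'I_(size i)) : L2c sigma n.+1 (fmul (lift ord0 l) (\1_(@cell r m v)) (fmul 0 (\1_(@cell r m v)) c)).
    have ln : (lift ord0 l < n.+1)%N by rewrite -si; exact: ltn_ord.
    by have [C1 _ h1] := coef_bounded_fmul (tv m v) ln; have [] := h1 _ (Lv m v).
  have szM (l : 'I_(size i)) : size (incr_nth (a :: i) (lift ord0 l)) = n.+1.
    by rewrite /= size_incr_nth ltn_ord si.
  have dM : domain Q M.
    by apply: (domain_sum HQ) => l; apply: (domain_dmon nu HQ); rewrite szM; exact: hM.
  have kM : killed M.
    apply: killed_sum => l; split.
      by apply: (domain_dmon nu HQ); rewrite szM; exact: hM.
    by apply: (ka (incr_nth i l)) (hM l); rewrite size_incr_nth ltn_ord.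
  have dDN : domain Q (D + N) by apply: (domainD HQ); [exact: dD|exact: dN].
  rewrite (addrA D N M) => kF.
  have := killedB (domainD HQ (domainD HQ dDN dM) dA) dA kF kA; rewrite addrK => kF'.
  by have := killedB (domainD HQ dDN dM) dM kF' kM; rewrite addrK.
have dmon_sum j (I : finType) (g : I -> coef) : dmon j (\sum_k g k) = \sum_k dmon j (g k).
  have dD' (c1 c2 : coef) : dmon j (c1 + c2) = dmon j c1 + dmon j c2.
    by have := dmon_linear sigma nu A Q j 1 c1 c2; rewrite !scale1r.
  exact: (big_morph (dmon j) dD' (dmon0 sigma nu A Q j)).
(* An indicator is its own square: the cell enters once through the coefficient and once through the
   field operator, and the cells partition [K r]. *)
have sumN m : \sum_(v : {ffun 'I_m -> bool}) fmul 0 (\1_(@cell r m v)) (fmul 0 (\1_(@cell r m v)) c) = fmul 0 (\1_(K r)) c :> coef.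
  apply/funext => s; rewrite fct_sumE /fmul.
  have -> : \1_(K r) (nth point s 0) = \sum_(v : {ffun 'I_m -> bool}) (\1_(@cell r m v) (nth point s 0) * \1_(@cell r m v) (nth point s 0) : R).
    by rewrite cell_sum eqxx mulr1 indicE; case: (_ \in _); rewrite ?mul1r ?mul0r.
  rewrite rmorph_sum mulr_suml; apply: eq_bigr => v _; rewrite rmorphM; exact: mulrA.
have keym m : killed (dmon [:: 0%N, a & i] (off_diagonal r m c) + dmon (a.+1 :: i) (fmul 0 (\1_(K r)) c)).
  rewrite -(sumN m) /off_diagonal !dmon_sum -big_split /=.
  apply: killed_sum => v; split; last exact: key.
  by apply: (domainD HQ); [exact: dD|exact: dN].
have LK : L2c sigma n.+1 (fmul 0 (\1_(K r)) c).
  have tK := B0_test (B0_indic (K_bounded HK r)).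
  by have [C1 _ h1] := coef_bounded_fmul tK (ltn0Sn n); have [] := h1 _ Lc.
have dK : domain Q (dmon (a.+1 :: i) (fmul 0 (\1_(K r)) c)) by apply: (domain_dmon nu HQ); rewrite /= si.
have Loff m : L2c sigma n.+2 (off_diagonal r m c).
  rewrite /L2c (_ : component _ = fun t => \sum_(v : {ffun 'I_m -> bool}) component (fcons (\1_(@cell r m v)) (fmul 0 (\1_(@cell r m v)) c)) t).
    by apply: L2_sum => v _; exact: Lf.
  by apply/funext => t; rewrite /component /off_diagonal fct_sumE.
move=> p np; have [C C0 hC] := functional_bound [:: 0%N, a & i] np.
(* The wanted term does not depend on [m], and neither does [C]; it is minus the creation term,
   which tends to 0. *)
have le m : cabs2 (fip (p (dmon (a.+1 :: i) (fmul 0 (\1_(K r)) c))) G) <=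
    C * fine (sqn n.+2 (off_diagonal r m c)).
  have dO : domain Q (dmon [:: 0%N, a & i] (off_diagonal r m c)).
    by apply: (domain_dmon nu HQ); rewrite /= si.
  have := keym m p np; rewrite (domain_linearD (nice_linear np) dO dK).
  have f1 := domain_fock HQ Hnu (nice_domain HQ np dO).
  have f2 := domain_fock HQ Hnu (nice_domain HQ np dK).
  move/(etrans (esym (fipDl HQ f1 f2 fG))) => E0.
  have Loff' : L2c sigma (size [:: 0%N, a & i]) (off_diagonal r m c) by rewrite /= si.
  have sz : size [:: 0%N, a & i] = n.+2 by rewrite /= si.
  have bnd := hC _ Loff'; rewrite sz in bnd.
  have neg (x y : R[i]) (z : R) : x + y = 0 -> cabs2 x <= z -> cabs2 y <= z.
    by rewrite addrC => /eqP; rewrite addr_eq0 => /eqP ->; rewrite cabs2N.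
  exact: neg E0 bnd.
apply: complex_cabs2_small => e e0; rewrite subr0.
have /cvgrPdist_lt/(_ (e / (C + 1))) := off_diagonal_cvg r Lc.
rewrite divr_gt0 ?ltr_wpDl// => /(_ isT)[N _ /(_ N (leqnn N))].
rewrite /= sub0r normrN => small.
apply: le_trans (le N) _; apply: (@le_trans _ _ (C * (e / (C + 1)))).
  by rewrite ler_wpM2l//; apply: le_trans (ler_norm _) (ltW small).
by rewrite mulrCA ler_piMr ?(ltW e0)// ler_pdivrMr ?mul1r ?lerDl// ltr_wpDl.
Qed.

(** Removes the cutoff: the [K r] exhaust T, so the truncated coefficients converge to [c] in L2. *)
Lemma kills_headS n a : (forall m, (m <= n)%N -> kills m) ->
  (forall i c, size i = n -> L2c sigma n.+1 c -> killed (dmon (a :: i) c)) ->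
  forall i c, size i = n -> L2c sigma n.+1 c -> killed (dmon (a.+1 :: i) c).
Proof.
move=> kn ka i c si Lc; have [mK K_mono cK _] := HK.
have LK r : L2c sigma n.+1 (fmul 0 (\1_(K r)) c).
  have tK := B0_test (B0_indic (K_bounded HK r)).
  by have [C1 _ h1] := coef_bounded_fmul tK (ltn0Sn n); have [] := h1 _ Lc.
have cv : (fun r => fine (sqn n.+1 (c - fmul 0 (\1_(K r)) c))) @ \oo --> (0 : R).
  have E r (t : n.+1.-tuple (borel T)) : (c - fmul 0 (\1_(K r)) c) t =
      (1 - \1_(K r) (nth point t 0))%:C * c t.
    have sub1 (k : R) (z : R[i]) : z - k%:C * z = (1 - k)%:C * z.
      by rewrite rmorphB rmorph1 mulrBl mul1r.
    exact: sub1.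
  apply: (sqnorm_eventually0 _ Lc).
  - by move=> r; exact: (L2B Lc (LK r)).1.
  - move=> r t; rewrite {1}/component E cabs2M cabs2_real ler_piMl ?cabs2_ge0// indicE.
  apply: aeW => t; have : [set: borel T] (nth point t 0) by [].
  rewrite -cK => -[N _ KN]; exists N => r Nr.
  by rewrite {1}/component E indicE mem_set ?subrr ?mul0r//; exact: K_mono KN.
apply: killed_approx => [|e e0]; first by rewrite /= si.
have /cvgrPdist_lt/(_ e e0)[N _ /(_ N (leqnn N))] := cv.
rewrite /= sub0r normrN => small.
exists (fmul 0 (\1_(K N)) c); split; first by rewrite /= si; exact: LK.
  exact: (kills_head_cut N kn ka).
by rewrite /= si; apply: le_lt_trans (ler_norm _) small.
Qed.

Hypothesis killed_vacuum : killed (vacuum mu).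

Lemma kills_all n : kills n.
Proof.
elim/ltn_ind: n => -[|n] IH i c si Lc.
  (* In degree 0 a coefficient is a number and the vector a multiple of the vacuum. *)
  have i0 : i = [::] by apply/nilP; rewrite /nilp si.
  rewrite i0 (dmon_ext (c' := c [::] *: (fun=> 1) + 0)).
    rewrite dmon_linear dmon0 -vacuum_dmon.
    exact: (killed_linear _ (domain_vacuum nu HQ) (domain0 nu HQ) killed_vacuum killed0).
  by move=> t; rewrite (tuple0 t) fctE; exact: (esym (etrans (addr0 _) (mulr1 _))).
have kn m : (m <= n)%N -> kills m by move=> mn; apply: IH.
have claim a : forall i' c', size i' = n -> L2c sigma n.+1 c' -> killed (dmon (a :: i') c').
  by elim: a => [|a IHa]; [exact: (kills_head0 kn)|exact: (kills_headS kn IHa)].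
case: i si => [|a i] si; first discriminate si.
by case: si => si; exact: claim.
Qed.

Lemma orthogonal_vacuum0 : G = 0.
Proof.
apply: (domain_total HQ Hnu HK fG) => H dH.
(* The unit of the algebra is one of the [p] in [killed]; it yields plain orthogonality to the
   domain. *)
have [q [n1 _ _]] := polynomial_nice HQ Hnu HK B0_test (polynomial_one sigma nu Q).
have := dH; move: H dH; apply: (domain_ind HQ) => [_|i c F Lc dF IH _]; first exact: (fip0l HQ fG).
have fM := domain_fock HQ Hnu (domain_dmon nu HQ Lc); have fF := domain_fock HQ Hnu dF.
apply: etrans (fipDl HQ fM fF fG) _.
have k := kills_all erefl Lc n1; rewrite (on_domainE id (domain_dmon nu HQ Lc)) in k.
exact: etrans (congr2 +%R k (IH dF)) (addr0 0).
Qed.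

End cyclicity.

(** * Relatively compact sets that cover and separate points *)

Section polish_topology.
Variables (R : realType) (T : ptopologicalType).

(** One countable family serves both purposes: balls around a dense sequence that are contained in a
    compact set. Arbitrarily small ones surround every point. *)
Lemma polish_lc_cover : polish_space R T -> locally_compact [set: T] ->
  hausdorff_space T /\ exists U : nat -> set T,
  [/\ forall k, open (U k), forall k, exists2 C : set T, compact C & U k `<=` C,
      forall x, exists k, U k x & forall x y, x <> y -> exists k, U k x /\ ~ U k y].
Proof.
move=> [[D [cD dD]] [d [d0 dE dC dT [dnbhs _]]]] lcT.
have hT : hausdorff_space T.
  move=> x y xy; apply/dE/eqP; rewrite eq_le d0 andbT leNgt; apply/negP => xy0.
  have r0 : (0 < d x y / 2)%R by rewrite divr_gt0.
  have nb z : nbhs z [set w | d z w < d x y / 2]%R by apply/dnbhs; exists (d x y / 2)%R.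
  have [z [/= xz yz]] := xy _ _ (nb x) (nb y).
  move: yz; rewrite dC => yz; have := le_lt_trans (dT x z y) (ltrD xz yz).
  by rewrite -splitr ltxx.
split => //.
pose ball q (n : nat) := [set w | d q w < n.+1%:R^-1]%R.
have ball_open q n : open (ball q n).
  rewrite openE => w /= qw; apply/dnbhs.
  exists (n.+1%:R^-1 - d q w)%R; first by rewrite subr_gt0.
  by move=> v /=; rewrite ltrBrDl => wv; exact: le_lt_trans (dT _ _ _) wv.
pose good (q : T * nat) := exists2 C : set T, compact C & ball q.1 q.2 `<=` C.
pose G : set (T * nat) := (D `*` setT) `&` good.
have cG : countable G.
  apply: (@sub_countable _ _ _ (D `*` setT)); first by apply: subset_card_le; exact: subIsetl.
  by apply: countableX => //; exact: countable_setT.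
have cover x (delta : R) : 0 < delta -> exists q, [/\ G q, ball q.1 q.2 x &
    forall w, ball q.1 q.2 w -> d x w < delta].
  move=> delta0; have [W xW [cW clW]] := lcT x I.
  have {}xW : nbhs x W by have := xW; rewrite /within/=; apply: filterS => y; apply.
  have /dnbhs[r r0 rW] := xW.
  (* The bound [r] keeps the ball inside a compact set, and [delta] makes it small enough to
     separate. *)
  pose rho := Num.min r delta; have rho0 : 0 < rho by rewrite lt_min r0.
  have [n nr] : exists n : nat, (n.+1%:R^-1 < rho / 2)%R.
    by have := near_infty_natSinv_lt (PosNum (divr_gt0 rho0 (ltr0Sn R 1))) => -[n _ /(_ n (leqnn _))]; exists n.
  have [q [/= xq Dq]] : ball x n `&` D !=set0.
    by apply: dD => //; exists x => /=; rewrite /ball/= (proj2 (dE x x) erefl) invr_gt0.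
  have small w : ball q n w -> d x w < rho.
    move=> /= qw; apply: le_lt_trans (dT _ q _) _; rewrite (splitr rho).
    by apply: ltrD; [exact: lt_trans xq nr|exact: lt_trans qw nr].
  exists (q, n); split.
  - by split => //; exists W => // w /small; rewrite lt_min => /andP[? _]; exact: rW.
  - by rewrite /ball /= dC.
  - by move=> w /small; rewrite lt_min => /andP[].
have [f fG] : exists f : nat -> T * nat, G = range f.
  move/pfcard_geP : cG => [G0|[f]]; last by exists f; exact/esym/image_eq.
  by have [q [Gq _ _]] := cover point 1 ltr01; move: Gq; rewrite G0.
exists (fun k => ball (f k).1 (f k).2); split => [k|k|x|x y xy].
- exact: ball_open.
- have : G (f k) by rewrite fG; exists k.
  by move=> [_ [C cC bC]]; exists C.
- by have [q [+ bx _]] := cover x 1 ltr01; rewrite fG => -[k _ kq]; exists k; rewrite kq.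
- have xy0 : 0 < d x y by rewrite lt_neqAle d0 andbT eq_sym; apply/eqP => /dE.
  have [q [+ bx small]] := cover x (d x y) xy0; rewrite fG => -[k _ kq]; exists k; rewrite kq; split => //.
  by move=> /small; rewrite ltxx.
Qed.

End polish_topology.

(** * Exhaustion by relatively compact sets and their test functions *)

Section radon_exhaustion.
Variables (R : realType) (T : ptopologicalType).
Variable sigma : {sigma_finite_measure set (borel T) -> \bar R}.
Hypotheses (hT : hausdorff_space T) (sigma_radon : radon_measure sigma).
Variable U : nat -> set T.
Hypotheses (oU : forall k, open (U k)) (cU : forall k, exists2 C : set T, compact C & U k `<=` C).
Hypothesis U_cover : forall x, exists k, U k x.

Lemma borel_compact (C : set T) : compact C -> measurable (C : set (borel T)).
Proof.
move=> cC; rewrite -(setCK C); apply: measurableC; apply: sub_sigma_algebra.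
by apply: closed_openC; exact: compact_closed.
Qed.

Lemma measurable_open_cover k : measurable (U k : set (borel T)).
Proof. by apply: sub_sigma_algebra; exact: oU. Qed.

Definition cover_union (n : nat) : set (borel T) := \bigcup_(k in `I_n.+1) U k.

Lemma cover_union_compact n : exists2 C : set T, compact C & cover_union n `<=` C.
Proof.
elim: n => [|n [C cC nC]].
  by have [C cC UC] := cU 0; exists C => // x [k /=]; rewrite ltnS leqn0 => /eqP -> /UC.
have [C' cC' UC'] := cU n.+1; exists (C `|` C'); first exact: compactU.
move=> x [k /=]; rewrite ltnS leq_eqVlt => /predU1P[->/UC'|kn Ux]; first by right.
by left; apply: nC; exists k.
Qed.

Lemma cover_exhaustion : exhaustion sigma cover_union.
Proof.
have mK n : measurable (cover_union n).
  by apply: bigcup_measurable => k _; exact: measurable_open_cover.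
split => //.
- by move=> k l kl x [j /= jk Ux]; exists j => //=; exact: leq_trans jk _.
- apply/seteqP; split => // x _; have [k Ux] := U_cover x.
  by exists k => //; exists k => /=.
- move=> n; have [C cC nC] := cover_union_compact n.
  apply: le_lt_trans (sigma_radon.1 _ cC); apply: le_measure; rewrite ?inE//.
  exact: borel_compact.
Qed.

Lemma B0_test f : B0 f -> test sigma (f : borel T -> R).
Proof.
move=> [mf [M hM] cf]; split; [exact: mf|by exists M|].
set C := closure _ in cf; have mC := borel_compact cf.
have M0 : 0 <= M := le_trans (normr_ge0 _) (hM point).
have mf2 : measurable_fun setT (fun t : borel T => (f t ^+ 2)%:E).
  by apply/measurable_EFinP; exact: measurable_funX.
have mI : measurable_fun setT (fun t : borel T => (\1_C t : R)%:E).
  by apply/measurable_EFinP; exact: measurable_indic.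
apply: (@le_lt_trans _ _ (\int[sigma]_t ((M ^+ 2)%:E * (\1_C t)%:E))%E).
  apply: ge0_le_integral => //.
  - by move=> t _; rewrite lee_fin sqr_ge0.
  - by apply: emeasurable_funM => //; exact: measurable_cst.
  move=> t _; rewrite -EFinM lee_fin indicE; have [ft0|ft0] := eqVneq (f t) 0.
    by rewrite ft0 expr0n mulr_ge0 ?sqr_ge0.
  rewrite mem_set ?mulr1; last by apply: subset_closure.
  by rewrite -real_normK ?num_real// lerXn2r ?nnegrE.
rewrite ge0_integralZl_EFin ?sqr_ge0//.
rewrite integral_indic// setIT lte_mul_pinfty ?lee_fin ?sqr_ge0//.
exact: sigma_radon.1.
Qed.

Lemma B0_indic (B : set (borel T)) : bounded_set cover_union B -> B0 (\1_B : T -> R).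
Proof.
move=> [mB [n Bn]]; split; first exact: measurable_indic.
  by exists 1 => t; rewrite indicE; case: (_ \in _); rewrite ?normr1 ?normr0.
have [C cC nC] := cover_union_compact n.
apply: (@subclosed_compact _ _ C) => //; first exact: closed_closure.
rewrite [X in _ `<=` X](closure_id C).1; last exact: compact_closed.
apply: closureS => t /=; rewrite indicE => /eqP; case: (boolP (t \in B)) => // /set_mem Bt _.
by apply: nC; exact: Bn.
Qed.

End radon_exhaustion.

Theorem proposition6p7 (R : realType) (T : ptopologicalType)
    (T_polish : polish_space R T) (T_lc : locally_compact [set: T])
    (sigma : {measure set (borel T) -> \bar R})
    (sigma_radon : radon_measure sigma) (sigma_nonatomic : nonatomic sigma)
    (A : set (borel T * borel T)) (A_measurable : measurable A)
    (A_sym : forall s t, A (s, t) -> A (t, s))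
    (A_diag : forall t, A (t, t))
    (A_null : (sigma \x sigma)%E A = 0%E)
    (Q : borel T * borel T -> R[i])
    (Q_measurable :
      measurable_fun (~` A) (fun z => complex.Re (Q z) : measurableTypeR R) /\
      measurable_fun (~` A) (fun z => complex.Im (Q z) : measurableTypeR R))
    (Q_circle : forall z, ~ A z -> `|Q z| = 1)
    (Q_hermitian : forall s t, ~ A (s, t) -> Q (s, t) = (Q (t, s))^*%C)
    (nu : probability (measurableTypeR R) R)
    (nu_exp_moment : exists2 eps : R, 0 < eps &
      (\int[nu]_x (expR (eps * `|x : R|))%:E < +oo)%E) :
  let sigma' := sigma_finite_pack (radon_sigma_finite T_polish T_lc sigma_radon) in
  let Omega := vacuum (marked_measure sigma' nu) in
  ((forall p : poly_op sigma' nu Q, fock Q (p Omega)) /\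
   cyclic_vacuum sigma' nu Q) /\
  exists tau_semi_inner : semi_inner (@tau_ip R T sigma' nu Q),
    (forall p1 p2 : poly_op sigma' nu Q,
       squot_proj tau_semi_inner p1 = squot_proj tau_semi_inner p2 ->
       p1 Omega = p2 Omega) /\
    exists I : L2tau tau_semi_inner -> fclass (marked_measure sigma' nu),
      unitary_onto_fock I /\
      forall p : poly_op sigma' nu Q,
        I (L2tau_incl (squot_proj tau_semi_inner p)) = p Omega.
Proof.
move=> sigma' Omega.
have HQ : q_kernel sigma' A Q by split.
have [hT [U [oU cU U_cover U_sep]]] := polish_lc_cover T_polish T_lc.
have sigma_radon' : radon_measure sigma' by exact: sigma_radon.
have HK := cover_exhaustion hT sigma_radon' oU cU U_cover.
have Htest := B0_test hT sigma_radon'.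
have Hindic := B0_indic R hT cU.
have PN := polynomial_nice HQ nu_exp_moment HK Htest.
have dOm : domain Q Omega by exact: (domain_vacuum nu HQ).
have fOm : fock Q Omega by exact: (domain_fock HQ nu_exp_moment dOm).
have polyP (p : poly_op sigma' nu Q) : Defs.polynomial Q p by case: p => p /= /asboolP.
have fP (p : poly_op sigma' nu Q) : fock Q (p Omega).
  have [q [np _ _]] := PN _ (polyP p).
  exact: (domain_fock HQ nu_exp_moment (nice_domain HQ np dOm)).
(* Turns the form of L2(tau) into the inner product of the images of the vacuum; [star p2] is
   replaced by the true adjoint found in [polynomial_nice]. *)
have tauE (p1 p2 : poly_op sigma' nu Q) : tau_ip p1 p2 = fip (p1 Omega) (p2 Omega).
  have [q1 [n1 _ _]] := PN _ (polyP p1).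
  have [q2 [n2 m2 a2]] := PN _ (polyP p2).
  rewrite /tau_ip /tau (star_eq HQ nu_exp_moment HK m2 a2).
  exact: (adjoint_pair_sym HQ nu_exp_moment n2 m2 a2 (nice_domain HQ n1 dOm) dOm).
have cyc : cyclic_vacuum sigma' nu Q.
  move=> F fF e e0.
  (* The orbit of the vacuum is a subspace of a complete space, so density follows once its
     orthogonal complement is trivial. *)
  pose S (x : fock_space nu HQ) := exists p : poly_op sigma' nu Q, val x = p Omega.
  have S0 : S 0 by exists 0.
  have SZD a u v : S u -> S v -> S (a *: u + v).
    by move=> [p pu] [q qv]; exists (a *: p + q); rewrite /= pu qv.
  have Sperp v : (forall s, S s -> fock_ip s v = 0) -> nsq (@fock_ip _ _ sigma' nu A Q HQ) v = 0.
    move=> hv.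
    have kv : killed A Q (val v) Omega.
      move=> p np; have hp : p \in polynomials Q by rewrite unfold_in; apply/asboolP; exact: nice_poly np.
      pose pp : poly_op sigma' nu Q := PolyOp hp.
      exact: (hv (mk_fock HQ (fP pp)) (ex_intro _ pp erefl)).
    have v0 := orthogonal_vacuum0 HQ nu_exp_moment HK Htest Hindic
      (measurable_open_cover oU) U_sep (fock_spaceP v) kv.
    have -> : v = 0 by exact/val_inj.
    exact: (nsq0 (fock_ip_semi_inner nu HQ)).
  have [|s [p sp] small] := perp_dense (fock_ip_semi_inner nu HQ) (@fock_ip_complete _ _ sigma' nu A Q HQ)
    S0 SZD Sperp (mk_fock HQ fF) (e := e ^+ 2); first by rewrite exprn_gt0.
  exists p; rewrite -sp; move: small; rewrite -lte_fin; congr (_ < _)%E.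
  exact: nsq_fock.
split => //.
have hB : semi_inner (@tau_ip R T sigma' nu Q).
  split=> [w a u v|u v|u]; rewrite !tauE.
  - exact: (fip_linear HQ a (fP u) (fP v) (fP w)).
  - exact: (fip_conj HQ (fP u) (fP v)).
  - by rewrite (fip_self HQ (fP u)).2 lecR fine_ge0// fsqnorm_ge0.
have indep (p1 p2 : poly_op sigma' nu Q) : squot_proj hB p1 = squot_proj hB p2 -> p1 Omega = p2 Omega.
  (* The difference of equivalent operators is a null vector of the form, that is, it sends the
     vacuum to a vector of norm 0. *)
  move=> /lproj_eq/eqP; rewrite tauE => D0.
  have := fip_definite HQ (fP (p1 - p2)) D0 => /eqP.
  by rewrite [X in X == _](_ : _ = p1 Omega - p2 Omega)// subr_eq0 => /eqP.
exists hB; split => //.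
(* Defined through a representative of the class; [indep] makes it independent of it, hence
   linear. *)
pose j (x : squot hB) : fock_space nu HQ := mk_fock HQ (fP (generic_quotient.repr x)).
have jE (p : poly_op sigma' nu Q) : val (j (squot_proj hB p)) = p Omega.
  by apply: indep; exact: lproj_repr.
have j_lin : linear j.
  move=> a x y; apply/val_inj.
  rewrite -{1}(lproj_repr x) -{1}(lproj_repr y) -linearP.
  exact: (jE (a *: generic_quotient.repr x + generic_quotient.repr y)).
have j_iso u v : fock_ip (j u) (j v) = squot_ip u v by rewrite /squot_ip tauE.
have j_dense (w : fock_space nu HQ) (e : R) : 0 < e -> exists v, nsq (@fock_ip _ _ sigma' nu A Q HQ) (w - j v) < e.
  (* The root appears because [cyclic_vacuum] bounds the squared norm by the square of its
     tolerance. *)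
  move=> e0; have [p small] := cyc _ (fock_spaceP w) (Num.sqrt e) ltac:(by rewrite sqrtr_gt0).
  exists (squot_proj hB p); rewrite -lte_fin nsq_fock.
  by move: small; rewrite sqr_sqrtr ?(ltW e0)// -(jE p).
have [V [V_lin V_iso V_surj V_incl]] := completion_unitary (squot_ipP hB) (fock_ip_semi_inner nu HQ)
  (@fock_ip_complete _ _ sigma' nu A Q HQ) (@fock_ip_definite _ _ sigma' nu A Q HQ) j_lin j_iso j_dense.
exists (fun x => val (V x)); split; last by move=> p; rewrite /L2tau_incl V_incl jE.
split.
- by move=> a x y; rewrite V_lin.
- by move=> x; exact: fock_spaceP.
- by move=> x y; exact: V_iso.
- by move=> F fF; have [x Vx] := V_surj (mk_fock HQ fF); exists x; rewrite Vx.
Qed.
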